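(* Let $q\in\mathbb C$, $0<|q|<1$, and let $\kappa=(\kappa_0,\kappa_t,\kappa_1,\kappa_\infty)\in(\mathbb C^* )^4$, $t_0\in\mathbb C^*$ satisfy the non-resonance conditions. If the non-splitting conditions hold true, then the monodromy manifold $\mathcal M(\kappa,t_0)$ is a smooth complex surface. On the other hand, if one or more of the non-splitting conditions are violated, then the set $$\mathcal M_{sing}:=\{[C(z)]\in\mathcal M(\kappa,t_0):C(z)\text{ is diagonal or anti-diagonal}\}$$ is non-empty (but finite), its elements form singularities of the monodromy manifold, and away from them the monodromy manifold is smooth.
   Context: **Notation.** $(z;q)_\infty=\prod_{k\ge0}(1-q^kz)$, $\theta_q(z)=(z;q)_\infty(q/z;q)_\infty$, $\theta_q(z_1,\dots,z_n)=\prod_j\theta_q(z_j)$, $\sigma_3=\mathrm{diag}(1,-1)$, $|M|=\det M$, $q^{\mathbb Z}=\{q^n:n\in\mathbb Z\}$, $\mathbb P^1=\mathbb{CP}^1$. **Non-resonance conditions.** $\kappa_0^2,\kappa_t^2,\kappa_1^2,\kappa_\infty^2\notin q^{\mathbb Z}$ and $(\kappa_t\kappa_1)^{\pm1},(\kappa_t/\kappa_1)^{\pm1}\notin t_0q^{\mathbb Z}$. **Non-splitting conditions.** $\kappa_0^{\epsilon_0}\kappa_t^{\epsilon_t}\kappa_1^{\epsilon_1}\kappa_\infty^{\epsilon_\infty}\notin q^{\mathbb Z}$ and $\kappa_0^{\epsilon_0}\kappa_\infty^{\epsilon_\infty}\notin t_0q^{\mathbb Z}$ for all choices of $\epsilon_0,\epsilon_t,\epsilon_1,\epsilon_\infty\in\{\pm1\}$.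 **Monodromy manifold.** $\mathfrak C(\kappa,t_0)$ is the set of $2\times2$ matrix functions $C(z)$ that are (1) single-valued and analytic on $\mathbb C^*$; (2) satisfy $C(qz)=t_0z^{-2}\kappa_0^{\sigma_3}C(z)\kappa_\infty^{-\sigma_3}$; (3) satisfy $|C(z)|=c\,\theta_q(\kappa_tz/t_0,\kappa_t^{-1}z/t_0,\kappa_1z,\kappa_1^{-1}z)$ for some $c\in\mathbb C^*$. $\mathcal M(\kappa,t_0)$ is the quotient of $\mathfrak C(\kappa,t_0)$ by arbitrary left- and right-multiplication by invertible diagonal matrices; $[C(z)]$ is the class of $C(z)$. **Topology and complex structure on $\mathcal M(\kappa,t_0)$.** For a rank-one $2\times2$ matrix $R$ with columns $R_1,R_2$, $\pi(R)\in\mathbb P^1$ is defined by $R_1=\pi(R)R_2$, with $\pi(R)=0$ iff $R_1=0$ and $\pi(R)=\infty$ iff $R_2=0$. With $(x_1,x_2,x_3,x_4)=(\kappa_tt_0,\kappa_t^{-1}t_0,\kappa_1,\kappa_1^{-1})$ put $\rho_k=\pi(C(x_k))$, $1\le k\le4$. The map $\mathcal P:[C]\mapsto[\rho]$ is a bijection from $\mathcal M(\kappa,t_0)$ onto $\mathcal S^*(\kappa,t_0)=S^*(\kappa,t_0)/\mathbb C^*\subseteq(\mathbb P^1)^4/\mathbb C^*$, where $c\in\mathbb C^*$ acts by $\rho\mapsto c\rho$ and $S^*(\kappa,t_0)=S(\kappa,t_0)\setminus S(\widehat\kappa,t_0)$, $\widehat\kappa=(1,\kappa_t,\kappa_1,\kappa_\infty)$,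 with $S(\kappa,t_0)\subset(\mathbb P^1)^4$ the zero set of (the multihomogenisation, in $\rho_k=[\rho_k^x:\rho_k^y]$, of) $T(\rho:\kappa,t_0)=\sum_{1\le i<j\le4}T_{ij}\rho_i\rho_j$, $$\begin{aligned} T_{12}&=\theta_q(\kappa_t^2,\kappa_1^2)\,\theta_q(\kappa_0\kappa_\infty^{-1}t_0,\kappa_0^{-1}\kappa_\infty^{-1}t_0)\,\kappa_\infty^2,\\ T_{34}&=\theta_q(\kappa_t^2,\kappa_1^2)\,\theta_q(\kappa_0\kappa_\infty t_0,\kappa_0^{-1}\kappa_\infty t_0),\\ T_{13}&=-\theta_q(\kappa_t\kappa_1^{-1}t_0,\kappa_t^{-1}\kappa_1t_0)\,\theta_q(\kappa_t\kappa_1\kappa_0^{-1}\kappa_\infty^{-1},\kappa_0\kappa_t\kappa_1\kappa_\infty^{-1})\,\kappa_\infty^2,\\ T_{24}&=-\theta_q(\kappa_t\kappa_1^{-1}t_0,\kappa_t^{-1}\kappa_1t_0)\,\theta_q(\kappa_0\kappa_t\kappa_1\kappa_\infty,\kappa_t\kappa_1\kappa_\infty\kappa_0^{-1}),\\ T_{14}&=\theta_q(\kappa_t\kappa_1t_0,\kappa_t^{-1}\kappa_1^{-1}t_0)\,\theta_q(\kappa_1\kappa_\infty\kappa_0^{-1}\kappa_t^{-1},\kappa_0\kappa_1\kappa_\infty\kappa_t^{-1})\,\kappa_t^2,\\ T_{23}&=\theta_q(\kappa_t\kappa_1t_0,\kappa_t^{-1}\kappa_1^{-1}t_0)\,\theta_q(\kappa_t\kappa_\infty\kappa_0^{-1}\kappa_1^{-1},\kappa_0\kappa_t\kappa_\infty\kappa_1^{-1})\,\kappa_1^2.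 \end{aligned}$$ $\mathcal S^*(\kappa,t_0)$ carries the quotient topology and the complex structure induced from $S^*(\kappa,t_0)$ under the quotient by $\mathbb C^*$, and $\mathcal M(\kappa,t_0)$ carries the structure transported via $\mathcal P$. The space is smooth at a point if some open neighbourhood of the point is, with this structure, a two-dimensional complex manifold; otherwise the point is a singularity. *)

(* Defs.v *)
From HB Require Import structures.
From mathcomp Require Import all_boot all_order all_algebra.
From mathcomp Require Import complex.
From mathcomp Require Import all_classical all_reals all_analysis.
Set Implicit Arguments.
Unset Strict Implicit.
Unset Printing Implicit Defensive.
Import Order.TTheory GRing.Theory Num.Theory.
Import numFieldNormedType.Exports.
Local Open Scope classical_set_scope.
Local Open Scope ring_scope.

(* R[i] is packaged as a numClosedFieldType because MathComp-Analysis attaches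
   the norm topology to the structure and not to the bare type. *)
Definition cplx (R : realType) : numClosedFieldType := R[i]%C.

Section theta.
Context {R : realType}.
Local Notation C := (cplx R).
Implicit Types q z : C.

Definition qpoch z q : C := limn (fun n => \prod_(0 <= k < n) (1 - q ^+ k * z) : C).

Definition theta q z : C := qpoch z q * qpoch (q / z) q.

Definition thetas q (zs : seq C) : C := \prod_(z <- zs) theta q z.

Definition qZ q : set C := [set x | exists n : int, x = q ^ n].

(* a q^Z *)
Definition mulqZ (a q : C) : set C := [set a * x | x in qZ q].

End theta.

Record kappas (R : realType) := Kappas {
  k0 : cplx R ;
  kt : cplx R ;
  k1 : cplx R ;
  koo : cplx R }.

Definition pm1 : seq int := [:: 1; -1].

Section parameters.
Context {R : realType}.
Local Notation C := (cplx R).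
Implicit Types (q : C) (k : kappas R).

Definition nonzero_kappas k :=
  [/\ k0 k != 0, kt k != 0, k1 k != 0 & koo k != 0].

Definition nonresonant q k (t0 : C) : Prop :=
  [/\ ~ qZ q (k0 k ^+ 2), ~ qZ q (kt k ^+ 2),
      ~ qZ q (k1 k ^+ 2) & ~ qZ q (koo k ^+ 2)] /\
  forall e, e \in pm1 ->
    ~ mulqZ t0 q ((kt k * k1 k) ^ e) /\ ~ mulqZ t0 q ((kt k / k1 k) ^ e).

Definition nonsplitting q k (t0 : C) : Prop :=
  forall e0 et e1 eoo,
    e0 \in pm1 -> et \in pm1 -> e1 \in pm1 -> eoo \in pm1 ->
    ~ qZ q (k0 k ^ e0 * kt k ^ et * k1 k ^ e1 * koo k ^ eoo) /\
    ~ mulqZ t0 q (k0 k ^ e0 * koo k ^ eoo).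

Definition hat k : kappas R := Kappas 1 (kt k) (k1 k) (koo k).

End parameters.

Section connection.
Context {R : realType}.
Local Notation C := (cplx R).
Implicit Types (q : C) (k : kappas R) (Cm : C -> 'M[C]_2).

Definition analytic_at (f : C -> C) (z0 : C) : Prop :=
  exists a : nat -> C, \forall z \near z0,
    series (fun n => a n * (z - z0) ^+ n : C) @ \oo --> f z.

(* x ^ sigma_3 *)
Definition pow_sigma3 (x : C) : 'M[C]_2 :=
  diag_mx (\row_(j < 2) if j == ord0 then x else x^-1).

(* The matrix functions live on C^* : values at 0 are junk and are never
   constrained. *)
Definition connection_matrices q k (t0 : C) : set (C -> 'M[C]_2) :=
  [set Cm : C -> 'M[C]_2 |
    [/\ forall i j (z : C), z != 0 -> analytic_at (fun w => Cm w i j) z,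
        forall z, z != 0 ->
          Cm (q * z) =
          (t0 / z ^+ 2) *: (pow_sigma3 (k0 k) *m Cm z *m pow_sigma3 ((koo k)^-1))
      & exists2 c : C, c != 0 & forall z, z != 0 ->
          \det (Cm z) =
          c * thetas q [:: kt k * z / t0; (kt k)^-1 * z / t0;
                           k1 k * z; (k1 k)^-1 * z]]].

(* The class [Cm], as a set of functions.  Since equality is only required on
   C^*, functions differing at 0 alone have the same class. *)
Definition monodromy_class q k (t0 : C) Cm : set (C -> 'M[C]_2) :=
  [set Cm' : C -> 'M[C]_2 | connection_matrices q k t0 Cm' /\
    exists d1 d2 : 'rV[C]_2,
      [/\ forall j, d1 0 j != 0, forall j, d2 0 j != 0
        & forall z, z != 0 -> Cm' z = diag_mx d1 *m Cm z *m diag_mx d2]].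

Definition monodromy_manifold q k (t0 : C) : Type :=
  set_type (monodromy_class q k t0 @` connection_matrices q k t0).

HB.instance Definition _ q k (t0 : C) := Choice.on (monodromy_manifold q k t0).

Definition represents q k (t0 : C) (m : monodromy_manifold q k t0) Cm : Prop :=
  connection_matrices q k t0 Cm /\ set_val m = monodromy_class q k t0 Cm.

Definition diagonal_fun Cm : Prop := forall z : C, z != 0 -> is_diag_mx (Cm z).

Definition antidiagonal_fun Cm : Prop :=
  forall (z : C) i, z != 0 -> Cm z i i = 0.

Definition Msing q k (t0 : C) : set (monodromy_manifold q k t0) :=
  [set m | exists2 Cm, represents m Cm & diagonal_fun Cm \/ antidiagonal_fun Cm].

End connection.
Arguments Msing {R} q k t0 _.

Section projective.
Context {R : realType}.
Local Notation C := (cplx R).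
Local Notation P1 := (one_point_compactification C).
Local Notation P1x4 := 'rV[P1]_4.

(* homogeneous coordinates [hx p : hy p] *)
Definition hx (p : P1) : C := if p is Some z then z else 1.
Definition hy (p : P1) : C := if p is Some _ then 1 else 0.

Definition scaleP1 (c : C) (p : P1) : P1 :=
  if p is Some z then Some (c * z) else None.

Definition orbit (r : P1x4) : set P1x4 :=
  [set s | exists2 c : C, c != 0 & s = map_mx (scaleP1 c) r].

(* holomorphic coordinate of P^1 around p (z if p is finite, 1/z if p is
   infinity): parP1 p is the inverse of the coordinate, cenP1 p the coordinate
   of p itself *)
Definition parP1 (p : P1) (w : C) : P1 :=
  if p is Some _ then Some w else if w == 0 then None else Some w^-1.
Definition cenP1 (p : P1) : C := if p is Some z then z else 0.

Definition holo_at (F : P1x4 -> C) (r : P1x4) : Prop :=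
  \forall v \near (map_mx cenP1 r : 'rV[C]_4),
    differentiable
      (fun u : 'rV[C]_4 => F (\row_j parP1 (r 0 j) (u 0 j)) : C) v.

(* holomorphic functions on an analytic subset: local restrictions of
   holomorphic functions of the ambient space *)
Definition holo_on_at (S : set P1x4) (f : P1x4 -> C) (r : P1x4) : Prop :=
  exists2 F, holo_at F r & \forall s \near r, S s -> f s = F s.

(* for a rank-one M *)
Definition piP1 (M : 'M[C]_2) : P1 :=
  if col 1 M == 0 then None
  else Some (xget 0 [set p | col 0 M = p *: col 1 M]).

End projective.

Section surface.
Context {R : realType}.
Local Notation C := (cplx R).
Local Notation P1 := (one_point_compactification C).
Local Notation P1x4 := 'rV[P1]_4.
Implicit Types (q : C) (k : kappas R) (r : P1x4).

(* T_{ij} for 1 <= i < j <= 4 *)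
Definition Tcoef q k (t0 : C) (i j : nat) : C :=
  let: Kappas k0 kt k1 koo := k in
  match i, j with
  | 1%N, 2%N => thetas q [:: kt ^+ 2; k1 ^+ 2] *
            thetas q [:: k0 * koo^-1 * t0; k0^-1 * koo^-1 * t0] * koo ^+ 2
  | 3%N, 4%N => thetas q [:: kt ^+ 2; k1 ^+ 2] *
            thetas q [:: k0 * koo * t0; k0^-1 * koo * t0]
  | 1%N, 3%N => - thetas q [:: kt * k1^-1 * t0; kt^-1 * k1 * t0] *
            thetas q [:: kt * k1 * k0^-1 * koo^-1; k0 * kt * k1 * koo^-1] *
            koo ^+ 2
  | 2%N, 4%N => - thetas q [:: kt * k1^-1 * t0; kt^-1 * k1 * t0] *
            thetas q [:: k0 * kt * k1 * koo; kt * k1 * koo * k0^-1]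
  | 1%N, 4%N => thetas q [:: kt * k1 * t0; kt^-1 * k1^-1 * t0] *
            thetas q [:: k1 * koo * k0^-1 * kt^-1; k0 * k1 * koo * kt^-1] *
            kt ^+ 2
  | 2%N, 3%N => thetas q [:: kt * k1 * t0; kt^-1 * k1^-1 * t0] *
            thetas q [:: kt * koo * k0^-1 * k1^-1; k0 * kt * koo * k1^-1] *
            k1 ^+ 2
  | _, _ => 0
  end.

(* multihomogenisation of sum_{i<j} T_{ij} rho_i rho_j *)
Definition Tform q k (t0 : C) r : C :=
  \sum_(i < 4) \sum_(j < 4 | (i < j)%N)
    Tcoef q k t0 i.+1 j.+1 * hx (r 0 i) * hx (r 0 j) *
    \prod_(l < 4 | (l != i) && (l != j)) hy (r 0 l).

Definition Szero q k (t0 : C) : set P1x4 := [set r | Tform q k t0 r = 0].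

Definition Sstar q k (t0 : C) : set P1x4 := Szero q k t0 `\` Szero q (hat k) t0.

(* Points of S^* / C^* are the orbits of points of S^*; a set W of orbits is
   open for the quotient topology iff the set of points of S^* whose orbit is
   in W is open in S^*, and similarly for functions. *)
Definition quot_open q k (t0 : C) (W : set (set P1x4)) : Prop :=
  open ([set r | W (orbit r)] : set (subspace (Sstar q k t0))).

Definition quot_holo q k (t0 : C) (W : set (set P1x4)) (g : set P1x4 -> C) : Prop :=
  forall r, Sstar q k t0 r -> W (orbit r) ->
    holo_on_at (Sstar q k t0) (g \o @orbit R) r.

End surface.

Section structure.
Context {R : realType}.
Local Notation C := (cplx R).
Local Notation P1 := (one_point_compactification C).
Local Notation P1x4 := 'rV[P1]_4.
Variables (q : C) (k : kappas R) (t0 : C).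
Local Notation M := (monodromy_manifold q k t0).

Definition xpoint (j : 'I_4) : C :=
  nth 0 [:: kt k * t0; (kt k)^-1 * t0; k1 k; (k1 k)^-1] j.

Definition rho (Cm : C -> 'M[C]_2) : P1x4 := \row_j piP1 (Cm (xpoint j)).

(* The orbit of rho Cm for any representative Cm of m: the union does not
   depend on a choice of Cm, all representatives having the same orbit. *)
Definition Pmap (m : M) : set P1x4 :=
  \bigcup_(Cm in [set Cm | represents m Cm]) orbit (rho Cm).

(* P is a bijection onto S^* / C^*, so pulling back along P is the same as
   transporting the structure of S^* / C^*; the pull-back is a topology without
   appealing to this fact. *)
Definition mm_open (U : set M) : Prop :=
  exists2 W, quot_open q k t0 W & U = Pmap @^-1` W.

Lemma mm_openT : mm_open setT.
Proof. by exists setT; [exact: openT | rewrite preimage_setT]. Qed.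

Lemma mm_openI (A B : set M) : mm_open A -> mm_open B -> mm_open (A `&` B).
Proof.
move=> [V oV ->] [W oW ->]; exists (V `&` W); last by rewrite preimage_setI.
exact: (openI oV oW).
Qed.

Lemma mm_openU (I : Type) (f : I -> set M) :
  (forall i, mm_open (f i)) -> mm_open (\bigcup_i f i).
Proof.
move=> of_.
have /choice[W oW] : forall i, exists W, quot_open q k t0 W /\ f i = Pmap @^-1` W.
  by move=> i; have [W oW fW] := of_ i; exists W.
exists (\bigcup_i W i).
  by apply: (@bigcup_open _ _ setT) => i _; have [] := oW i.
by rewrite preimage_bigcup; apply: eq_bigcupr => i _; have [] := oW i.
Qed.

HB.instance Definition _ :=
  isOpenTopological.Build M mm_openT mm_openI mm_openU.

Definition mm_holo (U : set M) (f : M -> C) : Prop :=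
  exists W g, [/\ quot_open q k t0 W, U = Pmap @^-1` W, quot_holo q k t0 W g
                & forall m, U m -> f m = g (Pmap m)].

End structure.
Arguments mm_holo {R} q k t0 _ _.

Section complex_surfaces.
Context {R : realType} {X : topologicalType}.
Local Notation C := (cplx R).
(* holo U f : f is a holomorphic function on the open set U *)
Variable holo : set X -> (X -> C) -> Prop.

(* phi is a homeomorphism from the open set V onto an open set of C^2 which
   identifies the holomorphic functions on both sides *)
Definition holo_chart (V : set X) (phi : X -> 'rV[C]_2) : Prop :=
  [/\ open V,
      {in V &, injective phi},
      forall W, W `<=` V -> open W <-> open (phi @` W)
    & forall W f, W `<=` V -> open W ->
        (holo W f <->
         exists2 g : 'rV[C]_2 -> C,
           forall y, (phi @` W) y -> differentiable g y
           & forall x, W x -> f x = g (phi x))].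

(* the open set U is a two-dimensional complex manifold *)
Definition complex_surface (U : set X) : Prop :=
  [/\ open U, hausdorff_space (set_type U),
      @second_countable (set_type U)
    & forall x, U x -> exists V phi, [/\ V x, V `<=` U & holo_chart V phi]].

Definition smooth_at (x : X) : Prop := exists2 U, U x & complex_surface U.

Definition singularity (x : X) : Prop := ~ smooth_at x.

End complex_surfaces.

(* Main.v *)
Require Import Defs.
From HB Require Import structures.
From mathcomp Require Import all_boot all_order all_algebra.
From mathcomp Require Import complex.
From mathcomp Require Import all_classical all_reals all_analysis.
From mathcomp Require Import ring lra zify.
Set Implicit Arguments.
Unset Strict Implicit.
Unset Printing Implicit Defensive.
Import Order.TTheory GRing.Theory Num.Theory.
Import numFieldNormedType.Exports.
Local Open Scope classical_set_scope.
Local Open Scope ring_scope.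

(* A row of a connection matrix is a pair (f, g) of functions analytic on C^*,
   quasi-periodic of degree two under z -> q z, with f (x_k) = rho_k g (x_k).
   A function analytic on C^* with a constant multiplier is a monomial, so each
   of f and g ranges over a plane, and eliminating them shows that a nonzero row
   exists iff T rho = 0.  As T is even in kappa_0, the second row then exists
   too.  The determinant of the two rows vanishes at the four x_k, hence is a
   constant times the required product of thetas, and that constant is nonzero
   off the locus of hat kappa; so P is a bijection onto S^* / C^*.

   If T vanishes for every value of rho_k, the other coordinates being fixed,
   one of the rows vanishes at x_k.  When this happens for all k, each row has
   two zeros and C is diagonal or anti-diagonal, that is rho is in {0, oo}^4.
   At any other orbit one normalises some rho_j to 1 and solves T = 0 for some
   rho_i; the two remaining coordinates form a chart.

   A point of S^* in {0, oo}^4 has exactly two infinite coordinates i, j, and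
   T_ij = 0, which is a violated non-splitting condition.  Such a point lies in
   the closure of the orbit of the point with infinite coordinates i, j and the
   others equal to 1, so it has no Hausdorff neighbourhood.  If there is no such
   point, the ratios rho_i / rho_j separate the orbits. *)

(** * Analytic functions on the punctured plane *)

(** Analyticity means local expansion in a power series, so the function theory rests on coefficient
    estimates, and averages over the 2^(k+1)-th roots of unity stand in for contour integrals. These
    averages are asymptotically the same on every circle around 0, because the second-order estimate
    [quad_near] can be summed along a segment. A multiplier lam therefore rescales a limit that must
    not change: every Laurent mode with multiplier different from 1 has vanishing mean, and at most
    one mode survives.

    The locus of hat kappa enters through factorisation. Two proportional rows, with multipliers
    involving kap and 1 / kap, have a common part whose multiplier is halfway between, and this part
    is a row for kappa_0 = 1. Conversely such a row has zero determinant against both rows of a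
    connection matrix, which is impossible.

    Openness and holomorphy on the quotient are always tested on points of S^* in (P^1)^4, in
    coordinates of P^1 centred at the point considered. *)

Section modulus.
Context {R : realType}.
Local Notation C := (cplx R).
Implicit Types x y z w : C.

(* The order of [C] is partial; estimates are carried out on the real modulus. *)
Definition nm (z : C) : R := complex.Re (`|z| : R[i]%C).

Lemma nmE z : `|z| = (nm z)%:C%C.
Proof. by rewrite /nm RRe_real // normr_real. Qed.

Lemma nmM x y : nm (x * y) = nm x * nm y.
Proof. by apply: complexI; rewrite -nmE normrM !nmE rmorphM. Qed.

Lemma nm_ge0 x : 0 <= nm x.
Proof. by rewrite -ler0c -nmE normr_ge0. Qed.

Lemma nm0 : nm 0 = 0.
Proof. by apply: complexI; rewrite -nmE normr0. Qed.

Lemma nm1 : nm 1 = 1.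
Proof. by apply: complexI; rewrite -nmE normr1. Qed.

Lemma nmN x : nm (- x) = nm x.
Proof. by apply: complexI; rewrite -!nmE normrN. Qed.

Lemma nmD x y : nm (x + y) <= nm x + nm y.
Proof. by rewrite -lecR rmorphD /= -!nmE ler_normD. Qed.

Lemma nmB x y : nm (x - y) = nm (y - x).
Proof. by rewrite -nmN opprB. Qed.

Lemma nmBD x y : nm (x - y) <= nm x + nm y.
Proof. by rewrite -(nmN y) nmD. Qed.

Lemma nm_eq0 x : (nm x == 0) = (x == 0).
Proof. by rewrite -(inj_eq (@complexI R)) -nmE normr_eq0. Qed.

Lemma nm_gt0 x : (0 < nm x) = (x != 0).
Proof. by rewrite lt_def nm_eq0 nm_ge0 andbT. Qed.

Lemma nmX x n : nm (x ^+ n) = nm x ^+ n.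
Proof. by apply: complexI; rewrite -nmE normrX nmE rmorphXn. Qed.

Lemma nmV x : nm x^-1 = (nm x)^-1.
Proof. by apply: complexI; rewrite -nmE normfV nmE fmorphV. Qed.

Lemma nmn n : nm n%:R = n%:R.
Proof. by apply: complexI; rewrite -nmE normr_nat rmorph_nat. Qed.

Lemma nm_sum I (s : seq I) (P : pred I) (F : I -> C) :
  nm (\sum_(i <- s | P i) F i) <= \sum_(i <- s | P i) nm (F i).
Proof.
elim/big_rec2: _ => [|i y1 y2 Pi H]; first by rewrite nm0.
by apply: le_trans (nmD _ _) _; rewrite lerD2l.
Qed.

Lemma ltnmE x (e : R) : (`|x| < e%:C%C) = (nm x < e).
Proof. by rewrite nmE ltcR. Qed.

Lemma nm_tri x y z : nm (x - z) <= nm (x - y) + nm (y - z).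
Proof. by have := nmD (x - y) (y - z); rewrite addrA subrK. Qed.

Lemma nm_tri_mid y x z : nm (x - z) <= nm (y - x) + nm (y - z).
Proof. by rewrite (nmB y x); exact: nm_tri. Qed.

Lemma nbhs_nmP (z : C) (P : set C) :
  nbhs z P <-> exists2 e : R, 0 < e & forall w, nm (w - z) < e -> P w.
Proof.
split=> [/nbhs_ballP[e /= e0 He]|[e e0 He]].
  have eE : e = (complex.Re (e : R[i]%C))%:C%C by rewrite RRe_real // gtr0_real.
  exists (complex.Re (e : R[i]%C)); first by rewrite -ltcR -eE.
  by move=> w; rewrite -ltnmE -eE => hw; apply: He; rewrite /ball /= distrC.
apply/nbhs_ballP; exists (e%:C)%C; first by rewrite /= ltcR.
by move=> w; rewrite /ball /= distrC ltnmE; exact: He.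
Qed.

Lemma cvg_nmP (u : nat -> C) (l : C) :
  u @ \oo --> l <->
  forall e : R, 0 < e -> exists N, forall n, (N <= n)%N -> nm (u n - l) < e.
Proof.
split=> [ul e e0|H].
  have : nbhs l [set w | nm (w - l) < e] by apply/nbhs_nmP; exists e.
  by move=> /ul [N _ HN]; exists N => n /HN.
move=> P /nbhs_nmP[e e0 He]; have [N HN] := H e e0.
by exists N => // n /= /HN /He.
Qed.
End modulus.

Lemma eq_leR (R : numDomainType) (x y : R) : x = y -> x <= y.
Proof. by move->. Qed.

(** * Complex sequences with geometric convergence *)

Section sequences.
Context {R : realType}.
Local Notation C := (cplx R).
Implicit Types (u v : nat -> C) (l m x y : C).

Lemma geom_lt_eps (K rho e : R) : 0 <= rho < 1 -> 0 < e ->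
  exists N, forall n, (N <= n)%N -> K * rho ^+ n < e.
Proof.
move=> /andP[r0 r1] e0.
have [K0|K0] := leP K 0.
  exists 0%N => n _; apply: le_lt_trans e0; rewrite -oppr_ge0 -mulNr.
  by rewrite mulr_ge0 ?oppr_ge0 // exprn_ge0.
have : (fun n => rho ^+ n) @ \oo --> (0 : R) by apply: cvg_expr; rewrite ger0_norm.
move=> /cvgrPdist_lt/(_ (e / K)); rewrite divr_gt0 // => /(_ isT)[N _ HN].
exists N => n /HN /=; rewrite sub0r normrN ger0_norm ?exprn_ge0 //.
by rewrite ltr_pdivlMr // mulrC.
Qed.

Lemma nat_inv_lt (e : R) : 0 < e -> exists N, forall n, (N <= n)%N -> n.+1%:R^-1 < e.
Proof.
move=> e0; have [N HN] := @ltr_add_invr R 0 e e0; exists N => n Nn.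
move: HN; rewrite add0r; apply: le_lt_trans.
by rewrite lef_pV2 ?posrE ?ltr0n // ler_nat.
Qed.

Lemma cvg_nm_const l : (fun _ : nat => l) @ \oo --> l.
Proof. exact: cvg_cst. Qed.

Lemma cvg_nmB u l v m : u @ \oo --> l -> v @ \oo --> m ->
  (fun n => u n - v n) @ \oo --> l - m.
Proof. exact: cvgB. Qed.

Lemma cvg_nmM u l v m : u @ \oo --> l -> v @ \oo --> m ->
  (fun n => u n * v n) @ \oo --> l * m.
Proof. exact: cvgM. Qed.

Lemma cvg_nm_unique u l m : u @ \oo --> l -> u @ \oo --> m -> l = m.
Proof. by move=> ul um; exact: (cvg_unique _ ul um). Qed.

Lemma cvg_nm_le u l (b : R) : u @ \oo --> l -> (forall n, nm (u n) <= b) -> nm l <= b.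
Proof.
move=> /cvg_nmP ul ub; rewrite leNgt; apply/negP => bl.
have [|N HN] := ul (nm l - b); first by rewrite subr_gt0.
have := HN N (leqnn N); have := ub N; have := nm_tri l (u N) 0.
by rewrite !subr0 nmB => h1 h2 h3; lra.
Qed.

Lemma cvg_nm_dist_le u l x (b : R) : u @ \oo --> l ->
  (forall n, nm (u n - x) <= b) -> nm (l - x) <= b.
Proof.
move=> ul H; apply: (@cvg_nm_le (fun n => u n - x) _ _ _ H).
exact: cvg_nmB ul (@cvg_nm_const x).
Qed.

Lemma cvg_nm_near u v l : u @ \oo --> l ->
  (forall e, 0 < e -> exists N, forall n, (N <= n)%N -> nm (u n - v n) < e) ->
  v @ \oo --> l.
Proof.
move=> /cvg_nmP ul H; apply/cvg_nmP => e e0.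
have e2 : 0 < e / 2 by rewrite divr_gt0.
have [N HN] := ul _ e2; have [N' HN'] := H _ e2; exists (maxn N N') => n.
rewrite geq_max => /andP[/HN h1 /HN' h2].
by have := nm_tri (v n) (u n) l; rewrite nmB in h2; lra.
Qed.

Lemma cvg_nm_shift u l k : u @ \oo --> l -> (fun n => u (k + n)%N) @ \oo --> l.
Proof.
move=> /cvg_nmP H; apply/cvg_nmP => e /H[N HN]; exists N => n Nn; apply: HN.
exact: leq_trans Nn (leq_addl _ _).
Qed.

(** Completeness comes from R: the real and imaginary parts are Cauchy sequences. The explicit rate
    is what later permits the exchange of limits. *)
Lemma cvg_geom u (K rho : R) : 0 <= rho < 1 ->
  (forall n, nm (u n.+1 - u n) <= K * rho ^+ n) ->
  exists2 l, u @ \oo --> l & forall n, nm (l - u n) <= K * rho ^+ n / (1 - rho).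
Proof.
move=> r01 H; have /andP[r0 r1] := r01.
have r1' : 0 < 1 - rho by rewrite subr_gt0.
have K0 : 0 <= K by have := H 0%N; rewrite expr0 mulr1; apply: le_trans (nm_ge0 _).
have D n k : nm (u (n + k)%N - u n) <= K * rho ^+ n / (1 - rho).
  suff : nm (u (n + k)%N - u n) <= K * rho ^+ n / (1 - rho) * (1 - rho ^+ k).
    move=> /le_trans; apply; rewrite ler_piMr //.
      by rewrite divr_ge0 ?mulr_ge0 ?exprn_ge0 // ltW.
    by rewrite lerBlDr lerDl exprn_ge0.
  elim: k => [|k IH]; first by rewrite addn0 subrr nm0 expr0 subrr mulr0.
  rewrite addnS; apply: le_trans (nm_tri _ (u (n + k)%N) _) _.
  apply: le_trans (lerD (H _) IH) _; rewrite exprD exprS.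
  by apply: eq_leR; field; rewrite gt_eqF.
have ReB x y : `|complex.Re (x : R[i]%C) - complex.Re (y : R[i]%C)| <= nm (x - y).
  rewrite /nm normc_def /= -sqrtr_sqr ler_sqrt ?addr_ge0 ?sqr_ge0 //.
  by case: x y => a b [c d] /=; rewrite lerDl sqr_ge0.
have ImB x y : `|complex.Im (x : R[i]%C) - complex.Im (y : R[i]%C)| <= nm (x - y).
  rewrite /nm normc_def /= -sqrtr_sqr ler_sqrt ?addr_ge0 ?sqr_ge0 //.
  by case: x y => a b [c d] /=; rewrite lerDr sqr_ge0.
have cau (f : C -> R) : (forall x y, `|f x - f y| <= nm (x - y)) ->
    exists l : R, forall e, 0 < e -> exists N, forall n, (N <= n)%N -> `|f (u n) - l| < e.
  move=> Hf; have : cvg ((f \o u) @ \oo).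
    apply: cauchy_cvg; apply/cauchy_ballP => e e0; rewrite near_map2.
    have [N HN] := @geom_lt_eps (K / (1 - rho)) rho (e / 2) r01 (divr_gt0 e0 (ltr0n _ 2)).
    exists ([set n | (N <= n)%N], [set n | (N <= n)%N]) => /=.
      by split; exists N.
    move=> [n m] [/= Nn Nm]; rewrite /ball /=.
    have HH p : (N <= p)%N -> `|f (u p) - f (u N)| < e / 2.
      move=> Np; apply: le_lt_trans (Hf _ _) _.
      rewrite -(subnKC Np); apply: le_lt_trans (D _ _) _.
      by rewrite mulrAC; exact: HN.
    have h1 := HH _ Nn; have h2 := HH _ Nm.
    have := ler_distD (f (u N)) (f (u n)) (f (u m)).
    by rewrite (distrC (f (u N)) (f (u m))); lra.
  move=> /cvg_ex[l /cvgrPdist_lt Hl]; exists l => e /Hl[N _ HN]; exists N => n /HN /=.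
  by rewrite distrC.
have [l1 H1] := cau _ ReB; have [l2 H2] := cau _ ImB.
have ul : u @ \oo --> ((l1 +i* l2)%C : C).
  apply/cvg_nmP => e e0; have e2 : 0 < e / 2 by rewrite divr_gt0.
  have [N HN] := H1 _ e2; have [N' HN'] := H2 _ e2; exists (maxn N N') => n.
  rewrite geq_max => /andP[/HN h1 /HN' h2].
  have hs (a b : R) : Num.sqrt (a ^+ 2 + b ^+ 2) <= `|a| + `|b|.
    rewrite -[leRHS]ger0_norm ?addr_ge0 // -sqrtr_sqr ler_sqrt ?sqr_ge0 //.
    rewrite sqrrD !real_normK ?num_real //.
    by have := mulr_ge0 (normr_ge0 a) (normr_ge0 b); lra.
  rewrite /nm normc_def /=; apply: le_lt_trans (hs _ _) _.
  by move: h1 h2; case: (u n) => a b /=; lra.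
exists ((l1 +i* l2)%C : C) => // n.
apply: (@cvg_nm_dist_le (fun k => u (n + k)%N)) (D n) => //.
exact: cvg_nm_shift.
Qed.

End sequences.

(** * Power series with explicit majorants *)

Section power_series.
Context {R : realType}.
Local Notation C := (cplx R).
Implicit Types (a b : nat -> C) (f g : C -> C) (z h w l m : C) (r K : R).

Definition psum a h N : C := \sum_(n < N) a n * h ^+ n.

Lemma psumS a h N : psum a h N.+1 - psum a h N = a N * h ^+ N.
Proof. by rewrite /psum big_ord_recr /= addrAC subrr add0r. Qed.

(** Absolute convergence at radius r, quantified by K. This norm is submultiplicative for products
    of series ([nb_conv]), and on the disc of half the radius the series converges at rate 2^-n;
    hence the bounds r / 2 everywhere. *)
Definition nb a r K := forall N, \sum_(n < N) nm (a n) * r ^+ n <= K.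

Lemma nb_ge0 a r K : nb a r K -> 0 <= K.
Proof. by move=> /(_ 0%N); rewrite big_ord0. Qed.

Lemma nb_term a r K n : 0 <= r -> nb a r K -> nm (a n) * r ^+ n <= K.
Proof.
move=> r0 /(_ n.+1); rewrite big_ord_recr /=; apply: le_trans.
by rewrite lerDr sumr_ge0 // => i _; rewrite mulr_ge0 ?nm_ge0 ?exprn_ge0.
Qed.

Lemma nb_le a r r' K : 0 <= r' <= r -> nb a r K -> nb a r' K.
Proof.
move=> /andP[r0 rr] H N; apply: le_trans (H N); apply: ler_sum => i _.
by rewrite ler_wpM2l ?nm_ge0 // lerXn2r // nnegrE // (le_trans r0).
Qed.

Lemma nb_leK a r K K' : K <= K' -> nb a r K -> nb a r K'.
Proof. by move=> KK H N; exact: le_trans (H N) KK. Qed.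

Lemma half01 : 0 <= (2^-1 : R) < 1.
Proof. by apply/andP; split; lra. Qed.

Lemma sum_half N : \sum_(n < N) (2^-1 : R) ^+ n <= 2.
Proof.
suff -> : \sum_(n < N) (2^-1 : R) ^+ n = 2 - 2 * 2^-1 ^+ N.
  by rewrite lerBlDr lerDl mulr_ge0 ?exprn_ge0.
elim: N => [|N IH]; first by rewrite big_ord0 expr0; lra.
by rewrite big_ord_recr /= IH exprS; field.
Qed.

Lemma nm_half_pow h r n : 0 <= r -> nm h <= r / 2 -> nm h ^+ n <= r ^+ n * 2^-1 ^+ n.
Proof.
by move=> r0 hr; rewrite -exprMn lerXn2r // nnegrE ?nm_ge0 // mulr_ge0 ?invr_ge0.
Qed.

Lemma nb_term_half a r K h n : 0 <= r -> nb a r K -> nm h <= r / 2 ->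
  nm (a n * h ^+ n) <= K * 2^-1 ^+ n.
Proof.
move=> r0 H hr; rewrite nmM nmX.
apply: (@le_trans _ _ (nm (a n) * (r ^+ n * 2^-1 ^+ n))).
  by rewrite ler_wpM2l ?nm_ge0 // nm_half_pow.
by rewrite mulrA ler_wpM2r ?exprn_ge0 // nb_term.
Qed.

Lemma psum_cvg a r K h : 0 <= r -> nb a r K -> nm h <= r / 2 ->
  exists2 l, psum a h @ \oo --> l & forall n, nm (l - psum a h n) <= 2 * K * 2^-1 ^+ n.
Proof.
move=> r0 H hr; have [|l ul Hl] := @cvg_geom R (psum a h) K 2^-1 half01.
  by move=> n; rewrite psumS; exact: nb_term_half H hr.
by exists l => // n; apply: le_trans (Hl n) _; apply: eq_leR; field.
Qed.

Lemma cvg_nm_bounded (u : nat -> C) l : u @ \oo --> l -> exists B, forall n, nm (u n) <= B.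
Proof.
move=> /cvg_nmP/(_ 1 ltr01)[N HN]; exists (nm l + 1 + \sum_(i < N) nm (u i)) => n.
have S0 k : 0 <= \sum_(i < k) nm (u i) by apply: sumr_ge0 => i _; exact: nm_ge0.
have [Nn|nN] := leqP N n.
  have := HN _ Nn; have := nm_tri (u n) l 0; have := S0 N; rewrite !subr0; lra.
have := nm_ge0 l.
suff : nm (u n) <= \sum_(i < N) nm (u i) by lra.
rewrite (bigD1 (Ordinal nN)) //= lerDl; apply: sumr_ge0 => i _; exact: nm_ge0.
Qed.

(** Convergence at one point of modulus e / 2 bounds the terms there, so that at radius e / 4 they
    are dominated by a geometric series of ratio 1 / 2. All later work uses this quantitative
    form. *)
Lemma analytic_atP f z : analytic_at f z <->
  exists a r K, [/\ 0 < r, nb a r K &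
    forall h, nm h <= r / 2 -> psum a h @ \oo --> f (z + h)].
Proof.
have seE a w : series (fun n => a n * w ^+ n : C) = psum a w.
  by apply/funext => n; rewrite /series /= big_mkord.
split=> [[a /nbhs_nmP[e e0 He]]|[a [r [K [r0 H Hc]]]]]; last first.
  exists a; apply/nbhs_nmP; exists (r / 2); first by rewrite divr_gt0.
  move=> w hw /=; rewrite seE; have := Hc (w - z) (ltW hw).
  by rewrite (_ : z + (w - z) = w); [apply | ring].
have hc h : nm h < e -> psum a h @ \oo --> f (z + h).
  by move=> he; have := He (z + h); rewrite addrAC subrr add0r seE; apply.
pose h0 : C := (e / 2)%:C%C.
have nh0 : nm h0 = e / 2.
  by apply: complexI; rewrite -nmE ger0_norm // ler0c divr_ge0 // ltW.
have [|B HB] := cvg_nm_bounded (hc h0 _); first by rewrite nh0; lra.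
have HB2 n : nm (a n) * (e / 2) ^+ n <= 2 * B.
  rewrite -nh0 -nmX -nmM.
  rewrite -psumS.
  by have := nmBD (psum a h0 n.+1) (psum a h0 n); have := HB n; have := HB n.+1; lra.
have B0 : 0 <= B by apply: le_trans (nm_ge0 _) (HB 0%N).
exists a, (e / 4), (4 * B); split; first by rewrite divr_gt0.
- move=> N; apply: (@le_trans _ _ (\sum_(n < N) 2 * B * 2^-1 ^+ n)).
    apply: ler_sum => n _.
    have -> : e / 4 = e / 2 / 2 by field.
    by rewrite exprMn mulrA ler_wpM2r ?exprn_ge0.
  by rewrite -mulr_sumr; have := ler_wpM2l (mulr_ge0 (ler0n R 2) B0) (sum_half N); lra.
- by move=> h hr; apply: hc; apply: le_lt_trans hr _; lra.
Qed.

Lemma analytic_cst z (c : C) : analytic_at (fun _ => c) z.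
Proof.
apply/analytic_atP; exists (fun n => if n == 0%N then c else 0), 1, (nm c); split=> //.
- case=> [|N]; first by rewrite big_ord0 nm_ge0.
  rewrite big_ord_recl /= expr0 mulr1 big1 ?addr0 // => i _.
  by rewrite nm0 mul0r.
- move=> h _; apply/cvg_nmP => e e0; exists 1%N => -[//|n] _.
  by rewrite /psum big_ord_recl big1 /= ?expr0 ?mulr1 ?addr0 ?subrr ?nm0 // => i _; rewrite mul0r.
Qed.

Lemma analytic_id z : analytic_at id z.
Proof.
apply/analytic_atP.
exists (fun n => if n == 0%N then z else if n == 1%N then 1 else 0), 1, (nm z + 1); split=> //.
- case=> [|[|N]]; first by rewrite big_ord0 addr_ge0 ?nm_ge0.
    by rewrite big_ord1 /= expr0 mulr1 lerDl.
  rewrite !big_ord_recl /= expr0 mulr1 nm1 expr1n mulr1 big1 ?addr0 // => i _.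
  by rewrite nm0 mul0r.
- move=> h _; apply/cvg_nmP => e e0; exists 2%N => -[|[|n]] // _.
  rewrite /psum !big_ord_recl big1 /= ?expr0 ?mulr1 ?addr0; last by move=> i _; rewrite mul0r.
  by rewrite mul1r subrr nm0.
Qed.

Lemma analytic_at_near f g z : analytic_at f z ->
  (exists2 e : R, 0 < e & forall h, nm h < e -> g (z + h) = f (z + h)) ->
  analytic_at g z.
Proof.
move=> /analytic_atP[a [r [K [r0 H Hc]]]] [e e0 He].
apply/analytic_atP; exists a, (Num.min r e), K.
have m0 : 0 < Num.min r e by rewrite lt_min r0.
split=> //; first by apply: nb_le H; rewrite ltW //= ge_min lexx.
move=> h hm; have hr : nm h <= r / 2.
  by apply: le_trans hm _; rewrite ler_pM2r ?invr_gt0 // ge_min lexx.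
have he : nm h < e.
  apply: le_lt_trans hm _; apply: (@le_lt_trans _ _ (e / 2)); last by lra.
  by rewrite ler_pM2r ?invr_gt0 // ge_min lexx orbT.
by rewrite He //; exact: Hc.
Qed.

Lemma analytic_at2 f g z : analytic_at f z -> analytic_at g z ->
  exists a b r K, [/\ 0 < r, nb a r K, nb b r K &
    forall h, nm h <= r / 2 -> psum a h @ \oo --> f (z + h) /\ psum b h @ \oo --> g (z + h)].
Proof.
move=> /analytic_atP[a [r [K [r0 H Hc]]]] /analytic_atP[b [r' [K' [r0' H' Hc']]]].
have m0 : 0 < Num.min r r' by rewrite lt_min r0.
exists a, b, (Num.min r r'), (Num.max K K'); split=> //.
- apply: (@nb_leK _ _ K); first by rewrite le_max lexx.
  by apply: nb_le H; rewrite ltW //= ge_min lexx.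
- apply: (@nb_leK _ _ K'); first by rewrite le_max lexx orbT.
  by apply: nb_le H'; rewrite ltW //= ge_min lexx orbT.
- move=> h hm; split; [apply: Hc|apply: Hc']; apply: le_trans hm _;
  by rewrite ler_pM2r ?invr_gt0 // ge_min lexx ?orbT.
Qed.

Lemma analyticD f g z : analytic_at f z -> analytic_at g z ->
  analytic_at (fun w => f w + g w) z.
Proof.
move=> Hf Hg; have [a [b [r [K [r0 Ha Hb Hc]]]]] := analytic_at2 Hf Hg.
apply/analytic_atP; exists (fun n => a n + b n), r, (K + K); split=> //.
- move=> N; apply: le_trans (lerD (Ha N) (Hb N)); rewrite -big_split /=.
  apply: ler_sum => n _; rewrite -mulrDl ler_wpM2r ?nmD // exprn_ge0 // ltW //.
- move=> h hr; have [h1 h2] := Hc h hr.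
  have -> : psum (fun n => a n + b n) h = (fun N => psum a h N + psum b h N).
    by apply/funext => N; rewrite /psum -big_split /=; apply: eq_bigr => n _; rewrite mulrDl.
  exact: cvgD h1 h2.
Qed.

Lemma expr_ord_split (T : pzRingType) (x : T) n (i : 'I_n.+1) :
  x ^+ n = x ^+ i * x ^+ (n - i).
Proof. by rewrite -exprD subnKC // -ltnS. Qed.

Definition conv a b n : C := \sum_(i < n.+1) a i * b (n - i)%N.

Lemma sum_conv (T : comPzRingType) (x y : nat -> T) N :
  \sum_(n < N) \sum_(i < n.+1) x i * y (n - i)%N =
  \sum_(i < N) x i * \sum_(j < N - i) y j.
Proof.
elim: N => [|N IH]; first by rewrite !big_ord0.
rewrite big_ord_recr /= IH.
rewrite [RHS](eq_bigr (fun i : 'I_N.+1 => x i * (\sum_(j < N - i) y j) + x i * y (N - i)%N)).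
  rewrite big_split /=; congr (_ + _).
  by rewrite [RHS]big_ord_recr /= subnn big_ord0 mulr0 addr0.
by move=> i _; rewrite subSn ?big_ord_recr /= ?mulrDr // -ltnS.
Qed.

Lemma nb_conv a b r K K' : 0 <= r -> nb a r K -> nb b r K' -> nb (conv a b) r (K * K').
Proof.
move=> r0 Ha Hb N.
apply: (@le_trans _ _ (\sum_(n < N) \sum_(i < n.+1)
   (nm (a i) * r ^+ i) * (nm (b (n - i)%N) * r ^+ (n - i)))).
  apply: ler_sum => n _; apply: (@le_trans _ _ ((\sum_(i < n.+1) nm (a i * b (n - i)%N)) * r ^+ n)).
    by rewrite ler_wpM2r ?exprn_ge0 // nm_sum.
  rewrite mulr_suml; apply: ler_sum => i _.
  rewrite nmM (expr_ord_split r i); apply: eq_leR; ring.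
rewrite (@sum_conv _ (fun i => nm (a i) * r ^+ i) (fun j => nm (b j) * r ^+ j)).
apply: (@le_trans _ _ (\sum_(i < N) (nm (a i) * r ^+ i) * K')).
  by apply: ler_sum => i _; rewrite ler_wpM2l ?mulr_ge0 ?nm_ge0 ?exprn_ge0.
by rewrite -mulr_suml ler_wpM2r // (nb_ge0 Hb).
Qed.

(** The product of the partial sums differs from the partial sum of the convolution by the terms
    with i + j >= n; grouped by i, each of the n groups is at most 4 K K' 2^-n. *)
Lemma psum_conv a b r K K' h l m : 0 <= r -> nb a r K -> nb b r K' -> nm h <= r / 2 ->
  psum a h @ \oo --> l -> psum b h @ \oo --> m -> psum (conv a b) h @ \oo --> l * m.
Proof.
move=> r0 Ha Hb hr al bm; apply: cvg_nm_near (cvg_nmM al bm) _ => e e0.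
have [m' bm' Hm] := psum_cvg r0 Hb hr.
have K0 := nb_ge0 Ha; have K0' := nb_ge0 Hb.
(* n 2^-n is at most 2 (3/4)^n, by the Bernoulli inequality for (3/2)^n; this also gives the
   constant 8 below. *)
pose rho : R := 3 / 4.
have [|N HN] := @geom_lt_eps R (8 * K * K') rho e _ e0; first by apply/andP; split; rewrite /rho; lra.
exists N => n /HN; apply: le_lt_trans.
  have -> : psum (conv a b) h n = \sum_(i < n) (a i * h ^+ i) * psum b h (n - i).
    rewrite /psum -(@sum_conv _ (fun i => a i * h ^+ i) (fun j => b j * h ^+ j)).
    apply: eq_bigr => k _; rewrite mulr_suml; apply: eq_bigr => i _.
    by rewrite (expr_ord_split h i); ring.
  rewrite {1}/psum mulr_suml -sumrB; apply: le_trans (nm_sum _ _ _) _.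
  apply: (@le_trans _ _ (\sum_(i < n) 4 * K * K' * 2^-1 ^+ n)).
    apply: ler_sum => i _; rewrite -mulrBr nmM.
    have h1 : nm (psum b h n - psum b h (n - i)) <= 4 * K' * 2^-1 ^+ (n - i).
      have := nm_tri_mid m' (psum b h n) (psum b h (n - i)).
      have := Hm n; have := Hm (n - i)%N.
      have : (2^-1 : R) ^+ n <= 2^-1 ^+ (n - i).
        have i1 : (2^-1 : R) <= 1 by lra.
        apply: ler_wiXn2l => //; exact: leq_subr.
      move=> /(ler_wpM2l K0') q1 q2 q3 q4.
      lra.
    have h2 := nb_term_half i r0 Ha hr.
    apply: le_trans (ler_pM (nm_ge0 _) (nm_ge0 _) h2 h1) _.
    rewrite (_ : 2^-1 ^+ n = 2^-1 ^+ i * 2^-1 ^+ (n - i) :> R); last by rewrite -exprD subnKC // ltnW.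
    apply: eq_leR; ring.
  rewrite sumr_const card_ord -mulr_natr.
  have bern k : k%:R / 2 <= (3 / 2 : R) ^+ k - 1.
    elim: k => [|k IH]; first by rewrite expr0; lra.
    by rewrite exprS -natr1; move: IH; have := ler0n R k; set x := _ ^+ k; lra.
  have -> : rho ^+ n = (3 / 2) ^+ n * 2^-1 ^+ n by rewrite -exprMn; congr (_ ^+ n); rewrite /rho; field.
  have h2 : 0 <= (2^-1 : R) ^+ n by rewrite exprn_ge0.
  have := bern n; set x := (3 / 2) ^+ n => hb.
  have : n%:R <= 2 * x by lra.
  move=> /(ler_wpM2l (mulr_ge0 (mulr_ge0 K0 K0') h2)); lra.
Qed.
End power_series.

(** * Products, difference quotients and reciprocals of analytic functions *)

Section analytic_operations.
Context {R : realType}.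
Local Notation C := (cplx R).
Implicit Types (a b : nat -> C) (f g F : C -> C) (z h w l m : C) (r K : R).

Lemma analyticM f g z : analytic_at f z -> analytic_at g z ->
  analytic_at (fun w => f w * g w) z.
Proof.
move=> Hf Hg; have [a [b [r [K [r0 Ha Hb Hc]]]]] := analytic_at2 Hf Hg.
apply/analytic_atP; exists (conv a b), r, (K * K); split=> //.
  exact: nb_conv (ltW r0) Ha Hb.
by move=> h hr; have [h1 h2] := Hc h hr; exact: psum_conv (ltW r0) Ha Hb hr h1 h2.
Qed.

Lemma psum0 a n : psum a 0 n.+1 = a 0%N.
Proof.
by rewrite /psum big_ord_recl expr0 mulr1 big1 ?addr0 // => i _; rewrite expr0n /= mulr0.
Qed.

Lemma psum_coef0 a f z r : 0 < r ->
  (forall h, nm h <= r / 2 -> psum a h @ \oo --> f (z + h)) -> a 0%N = f z.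
Proof.
move=> r0 H; have := H 0; rewrite nm0 addr0 => /(_ (ltW (divr_gt0 r0 (ltr0n _ 2)))) H0.
apply: (cvg_nm_unique _ H0); apply/cvg_nmP => e e0; exists 1%N => -[//|n] _.
by rewrite psum0 subrr nm0.
Qed.

(* Removable singularity of the difference quotient: shift the coefficients. *)
Lemma analytic_quotient f z : analytic_at f z ->
  exists d, analytic_at (fun w => if w == z then d else (f w - f z) / (w - z)) z.
Proof.
move=> /analytic_atP[a [r [K [r0 H Hc]]]]; exists (a 1%N).
have a0 := psum_coef0 r0 Hc.
apply/analytic_atP; exists (fun n => a n.+1), r, (K / r); split; first exact: r0.
- move=> N; rewrite ler_pdivlMr // mulr_suml; apply: le_trans (H N.+1).
  rewrite big_ord_recl /= -[leLHS]add0r lerD ?mulr_ge0 ?nm_ge0 // ler_sum // => i _.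
  by rewrite exprSr mulrA.
- move=> h hr; case: ifPn => [/eqP hz|hz].
    have -> : h = 0 by apply: (addrI z); rewrite hz addr0.
    apply/cvg_nmP => e e0; exists 1%N => -[//|n] _.
    by rewrite psum0 subrr nm0.
  have h0 : h != 0 by apply: contraNneq hz => ->; rewrite addr0.
  have -> : z + h - z = h by rewrite addrAC subrr add0r.
  have -> : psum (fun n => a n.+1) h = (fun n => (psum a h (1 + n)%N - f z) * h^-1).
    apply/funext => n; rewrite /psum add1n big_ord_recl expr0 mulr1 a0 addrAC subrr add0r.
    by rewrite mulr_suml; apply: eq_bigr => i _; rewrite /= exprSr; field.
  apply: cvg_nmM (@cvg_nm_const _ h^-1).
  apply: cvg_nmB (@cvg_nm_const _ (f z)).
  by apply: cvg_nm_shift; exact: Hc.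
Qed.

(** Course-of-values recursion: each coefficient of 1 / f depends on all earlier ones, which are
    carried in a list. [recipE] is the resulting recurrence. *)
Fixpoint recip_seq a n : seq C :=
  if n is k.+1 then
    let s := recip_seq a k in
    rcons s (((k == 0%N)%:R - \sum_(i < k) s`_i * a (k - i)%N) / a 0%N)
  else [::].

Definition recip a n : C := (recip_seq a n.+1)`_n.

Lemma size_recip_seq a n : size (recip_seq a n) = n.
Proof. by elim: n => //= n IH; rewrite size_rcons IH. Qed.

Lemma nth_recip_seq a n i : (i < n)%N -> (recip_seq a n)`_i = recip a i.
Proof.
elim: n => // n IH; rewrite ltnS leq_eqVlt => /predU1P[->//|ni].
by rewrite /= nth_rcons size_recip_seq ni IH.
Qed.

Lemma recipE a n :
  recip a n = ((n == 0%N)%:R - \sum_(i < n) recip a i * a (n - i)%N) / a 0%N.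
Proof.
rewrite /recip /= nth_rcons size_recip_seq ltnn eqxx; congr ((_ - _) / _).
by apply: eq_bigr => i _; rewrite nth_recip_seq.
Qed.

Lemma conv_recip a n : a 0%N != 0 -> conv (recip a) a n = (n == 0%N)%:R.
Proof.
move=> a0; rewrite /conv big_ord_recr /= subnn recipE divfK //.
by rewrite addrC subrK.
Qed.

(** With A = |a_0| and t = A / (2 K + A), the terms of index at least 1 sum to at most A / 2 at
    radius t r. The recurrence then bounds |b_n| (t r)^n by 1 / A inductively, and halving the
    radius makes these bounds summable. *)
Lemma nb_recip a r K : 0 < r -> nb a r K -> a 0%N != 0 ->
  exists r', [/\ 0 < r', r' <= r & nb (recip a) r' (2 * (nm (a 0%N))^-1)].
Proof.
move=> r0 H a0; set A := nm (a 0%N); have A0 : 0 < A by rewrite nm_gt0.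
have K0 := nb_ge0 H.
pose t := A / (2 * K + A).
have D0 : 0 < 2 * K + A by lra.
have t0 : 0 < t by rewrite divr_gt0.
have t1 : t <= 1 by rewrite ler_pdivrMr // mul1r; lra.
have tK : t * K <= A / 2.
  rewrite /t mulrAC ler_pdivrMr //; have : 0 <= A * A by rewrite mulr_ge0 // ltW.
  lra.
have tail n : \sum_(i < n) nm (a i.+1) * (t * r) ^+ i.+1 <= A / 2.
  apply: le_trans tK.
  apply: (@le_trans _ _ (t * \sum_(i < n.+1) nm (a i) * r ^+ i)); last first.
    by rewrite ler_wpM2l // ltW.
  rewrite big_ord_recl mulrDr -[leLHS]add0r lerD //.
    by apply: (mulr_ge0 (ltW t0)); exact: (mulr_ge0 (nm_ge0 _) (exprn_ge0 _ (ltW r0))).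
  rewrite mulr_sumr; apply: ler_sum => i _; rewrite mulrCA ler_wpM2l ?nm_ge0 //.
  have te : t ^+ i.+1 <= t by rewrite exprSr ler_piMl ?exprn_ile1 // ltW.
  by rewrite exprMn; apply: ler_wpM2r te; rewrite exprn_ge0 // ltW.
have bd n : nm (recip a n) * (t * r) ^+ n <= A^-1.
  elim/ltn_ind: n => n IH; rewrite recipE nmM nmV -/A mulrAC ler_pdivrMr // mulVf ?(gt_eqF A0) //.
  case: n IH => [|n] IH; first by rewrite eqxx big_ord0 subr0 nm1 expr0 mulr1.
  rewrite /= sub0r nmN.
  have P0 : 0 <= (t * r) ^+ n.+1 by rewrite exprn_ge0 // mulr_ge0 // ltW.
  apply: le_trans (ler_wpM2r P0 (nm_sum _ _ _)) _.
  rewrite mulr_suml.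
  apply: (@le_trans _ _ (A^-1 * (A / 2))); last by rewrite mulrA mulVf ?gt_eqF //; lra.
  apply: le_trans (ler_wpM2l _ (tail n.+1)); last by rewrite invr_ge0 ltW.
  rewrite (reindex_inj rev_ord_inj) mulr_sumr /=; apply: ler_sum => i _.
  rewrite subSS (subSn (leq_subr i n)) subKn; last by rewrite -ltnS.
  have hi : (n - i < n.+1)%N by rewrite ltnS leq_subr.
  have -> : (t * r) ^+ n.+1 = (t * r) ^+ (n - i) * (t * r) ^+ i.+1.
    by rewrite -exprD addnS subnK // -ltnS.
  rewrite nmM; have := IH _ hi; set x := nm (recip a _); set y := _ ^+ (n - i).
  set u := nm _; set v := _ ^+ i.+1.
  have uv : 0 <= u * v by rewrite mulr_ge0 ?nm_ge0 // exprn_ge0 // mulr_ge0 // ltW.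
  by move=> /(ler_wpM2r uv); lra.
exists (t * r / 2); split.
- by rewrite divr_gt0 // mulr_gt0.
- have : t * r <= 1 * r by rewrite ler_wpM2r // ltW.
  by have := mulr_gt0 t0 r0; lra.
- move=> N; apply: (@le_trans _ _ (\sum_(n < N) A^-1 * 2^-1 ^+ n)).
    by apply: ler_sum => n _; rewrite exprMn mulrA ler_wpM2r ?exprn_ge0.
  by rewrite -mulr_sumr mulrC ler_wpM2r ?invr_ge0 ?(ltW A0) // sum_half.
Qed.

Lemma analyticV f z : analytic_at f z -> f z != 0 -> analytic_at (fun w => (f w)^-1) z.
Proof.
move=> /analytic_atP[a [r [K [r0 H Hc]]]] fz0.
have a0 : a 0%N != 0 by rewrite (psum_coef0 r0 Hc).
have [r' [r0' rr Hb]] := nb_recip r0 H a0.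
apply/analytic_atP; exists (recip a), r', (2 * (nm (a 0%N))^-1); split; [exact: r0'|exact: Hb|move=> h hr].
have H' : nb a r' K by apply: nb_le H; rewrite rr ltW.
have [m bm _] := psum_cvg (ltW r0') Hb hr.
have hr2 : nm h <= r / 2 by apply: le_trans hr _; rewrite ler_pM2r.
have := psum_conv (ltW r0') Hb H' hr bm (Hc _ hr2).
have : psum (conv (recip a) a) h @ \oo --> (1 : C).
  apply/cvg_nmP => e e0; exists 1%N => -[//|n] _.
  rewrite /psum big_ord_recl conv_recip // expr0 mulr1 big1 ?addr0 ?subrr ?nm0 // => i _.
  by rewrite conv_recip // mul0r.
move=> h1 h2; have mf := cvg_nm_unique h1 h2.
have f0 : f (z + h) != 0.
  by apply/eqP => f0; move: mf; rewrite f0 mulr0 => /eqP; rewrite oner_eq0.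
have fm : (f (z + h))^-1 = m by apply: (mulIf f0); rewrite mulVf.
rewrite fm; exact: bm.
Qed.

(* [F (w + k) - F w] is, to second order, proportional to [k]: all that is used
   of analyticity in the Cauchy-type argument below. *)
Definition quad_near (M : R) F w k l :=
  nm (l * (F (w + k) - F w) - k * (F (w + l) - F w)) <= M * (nm k * nm l * (nm k + nm l)).

Lemma quad_monomial (x y w : C) (rho : R) n :
  nm x <= rho -> nm y <= rho -> nm w <= rho ->
  rho ^+ 2 * nm ((y - w) * (x ^+ n - w ^+ n) - (x - w) * (y ^+ n - w ^+ n)) <=
  n%:R ^+ 2 * rho ^+ n * (nm (x - w) * nm (y - w) * (nm (x - w) + nm (y - w))).
Proof.
move=> hx hy hw; have rho0 : 0 <= rho := le_trans (nm_ge0 _) hx.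
set k := x - w; set l := y - w; set Q : R := nm k * nm l * (nm k + nm l).
have Q0 : 0 <= Q by rewrite !mulr_ge0 ?addr_ge0 ?nm_ge0.
have lin j : rho * nm (y ^+ j - w ^+ j) <= j%:R * rho ^+ j * nm l.
  elim: j => [|j IH]; first by rewrite !expr0 subrr nm0 !mul0r mulr0.
  have -> : y ^+ j.+1 - w ^+ j.+1 = y * (y ^+ j - w ^+ j) + l * w ^+ j.
    by rewrite /l !exprS; ring.
  have h1 : nm (y * (y ^+ j - w ^+ j)) <= rho * nm (y ^+ j - w ^+ j).
    by rewrite nmM ler_wpM2r ?nm_ge0.
  have h2 : nm (l * w ^+ j) <= nm l * rho ^+ j.
    by rewrite nmM nmX ler_wpM2l ?nm_ge0 // lerXn2r ?nnegrE ?nm_ge0.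
  apply: (@le_trans _ _ (rho * (rho * nm (y ^+ j - w ^+ j) + nm l * rho ^+ j))).
    by rewrite ler_wpM2l // (le_trans (nmD _ _)) // lerD.
  rewrite exprS -natr1; have := ler_wpM2l rho0 IH; lra.
elim: n => [|n IH].
  by rewrite !expr0 !subrr !mulr0 subrr nm0 mulr0 mulr_ge0 // mulr_ge0 ?exprn_ge0.
have -> : l * (x ^+ n.+1 - w ^+ n.+1) - k * (y ^+ n.+1 - w ^+ n.+1) =
    x * (l * (x ^+ n - w ^+ n) - k * (y ^+ n - w ^+ n)) + k * (k - l) * (y ^+ n - w ^+ n).
  by rewrite /l /k !exprS; ring.
set D := l * _ - _ in IH *.
have h1 : nm (x * D) <= rho * nm D by rewrite nmM ler_wpM2r ?nm_ge0.
have h2 : rho * nm (k * (k - l) * (y ^+ n - w ^+ n)) <= n%:R * rho ^+ n * Q.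
  rewrite !nmM mulrCA; apply: le_trans (ler_wpM2l _ (lin n)) _; first by rewrite mulr_ge0 ?nm_ge0.
  rewrite /Q; have := nmBD k l.
  have q0 : 0 <= n%:R * rho ^+ n * nm l * nm k by rewrite !mulr_ge0 ?nm_ge0 ?exprn_ge0.
  move=> /(ler_wpM2l q0); lra.
have h3 : rho ^+ 2 * nm (x * D + k * (k - l) * (y ^+ n - w ^+ n)) <=
    rho * (rho ^+ 2 * nm D) + rho * (rho * nm (k * (k - l) * (y ^+ n - w ^+ n))).
  have := nmD (x * D) (k * (k - l) * (y ^+ n - w ^+ n)) => h3.
  have p2 : 0 <= rho ^+ 2 by rewrite exprn_ge0.
  have := ler_wpM2l p2 (le_trans h3 (lerD h1 (lexx _))).
  by rewrite !expr2; lra.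
apply: le_trans h3 _.
have h4 := ler_wpM2l rho0 IH; have h5 := ler_wpM2l rho0 h2.
rewrite (exprS rho n) -natr1.
have : 0 <= (n%:R + 1) * (rho * rho ^+ n) * Q.
  have n1 : 0 <= n%:R + 1 :> R by rewrite addr_ge0.
  exact: mulr_ge0 (mulr_ge0 n1 (mulr_ge0 rho0 (exprn_ge0 _ rho0))) Q0.
by move: h4 h5; rewrite !expr2; lra.
Qed.

Lemma analytic_quad F z : analytic_at F z -> exists M d, [/\ 0 <= M, 0 < d &
  forall w k l, nm (w - z) <= d -> nm (w + k - z) <= d -> nm (w + l - z) <= d ->
  quad_near M F w k l].
Proof.
move=> /analytic_atP[a [r [K [r0 H Hc]]]].
have K0 := nb_ge0 H.
(* n^2 <= 4^n <= 8^n, so the factor n^2 rho^n of [quad_monomial] is absorbed by r^n = (8 rho)^n. *)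
pose rho := r / 8; have rho0 : 0 < rho by rewrite divr_gt0.
have rho2 : 0 < rho ^+ 2 by rewrite exprn_gt0.
exists (K / rho ^+ 2), rho; split=> //; first by rewrite divr_ge0 // ltW.
move=> w k l hw hk hl; rewrite /quad_near.
set x := w + k - z in hk; set y := w + l - z in hl; set v := w - z in hw.
have kE : k = x - v by rewrite /x /v; ring.
have lE : l = y - v by rewrite /y /v; ring.
have xE : w + k = z + x by rewrite /x; ring.
have yE : w + l = z + y by rewrite /y; ring.
have vE : w = z + v by rewrite /v; ring.
rewrite xE yE (_ : F w = F (z + v)); last by rewrite -vE.
have C0 u : nm u <= rho -> psum a u @ \oo --> F (z + u).
  by move=> hu; apply: Hc; apply: le_trans hu _; rewrite /rho; lra.
have cv := cvg_nmB (cvg_nmM (@cvg_nm_const _ l) (cvg_nmB (C0 x hk) (C0 v hw)))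
                   (cvg_nmM (@cvg_nm_const _ k) (cvg_nmB (C0 y hl) (C0 v hw))).
apply: (cvg_nm_le cv) => n.
rewrite mulrAC ler_pdivlMr // /psum -!sumrB !mulr_sumr -sumrB mulrC.
apply: le_trans (ler_wpM2l (ltW rho2) (nm_sum _ _ _)) _.
set Q : R := nm k * nm l * (nm k + nm l).
have Q0 : 0 <= Q by rewrite !mulr_ge0 ?addr_ge0 ?nm_ge0.
rewrite mulr_sumr; apply: le_trans (ler_wpM2r Q0 (H n)).
rewrite mulr_suml; apply: ler_sum => i _.
have -> : l * (a i * x ^+ i - a i * v ^+ i) - k * (a i * y ^+ i - a i * v ^+ i) =
   a i * (l * (x ^+ i - v ^+ i) - k * (y ^+ i - v ^+ i)) by ring.
have := quad_monomial i hk hl hw; rewrite -kE -lE -/Q nmM.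
set D := nm (_ - _) => hD.
suff hr : (i : nat)%:R ^+ 2 * rho ^+ i * Q <= r ^+ i * Q.
  by have := ler_wpM2l (nm_ge0 (a i)) (le_trans hD hr); lra.
rewrite ler_wpM2r //.
have -> : r = rho * 8 by rewrite /rho; field.
rewrite [(rho * 8) ^+ i]exprMn [leRHS]mulrC; apply: ler_wpM2r; first by rewrite exprn_ge0 // ltW.
have n4 : (i : nat)%:R <= (2 : R) ^+ i by rewrite -natrX ler_nat ltnW // ltn_expl.
apply: (@le_trans _ _ ((2 ^+ i) ^+ 2)); first by rewrite lerXn2r // nnegrE ?exprn_ge0.
by rewrite -exprM mulnC exprM lerXn2r // ?nnegrE //; lra.
Qed.

Lemma analytic_bounded F z : analytic_at F z -> exists M d, 0 < d /\
  forall w, nm (w - z) <= d -> nm (F w) <= M.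
Proof.
move=> /analytic_atP[a [r [K [r0 H Hc]]]]; exists (2 * K), (r / 2); split; first by rewrite divr_gt0.
move=> w hw; have := Hc _ hw; rewrite (_ : z + (w - z) = w); last by ring.
move=> cw; have [m cm /(_ 0%N)] := psum_cvg (ltW r0) H hw.
by rewrite (cvg_nm_unique cw cm) /psum big_ord0 subr0 expr0 mulr1.
Qed.

End analytic_operations.

Section tends_to_zero.
Context {R : realType}.
Local Notation C := (cplx R).
Implicit Types (u v : nat -> C).

Definition tends0 u := forall e : R, 0 < e -> exists N, forall n, (N <= n)%N -> nm (u n) < e.

Lemma tends0D u v : tends0 u -> tends0 v -> tends0 (fun n => u n + v n).
Proof.
move=> Hu Hv e e0; have e2 : 0 < e / 2 by rewrite divr_gt0.
have [N HN] := Hu _ e2; have [N' HN'] := Hv _ e2; exists (maxn N N') => n.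
rewrite geq_max => /andP[/HN h1 /HN' h2].
by have := nmD (u n) (v n); lra.
Qed.

Lemma tends0M (c : C) u : tends0 u -> tends0 (fun n => c * u n).
Proof.
move=> Hu e e0; have c1 : 0 < nm c + 1 by have := nm_ge0 c; lra.
have [|N HN] := Hu (e / (nm c + 1)); first by rewrite divr_gt0.
exists N => n /HN; rewrite ltr_pdivlMr // nmM => h.
by have := nm_ge0 (u n); lra.
Qed.

Lemma tends0N u : tends0 u -> tends0 (fun n => - u n).
Proof. by move=> H e /H[N HN]; exists N => n /HN; rewrite nmN. Qed.

Lemma tends0B u v : tends0 u -> tends0 v -> tends0 (fun n => u n - v n).
Proof. by move=> Hu /tends0N; exact: tends0D. Qed.

Lemma eq_tends0 u v : u =1 v -> tends0 u -> tends0 v.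
Proof. by move=> uv H e /H[N HN]; exists N => n /HN; rewrite uv. Qed.

Lemma tends00 : tends0 (fun _ => 0).
Proof. by move=> e e0; exists 0%N => n _; rewrite nm0. Qed.

Lemma tends0_sum (u : nat -> nat -> C) K : (forall i, tends0 (u i)) ->
  tends0 (fun n => \sum_(i < K) u i n).
Proof.
move=> H; elim: K => [|K IH].
  by apply: eq_tends0 tends00 => n; rewrite big_ord0.
by apply: eq_tends0 (tends0D IH (H K)) => n; rewrite big_ord_recr.
Qed.

(** K is the number of terms kept in a geometric expansion; its remainder is uniform in n, so K can
    be fixed first. *)
Lemma tends0_approx u (B rho : R) : 0 <= rho < 1 ->
  (forall K, exists2 v, tends0 v & forall n, nm (u n - v n) <= B * rho ^+ K) -> tends0 u.
Proof.
move=> r01 H e e0; have e2 : 0 < e / 2 by rewrite divr_gt0.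
have [K HK] := geom_lt_eps B r01 e2; have [v Hv hv] := H K.
have [N HN] := Hv _ e2; exists N => n /HN h.
have := hv n; have := HK _ (leqnn K); have := nm_tri (u n) (v n) 0; rewrite !subr0; lra.
Qed.

Lemma tends0_const (c : C) : tends0 (fun _ => c) -> c = 0.
Proof.
move=> H; apply/eqP; apply: contraT; rewrite -nm_gt0 => c0.
by have [N /(_ _ (leqnn N))] := H _ c0; rewrite ltxx.
Qed.

End tends_to_zero.

(** * Roots of unity of order a power of two *)

Section roots_of_unity.
Context {R : realType}.
Local Notation C := (cplx R).
Implicit Types (z s : C).

Lemma nm_sq z : nm z ^+ 2 = complex.Re (z : R[i]%C) ^+ 2 + complex.Im (z : R[i]%C) ^+ 2.
Proof. by apply: complexI; rewrite rmorphXn /= -nmE add_Re2_Im2. Qed.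

(** The square root closer to 1 than to -1, hence the one in the closed right half-plane. *)
Definition half_root z : C :=
  let s := sqrtC z in if nm (s - 1) <= nm (s + 1) then s else - s.

Lemma half_rootK z : half_root z ^+ 2 = z.
Proof. by rewrite /half_root; case: ifP; rewrite ?sqrrN sqrtCK. Qed.

Lemma half_root_le z : nm (half_root z - 1) <= nm (half_root z + 1).
Proof.
rewrite /half_root; case: ifPn => //; rewrite -ltNge => h.
have -> : - sqrtC z - 1 = - (sqrtC z + 1) by ring.
have -> : - sqrtC z + 1 = - (sqrtC z - 1) by ring.
by rewrite !nmN ltW.
Qed.

Lemma Re_half_root z : 0 <= complex.Re (half_root z : R[i]%C).
Proof.
have := half_root_le z; rewrite -(@ler_pXn2r _ 2) // ?nnegrE ?nm_ge0 //.
by rewrite !nm_sq; case: (half_root z) => a b /=; lra.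
Qed.

Lemma half_root_eq0 z : (half_root z == 0) = (z == 0).
Proof. by rewrite -[in RHS](half_rootK z) expf_eq0. Qed.

(** Iterated square roots of -1: a root of unity of order 2^(k+1), which tends to 1 as k grows. *)
Fixpoint zeta k : C := if k is k'.+1 then half_root (zeta k') else -1.

Lemma zeta_pow k : zeta k ^+ (2 ^ k.+1) = 1.
Proof.
elim: k => [|k IH]; first by rewrite /= expn1 sqrrN expr1n.
by rewrite expnS exprM /= half_rootK.
Qed.

Lemma zeta_neq1 k : zeta k != 1.
Proof.
elim: k => [|k] /=.
  by rewrite -subr_eq0 -opprD oppr_eq0 -(natrD _ 1 1) pnatr_eq0.
by apply: contraNneq => h; rewrite -(half_rootK (zeta k)) h expr1n.
Qed.

Lemma nm_zeta k : nm (zeta k) = 1.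
Proof.
elim: k => [|k IH] /=; first by rewrite nmN nm1.
apply/eqP; rewrite -(@eqrXn2 _ 2) ?nm_ge0 // expr1n -nmX half_rootK IH //.
Qed.

(** If s^2 = zeta k, then |s - 1| |s + 1| = |zeta k - 1|, and |s + 1|^2 >= 2 because |s| = 1 and Re
    s >= 0; so the squared distance to 1 is at least halved at each step. *)
Lemma zeta_dist k : nm (zeta k - 1) ^+ 2 <= 4 * 2^-1 ^+ k.
Proof.
elim: k => [|k IH].
  rewrite /= -opprD nmN -(natrD _ 1 1) nmn expr0; lra.
have h1 : nm (zeta k.+1 - 1) ^+ 2 * nm (zeta k.+1 + 1) ^+ 2 = nm (zeta k - 1) ^+ 2.
  rewrite -exprMn -nmM -(half_rootK (zeta k)) /=; congr (nm _ ^+ 2); ring.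
have h2 : 2 <= nm (zeta k.+1 + 1) ^+ 2.
  have : nm (zeta k.+1) ^+ 2 = 1 by rewrite nm_zeta expr1n.
  have := Re_half_root (zeta k).
  rewrite !nm_sq /=; case: (half_root _) => a b /=; rewrite !expr2; lra.
rewrite [2^-1 ^+ k.+1]exprS; have := ler_wpM2l (sqr_ge0 (nm (zeta k.+1 - 1))) h2.
rewrite h1; lra.
Qed.

Lemma zeta_cvg (e : R) : 0 < e -> exists N, forall k, (N <= k)%N -> nm (zeta k - 1) < e.
Proof.
move=> e0; have e2 : 0 < e ^+ 2 by rewrite exprn_gt0.
have [N HN] := geom_lt_eps 4 (@half01 R) e2; exists N => k /HN h.
rewrite -(@ltr_pXn2r _ 2) // ?nnegrE ?nm_ge0 ?(ltW e0) //.
exact: le_lt_trans (zeta_dist k) h.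
Qed.

End roots_of_unity.

(** * Uniform estimates on annuli *)

Section annulus.
Context {R : realType}.
Local Notation C := (cplx R).

Definition annulus (r1 r2 : R) : set C := [set z | r1 <= nm z <= r2].

Lemma nm_le_ReIm (z : C) : nm z <= `|complex.Re (z : R[i]%C)| + `|complex.Im (z : R[i]%C)|.
Proof.
rewrite -(@ler_pXn2r _ 2) // ?nnegrE ?nm_ge0 ?addr_ge0 // nm_sq sqrrD !real_normK ?num_real //.
by have := mulr_ge0 (normr_ge0 (complex.Re (z : R[i]%C))) (normr_ge0 (complex.Im (z : R[i]%C))); lra.
Qed.

Lemma Re_le_nm (z : C) : `|complex.Re (z : R[i]%C)| <= nm z.
Proof.
by rewrite -(@ler_pXn2r _ 2) // ?nnegrE ?nm_ge0 // nm_sq real_normK ?num_real // lerDl sqr_ge0.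
Qed.

Lemma Im_le_nm (z : C) : `|complex.Im (z : R[i]%C)| <= nm z.
Proof.
by rewrite -(@ler_pXn2r _ 2) // ?nnegrE ?nm_ge0 // nm_sq real_normK ?num_real // lerDr sqr_ge0.
Qed.

Lemma closed_nm (A : set C) :
  (forall z, (forall e : R, 0 < e -> exists2 w, A w & nm (w - z) < e) -> A z) -> closed A.
Proof.
move=> H z clz; apply: H => e e0.
have : nbhs z [set w | nm (w - z) < e] by apply/nbhs_nmP; exists e.
by move=> /clz[w [Aw hw]]; exists w.
Qed.

Lemma compact_annulus (r1 r2 : R) : compact (annulus r1 r2).
Proof.
pose f (p : R * R) : C := (p.1 +i* p.2)%C.
have cS : compact (f @` (`[- r2, r2]%classic `*` `[- r2, r2]%classic)).
  apply: continuous_compact; last by apply: compact_setX; exact: segment_compact.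
  apply: continuous_subspaceT => -[x y] B /nbhs_nmP[e e0 He].
  have e2 : 0 < e / 2 by rewrite divr_gt0.
  exists (ball x (e / 2), ball y (e / 2)) => /=; first by split; exact: nbhsx_ballx.
  move=> [x' y'] [/= hx hy]; apply: He; apply: le_lt_trans (nm_le_ReIm _) _ => /=.
  by move: hx hy; rewrite /ball /= !(distrC x) !(distrC y); lra.
apply: (subclosed_compact _ cS).
  apply: closed_nm => z H; rewrite /annulus /=.
  apply/andP; split; rewrite leNgt; apply/negP => h.
    have [|w /andP[h1 h2] h3] := H (r1 - nm z); first by rewrite subr_gt0.
    by have := nm_tri w z 0; rewrite !subr0; lra.
  have [|w /andP[h1 h2] h3] := H (nm z - r2); first by rewrite subr_gt0.
  by have := nm_tri_mid w z 0; rewrite !subr0; lra.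
move=> z /andP[_ hz]; exists (complex.Re (z : R[i]%C), complex.Im (z : R[i]%C)); last by case: (z).
have hR := le_trans (Re_le_nm z) hz; have hI := le_trans (Im_le_nm z) hz.
by split; rewrite /= in_itv /= -ler_norml.
Qed.

(** Compactness in near-covering form: an index that works locally can be chosen once for the whole
    annulus. *)
Lemma annulus_uniform (r1 r2 : R) (P : nat -> C -> Prop) :
  (forall z, annulus r1 r2 z ->
     exists e N, 0 < e /\ forall n w, (N <= n)%N -> nm (w - z) < e -> P n w) ->
  exists n, forall w, annulus r1 r2 w -> P n w.
Proof.
move=> H; have /compact_near_coveringP cov := @compact_annulus r1 r2.
have [|N _ HN] := cov nat \oo P _; last by exists N; exact: (HN N (leqnn N)).
move=> z /H[e [N [e0 He]]].
exists ([set w | nm (w - z) < e], [set n | (N <= n)%N]) => /=.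
  by split; [apply/nbhs_nmP; exists e | exists N].
by move=> [w n] [/= hw hn]; exact: He.
Qed.

Lemma analytic_quad_annulus (F : C -> C) (r1 r2 : R) : 0 < r1 ->
  (forall z, z != 0 -> analytic_at F z) ->
  exists M d, [/\ 0 <= M, 0 < d & forall w k l, annulus r1 r2 w -> nm k <= d -> nm l <= d ->
    quad_near M F w k l].
Proof.
(* One index serves as the constant and as the inverse of the radius, so that [P n] becomes weaker
   as n grows. *)
move=> r0 HF; pose P n w := forall k l, nm k <= n.+1%:R^-1 :> R -> nm l <= n.+1%:R^-1 :> R ->
  quad_near n%:R F w k l.
have [z /andP[hz _]|n Hn] := @annulus_uniform r1 r2 P; last first.
  exists n%:R, n.+1%:R^-1; split=> //.
  by move=> w k l /Hn; apply.
have z0 : z != 0 by rewrite -nm_gt0; apply: lt_le_trans hz.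
have [M [d [M0 d0 Hd]]] := analytic_quad (HF z z0).
have d2 : 0 < d / 2 by rewrite divr_gt0.
have [N1 HN1] := nat_inv_lt d2.
exists (d / 2), (maxn N1 (Num.trunc M).+1); split=> // n w.
rewrite geq_max => /andP[/HN1 h1 h2] hw k l hk hl.
have hk' := le_lt_trans hk h1; have hl' := le_lt_trans hl h1.
have hM : M <= n%:R.
  apply: ltW; apply: lt_le_trans (truncnS_gt M) _; by rewrite ler_nat.
apply: (@le_trans _ _ (M * (nm k * nm l * (nm k + nm l)))).
  apply: Hd.
  - by lra.
  - by rewrite addrAC; have := nmD (w - z) k; move: hk' hw {hk hl hl' h1}; lra.
  - by rewrite addrAC; have := nmD (w - z) l; move: hl' hw {hk hl hk' h1}; lra.
by rewrite ler_wpM2r // !mulr_ge0 ?addr_ge0 ?nm_ge0.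
Qed.

Lemma analytic_bounded_annulus (F : C -> C) (r1 r2 : R) : 0 < r1 ->
  (forall z, z != 0 -> analytic_at F z) ->
  exists B, forall w, annulus r1 r2 w -> nm (F w) <= B.
Proof.
move=> r0 HF; pose P n w := nm (F w) <= n%:R :> R.
have [z /andP[hz _]|n Hn] := @annulus_uniform r1 r2 P; last by exists n%:R.
have z0 : z != 0 by rewrite -nm_gt0; apply: lt_le_trans hz.
have [M [d [d0 Hd]]] := analytic_bounded (HF z z0).
exists d, (Num.trunc M).+1; split=> // n w hn hw.
apply: le_trans (Hd _ (ltW hw)) _.
apply: ltW; apply: lt_le_trans (truncnS_gt M) _; by rewrite ler_nat.
Qed.

End annulus.

(** * Discrete means over circles *)

Section circle_means.
Context {R : realType}.
Local Notation C := (cplx R).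
Implicit Types (F G : C -> C) (z w h p : C).

Definition analytic_star F := forall z, z != 0 -> analytic_at F z.

(** A Riemann sum for the mean of F over the circle through z; limits of such sums replace contour
    integrals. *)
Definition mean F k z : C :=
  (2 ^ k.+1)%:R^-1 * \sum_(j < 2 ^ k.+1) F (zeta k ^+ j * z).

Lemma pow2_neq0 k : ((2 ^ k.+1)%:R : C) != 0.
Proof. by rewrite pnatr_eq0 expn_eq0. Qed.

Lemma mean_le F k z (B : R) : (forall w, nm w = nm z -> nm (F w) <= B) -> nm (mean F k z) <= B.
Proof.
move=> H; have n0 : 0 < nm ((2 ^ k.+1)%:R : C) by rewrite nm_gt0 pow2_neq0.
rewrite /mean nmM nmV mulrC ler_pdivrMr //; apply: le_trans (nm_sum _ _ _) _.
apply: (@le_trans _ _ (\sum_(j < 2 ^ k.+1) B)).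
  by apply: ler_sum => j _; apply: H; rewrite nmM nmX nm_zeta expr1n mul1r.
by rewrite nmn sumr_const card_ord mulr_natr.
Qed.

Lemma eq_mean F G k z : (forall w, nm w = nm z -> F w = G w) -> mean F k z = mean G k z.
Proof.
move=> H; rewrite /mean; congr (_ * _); apply: eq_bigr => j _; apply: H.
by rewrite nmM nmX nm_zeta expr1n mul1r.
Qed.

Lemma meanZ c F k z : mean (fun w => c * F w) k z = c * mean F k z.
Proof. by rewrite /mean -mulr_sumr mulrCA. Qed.

Lemma meanB F G k z : mean (fun w => F w - G w) k z = mean F k z - mean G k z.
Proof. by rewrite /mean sumrB mulrBr. Qed.

Lemma mean_sum (F : nat -> C -> C) K k z :
  mean (fun w => \sum_(i < K) F i w) k z = \sum_(i < K) mean (F i) k z.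
Proof. by rewrite /mean exchange_big /= mulr_sumr. Qed.

Lemma mean_cst c k z : mean (fun _ => c) k z = c.
Proof.
by rewrite /mean sumr_const card_ord -[c *+ _]mulr_natr mulrC mulfK // pow2_neq0.
Qed.

Lemma mean_scale F (q lam : C) k z : q != 0 -> z != 0 ->
  (forall w, w != 0 -> F (q * w) = lam * F w) -> mean F k (q * z) = lam * mean F k z.
Proof.
move=> q0 z0 H; rewrite -meanZ /mean; congr (_ * _); apply: eq_bigr => j _.
by rewrite mulrCA H // mulf_neq0 // expf_neq0 // -nm_gt0 nm_zeta.
Qed.

(* The increments over one step of the roots of unity telescope to 0. *)
Lemma mean_step F k z h (M : R) : z != 0 ->
  (forall w, nm w = nm z -> quad_near M F w (w * h) (w * (zeta k - 1))) ->
  nm (mean F k (z * (1 + h)) - mean F k z) <=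
    M * nm z ^+ 2 * (nm h * (nm h + nm (zeta k - 1))).
Proof.
move=> z0 H; set e := zeta k - 1; have e0 : e != 0 by rewrite subr_eq0 zeta_neq1.
have ne0 : 0 < nm e by rewrite nm_gt0.
have nz0 : 0 < nm z by rewrite nm_gt0.
pose f j := F (zeta k ^+ j * z).
have tele : \sum_(j < 2 ^ k.+1) (f j.+1 - f j) = 0.
  rewrite -(big_mkord xpredT (fun j => f j.+1 - f j)) telescope_sumr //.
  by rewrite /f zeta_pow expr0 subrr.
have E : e * (mean F k (z * (1 + h)) - mean F k z) = (2 ^ k.+1)%:R^-1 *
    \sum_(j < 2 ^ k.+1) (e * (F (zeta k ^+ j * z * (1 + h)) - f j) - h * (f j.+1 - f j)).
  rewrite sumrB -(mulr_sumr _ _ _ h) tele mulr0 subr0 -mulr_sumr sumrB /mean.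
  under eq_bigr do rewrite mulrA.
  ring.
rewrite -(ler_pM2l ne0) -nmM E nmM nmV.
have n0 : 0 < nm ((2 ^ k.+1)%:R : C) by rewrite nm_gt0 pow2_neq0.
rewrite mulrC ler_pdivrMr //; apply: le_trans (nm_sum _ _ _) _.
apply: (@le_trans _ _ (\sum_(j < 2 ^ k.+1) nm e * (M * nm z ^+ 2 * (nm h * (nm h + nm e))))); last first.
  by rewrite nmn sumr_const card_ord mulr_natr.
apply: ler_sum => j _; set w := zeta k ^+ j * z.
have nw : nm w = nm z by rewrite nmM nmX nm_zeta expr1n mul1r.
have := H w nw; rewrite /quad_near -/e.
have -> : w + w * h = w * (1 + h) by ring.
have -> : w + w * e = zeta k ^+ j.+1 * z by rewrite /w /e exprS; ring.
have -> : w * e * (F (w * (1 + h)) - F w) - w * h * (F (zeta k ^+ j.+1 * z) - F w) =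
  w * (e * (F (w * (1 + h)) - f j) - h * (f j.+1 - f j)) by rewrite /f; ring.
rewrite !(nmM w) nw => hq; rewrite -(ler_pM2l nz0); apply: le_trans hq _.
apply: eq_leR; ring.
Qed.

(** Cut the segment into n steps. By [mean_step] each changes the mean by at most L / n times D / (c
    n) + |zeta k - 1|, so the total change is at most L D / (c n) + L |zeta k - 1|, which is small
    for n and k large. The bound c keeps the segment in an annulus. *)
Lemma mean_segment F z w (c : R) : analytic_star F -> 0 < c ->
  (forall t : R, 0 <= t <= 1 -> c <= nm (z + t%:C%C * (w - z))) ->
  tends0 (fun k => mean F k w - mean F k z).
Proof.
move=> HF c0 Hc e e0.
set D := nm (w - z); have D0 : 0 <= D := nm_ge0 _.
pose r2 := nm z + D.
have [M [d [M0 d0 Hd]]] := analytic_quad_annulus r2 c0 HF.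
have r20 : 0 <= r2 by rewrite addr_ge0 ?nm_ge0.
pose L := M * r2 ^+ 2 * (D / c).
have L0 : 0 <= L by rewrite !mulr_ge0 ?invr_ge0 ?exprn_ge0 // ltW.
(* The two halves control L |zeta k - 1| and the size of the rotation increments; the added 1 keeps
   the denominators positive when L or r2 is 0. *)
have ed : 0 < Num.min (e / (2 * (L + 1))) (d / (r2 + 1)).
  by rewrite lt_min !divr_gt0 ?mulr_gt0 //; lra.
have [N HN] := zeta_cvg ed; exists N => k /HN; set ze := nm (zeta k - 1).
rewrite lt_min => /andP[hz1 hz2].
have aux (x y b : R) : 0 <= y -> (x + 1) * y < b -> x * y < b by lra.
have ze0 : 0 <= ze := nm_ge0 _.
have hz1' : L * ze < e / 2.
  have : (L + 1) * ze < e / 2.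
    by move: hz1; rewrite invfM mulrA ltr_pdivlMr; [rewrite mulrC|lra].
  exact: aux ze0.
have hz2' : r2 * ze <= d.
  by apply: ltW; apply: (aux _ _ _ ze0); move: hz2; rewrite ltr_pdivlMr ?(mulrC ze) //; lra.
have en : 0 < Num.min (e / (2 * (L * (D / c) + 1))) (d / (D + 1)).
  have : 0 <= L * (D / c) by rewrite !mulr_ge0 ?invr_ge0 // ltW.
  by move=> h; rewrite lt_min !divr_gt0 ?mulr_gt0 //; lra.
have [n0 /(_ n0 (leqnn _))] := nat_inv_lt en; set n := n0.+1.
rewrite lt_min => /andP[hn1 hn2].
have n0' : (0 : R) < n%:R by rewrite ltr0n.
have ni0 : (0 : R) <= n%:R^-1 by rewrite invr_ge0 ltW.
have hn1' : L * (D / c) / n%:R < e / 2.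
  have h0 : 0 <= L * (D / c) by rewrite !mulr_ge0 ?invr_ge0 // ltW.
  have : (L * (D / c) + 1) * n%:R^-1 < e / 2.
    by move: hn1; rewrite invfM mulrA ltr_pdivlMr; [rewrite mulrC|lra].
  apply: aux; exact: ni0.
have hn2' : D / n%:R <= d.
  by apply: ltW; apply: (aux _ _ _ ni0); move: hn2; rewrite ltr_pdivlMr ?(mulrC n%:R^-1) //; lra.
pose t i : R := i%:R / n%:R.
pose p i : C := z + (t i)%:C%C * (w - z).
have pb i : (i <= n)%N -> annulus c r2 (p i).
  move=> le_in; have t01 : 0 <= t i <= 1.
    by rewrite /t divr_ge0 //= ler_pdivrMr // mul1r ler_nat.
  rewrite /annulus /= Hc //=; apply: le_trans (nmD _ _) _.
  rewrite lerD2l nmM -/D ler_piMl //.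
  have -> : nm (t i)%:C%C = t i by apply: complexI; rewrite -nmE ger0_norm // ler0c; case/andP: t01.
  by case/andP: t01.
have step i : (i < n)%N -> nm (mean F k (p i.+1) - mean F k (p i)) <=
    L / n%:R * (D / c / n%:R + ze).
  move=> lt_in; have /andP[pc pr] := pb i (ltnW lt_in).
  have pp : 0 < nm (p i) := lt_le_trans c0 pc.
  have p0 : p i != 0 by rewrite -nm_gt0.
  pose h : C := (n%:R^-1)%:C%C * (w - z) / p i.
  have nh : nm (p i * h) = D / n%:R.
    rewrite /h mulrC divfK // nmM -/D mulrC; congr (_ * _).
    by apply: complexI; rewrite -nmE ger0_norm // ler0c invr_ge0.
  have nh' : nm h <= D / c / n%:R.
    rewrite -(ler_pM2l pp) -nmM nh mulrAC mulrCA mulrA mulrAC.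
    by rewrite mulrAC ler_pdivlMr // ler_wpM2l // mulr_ge0.
  have -> : p i.+1 = p i * (1 + h).
    rewrite mulrDr mulr1 /h mulrCA mulfV // mulr1 /p /t -natr1 mulrDl mul1r rmorphD /=.
    by ring.
  apply: le_trans (@mean_step F k (p i) h M p0 _) _.
    move=> v nv; apply: Hd; first by rewrite /annulus /= nv pc.
      by rewrite nmM nv -nmM nh.
    rewrite nmM nv; apply: le_trans hz2'; rewrite ler_wpM2r ?nm_ge0 //.
  rewrite -/ze.
  have h1 : nm (p i) ^+ 2 <= r2 ^+ 2 by rewrite lerXn2r ?nnegrE ?nm_ge0.
  have h2 : nm h * (nm h + ze) <= D / c / n%:R * (D / c / n%:R + ze).
    by apply: ler_pM; rewrite ?addr_ge0 ?nm_ge0 // lerD2r.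
  apply: (@le_trans _ _ (M * r2 ^+ 2 * (D / c / n%:R * (D / c / n%:R + ze)))).
    apply: ler_pM => //; rewrite ?mulr_ge0 ?addr_ge0 ?nm_ge0 ?exprn_ge0 //.
    by rewrite ler_wpM2l.
  apply: eq_leR; rewrite /L; ring.
have tot i : (i <= n)%N -> nm (mean F k (p i) - mean F k (p 0%N)) <=
    i%:R * (L / n%:R * (D / c / n%:R + ze)).
  elim: i => [|i IH] lt_in; first by rewrite subrr nm0 mul0r.
  apply: le_trans (nm_tri _ (mean F k (p i)) _) _.
  by have := step i lt_in; have := IH (ltnW lt_in); rewrite -natr1; lra.
have := tot n (leqnn n).
have -> : p n = w by rewrite /p /t divff ?gt_eqF // rmorph1 mul1r; ring.
have -> : p 0%N = z by rewrite /p /t mul0r rmorph0 mul0r addr0.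
move=> h; apply: le_lt_trans h _.
have -> : n%:R * (L / n%:R * (D / c / n%:R + ze)) = L * (D / c) / n%:R + L * ze.
  by field; rewrite ?gt_eqF.
by lra.
Qed.

(** For Re s >= 0, |1 - t + t s|^2 is at least (1 - t)^2 + t^2 |s|^2, so the segment from z to s z
    keeps a positive distance from 0. *)
Lemma mean_half_root F z s : analytic_star F -> z != 0 -> s != 0 ->
  0 <= complex.Re (s : R[i]%C) -> tends0 (fun k => mean F k (s * z) - mean F k z).
Proof.
move=> HF z0 s0 Res.
have ns : 0 < nm s by rewrite nm_gt0.
have nz : 0 < nm z by rewrite nm_gt0.
pose m := Num.min 1 (nm s).
have m0 : 0 < m by rewrite lt_min ltr01.
apply: (@mean_segment F z (s * z) (nm z * (m / 2)) HF); first by rewrite mulr_gt0 // divr_gt0.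
move=> t /andP[t0 t1].
have -> : z + t%:C%C * (s * z - z) = z * (1 - t%:C%C + t%:C%C * s) by ring.
rewrite nmM ler_pM2l // -(@ler_pXn2r _ 2) // ?nnegrE ?nm_ge0 ?divr_ge0 // ?(ltW m0) //.
have m1 : m ^+ 2 <= 1 by rewrite expr_le1 // ?(ltW m0) // ge_min lexx.
have m2 : m ^+ 2 <= nm s ^+ 2.
  by rewrite lerXn2r ?nnegrE ?nm_ge0 ?(ltW m0) // ge_min lexx orbT.
apply: (@le_trans _ _ (m ^+ 2 * ((1 - t) ^+ 2 + t ^+ 2))).
  have -> : (m / 2) ^+ 2 = m ^+ 2 * 4^-1 by field.
  rewrite ler_wpM2l ?sqr_ge0 //; have := sqr_ge0 (2 * t - 1); rewrite !expr2; lra.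
have h1 : nm s ^+ 2 * t ^+ 2 + (1 - t) ^+ 2 <= nm (1 - t%:C%C + t%:C%C * s) ^+ 2.
  have p0 : 0 <= t * (1 - t) * complex.Re (s : R[i]%C) by rewrite !mulr_ge0 // subr_ge0.
  move: p0; rewrite !nm_sq; case: (s) => a b /=; rewrite !expr2; lra.
apply: le_trans h1.
have := ler_wpM2r (sqr_ge0 t) m2; have := ler_wpM2r (sqr_ge0 (1 - t)) m1; lra.
Qed.

(** Writing w / z as s^2 with Re s >= 0 joins z to w by two segments that avoid 0; a single one
    would hit 0 when w / z is a negative real. *)
Lemma mean_indep F z w : analytic_star F -> z != 0 -> w != 0 ->
  tends0 (fun k => mean F k w - mean F k z).
Proof.
move=> HF z0 w0; set s := half_root (w / z).
have s0 : s != 0 by rewrite half_root_eq0 mulf_neq0 ?invr_eq0.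
have h1 := mean_half_root HF z0 s0 (Re_half_root _).
have h2 := mean_half_root HF (mulf_neq0 s0 z0) s0 (Re_half_root _).
apply: eq_tends0 (tends0D h1 h2) => k.
have -> : s * (s * z) = w by rewrite mulrA -expr2 half_rootK divfK.
ring.
Qed.

End circle_means.

(** * Functions with a constant multiplier *)

Section multipliers.
Context {R : realType}.
Local Notation C := (cplx R).
Implicit Types (F G : C -> C) (z w p q lam : C).

Lemma analytic_starM F G : analytic_star F -> analytic_star G ->
  analytic_star (fun w => F w * G w).
Proof. by move=> HF HG z z0; apply: analyticM; [exact: HF | exact: HG]. Qed.

Lemma analytic_starD F G : analytic_star F -> analytic_star G ->
  analytic_star (fun w => F w + G w).
Proof. by move=> HF HG z z0; apply: analyticD; [exact: HF | exact: HG]. Qed.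

Lemma analytic_star_cst (c : C) : analytic_star (fun _ => c).
Proof. by move=> z _; exact: analytic_cst. Qed.

Lemma analytic_starZ (c : C) F : analytic_star F -> analytic_star (fun w => c * F w).
Proof. by move=> HF; exact: (analytic_starM (@analytic_star_cst c) HF). Qed.

Lemma analytic_star_pow n : analytic_star (fun w : C => w ^+ n).
Proof.
elim: n => [|n IH]; first exact: analytic_star_cst.
have := analytic_starM (fun z _ => @analytic_id R z) IH.
by under [X in analytic_star X -> _]eq_fun do rewrite -exprS.
Qed.

Lemma analytic_star_inv F : analytic_star F -> (forall z, z != 0 -> F z != 0) ->
  analytic_star (fun w => (F w)^-1).
Proof. by move=> HF H0 z z0; apply: analyticV; [exact: HF | exact: H0]. Qed.

Lemma analytic_star_exprz (m : int) : analytic_star (fun w : C => w ^ m).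
Proof.
case: m => n; first exact: analytic_star_pow.
by apply: analytic_star_inv; [exact: analytic_star_pow | move=> z z0; rewrite expf_neq0].
Qed.

Lemma eq_analytic_star F G : (forall z, z != 0 -> F z = G z) -> analytic_star F -> analytic_star G.
Proof.
move=> FG HF z z0; apply: (analytic_at_near (HF z z0)).
exists (nm z); first by rewrite nm_gt0.
move=> h hz; rewrite FG //; apply: contraTneq hz => zh0.
by rewrite (_ : h = - z) ?nmN ?ltxx //; apply/eqP; rewrite -addr_eq0 addrC zh0.
Qed.

(** Passing from p to q p multiplies the mean by lam, yet changes it only by a null sequence. *)
Lemma mean_tends0 F q lam p : q != 0 -> p != 0 -> analytic_star F ->
  (forall w, w != 0 -> F (q * w) = lam * F w) -> lam != 1 -> tends0 (fun k => mean F k p).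
Proof.
move=> q0 p0 HF H l1; have l10 : lam - 1 != 0 by rewrite subr_eq0.
apply: eq_tends0 (tends0M (lam - 1)^-1 (mean_indep HF p0 (mulf_neq0 q0 p0))) => k.
by rewrite (mean_scale k q0 p0 H); field.
Qed.

Lemma kernel_bound z w p : nm w = nm p -> nm p != nm z ->
  nm (w / (w - z)) <= nm p / `|nm p - nm z|.
Proof.
move=> wp pz; have pz0 : 0 < `|nm p - nm z| by rewrite normr_gt0 subr_eq0.
have h : `|nm p - nm z| <= nm (w - z).
  rewrite ler_norml -wp; apply/andP; split.
    by have := nm_tri z w 0; rewrite !subr0 (nmB z); lra.
  by have := nm_tri w z 0; rewrite !subr0; lra.
rewrite nmM nmV wp ler_wpM2l ?nm_ge0 // lef_pV2 ?posrE //.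
exact: lt_le_trans pz0 h.
Qed.

Lemma neq_of_nm z w : nm z != nm w -> z - w != 0.
Proof. by rewrite subr_eq0; apply: contraNneq => ->. Qed.

(* Expand [w / (w - z) = \sum_n (z / w) ^ n] outside the circle of radius [|z|]. *)
Lemma mean_kernel_out F q lam z p : q != 0 -> z != 0 -> nm z < nm p ->
  analytic_star F -> (forall w, w != 0 -> F (q * w) = lam * F w) ->
  (forall n, lam != q ^+ n.+1) ->
  tends0 (fun k => mean (fun w => F w * (w / (w - z))) k p - mean F k p).
Proof.
move=> q0 z0 zp HF H Hl.
have np : 0 < nm p := le_lt_trans (nm_ge0 z) zp.
have p0 : p != 0 by rewrite -nm_gt0.
have [B HB] := @analytic_bounded_annulus R F (nm p) (nm p) np HF.
pose rho := nm (z / p).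
have r01 : 0 <= rho < 1 by rewrite nm_ge0 /rho nmM nmV ltr_pdivrMr // mul1r zp.
pose B' := B * (nm p / `|nm p - nm z|) * rho.
apply: (@tends0_approx _ _ B' rho r01) => K.
pose f i w := z ^+ i.+1 * (F w * (w ^+ i.+1)^-1).
exists (fun k => \sum_(i < K) mean (f i) k p).
  apply: (@tends0_sum _ (fun i k => mean (f i) k p)) => i.
  apply: (eq_tends0 (fun k => esym (meanZ _ _ k p))); apply: tends0M; apply: (@mean_tends0 _ q (lam / q ^+ i.+1) _ q0 p0).
  - apply: (analytic_starM HF); apply: analytic_star_inv; first exact: analytic_star_pow.
    by move=> w w0; rewrite expf_neq0.
  - by move=> w w0; rewrite H // exprMn invfM; ring.
  - by rewrite -subr_eq0; apply: contra (Hl i); rewrite subr_eq0 => /eqP h; rewrite -(divfK (expf_neq0 i.+1 q0) lam) h mul1r.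
move=> k; rewrite -mean_sum -!meanB; apply: mean_le => w nw.
have w0 : w != 0 by rewrite -nm_gt0 nw.
have wz : w - z != 0 by apply: neq_of_nm; rewrite nw gt_eqF.
have -> : F w * (w / (w - z)) - F w - \sum_(i < K) f i w =
    F w * (w / (w - z)) * (z / w) ^+ K.+1.
  elim: K => [|K IH]; first by rewrite big_ord0 subr0 expr1; field; rewrite w0.
  rewrite big_ord_recr /= opprD addrA IH /f [(z / w) ^+ K.+2]exprS [(z / w) ^+ K.+1]exprMn exprVn.
  by field; rewrite wz w0 expf_neq0.
have rE : nm (z / w) = rho by rewrite /rho !nmM !nmV nw.
rewrite nmM nmX rE (nmM (F w)) exprS; have /andP[rho0 _] := r01.
rewrite /B' -[leRHS]mulrA; apply: ler_wpM2r; first by rewrite mulr_ge0 ?exprn_ge0.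
have hw : annulus (nm p) (nm p) w by rewrite /annulus /= nw lexx.
apply: ler_pM; rewrite ?nm_ge0 ?HB //; apply: kernel_bound => //.
by rewrite gt_eqF.
Qed.

(** On a circle of radius less than |z|, w / (w - z) expands in positive powers of w / z without
    constant term, and F times each of them has a multiplier different from 1. *)
Lemma mean_kernel_in F q lam z p : q != 0 -> p != 0 -> nm p < nm z ->
  analytic_star F -> (forall w, w != 0 -> F (q * w) = lam * F w) ->
  (forall n, lam * q ^+ n.+1 != 1) ->
  tends0 (fun k => mean (fun w => F w * (w / (w - z))) k p).
Proof.
move=> q0 p0 zp HF H Hl.
have np : 0 < nm p by rewrite nm_gt0.
have nz := lt_trans np zp.
have z0 : z != 0 by rewrite -nm_gt0.
have [B HB] := @analytic_bounded_annulus R F (nm p) (nm p) np HF.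
pose rho := nm (p / z).
have r01 : 0 <= rho < 1 by rewrite nm_ge0 /rho nmM nmV ltr_pdivrMr // mul1r zp.
pose B' := B * (nm p / `|nm p - nm z|).
apply: (@tends0_approx _ _ B' rho r01) => K.
pose f i w := - (z ^+ i.+1)^-1 * (F w * w ^+ i.+1).
exists (fun k => \sum_(i < K) mean (f i) k p).
  apply: (@tends0_sum _ (fun i k => mean (f i) k p)) => i.
  apply: (eq_tends0 (fun k => esym (meanZ _ _ k p))); apply: tends0M; apply: (@mean_tends0 _ q (lam * q ^+ i.+1) _ q0 p0); last exact: Hl.
  - exact: (analytic_starM HF (@analytic_star_pow i.+1)).
  - by move=> w w0; rewrite H // exprMn; ring.
move=> k; rewrite -mean_sum -!meanB; apply: mean_le => w nw.
have w0 : w != 0 by rewrite -nm_gt0 nw.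
have wz : w - z != 0 by apply: neq_of_nm; rewrite nw lt_eqF.
have -> : F w * (w / (w - z)) - \sum_(i < K) f i w =
    F w * (w / (w - z)) * (w / z) ^+ K.
  elim: K => [|K IH]; first by rewrite big_ord0 subr0 expr0 mulr1.
  rewrite big_ord_recr /= opprD addrA IH /f [(w / z) ^+ K.+1]exprS exprMn exprVn.
  by rewrite !exprS; field; rewrite z0 wz expf_neq0.
have rE : nm (w / z) = rho by rewrite /rho !nmM !nmV nw.
rewrite nmM nmX rE (nmM (F w)); have /andP[rho0 _] := r01.
apply: ler_wpM2r; first by rewrite exprn_ge0.
have hw : annulus (nm p) (nm p) w by rewrite /annulus /= nw lexx.
apply: ler_pM; rewrite ?nm_ge0 ?HB //; apply: kernel_bound => //.
by rewrite lt_eqF.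
Qed.

Lemma nm_expn_lt1 q n : nm q < 1 -> nm (q ^+ n.+1) < 1.
Proof.
by move=> q1; rewrite nmX exprn_ilt1 ?nm_ge0.
Qed.

(** A discrete Cauchy formula. [G], that is w (F w - F z) / (w - z), has a removable singularity at
    z, so its means over the circles through z / q and q z agree in the limit; the kernel expansions
    evaluate both. The conditions on lam exclude the multiplier 1 for F w^n with n nonzero. *)
Lemma cauchy_circle F q lam z : q != 0 -> nm q < 1 -> z != 0 ->
  analytic_star F -> (forall w, w != 0 -> F (q * w) = lam * F w) ->
  (forall n, lam != q ^+ n.+1) -> (forall n, lam * q ^+ n.+1 != 1) ->
  tends0 (fun k => F z - mean F k (z / q)).
Proof.
move=> q0 q1 z0 HF H Hl Hl'.
have nq : 0 < nm q by rewrite nm_gt0.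
have nz : 0 < nm z by rewrite nm_gt0.
have [d Hd] := analytic_quotient (HF z z0).
pose G w := (if w == z then d else (F w - F z) / (w - z)) * w.
have HG : analytic_star G.
  move=> w w0; apply: analyticM; last exact: analytic_id.
  have [->|wz] := eqVneq w z; first exact: Hd.
  have h : analytic_at (fun v => (F v - F z) * (v - z)^-1) w.
    apply: analyticM.
      have := analyticD (HF w w0) (@analytic_cst R w (- F z)); exact.
    apply: analyticV; last by rewrite subr_eq0.
    exact: analyticD (@analytic_id R w) (@analytic_cst R w (- z)).
  apply: (analytic_at_near h); exists (nm (w - z)); first by rewrite nm_gt0 subr_eq0.
  move=> v hv; case: eqP => // e; move: hv; rewrite -e.
  by rewrite opprD addrA subrr sub0r nmN ltxx.
have pout : nm z < nm (z / q) by rewrite nmM nmV ltr_pdivlMr // gtr_pMr.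
have pin : nm (q * z) < nm z by rewrite nmM gtr_pMl.
have qz0 : q * z != 0 by rewrite mulf_neq0.
have zq0 : z / q != 0 by rewrite mulf_neq0 ?invr_eq0.
have GE k p : nm p != nm z -> mean G k p =
    mean (fun w => F w * (w / (w - z))) k p - F z * mean (fun w => 1 * (w / (w - z))) k p.
  move=> pz; rewrite -meanZ -meanB; apply: eq_mean => w nw; rewrite /G ifN; last first.
    by apply: contraNneq pz => <-; rewrite nw.
  by rewrite mul1r; ring.
have one w : w != 0 -> (fun _ : C => 1) (q * w) = 1 * (fun _ : C => 1) w :> C by rewrite mulr1.
have q1n n : (1 : C) != q ^+ n.+1.
  by apply: contraTneq (nm_expn_lt1 n q1) => <-; rewrite nm1 ltxx.
have q1n' n : 1 * q ^+ n.+1 != 1 :> C by rewrite mul1r eq_sym.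
have t1 := mean_kernel_out q0 z0 pout HF H Hl.
have t2 := mean_kernel_in q0 qz0 pin HF H Hl'.
have t3 := mean_kernel_out q0 z0 pout (@analytic_star_cst 1) one q1n.
have t4 := mean_kernel_in q0 qz0 pin (@analytic_star_cst 1) one q1n'.
have t5 := mean_indep HG qz0 zq0.
have := tends0B (tends0B t1 t2) (tends0D t5 (tends0M (F z) (tends0B t3 t4))).
apply: eq_tends0 => k.
rewrite (GE k (z / q)) ?gt_eqF // (GE k (q * z)) ?lt_eqF //.
have -> : mean (fun _ : C => 1) k (z / q) = 1 by exact: mean_cst.
ring.
Qed.

(** If lam = q^m, dividing by z^m leaves the multiplier 1, and [cauchy_circle] makes any two values
    limits of asymptotically equal means. If lam is off q^Z, the means tend to 0 and F vanishes. *)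
Theorem constant_multiplier F q lam : q != 0 -> nm q < 1 ->
  analytic_star F -> (forall w, w != 0 -> F (q * w) = lam * F w) ->
  exists c (m : int), (c != 0 -> lam = q ^ m) /\ forall z, z != 0 -> F z = c * z ^ m.
Proof.
move=> q0 q1 HF H.
have [[m lm]|nl] := pselect (exists m : int, lam = q ^ m).
  pose F1 w := F w * w ^ (- m).
  have HF1 : analytic_star F1 by apply: analytic_starM HF _; exact: analytic_star_exprz.
  have H1 w : w != 0 -> F1 (q * w) = 1 * F1 w.
    move=> w0; rewrite /F1 H // lm exprzMl ?unitfE // mulrACA.
    by rewrite -expfzDr // subrr expr0z.
  have q1n n : (1 : C) != q ^+ n.+1.
    by apply: contraTneq (nm_expn_lt1 n q1) => <-; rewrite nm1 ltxx.
  have q1n' n : 1 * q ^+ n.+1 != 1 :> C by rewrite mul1r eq_sym.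
  exists (F1 1), m; split=> // z z0.
  suff E : F1 z = F1 1 by rewrite -E /F1 -mulrA -expfzDr // addNr expr0z mulr1.
  apply/eqP; rewrite -subr_eq0; apply/eqP; apply: tends0_const.
  clearbody F1.
  have i1 : (1 : C) / q != 0 by rewrite mul1r invr_eq0.
  have iz : z / q != 0 by rewrite mulf_neq0 ?invr_eq0.
  have := tends0D (tends0B (cauchy_circle q0 q1 z0 HF1 H1 q1n q1n')
    (cauchy_circle q0 q1 (oner_neq0 _) HF1 H1 q1n q1n')) (mean_indep HF1 i1 iz).
  by apply: eq_tends0 => k; ring.
exists 0, 0; split=> [|z z0]; first by rewrite eqxx.
rewrite mul0r; apply: tends0_const.
have Hl n : lam != q ^+ n.+1.
  by apply: contra_notN nl => /eqP ->; exists n.+1%:Z.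
have Hl' n : lam * q ^+ n.+1 != 1.
  apply: contra_notN nl => /eqP h; exists (- n.+1%:Z).
  by rewrite -[LHS](mulfK (expf_neq0 n.+1 q0)) h mul1r.
have l1 : lam != 1 by apply: contra_notN nl => /eqP ->; exists 0; rewrite expr0z.
have iz : z / q != 0 by rewrite mulf_neq0 ?invr_eq0.
have := tends0D (cauchy_circle q0 q1 z0 HF H Hl Hl') (mean_tends0 q0 iz HF H l1).
by apply: eq_tends0 => k; ring.
Qed.

End multipliers.

(** * Theta functions *)

Section qpochhammer.
Context {R : realType}.
Local Notation C := (cplx R).
Implicit Types (f g : C -> C) (z w q : C).

Lemma prod1D_le_expR (x rho : R) n : 0 <= x -> 0 <= rho < 1 ->
  \prod_(k < n) (1 + rho ^+ k * x) <= expR (x / (1 - rho)).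
Proof.
move=> x0 /andP[r0 r1]; have r1' : 0 < 1 - rho by rewrite subr_gt0.
apply: (@le_trans _ _ (expR (\sum_(k < n) rho ^+ k * x))).
  rewrite expR_sum; apply: ler_prod => k _; rewrite expR_ge1Dx andbT.
  by rewrite addr_ge0 // mulr_ge0 // exprn_ge0.
rewrite ler_expR -mulr_suml mulrC ler_wpM2l // -[leRHS]mul1r ler_pdivlMr //.
elim: n => [|n IH]; first by rewrite big_ord0 mul0r.
suff -> : \sum_(i < n.+1) rho ^+ i = (1 - rho ^+ n.+1) / (1 - rho).
  by rewrite divfK ?gt_eqF // gerBl exprn_ge0.
elim: (n.+1) => [|k IHk]; first by rewrite big_ord0 expr0 subrr mul0r.
by rewrite big_ord_recr /= IHk exprS; field; rewrite gt_eqF.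
Qed.

Definition qprod n z q : C := \prod_(0 <= k < n) (1 - q ^+ k * z).

Lemma qprodS n z q : qprod n.+1 z q = qprod n z q * (1 - q ^+ n * z).
Proof. by rewrite /qprod big_nat_recr. Qed.

Lemma nm_qprod n z q : nm q < 1 -> nm (qprod n z q) <= expR (nm z / (1 - nm q)).
Proof.
move=> q1; apply: le_trans (prod1D_le_expR n (nm_ge0 z) _); last by rewrite nm_ge0.
rewrite /qprod big_mkord; elim: n => [|n IH]; first by rewrite !big_ord0 nm1.
rewrite !big_ord_recr /= nmM; apply: ler_pM; rewrite ?nm_ge0 //.
by apply: le_trans (nmBD _ _) _; rewrite nm1 nmM nmX.
Qed.

Lemma qprod_cvg z q : nm q < 1 ->
  (fun n => qprod n z q) @ \oo --> qpoch z q /\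
  nm (qpoch z q - 1) <= expR (nm z / (1 - nm q)) * nm z / (1 - nm q).
Proof.
move=> q1; pose K := expR (nm z / (1 - nm q)) * nm z.
have [||l ul Hl] := @cvg_geom R (fun n => qprod n z q) K (nm q).
- by rewrite nm_ge0.
- move=> n; rewrite qprodS mulrBr mulr1 addrAC subrr add0r nmN !nmM nmX.
  have p0 : 0 <= nm q ^+ n * nm z by rewrite mulr_ge0 ?exprn_ge0 ?nm_ge0.
  by apply: le_trans (ler_wpM2r p0 (nm_qprod n z q1)) _; apply: eq_leR; rewrite /K; ring.
have -> : qpoch z q = l by rewrite /qpoch; apply: cvg_lim ul; exact: norm_hausdorff.
split; first exact: ul.
by have := Hl 0%N; rewrite /qprod big_nil expr0 mulr1.
Qed.

Lemma qpochS z q : nm q < 1 -> qpoch z q = (1 - z) * qpoch (q * z) q.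
Proof.
move=> q1; have [h1 _] := qprod_cvg z q1; have [h2 _] := qprod_cvg (q * z) q1.
have h3 := @cvg_nm_shift _ _ _ 1 h1; apply: (cvg_nm_unique h3); move: h3 => _.
have -> : (fun n => qprod (1 + n) z q) = (fun n => (1 - z) * qprod n (q * z) q).
  apply/funext => n; rewrite /qprod add1n big_nat_recl // expr0 mul1r; congr (_ * _).
  by apply: eq_bigr => i _; rewrite exprSr mulrA.
exact: cvg_nmM (@cvg_nm_const _ (1 - z)) h2.
Qed.

Lemma qpoch_iter z q n : nm q < 1 -> qpoch z q = qprod n z q * qpoch (q ^+ n * z) q.
Proof.
move=> q1; elim: n => [|n ->]; first by rewrite /qprod big_nil expr0 !mul1r.
by rewrite qprodS [qpoch (q ^+ n * z) q]qpochS // exprS !mulrA.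
Qed.

(** After enough factors are split off, the tail is a product at q^N z, within distance less than 1
    of 1 by [qprod_cvg]; so a zero must come from a factor. *)
Lemma qpoch_eq0 z q : nm q < 1 -> qpoch z q = 0 <-> exists n, q ^+ n * z = 1.
Proof.
move=> q1; split=> [|[n zn]]; last first.
  by rewrite (qpoch_iter z n.+1 q1) qprodS zn subrr mulr0 mul0r.
have q01 : 0 <= nm q < 1 by rewrite nm_ge0.
have q1' : 0 < 1 - nm q by rewrite subr_gt0.
pose B := expR (nm z / (1 - nm q)) / (1 - nm q).
have [N /(_ N (leqnn N)) HN] := geom_lt_eps (B * nm z) q01 ltr01.
move=> H; have [//|nex] := pselect (exists n, q ^+ n * z = 1).
exfalso; move: H; rewrite (qpoch_iter z N q1) => /eqP; rewrite mulf_eq0 => /orP[].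
  rewrite /qprod big_mkord => /prodf_eq0[i _]; rewrite subr_eq0 => /eqP h.
  by apply: nex; exists i.
apply/negP; set w := q ^+ N * z.
have nw : nm w = nm q ^+ N * nm z by rewrite nmM nmX.
have [_ hw] := qprod_cvg w q1.
apply: contraTneq hw => ->; rewrite sub0r nmN nm1 -ltNge.
apply: le_lt_trans HN.
have wz : nm w <= nm z by rewrite nw ler_piMl ?nm_ge0 // exprn_ile1 ?nm_ge0 // ltW.
have -> : B * nm z * nm q ^+ N = expR (nm z / (1 - nm q)) * nm w / (1 - nm q).
  by rewrite nw /B; ring.
rewrite ler_wpM2r ?invr_ge0 ?(ltW q1') // ler_wpM2r ?nm_ge0 // ler_expR.
by rewrite ler_wpM2r // invr_ge0 ltW.
Qed.

(** The Taylor coefficients of the partial products have a common majorant and converge one by one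
    at rate |q|^n. The limit coefficients inherit the majorant, and the limits over the factors and
    over the terms of the series are exchanged by a uniform bound. *)
Lemma analytic_qpoch g z q : nm q < 1 -> analytic_at g z ->
  analytic_at (fun w => qpoch (g w) q) z.
Proof.
move=> q1 /analytic_atP[a [r [K [r0 H Hc]]]].
have q01 : 0 <= nm q < 1 by rewrite nm_ge0.
have K0 := nb_ge0 H.
(* [c n] are the coefficients of the n-th partial product at g, multiplied at each step by 1 - q^m
   g. *)
pose c := fix c n : nat -> C := if n is m.+1 then
   (fun i => c m i - q ^+ m * conv a (c m) i) else (fun i => (i == 0%N)%:R).
have nbc n : nb (c n) r (\prod_(k < n) (1 + nm q ^+ k * K)).
  elim: n => [|n IH] N.
    rewrite big_ord0; case: N => [|N]; first by rewrite big_ord0.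
    rewrite big_ord_recl /= nm1 expr0 mulr1 big1 ?addr0 // => i _.
    by rewrite nm0 mul0r.
  rewrite big_ord_recr /= mulrDr mulr1.
  apply: (@le_trans _ _ (\sum_(i < N) (nm (c n i) * r ^+ i +
      nm q ^+ n * (nm (conv a (c n) i) * r ^+ i)))).
    apply: ler_sum => i _; rewrite mulrA -mulrDl ler_wpM2r ?exprn_ge0 ?(ltW r0) //.
    by apply: le_trans (nmBD _ _) _; rewrite nmM nmX.
  rewrite big_split /= lerD ?IH // -mulr_sumr [leRHS]mulrC -[leRHS]mulrA.
  by rewrite ler_wpM2l ?exprn_ge0 ?nm_ge0 //; exact: nb_conv (ltW r0) H IH N.
pose B := expR (K / (1 - nm q)).
have nbB n : nb (c n) r B by apply: nb_leK (nbc n); exact: prod1D_le_expR.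
have r0' := ltW r0.
have inc n i : nm (c n.+1 i - c n i) <= K * B / r ^+ i * nm q ^+ n.
  rewrite /= addrAC subrr add0r nmN nmM nmX mulrC ler_wpM2r ?exprn_ge0 ?nm_ge0 //.
  rewrite ler_pdivlMr ?exprn_gt0 //; apply: (@nb_term R (conv a (c n)) r _ i r0').
  exact: nb_conv r0' H (nbB n).
have lim i : exists l, c ^~ i @ \oo --> l /\ forall n, nm (l - c n i) <= K * B / r ^+ i * nm q ^+ n / (1 - nm q).
  by have [l h1 h2] := cvg_geom q01 (fun n => inc n i); exists l.
have /choice[cc Hcc] := lim.
have nbcc : nb cc r B.
  (* A finite sum of limit coefficients that exceeds B would, for a late partial product, contradict
     [nbB]. *)
  move=> N; rewrite leNgt; apply/negP; rewrite -subr_gt0 => e0.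
  have [n /(_ n (leqnn n))] := geom_lt_eps (N%:R * (K * B / (1 - nm q))) q01 e0.
  apply/negP; rewrite -leNgt lerBlDl.
  apply: le_trans (lerD (nbB n N) (lexx _)).
  have -> : N%:R * (K * B / (1 - nm q)) * nm q ^+ n =
      \sum_(i < N) (K * B / r ^+ i * nm q ^+ n / (1 - nm q)) * r ^+ i.
    rewrite (eq_bigr (fun _ => K * B / (1 - nm q) * nm q ^+ n)).
      by rewrite sumr_const card_ord -[RHS]mulr_natr; ring.
    by move=> i _; field; rewrite expf_neq0 ?gt_eqF // subr_gt0.
  rewrite -big_split /=; apply: ler_sum => i _; rewrite -mulrDl ler_wpM2r ?exprn_ge0 //.
  have [_ /(_ n)] := Hcc i; have := nm_tri (cc i) (c n i) 0; rewrite !subr0; lra.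
apply/analytic_atP; exists cc, r, B; split; [exact: r0|exact: nbcc|move=> h hr].
have [l cl _] := psum_cvg r0' nbcc hr.
have pc n : psum (c n) h @ \oo --> qprod n (g (z + h)) q.
  elim: n => [|n IH].
    rewrite /qprod big_nil; apply/cvg_nmP => e e0; exists 1%N => -[//|n] _.
    rewrite /psum big_ord_recl /= expr0 mulr1 big1 ?addr0 ?subrr ?nm0 // => i _.
    by rewrite mul0r.
  rewrite qprodS mulrBr mulr1.
  have -> : psum (c n.+1) h = (fun N => psum (c n) h N - q ^+ n * psum (conv a (c n)) h N).
    apply/funext => N; rewrite /psum mulr_sumr -sumrB; apply: eq_bigr => i _ /=.
    by rewrite mulrBl mulrA.
  rewrite mulrCA [X in _ - _ * X]mulrC.
  exact: cvg_nmB IH (cvg_nmM (@cvg_nm_const _ _) (psum_conv r0' H (nbB n) hr (Hc h hr) IH)).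
have [qc _] := qprod_cvg (g (z + h)) q1.
suff E : qpoch (g (z + h)) q = l by rewrite E; exact: cl.
apply: (cvg_nm_unique qc); apply: (cvg_nm_near (@cvg_nm_const _ l)) => e e0.
pose D := 2 * (K * B / (1 - nm q)).
have [N HN] := geom_lt_eps D q01 e0; exists N => n /HN; apply: le_lt_trans.
apply: (cvg_nm_le (cvg_nmB cl (pc n))) => M.
rewrite /psum -sumrB; apply: le_trans (nm_sum _ _ _) _.
apply: (@le_trans _ _ (\sum_(i < M) K * B * nm q ^+ n / (1 - nm q) * 2^-1 ^+ i)).
  apply: ler_sum => i _; rewrite -mulrBl nmM nmX.
  have [_ /(_ n) h1] := Hcc i.
  apply: le_trans (ler_pM (nm_ge0 _) _ h1 (nm_half_pow i r0' hr)) _.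
    by rewrite exprn_ge0 ?nm_ge0.
  by apply: eq_leR; field; rewrite expf_neq0 ?gt_eqF // subr_gt0.
rewrite -mulr_sumr /D.
have X0 : 0 <= K * B * nm q ^+ n / (1 - nm q).
  by rewrite !mulr_ge0 ?expR_ge0 ?exprn_ge0 ?nm_ge0 // invr_ge0 subr_ge0 ltW.
apply: le_trans (ler_wpM2l X0 (sum_half M)) _; apply: eq_leR; ring.
Qed.

End qpochhammer.

(** * Values of analytic functions near an isolated point *)

Section analytic_uniqueness.
Context {R : realType}.
Local Notation C := (cplx R).

(** Were f z nonzero, the difference quotient - f z / (w - z) would be unbounded near z, although it
    extends analytically. *)
Lemma analytic_at_punctured0 (f : C -> C) (z : C) (e : R) : analytic_at f z -> 0 < e ->
  (forall w, w != z -> nm (w - z) < e -> f w = 0) -> f z = 0.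
Proof.
move=> Hf e0 H; have [d Hd] := analytic_quotient Hf.
have [M [r [r0 Hr]]] := analytic_bounded Hd.
apply/eqP; apply: contraT; rewrite -nm_gt0 => fz.
have M0 : 0 <= M by apply: le_trans (nm_ge0 _) (Hr z _); rewrite subrr nm0 ltW.
pose t : R := Num.min (Num.min (e / 2) r) (nm (f z) / (2 * (M + 1))).
have t0 : 0 < t by rewrite !lt_min !divr_gt0 ?mulr_gt0 //; lra.
have te : t < e.
  have : t <= e / 2 by rewrite !ge_min lexx.
  by lra.
have tr : t <= r by rewrite !ge_min lexx orbT.
have tM : t <= nm (f z) / (2 * (M + 1)) by rewrite !ge_min lexx !orbT.
have nt : nm (t%:C%C : C) = t by apply: complexI; rewrite -nmE ger0_norm // ler0c ltW.
have := Hr (z + t%:C%C); rewrite addrAC subrr add0r nt => /(_ tr).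
have tz : z + t%:C%C != z.
  by rewrite -subr_eq0 addrAC subrr add0r -nm_gt0 nt.
rewrite ifN // (H _ tz); last by rewrite addrAC subrr add0r nt.
rewrite sub0r nmM nmN nmV nt ler_pdivrMr // => h.
move: tM; rewrite ler_pdivlMr; last lra.
by move=> h2; have := mulr_ge0 M0 (ltW t0); move: h h2 t0; lra.
Qed.

Lemma analytic_neq0_near (f : C -> C) (z : C) : analytic_at f z -> f z != 0 ->
  exists2 e : R, 0 < e & forall w, nm (w - z) < e -> f w != 0.
Proof.
move=> Hf fz; have [d Hd] := analytic_quotient Hf.
have [M [r [r0 Hr]]] := analytic_bounded Hd.
have M0 : 0 <= M by apply: le_trans (nm_ge0 _) (Hr z _); rewrite subrr nm0 ltW.
have fz0 : 0 < nm (f z) by rewrite nm_gt0.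
exists (Num.min r (nm (f z) / (M + 1))); first by rewrite lt_min r0 divr_gt0 //; lra.
move=> w; rewrite lt_min => /andP[wr]; rewrite ltr_pdivlMr; last lra.
move=> hM; have [->//|wz] := eqVneq w z.
apply: contraTneq (Hr w (ltW wr)) => fw.
have wz0 : 0 < nm (w - z) by rewrite nm_gt0 subr_eq0.
rewrite ifN // fw sub0r nmM nmN nmV -ltNge ltr_pdivlMr //.
by move: hM wz0; lra.
Qed.

Lemma analytic_at_scale (f : C -> C) (z c : C) : c != 0 -> analytic_at f (c * z) ->
  analytic_at (fun w => f (c * w)) z.
Proof.
move=> c0 /analytic_atP[a [r [K [r0 H Hc]]]]; have nc : 0 < nm c by rewrite nm_gt0.
apply/analytic_atP; exists (fun n => a n * c ^+ n), (r / nm c), K; split.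
- by rewrite divr_gt0.
- move=> N; apply: le_trans (H N); apply: ler_sum => i _; apply: eq_leR.
  by rewrite nmM nmX exprMn exprVn; field; rewrite expf_neq0 ?gt_eqF.
- move=> h hr; rewrite mulrDr.
  have -> : psum (fun n => a n * c ^+ n) h = psum a (c * h).
    by apply/funext => N; apply: eq_bigr => i _; rewrite exprMn mulrA.
  by apply: Hc; rewrite nmM mulrC -ler_pdivlMr //; move: hr; rewrite mulrAC.
Qed.

Lemma analytic_at_punctured (f g : C -> C) (z : C) (e : R) : analytic_at f z -> analytic_at g z ->
  0 < e -> (forall w, w != z -> nm (w - z) < e -> f w = g w) -> f z = g z.
Proof.
move=> Hf Hg e0 H; apply/eqP; rewrite -subr_eq0; apply/eqP.
have h := analyticD Hf (analyticM (@analytic_cst R z (-1)) Hg).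
rewrite -[- g z]mulN1r; apply: (analytic_at_punctured0 h e0).
by move=> w wz we; rewrite (H w wz we) mulN1r subrr.
Qed.
End analytic_uniqueness.

(** * Zeros of theta and division by theta *)

Section theta_functions.
Context {R : realType}.
Local Notation C := (cplx R).
Variable q : C.
Hypotheses (q0 : q != 0) (q1 : nm q < 1).
Implicit Types (a b c x y z w : C) (f g : C -> C).

Lemma qZ1 : qZ q 1.
Proof. by exists 0; rewrite expr0z. Qed.

Lemma qZM x y : qZ q x -> qZ q y -> qZ q (x * y).
Proof. by move=> [m ->] [n ->]; exists (m + n); rewrite expfzDr. Qed.

Lemma qZV x : qZ q x -> qZ q x^-1.
Proof. by move=> [m ->]; exists (- m); rewrite invr_expz. Qed.

Lemma qZVE x : qZ q x^-1 <-> qZ q x.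
Proof. by split=> [/qZV|/qZV //]; rewrite invrK. Qed.

Lemma expq_neq1 n : q ^+ n.+1 != 1.
Proof. by apply: contraTneq (nm_expn_lt1 n q1) => ->; rewrite nm1 ltxx. Qed.

Lemma expqz_eq1 (m : int) : q ^ m = 1 -> m = 0.
Proof.
case: m => [[|n]|n] //; first by move/eqP; rewrite -exprnP (negPf (expq_neq1 n)).
move/eqP; rewrite NegzE -exprz_inv -exprnP exprVn invr_eq1.
by rewrite (negPf (expq_neq1 n)).
Qed.

Lemma thetaV z : z != 0 -> theta q z^-1 = theta q (q * z).
Proof. by move=> z0; rewrite /theta invrK invfM mulrA divff // mul1r mulrC. Qed.

Lemma thetaq z : z != 0 -> theta q (q * z) = - z^-1 * theta q z.
Proof.
move=> z0; rewrite /theta invfM mulrA divff // mul1r.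
by rewrite (qpochS z q1) (qpochS z^-1 q1); field.
Qed.

Lemma theta_inv z : z != 0 -> theta q z^-1 = - z^-1 * theta q z.
Proof. by move=> z0; rewrite thetaV // thetaq. Qed.

Lemma theta_eq0 z : z != 0 -> theta q z = 0 <-> qZ q z.
Proof.
move=> z0; split=> [/eqP|[m zm]].
  rewrite /theta mulf_eq0 => /orP[] /eqP /(qpoch_eq0 _ q1)[n h].
    exists (- n%:Z); apply: (mulfI (expf_neq0 n q0)); rewrite h.
    by rewrite exprnP -expfzDr // subrr expr0z.
  exists n.+1%:Z; rewrite -exprnP exprSr; apply: (mulIf (invr_neq0 z0)).
  by rewrite mulfV // -mulrA h.
apply/eqP; rewrite /theta mulf_eq0; apply/orP.
case: m zm => [[|n]|n] zm.
- by left; apply/eqP/(qpoch_eq0 _ q1); exists 0%N; rewrite zm expr0 mul1r.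
- right; apply/eqP/(qpoch_eq0 _ q1); exists n.
  by rewrite zm -exprnP mulrA -exprSr divff // expf_neq0.
- left; apply/eqP/(qpoch_eq0 _ q1); exists n.+1.
  by rewrite zm NegzE -exprnN mulfV // expf_neq0.
Qed.

Lemma theta1 : theta q 1 = 0.
Proof. by apply/theta_eq0; rewrite ?oner_neq0 //; exact: qZ1. Qed.

Lemma analytic_theta_scale a : a != 0 -> analytic_star (fun z => theta q (z / a)).
Proof.
move=> a0 z z0.
have h1 : analytic_at (fun w : C => w * a^-1) z.
  exact: analyticM (@analytic_id R z) (@analytic_cst R z a^-1).
have za : z / a != 0 by rewrite mulf_neq0 ?invr_eq0.
rewrite /theta; apply: analyticM; first exact: (analytic_qpoch q1 h1).
apply: (analytic_qpoch q1); exact: analyticM (@analytic_cst R z q) (analyticV h1 za).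
Qed.

Lemma theta_iter (m : int) : exists2 c, c != 0 &
  forall z, z != 0 -> theta q (q ^ m * z) = c * z ^ (- m) * theta q z.
Proof.
have pos n : exists2 c, c != 0 &
    forall z, z != 0 -> theta q (q ^+ n * z) = c * (z ^+ n)^-1 * theta q z.
  elim: n => [|n [c c0 IH]].
    by exists 1 => [|z z0]; rewrite ?oner_neq0 // expr0 invr1 !mul1r.
  exists (- c * (q ^+ n)^-1); first by rewrite mulf_neq0 ?oppr_eq0 ?invr_eq0 ?expf_neq0.
  move=> z z0; rewrite exprS -mulrA thetaq ?mulf_neq0 ?expf_neq0 // IH // exprS.
  by field; rewrite z0 !expf_neq0.
case: m => n.
  by have [c c0 H] := pos n; exists c => // z z0; rewrite -exprnN H.
have [c c0 H] := pos n.+1; exists (c^-1 * ((q ^+ n.+1)^-1) ^+ n.+1).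
  by rewrite mulf_neq0 ?invr_eq0 ?expf_neq0 ?invr_eq0 ?expf_neq0.
move=> z z0; have Q0 : q ^+ n.+1 != 0 by rewrite expf_neq0.
have := H ((q ^+ n.+1)^-1 * z); rewrite mulrA divff // mul1r => ->.
  rewrite NegzE opprK -exprnN -!exprnP exprMn.
  by field; rewrite c0 !expf_neq0 ?invr_eq0 // expf_neq0.
by rewrite mulf_neq0 ?invr_eq0.
Qed.

(** Zeros of theta are simple: a shift by q^m moves the zero to 1, where it comes from the single
    factor 1 - w / z. *)
Lemma theta_factor a z : a != 0 -> qZ q (z / a) ->
  exists U, [/\ analytic_star U, U z != 0 & forall w, w != 0 -> theta q (w / a) = (w - z) * U w].
Proof.
move=> a0 [m zam]; have z0 : z != 0.
  by apply: contraNneq (expfz_neq0 m q0) => z0; rewrite -zam z0 mul0r.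
have [c c0 H] := theta_iter m.
pose T w := qpoch (q * (w * z^-1)) q * qpoch (q * (w * z^-1)^-1) q.
pose U w := (- c * z^-1) * (w * z^-1) ^ (- m) * T w.
have aw : analytic_star (fun w => w * z^-1).
  by move=> w w0; exact: analyticM (@analytic_id R w) (@analytic_cst R w z^-1).
exists U; split.
- apply: analytic_starM.
    apply: analytic_starZ => w w0.
    have hz : analytic_at (fun v : C => (z ^ m) * v ^ (- m)) w.
      exact: analyticM (@analytic_cst R w _) (@analytic_star_exprz R (- m) w w0).
    apply: (analytic_at_near hz); exists 1 => // h _.
    by rewrite expfzMl exprz_inv opprK mulrC.
  move=> w w0; apply: analyticM; apply: (analytic_qpoch q1).
    exact: analyticM (@analytic_cst R w q) (aw w w0).
  apply: analyticM; first exact: (@analytic_cst R w q).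
  by apply: analyticV; [exact: aw | rewrite mulf_neq0 ?invr_eq0].
- rewrite /U /T divff // exp1rz mulr1 invr1 !mulf_neq0 ?oppr_eq0 ?invr_eq0 //;
  by apply/eqP => /(qpoch_eq0 _ q1)[n /eqP]; rewrite mulr1 -exprSr (negPf (expq_neq1 n)).
- move=> w w0; have -> : w / a = q ^ m * (w / z).
    by rewrite -zam; field; rewrite a0 z0.
  have wz0 : w / z != 0 by rewrite mulf_neq0 ?invr_eq0.
  rewrite H // /U /T /theta (qpochS (w / z) q1).
  by field.
Qed.

(* Theta functions of degree [n]: for [n > 0] they form a space of dimension [n]. *)
Definition qper n c f :=
  analytic_star f /\ forall z, z != 0 -> f (q * z) = c / z ^+ n * f z.

Lemma qperD n c f g : qper n c f -> qper n c g -> qper n c (fun z => f z + g z).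
Proof.
move=> [hf Hf] [hg Hg]; split; first exact: analytic_starD.
by move=> z z0; rewrite Hf // Hg // mulrDr.
Qed.

Lemma qperZ n c f (k : C) : qper n c f -> qper n c (fun z => k * f z).
Proof.
move=> [hf Hf]; split; first exact: analytic_starZ.
by move=> z z0; rewrite Hf // mulrCA.
Qed.

Lemma qperB n c f g : qper n c f -> qper n c g -> qper n c (fun z => f z - g z).
Proof.
move=> hf /(qperZ (-1)) hg; have := qperD hf hg.
by under eq_fun do rewrite mulN1r.
Qed.

Lemma qperM n m c d f g : qper n c f -> qper m d g -> qper (n + m) (c * d) (fun z => f z * g z).
Proof.
move=> [hf Hf] [hg Hg]; split; first exact: analytic_starM.
by move=> z z0; rewrite Hf // Hg // exprD; field; rewrite !expf_neq0.
Qed.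

Lemma qper_theta a : a != 0 -> qper 1 (- a) (fun z => theta q (z / a)).
Proof.
move=> a0; split; first exact: analytic_theta_scale.
move=> z z0; rewrite -mulrA thetaq ?mulf_neq0 ?invr_eq0 // expr1; congr (_ * _).
by field; rewrite z0 a0.
Qed.

Lemma qper_eq n c f g : (forall z, z != 0 -> f z = g z) -> qper n c f -> qper n c g.
Proof.
move=> fg [hf Hf]; split; first exact: (eq_analytic_star fg).
by move=> z z0; rewrite -!fg ?mulf_neq0 // Hf.
Qed.

Lemma qper_zero_shift n c f a (m : int) : c != 0 -> qper n c f -> a != 0 -> f a = 0 -> f (q ^ m * a) = 0.
Proof.
move=> c0 [hf Hf] a0 fa.
have pos k b : b != 0 -> f (q ^+ k * b) = 0 <-> f b = 0.
  elim: k => [|k IH] b0; first by rewrite expr0 mul1r.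
  rewrite exprS -mulrA Hf ?mulf_neq0 ?expf_neq0 //; rewrite -(IH b0); split.
    move/eqP; rewrite mulf_eq0 mulf_eq0 (negPf c0) invr_eq0 expf_eq0 mulf_eq0.
    by rewrite expf_eq0 (negPf q0) (negPf b0) !andbF /= => /eqP.
  by move=> ->; rewrite mulr0.
case: m => k; first by apply/pos.
have qa : (q ^+ k.+1)^-1 * a != 0 by rewrite mulf_neq0 ?invr_eq0 ?expf_neq0.
by rewrite NegzE -exprnN; apply/(pos k.+1 _ qa); rewrite mulrA divff ?expf_neq0 // mul1r.
Qed.

(** The quasi-periodicity of f spreads its zero at a over a q^Z, which contains all zeros of theta(z
    / a). These being simple, the quotient extends analytically. *)
Lemma qper_div n c f a : a != 0 -> c != 0 -> qper n.+1 c f -> f a = 0 ->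
  exists2 g, qper n (- c / a) g & forall z, z != 0 -> f z = theta q (z / a) * g z.
Proof.
move=> a0 c0 Hf fa; have [hf Ef] := Hf.
(* At a zero, the simple factor of theta cancels against the difference quotient of f; d is the
   value of f / theta there. *)
have loc z : exists d, z != 0 -> qZ q (z / a) ->
    f z = 0 /\ analytic_at (fun w => if w == z then d else f w / theta q (w / a)) z.
  have [[z0 za]|nz] := pselect (z != 0 /\ qZ q (z / a)); last first.
    by exists 0 => z0 za; exfalso; apply: nz.
  have fz : f z = 0.
    have [m zm] := za; have := qper_zero_shift m c0 Hf a0 fa.
    by rewrite -zm divfK.
  have [d Hd] := analytic_quotient (hf z z0).
  have [U [hU Uz HU]] := theta_factor a0 za.
  exists (d * (U z)^-1) => _ _; split; first exact: fz.
  apply: (analytic_at_near (analyticM Hd (analyticV (hU z z0) Uz))).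
  exists (nm z); first by rewrite nm_gt0.
  move=> h hz; have zh0 : z + h != 0.
    apply: contraTneq hz => zh0.
    by rewrite (_ : h = - z) ?nmN ?ltxx //; apply/eqP; rewrite -addr_eq0 addrC zh0.
  rewrite fz subr0 HU //; case: eqP => [->//|/eqP zh].
  by rewrite invfM mulrA.
have /choice[d Hd] := loc.
pose g z := if `[< qZ q (z / a) >] then d z else f z / theta q (z / a).
have th z : z != 0 -> ~ qZ q (z / a) -> theta q (z / a) != 0.
  move=> z0 nz; apply/eqP => /theta_eq0; apply: contra_not nz; apply.
  by rewrite mulf_neq0 ?invr_eq0.
have fg z : z != 0 -> f z = theta q (z / a) * g z.
  move=> z0; rewrite /g; case: asboolP => [za|nz].
    have [-> _] := Hd z z0 za.
    have [_ h] := @theta_eq0 (z / a) (mulf_neq0 z0 (invr_neq0 a0)).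
    by rewrite (h za) mul0r.
  by field; exact: th.
have near_z z : z != 0 -> exists2 e : R, 0 < e & forall w, w != z -> nm (w - z) < e ->
    w != 0 /\ ~ qZ q (w / a).
  move=> z0; have nz : 0 < nm z by rewrite nm_gt0.
  have wn0 w : nm (w - z) < nm z -> w != 0.
    by apply: contraTneq => ->; rewrite sub0r nmN ltxx.
  have [za|nza] := pselect (qZ q (z / a)).
    have [U [hU Uz HU]] := theta_factor a0 za.
    have [e e0 He] := analytic_neq0_near (hU z z0) Uz.
    exists (Num.min e (nm z)); first by rewrite lt_min e0.
    move=> w wz; rewrite lt_min => /andP[we /wn0 w0]; split=> // wa.
    have [_ h] := @theta_eq0 (w / a) (mulf_neq0 w0 (invr_neq0 a0)).
    move: (h wa) => /eqP; rewrite HU // mulf_eq0 subr_eq0 (negPf wz) /=.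
    exact/negP/He.
  have [e e0 He] := analytic_neq0_near (analytic_theta_scale a0 z0) (th z z0 nza).
  exists (Num.min e (nm z)); first by rewrite lt_min e0.
  move=> w wz; rewrite lt_min => /andP[we /wn0 w0]; split=> // wa.
  have [_ h] := @theta_eq0 (w / a) (mulf_neq0 w0 (invr_neq0 a0)).
  by have := He w we; rewrite (h wa) eqxx.
have hg : analytic_star g.
  move=> z z0.
  have [za|nz] := pselect (qZ q (z / a)).
    have [_ h] := Hd z z0 za; have [e e0 He] := near_z z z0.
    apply: (analytic_at_near h); exists e; [exact: e0 | move=> k ke].
    case: eqP => [->|/eqP kz]; first by rewrite /g asboolT.
    have [|_ nq] := He _ kz; first by rewrite addrAC subrr add0r.
    by rewrite /g asboolF.
  apply: (analytic_at_near (analyticM (hf z z0) (analyticV (analytic_theta_scale a0 z0) (th z z0 nz)))).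
  have [e e0 He] := near_z z z0; exists e; [exact: e0 | move=> k ke].
  have [->|kz] := eqVneq (z + k) z; first by rewrite /g asboolF.
  have [|_ nq] := He _ kz; first by rewrite addrAC subrr add0r.
  by rewrite /g asboolF.
exists g; last exact: fg.
split; first exact: hg.
(* The functional equation of the quotient is checked off the zeros of theta and extended across
   them by analyticity. *)
move=> z z0; have [e e0 He] := near_z z z0.
have qz0 : q * z != 0 by rewrite mulf_neq0.
have h1 : analytic_at (fun w => g (q * w)) z by apply: (analytic_at_scale q0); exact: (hg _ qz0).
have h2 : analytic_at (fun w => - c / a / w ^+ n * g w) z.
  apply: analyticM (hg z z0); apply: analyticM; first exact: (@analytic_cst R z (- c / a)).
  by apply: analyticV; [exact: analytic_star_pow | rewrite expf_neq0].
apply: (analytic_at_punctured h1 h2 e0) => w wz we.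
have [w0 nwa] := He w wz we; have tw := th w w0 nwa.
have wa0 : w / a != 0 by rewrite mulf_neq0 ?invr_eq0.
have := Ef w w0; rewrite !fg ?mulf_neq0 // -(mulrA q) thetaq // => h.
apply: (mulfI tw); apply: (mulfI (invr_neq0 wa0)).
have -> : (w / a)^-1 * (theta q (w / a) * g (q * w)) =
    - (- (w / a)^-1 * theta q (w / a) * g (q * w)) by ring.
rewrite h exprS; move: (theta q _) (g w) => X Y.
by field; rewrite w0 a0 expf_neq0.
Qed.
End theta_functions.

(** * Theta functions of a given degree *)

Section quasi_periodic.
Context {R : realType}.
Local Notation C := (cplx R).
Variable q : C.
Hypotheses (q0 : q != 0) (q1 : nm q < 1).
Implicit Types (a b c x y z w : C) (f g : C -> C) (s : seq C).

Lemma qper0_cst f : qper q 0 1 f -> exists k, forall z, z != 0 -> f z = k.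
Proof.
move=> [hf Hf]; have [|k [m [km Hk]]] := @constant_multiplier R f q 1 q0 q1 hf.
  by move=> w w0; rewrite Hf // expr0 divr1.
exists k => z z0; rewrite Hk //; have [->|k0] := eqVneq k 0; first by rewrite mul0r.
by rewrite (expqz_eq1 q1 (esym (km k0))) expr0z mulr1.
Qed.

Lemma qper0_eq0 c f : ~ qZ q c -> qper q 0 c f -> forall z, z != 0 -> f z = 0.
Proof.
move=> nc [hf Hf]; have [|k [m [km Hk]]] := @constant_multiplier R f q c q0 q1 hf.
  by move=> w w0; rewrite Hf // expr0 divr1.
move=> z z0; rewrite Hk //; have [->|k0] := eqVneq k 0; first by rewrite mul0r.
by exfalso; apply: nc; exists m; exact: km.
Qed.

Fixpoint qdistinct s : Prop :=
  if s is a :: t then [/\ a != 0, forall b, b \in t -> ~ qZ q (b / a) & qdistinct t] else True.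

(** Each zero divided out lowers the degree by one and divides the multiplier by -a; inequivalence
    modulo q^Z passes the other zeros on to the quotient. *)
Lemma qper_factor n c f s : c != 0 -> qdistinct s -> qper q (size s + n) c f ->
  (forall a, a \in s -> f a = 0) ->
  exists2 g, qper q n (c / \prod_(a <- s) (- a)) g &
    forall z, z != 0 -> f z = (\prod_(a <- s) theta q (z / a)) * g z.
Proof.
elim: s c f => [|a s IH] c f c0.
  by move=> _ Hf _; exists f => [|z z0]; rewrite big_nil ?divr1 ?mul1r.
move=> [a0 Ha Hs] Hf Hz.
have [|g Hg fg] := qper_div q0 q1 a0 c0 Hf; first by apply: Hz; rewrite inE eqxx.
have ca0 : - c / a != 0 by rewrite mulf_neq0 ?oppr_eq0 ?invr_eq0.
have sn0 b : b \in s -> b != 0.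
  elim: (s) Hs => // d t IHt [d0 _ Ht]; rewrite inE => /predU1P[->//|].
  exact: IHt.
have [||h Hh gh] := IH _ g ca0 Hs; first exact: Hg.
  move=> b bs; have b0 := sn0 b bs.
  have := Hz b; rewrite inE bs orbT fg // => /(_ isT) /eqP; rewrite mulf_eq0 => /orP[|/eqP //].
  move=> /eqP /(theta_eq0 q0 q1 (mulf_neq0 b0 (invr_neq0 a0))) h.
  by exfalso; exact: (Ha b bs).
exists h; last by move=> z z0; rewrite fg // gh // big_cons mulrA.
by rewrite big_cons mulNr invrN mulrN invfM; move: Hh; rewrite !mulNr mulrA.
Qed.

Lemma qper_vanish c f s : c != 0 -> qdistinct s -> qper q (size s) c f ->
  (forall a, a \in s -> f a = 0) -> ~ qZ q (c / \prod_(a <- s) (- a)) ->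
  forall z, z != 0 -> f z = 0.
Proof.
move=> c0 ds Hf Hz nc z z0; rewrite -(addn0 (size s)) in Hf.
have [g Hg fg] := qper_factor c0 ds Hf Hz.
by rewrite fg // (qper0_eq0 nc Hg) // mulr0.
Qed.

Lemma qper_theta_prod f s : qdistinct s -> \prod_(a <- s) (- a) != 0 ->
  qper q (size s) (\prod_(a <- s) (- a)) f -> (forall a, a \in s -> f a = 0) ->
  exists k, forall z, z != 0 -> f z = k * \prod_(a <- s) theta q (z / a).
Proof.
move=> ds p0 Hf Hz; rewrite -(addn0 (size s)) in Hf.
have [g Hg fg] := qper_factor p0 ds Hf Hz; rewrite divff // in Hg.
by have [k Hk] := qper0_cst Hg; exists k => z z0; rewrite fg // Hk // mulrC.
Qed.

(* a real number strictly between |q| and 1, hence a point off q^Z *)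
Definition tau : C := ((1 + nm q) / 2)%:C%C.

Lemma nm_tau : nm tau = (1 + nm q) / 2.
Proof.
apply: complexI; rewrite -nmE ger0_norm // ler0c divr_ge0 // addr_ge0 //.
exact: nm_ge0.
Qed.

Lemma tau_neq0 : tau != 0.
Proof. by rewrite -nm_gt0 nm_tau; have := nm_ge0 q; lra. Qed.

Lemma tauN : ~ qZ q tau.
Proof.
have nq := nm_ge0 q; have Q1 := q1.
move=> [[[|n]|n] h]; have := nm_tau; rewrite h.
- rewrite expr0z nm1 => e; lra.
- rewrite -exprnP nmX exprS => e.
  have : nm q * nm q ^+ n <= nm q * 1 by rewrite ler_wpM2l // exprn_ile1 // ltW.
  lra.
- rewrite NegzE -exprnN nmV nmX => e.
  have : 1 <= (nm q ^+ n.+1)^-1.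
    rewrite invf_ge1 ?exprn_ile1 ?(ltW q1) //.
    by rewrite exprn_gt0 // nm_gt0.
  lra.
Qed.

(** For a = -c, theta(z / a) has the same multiplier as g. The combination of the two that vanishes
    at a tau is identically 0, because dividing by that zero leaves the constant multiplier tau^-1,
    off q^Z. At a it reduces to a nonzero multiple of g. *)
Lemma qper1_zero c g : c != 0 -> qper q 1 c g -> g (- c) = 0.
Proof.
move=> c0 Hg; set a := - c; have a0 : a != 0 by rewrite oppr_eq0.
have Hh := qper_theta q0 q1 a0; rewrite opprK in Hh; set h := fun z => theta q (z / a) in Hh.
pose b := a * tau; have b0 : b != 0 by rewrite mulf_neq0 ?tau_neq0.
have hb : h b != 0.
  apply/eqP; rewrite /h /b mulrAC divff // mul1r => /(theta_eq0 q0 q1 tau_neq0).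
  exact: tauN.
have HF := qperB (qperZ (h b) Hg) (qperZ (g b) Hh).
have : h b * g a - g b * h a = 0.
  apply: (@qper_vanish c _ [:: b] c0 _ HF _ _ a a0).
  - by split.
  - by move=> x; rewrite inE => /eqP ->; ring.
  - rewrite big_seq1 /b /a mulNr opprK invfM mulrA divff // mul1r qZVE; exact: tauN.
have -> : h a = 0 by rewrite /h divff //; exact: theta1.
by move/eqP; rewrite mulr0 subr0 mulf_eq0 (negPf hb) /= => /eqP.
Qed.

Lemma qper1_theta c g : c != 0 -> qper q 1 c g ->
  exists k, forall z, z != 0 -> g z = k * theta q (z / - c).
Proof.
move=> c0 Hg; have c0' : - c != 0 by rewrite oppr_eq0.
have p : \prod_(a <- [:: - c]) (- a) = c by rewrite big_seq1 opprK.
have [||||k Hk] := @qper_theta_prod g [:: - c]; rewrite ?p.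
- by split.
- exact: c0.
- exact: Hg.
- by move=> a; rewrite inE => /eqP ->; exact: qper1_zero.
- by exists k => z z0; rewrite Hk // big_seq1.
Qed.

(** Dividing out the zeros in s leaves a function of degree one, whose zero is read off from its
    multiplier. *)
Lemma qper_last_zero c f s b : c != 0 -> qdistinct s -> qper q (size s).+1 c f ->
  (forall a, a \in s -> f a = 0) -> c = \prod_(a <- b :: s) (- a) -> f b = 0.
Proof.
move=> c0 ds Hf Hz cb; rewrite -addn1 in Hf; rewrite big_cons in cb.
have [g Hg fg] := qper_factor c0 ds Hf Hz.
have : - b * \prod_(a <- s) (- a) != 0 by rewrite -cb.
rewrite mulf_eq0 negb_or oppr_eq0 => /andP[b0 p0].
have cE : c / \prod_(a <- s) (- a) = - b by rewrite cb mulfK.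
rewrite cE in Hg; rewrite fg //; have := @qper1_zero (- b) g.
by rewrite opprK oppr_eq0 => ->; rewrite ?mulr0.
Qed.

(** As a function of x, the element of the plane of degree two and multiplier c that vanishes at y.
    The factor y makes it antisymmetric: up to a constant it is the determinant of a basis of the
    plane evaluated at x and y, which is the content of [wedge_plucker]. *)
Definition wedge c x y : C := y * theta q (x / y) * theta q (x * y / c).

Lemma qper_wedge c y : c != 0 -> y != 0 -> qper q 2 c (fun x => wedge c x y).
Proof.
move=> c0 y0; have cy0 : c / y != 0 by rewrite mulf_neq0 ?invr_eq0.
have := qperZ y (qperM (qper_theta q0 q1 y0) (qper_theta q0 q1 cy0)).
rewrite (_ : - y * - (c / y) = c); last by field.
apply: (qper_eq q0) => z z0.
by rewrite /wedge invf_div !mulrA.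
Qed.

Lemma wedgeC c x y : x != 0 -> y != 0 -> wedge c y x = - wedge c x y.
Proof.
move=> x0 y0; have xy0 : x / y != 0 by rewrite mulf_neq0 ?invr_eq0.
have -> : wedge c y x = x * theta q (x / y)^-1 * theta q (x * y / c).
  by rewrite /wedge invf_div [y * x]mulrC.
rewrite (theta_inv q0 q1 xy0) /wedge; set A := theta q _; set B := theta q _.
by field; rewrite x0 y0.
Qed.

Lemma wedgexx c x : x != 0 -> wedge c x x = 0.
Proof. by move=> x0; rewrite /wedge divff // (theta1 q0 q1) mulr0 mul0r. Qed.

Lemma wedge_eq0 c x y : c != 0 -> x != 0 -> y != 0 ->
  wedge c x y = 0 <-> qZ q (x / y) \/ qZ q (x * y / c).
Proof.
move=> c0 x0 y0.
have h1 : x / y != 0 by rewrite mulf_neq0 ?invr_eq0.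
have h2 : x * y / c != 0 by rewrite !mulf_neq0 ?invr_eq0.
split=> [/eqP|].
  rewrite /wedge mulf_eq0 (mulf_eq0 y) (negPf y0) /= => /orP[] /eqP.
    by move/(theta_eq0 q0 q1 h1); left.
  by move/(theta_eq0 q0 q1 h2); right.
move=> [/(theta_eq0 q0 q1 h1)|/(theta_eq0 q0 q1 h2)] h; by rewrite /wedge h ?mulr0 ?mul0r.
Qed.

(** The difference of the two sides vanishes at a and b, and wedge c a b != 0 says exactly that
    these can be inequivalent zeros only of the zero function. *)
Lemma qper2_span c a b f : c != 0 -> a != 0 -> b != 0 -> wedge c a b != 0 -> qper q 2 c f ->
  forall x, x != 0 -> wedge c a b * f x = f a * wedge c x b - f b * wedge c x a.
Proof.
move=> c0 a0 b0 wab Hf x x0.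
have nw : ~ (qZ q (a / b) \/ qZ q (a * b / c)).
  by move/(wedge_eq0 c0 a0 b0)/eqP; rewrite (negPf wab).
have HF := qperB (qperZ (wedge c a b) Hf)
  (qperB (qperZ (f a) (qper_wedge c0 b0)) (qperZ (f b) (qper_wedge c0 a0))).
apply/eqP; rewrite -subr_eq0; apply/eqP.
apply: (@qper_vanish c _ [:: a; b] c0 _ HF _ _ x x0).
- split=> //; move=> d; rewrite inE => /eqP -> h; apply: nw; left.
  by rewrite -invf_div; exact: qZV.
- move=> d; rewrite !inE => /orP[] /eqP ->; rewrite wedgexx // ?(wedgeC c a0 b0); ring.
- rewrite big_cons big_seq1 mulrNN => h; apply: nw; right.
  by rewrite -invf_div; exact: qZV.
Qed.

(** Expand wedge(., y) in the basis given by a and b and use antisymmetry. *)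
Lemma wedge_plucker c a b x y : c != 0 -> a != 0 -> b != 0 -> x != 0 -> y != 0 ->
  wedge c a b != 0 ->
  wedge c x a * wedge c y b - wedge c x b * wedge c y a = wedge c a b * wedge c x y.
Proof.
move=> c0 a0 b0 x0 y0 wab.
rewrite (qper2_span c0 a0 b0 wab (qper_wedge c0 y0) x0).
rewrite (wedgeC c a0 y0) (wedgeC c b0 y0); set W1 := wedge c a y; set W2 := wedge c b y.
ring.
Qed.

(** With a^2 = c and b = a tau, the ratio a / b is tau^-1 and a b / c is tau, both off q^Z. *)
Lemma wedge_basis c : c != 0 -> exists a b, [/\ a != 0, b != 0 & wedge c a b != 0].
Proof.
move=> c0; pose a := sqrtC c; have a0 : a != 0 by rewrite sqrtC_eq0.
have t0 := tau_neq0.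
have ac : a * a = c by rewrite -expr2 sqrtCK.
exists a, (a * tau); split=> //; first by rewrite mulf_neq0.
apply/eqP => /wedge_eq0 []; rewrite ?mulf_neq0 //.
  by rewrite invfM mulrA divff // mul1r qZVE; exact: tauN.
by rewrite mulrA ac mulrAC divff // mul1r; exact: tauN.
Qed.

(** Without a zero of f, the quotient wedge(z, a) / f would be constant; it is 0 at a but not at
    b. *)
Lemma qper2_zero c f : c != 0 -> qper q 2 c f -> exists2 a, a != 0 & f a = 0.
Proof.
move=> c0 Hf; have [//|nex] := pselect (exists2 a, a != 0 & f a = 0).
have f0 z : z != 0 -> f z != 0.
  by move=> z0; apply/eqP => fz; apply: nex; exists z.
have [a [b [a0 b0 wab]]] := wedge_basis c0.
have [hf Ef] := Hf; have [hw Ew] := qper_wedge c0 a0.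
have [|k Hk] := @qper0_cst (fun z => wedge c z a * (f z)^-1).
  split; first exact: (analytic_starM hw (analytic_star_inv hf f0)).
  move=> z z0; rewrite Ew // Ef // expr0 divr1 mul1r.
  have := f0 z z0; move: (f z) (wedge c z a) => X Y X0.
  by field; rewrite X0 z0 c0.
have k0 : k = 0 by rewrite -(Hk a a0) wedgexx // mul0r.
exfalso; move: wab; rewrite (wedgeC c b0 a0) oppr_eq0.
have := Hk b b0; rewrite k0 => /eqP; rewrite mulf_eq0 invr_eq0 (negPf (f0 b b0)) orbF.
by move=> ->.
Qed.

End quasi_periodic.

(** * Rows of connection matrices and the form T *)

Section determinants.
Context {T : comPzRingType}.
Implicit Types F : nat -> nat -> T.

Definition det_nat n F : T := \det (\matrix_(i < n, j < n) F i j).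

Lemma det_nat0 F : det_nat 0 F = 1.
Proof. exact: det_mx00. Qed.

Lemma det_nat_recl n F : det_nat n.+1 F =
  \sum_(j < n.+1) F 0%N j * ((-1) ^+ j * det_nat n (fun i k => F i.+1 (bump j k))).
Proof.
rewrite /det_nat (expand_det_row _ ord0); apply: eq_bigr => j _; rewrite mxE /cofactor add0n.
by congr (_ * (_ * \det _)); apply/matrixP => i k; rewrite !mxE.
Qed.

(** Laplace expansion along the first two rows; in the elimination below those rows involve only f,
    and the last two only g. *)
Lemma det4 F : det_nat 4 F =
  let m a b i j := F a i * F b j - F a j * F b i in
  m 0%N 1%N 0%N 1%N * m 2%N 3%N 2%N 3%N - m 0%N 1%N 0%N 2%N * m 2%N 3%N 1%N 3%N + m 0%N 1%N 0%N 3%N * m 2%N 3%N 1%N 2%N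
  + m 0%N 1%N 1%N 2%N * m 2%N 3%N 0%N 3%N - m 0%N 1%N 1%N 3%N * m 2%N 3%N 0%N 2%N + m 0%N 1%N 2%N 3%N * m 2%N 3%N 0%N 1%N.
Proof.
rewrite !det_nat_recl !big_ord_recl !big_ord0 !det_nat_recl.
rewrite !big_ord_recl !big_ord0 !det_nat_recl !big_ord_recl !big_ord0.
rewrite !det_nat_recl !big_ord_recl !big_ord0 !det_nat0 /= /bump /=.
ring.
Qed.
End determinants.

(** * The elimination determinant and T *)

Section rows.
Context {R : realType}.
Local Notation C := (cplx R).
Local Notation P1 := (one_point_compactification C).
Local Notation P1x4 := 'rV[P1]_4.
Variables (q t0 kt k1 koo : C).
Hypotheses (q0 : q != 0) (q1 : nm q < 1).
Hypotheses (t00 : t0 != 0) (kt0 : kt != 0) (k10 : k1 != 0) (koo0 : koo != 0).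
Implicit Types (f g : C -> C) (r : P1x4) (kap : C).

Definition xval (j : nat) : C := nth 0 [:: kt * t0; kt^-1 * t0; k1; k1^-1] j.

Lemma xval_neq0 j : (j < 4)%N -> xval j != 0.
Proof. by move: j => [|[|[|[|//]]]] _; rewrite /xval /= ?mulf_neq0 ?invr_eq0. Qed.

(* [(f, g)] is a candidate first ([kap = k0]) or second ([kap = 1 / k0]) row of a
   connection matrix with coordinates [r]. *)
Definition row_solution kap r f g :=
  [/\ qper q 2 (t0 * kap / koo) f, qper q 2 (t0 * kap * koo) g &
    forall j : 'I_4, hy (r 0 j) * f (xval j) = hx (r 0 j) * g (xval j)].

Definition nonzero_row f g := exists2 z, z != 0 & (f z != 0) || (g z != 0).

(** The elimination determinant in Laplace form, its minors rewritten by [wedge_plucker] and freed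
    of the constant factors that come from the two bases. *)
Definition dform (cf cg : C) (X Y x : nat -> C) : C :=
  let m i j := Y i * Y j * wedge q cf (x i) (x j) in
  let n i j := X i * X j * wedge q cg (x i) (x j) in
  m 0%N 1%N * n 2%N 3%N - m 0%N 2%N * n 1%N 3%N + m 0%N 3%N * n 1%N 2%N
  + m 1%N 2%N * n 0%N 3%N - m 1%N 3%N * n 0%N 2%N + m 2%N 3%N * n 0%N 1%N.

(** The four relations are a linear system in the two coefficients of f and the two of g; a nonzero
    solution exists iff the determinant of the system vanishes. *)
Lemma dform_eq0 cf cg (X Y x : nat -> C) : cf != 0 -> cg != 0 ->
  (forall j, (j < 4)%N -> x j != 0) ->
  dform cf cg X Y x = 0 <->
  exists f g, [/\ qper q 2 cf f, qper q 2 cg g, nonzero_row f g &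
    forall j, (j < 4)%N -> Y j * f (x j) = X j * g (x j)].
Proof.
move=> cf0 cg0 x0.
have [a [b [a0 b0 wab]]] := wedge_basis q0 q1 cf0.
have [a' [b' [a0' b0' wab']]] := wedge_basis q0 q1 cg0.
pose F i j : C := nth 0 [:: Y j * wedge q cf (x j) a; Y j * wedge q cf (x j) b;
   - (X j * wedge q cg (x j) a'); - (X j * wedge q cg (x j) b')] i.
pose A : 'M[C]_4 := \matrix_(i, j) F i j.
have dE : \det A = wedge q cf a b * wedge q cg a' b' * dform cf cg X Y x.
  rewrite -/(det_nat 4 F) det4 /=.
  have m01 i j : (i < 4)%N -> (j < 4)%N ->
      F 0%N i * F 1%N j - F 0%N j * F 1%N i = Y i * Y j * (wedge q cf a b * wedge q cf (x i) (x j)).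
    move=> i4 j4; rewrite -(wedge_plucker q0 q1 cf0 a0 b0 (x0 i i4) (x0 j j4) wab) /F /=; ring.
  have m23 i j : (i < 4)%N -> (j < 4)%N ->
      F 2%N i * F 3%N j - F 2%N j * F 3%N i = X i * X j * (wedge q cg a' b' * wedge q cg (x i) (x j)).
    move=> i4 j4; rewrite -(wedge_plucker q0 q1 cg0 a0' b0' (x0 i i4) (x0 j j4) wab') /F /=; ring.
  clear A; clearbody F.
  rewrite (m01 0 1)%N // (m01 0 2)%N // (m01 0 3)%N // (m01 1 2)%N // (m01 1 3)%N // (m01 2 3)%N //.
  rewrite (m23 0 1)%N // (m23 0 2)%N // (m23 0 3)%N // (m23 1 2)%N // (m23 1 3)%N // (m23 2 3)%N //.
  by rewrite /dform; move: (wedge q cf) (wedge q cg) => wf wg; ring.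
have detP : dform cf cg X Y x = 0 <-> \det A = 0.
  rewrite dE; split=> [->|/eqP]; first by rewrite mulr0.
  by rewrite mulf_eq0 (negPf (mulf_neq0 wab wab')) /= => /eqP.
pose i1 : 'I_4 := lift ord0 ord0; pose i2 : 'I_4 := lift ord0 (lift ord0 ord0).
pose i3 : 'I_4 := lift ord0 (lift ord0 (lift ord0 ord0)).
have vA (v : 'rV[C]_4) j : (v *m A) 0 j =
   Y j * (v 0 ord0 * wedge q cf (x j) a + v 0 i1 * wedge q cf (x j) b) -
   X j * (v 0 i2 * wedge q cg (x j) a' + v 0 i3 * wedge q cg (x j) b').
  rewrite mxE !big_ord_recl big_ord0 !mxE /F /= -/i1 -/i2 -/i3.
  by move: (wedge q cf) (wedge q cg) => wf wg; ring.
have wba : wedge q cf b a != 0 by rewrite (wedgeC q0 q1 cf a0 b0) oppr_eq0.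
have wba' : wedge q cg b' a' != 0 by rewrite (wedgeC q0 q1 cg a0' b0') oppr_eq0.
rewrite detP; split=> [/eqP/det0P[v v0 vA0]|[f [g [Hf Hg [z z0 nz] H]]]].
  pose f z := v 0 ord0 * wedge q cf z a + v 0 i1 * wedge q cf z b.
  pose g z := v 0 i2 * wedge q cg z a' + v 0 i3 * wedge q cg z b'.
  exists f, g; split.
  - exact: (qperD (qperZ _ (qper_wedge q0 q1 cf0 a0)) (qperZ _ (qper_wedge q0 q1 cf0 b0))).
  - exact: (qperD (qperZ _ (qper_wedge q0 q1 cg0 a0')) (qperZ _ (qper_wedge q0 q1 cg0 b0'))).
  (* A basis function vanishes at its own base point, so evaluation at b, a, b', a' isolates the
     four coefficients. *)
  - have fb : f b = v 0 ord0 * wedge q cf b a by rewrite /f (wedgexx q0 q1) // mulr0 addr0.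
    have fa : f a = v 0 i1 * wedge q cf a b by rewrite /f (wedgexx q0 q1) // mulr0 add0r.
    have gb : g b' = v 0 i2 * wedge q cg b' a' by rewrite /g (wedgexx q0 q1) // mulr0 addr0.
    have ga : g a' = v 0 i3 * wedge q cg a' b' by rewrite /g (wedgexx q0 q1) // mulr0 add0r.
    have /rV0Pn[[i i4] vi] := v0.
    case: i i4 vi => [|[|[|[|//]]]] i4 vi; [exists b|exists a|exists b'|exists a'] => //.
    + apply/orP; left; rewrite fb mulf_neq0 //; move: vi; rewrite (_ : Ordinal _ = ord0) //.
      exact: val_inj.
    + apply/orP; left; rewrite fa mulf_neq0 //; move: vi; rewrite (_ : Ordinal _ = i1) //.
      exact: val_inj.
    + apply/orP; right; rewrite gb mulf_neq0 //; move: vi; rewrite (_ : Ordinal _ = i2) //.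
      exact: val_inj.
    + apply/orP; right; rewrite ga mulf_neq0 //; move: vi; rewrite (_ : Ordinal _ = i3) //.
      exact: val_inj.
  - move=> j j4; apply/eqP; rewrite -subr_eq0; apply/eqP.
    by have := vA v (Ordinal j4); rewrite vA0 mxE => <-.
pose c i : C := nth 0 [:: - f b / wedge q cf a b; f a / wedge q cf a b;
   - g b' / wedge q cg a' b'; g a' / wedge q cg a' b'] i.
pose v : 'rV[C]_4 := \row_(i < 4) c i.
have fE y : y != 0 -> v 0 ord0 * wedge q cf y a + v 0 i1 * wedge q cf y b = f y.
  move=> y0; apply: (mulfI wab); rewrite (qper2_span q0 q1 cf0 a0 b0 wab Hf y0) !mxE /c /=.
  move: (wedge q cf) wab => wf wab1; field; exact: wab1.
have gE y : y != 0 -> v 0 i2 * wedge q cg y a' + v 0 i3 * wedge q cg y b' = g y.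
  move=> y0; apply: (mulfI wab'); rewrite (qper2_span q0 q1 cg0 a0' b0' wab' Hg y0) !mxE /c /=.
  move: (wedge q cg) wab' => wg wab1; field; exact: wab1.
apply/eqP/det0P; exists v.
  apply/eqP => v0; move: nz; rewrite -(fE z z0) -(gE z z0) v0 !mxE !mul0r addr0 eqxx //.
apply/rowP => j; rewrite vA [RHS]mxE fE ?x0 // gE ?x0 // H // subrr //.
Qed.

Definition hxn r (j : nat) : C := hx (r 0 (inord j)).
Definition hyn r (j : nat) : C := hy (r 0 (inord j)).

Definition tsum (t : nat -> nat -> C) (X Y : nat -> C) : C :=
  t 1%N 2%N * X 0%N * X 1%N * (Y 2%N * Y 3%N) + t 1%N 3%N * X 0%N * X 2%N * (Y 1%N * Y 3%N)
  + t 1%N 4%N * X 0%N * X 3%N * (Y 1%N * Y 2%N) + t 2%N 3%N * X 1%N * X 2%N * (Y 0%N * Y 3%N)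
  + t 2%N 4%N * X 1%N * X 3%N * (Y 0%N * Y 2%N) + t 3%N 4%N * X 2%N * X 3%N * (Y 0%N * Y 1%N).

Lemma TformE (k : kappas R) r : Tform q k t0 r = tsum (Tcoef q k t0) (hxn r) (hyn r).
Proof.
rewrite /Tform; move: (Tcoef q k t0) => T.
rewrite (eq_bigr (fun i : 'I_4 => \sum_(j < 4 | (i < j)%N) T i.+1 j.+1 * hxn r i * hxn r j *
   \prod_(l < 4 | (l != i) && (l != j)) hyn r l)); last first.
  move=> i _; apply: eq_bigr => j _; rewrite /hxn !inord_val; congr (_ * _).
  by apply: eq_bigr => l _; rewrite /hyn inord_val.
move: (hxn r) (hyn r) => X Y; rewrite /tsum.
rewrite !big_ord_recl big_ord0; do ![rewrite big_mkcond !big_ord_recl big_ord0 /=].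
by rewrite /bump /=; ring.
Qed.

Lemma thetas2 a b : thetas q [:: a; b] = theta q a * theta q b.
Proof. by rewrite /thetas big_cons big_seq1. Qed.

Section wedge_coefficients.
Variable kap : C.
Hypothesis kap0 : kap != 0.
Let k := Kappas kap kt k1 koo.
Let mu : C := - (kt * k1 * kap * koo)^-1.
Let wf i j := wedge q (t0 * kap / koo) (xval i) (xval j).
Let wg i j := wedge q (t0 * kap * koo) (xval i) (xval j).

Let theta_at (a b : C) : a = b -> theta q a = theta q b.
Proof. by move->. Qed.

Let theta_at_inv (a b : C) : b != 0 -> a = b^-1 -> theta q a = - b^-1 * theta q b.
Proof. by move=> b0 ->; exact: theta_inv. Qed.

Let nz := (kap0, t00, kt0, k10, koo0).

(** For each of the six pairs the theta arguments are those of T_ij, one of them inverted;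
    [theta_inv] turns every discrepancy into the one factor [mu]. The minus signs for 13 and 24
    agree with those of the Laplace expansion. *)
Lemma wedge12 : wg 0 1 * wf 2 3 = mu * Tcoef q k t0 1 2.
Proof.
rewrite /wg /wf /wedge /xval /= !thetas2.
rewrite (@theta_at (kt * t0 / (kt^-1 * t0)) (kt ^+ 2)); last by field; rewrite !nz.
rewrite (@theta_at (kt * t0 * (kt^-1 * t0) / (t0 * kap * koo)) (kap^-1 * koo^-1 * t0));
  last by field; rewrite !nz.
rewrite (@theta_at (k1 / k1^-1) (k1 ^+ 2)); last by field; rewrite !nz.
rewrite (@theta_at_inv (k1 * k1^-1 / (t0 * kap / koo)) (kap * koo^-1 * t0));
  [|by rewrite !mulf_neq0 ?invr_eq0|by field; rewrite !nz].
move: (theta q) => th; rewrite /mu; field; rewrite !nz //.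
Qed.
Lemma wedge13 : wg 0 2 * wf 1 3 = - (mu * Tcoef q k t0 1 3).
Proof.
rewrite /wg /wf /wedge /xval /= !thetas2.
rewrite (@theta_at (kt * t0 / k1) (kt * k1^-1 * t0)); last by field; rewrite !nz.
rewrite (@theta_at (kt * t0 * k1 / (t0 * kap * koo)) (kt * k1 * kap^-1 * koo^-1)); last by field; rewrite !nz.
rewrite (@theta_at (kt^-1 * t0 / k1^-1) (kt^-1 * k1 * t0)); last by field; rewrite !nz.
rewrite (@theta_at_inv (kt^-1 * t0 * k1^-1 / (t0 * kap / koo)) (kap * kt * k1 * koo^-1));
  [|by rewrite !mulf_neq0 ?invr_eq0|by field; rewrite !nz].
move: (theta q) => th; rewrite /mu; field; rewrite !nz //.
Qed.

Lemma wedge14 : wg 0 3 * wf 1 2 = mu * Tcoef q k t0 1 4.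
Proof.
rewrite /wg /wf /wedge /xval /= !thetas2.
rewrite (@theta_at (kt * t0 / k1^-1) (kt * k1 * t0)); last by field; rewrite !nz.
rewrite (@theta_at_inv (kt * t0 * k1^-1 / (t0 * kap * koo)) (kap * k1 * koo * kt^-1));
  [|by rewrite !mulf_neq0 ?invr_eq0|by field; rewrite !nz].
rewrite (@theta_at (kt^-1 * t0 / k1) (kt^-1 * k1^-1 * t0)); last by field; rewrite !nz.
rewrite (@theta_at (kt^-1 * t0 * k1 / (t0 * kap / koo)) (k1 * koo * kap^-1 * kt^-1)); last by field; rewrite !nz.
move: (theta q) => th; rewrite /mu; field; rewrite !nz //.
Qed.

Lemma wedge23 : wg 1 2 * wf 0 3 = mu * Tcoef q k t0 2 3.
Proof.
rewrite /wg /wf /wedge /xval /= !thetas2.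
rewrite (@theta_at (kt^-1 * t0 / k1) (kt^-1 * k1^-1 * t0)); last by field; rewrite !nz.
rewrite (@theta_at_inv (kt^-1 * t0 * k1 / (t0 * kap * koo)) (kap * kt * koo * k1^-1));
  [|by rewrite !mulf_neq0 ?invr_eq0|by field; rewrite !nz].
rewrite (@theta_at (kt * t0 / k1^-1) (kt * k1 * t0)); last by field; rewrite !nz.
rewrite (@theta_at (kt * t0 * k1^-1 / (t0 * kap / koo)) (kt * koo * kap^-1 * k1^-1)); last by field; rewrite !nz.
move: (theta q) => th; rewrite /mu; field; rewrite !nz //.
Qed.

Lemma wedge24 : wg 1 3 * wf 0 2 = - (mu * Tcoef q k t0 2 4).
Proof.
rewrite /wg /wf /wedge /xval /= !thetas2.
rewrite (@theta_at (kt^-1 * t0 / k1^-1) (kt^-1 * k1 * t0)); last by field; rewrite !nz.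
rewrite (@theta_at_inv (kt^-1 * t0 * k1^-1 / (t0 * kap * koo)) (kap * kt * k1 * koo));
  [|by rewrite !mulf_neq0 ?invr_eq0|by field; rewrite !nz].
rewrite (@theta_at (kt * t0 / k1) (kt * k1^-1 * t0)); last by field; rewrite !nz.
rewrite (@theta_at (kt * t0 * k1 / (t0 * kap / koo)) (kt * k1 * koo * kap^-1)); last by field; rewrite !nz.
move: (theta q) => th; rewrite /mu; field; rewrite !nz //.
Qed.

Lemma wedge34 : wg 2 3 * wf 0 1 = mu * Tcoef q k t0 3 4.
Proof.
rewrite /wg /wf /wedge /xval /= !thetas2.
rewrite (@theta_at (k1 / k1^-1) (k1 ^+ 2)); last by field; rewrite !nz.
rewrite (@theta_at_inv (k1 * k1^-1 / (t0 * kap * koo)) (kap * koo * t0));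
  [|by rewrite !mulf_neq0 ?invr_eq0|by field; rewrite !nz].
rewrite (@theta_at (kt * t0 / (kt^-1 * t0)) (kt ^+ 2)); last by field; rewrite !nz.
rewrite (@theta_at (kt * t0 * (kt^-1 * t0) / (t0 * kap / koo)) (kap^-1 * koo * t0)); last by field; rewrite !nz.
move: (theta q) => th; rewrite /mu; field; rewrite !nz //.
Qed.

Lemma dform_Tform r : dform (t0 * kap / koo) (t0 * kap * koo) (hxn r) (hyn r) xval =
  mu * Tform q k t0 r.
Proof.
rewrite TformE /dform /tsum.
have := wedge12; have := wedge13; have := wedge14.
have := wedge23; have := wedge24; have := wedge34.
rewrite /wf /wg; move: (wedge q (t0 * kap / koo)) (wedge q (t0 * kap * koo)) => f g.
move: (Tcoef q k t0) (hxn r) (hyn r) => t X Y h34 h24 h23 h14 h13 h12.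
rewrite !mulrDr.
have E u x y z w : mu * (u * x * y * (z * w)) = (mu * u) * (x * y * (z * w)) by ring.
have E' u x y z w : mu * (u * x * y * (z * w)) = - (- (mu * u)) * (x * y * (z * w)) by ring.
rewrite (E (t 1%N 2%N)) -h12 (E' (t 1%N 3%N)) -h13 (E (t 1%N 4%N)) -h14.
rewrite (E (t 2%N 3%N)) -h23 (E' (t 2%N 4%N)) -h24 (E (t 3%N 4%N)) -h34.
ring.
Qed.

End wedge_coefficients.

Lemma Tcoef_inv kap i j : Tcoef q (Kappas kap^-1 kt k1 koo) t0 i j = Tcoef q (Kappas kap kt k1 koo) t0 i j.
Proof.
have E a b a' b' : a = b' -> b = a' ->
    theta q a * theta q b = theta q a' * theta q b' by move=> -> ->; rewrite mulrC.
move: i j => [|[|[|[|i]]]] [|[|[|[|[|j]]]]] //=; rewrite ?thetas2 ?invrK;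
by [congr (_ * _ * _); apply: E; ring | congr (_ * _); apply: E; ring].
Qed.

Lemma Tform_inv kap r : Tform q (Kappas kap^-1 kt k1 koo) t0 r = Tform q (Kappas kap kt k1 koo) t0 r.
Proof. by rewrite !TformE /tsum !Tcoef_inv. Qed.

Lemma row_solution_exists kap r : kap != 0 ->
  Tform q (Kappas kap kt k1 koo) t0 r = 0 <->
  exists f g, row_solution kap r f g /\ nonzero_row f g.
Proof.
move=> kap0; have cf0 : t0 * kap / koo != 0 by rewrite !mulf_neq0 ?invr_eq0.
have cg0 : t0 * kap * koo != 0 by rewrite !mulf_neq0.
have mu0 : - (kt * k1 * kap * koo)^-1 != 0 by rewrite oppr_eq0 invr_eq0 !mulf_neq0.
have -> : Tform q (Kappas kap kt k1 koo) t0 r = 0 <->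
    dform (t0 * kap / koo) (t0 * kap * koo) (hxn r) (hyn r) xval = 0.
  rewrite dform_Tform //; split=> [->|/eqP]; first by rewrite mulr0.
  by rewrite mulf_eq0 (negPf mu0) /= => /eqP.
rewrite dform_eq0 //; last exact: xval_neq0.
split=> [[f [g [Hf Hg nz H]]]|[f [g [[Hf Hg H] nz]]]]; exists f, g.
  split; last exact: nz.
  split; [exact: Hf|exact: Hg|move=> j].
  by have := H j (ltn_ord j); rewrite /hyn /hxn inord_val.
split; [exact: Hf|exact: Hg|exact: nz|move=> j j4].
by have := H (inord j); rewrite inordK.
Qed.

Lemma tsum_scale t X Y X' Y' (l : nat -> C) (c : C) :
  (forall j, X' j = l j * (c * X j)) -> (forall j, Y' j = l j * Y j) ->
  tsum t X' Y' = c ^+ 2 * (l 0%N * l 1%N * l 2%N * l 3%N) * tsum t X Y.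
Proof. by move=> hX hY; rewrite /tsum !hX !hY; ring. Qed.

Lemma Tform_scale (k : kappas R) r c : c != 0 ->
  Tform q k t0 (map_mx (scaleP1 c) r) = 0 <-> Tform q k t0 r = 0.
Proof.
(* Infinity keeps the representative [1 : 0] under scaling, and c^-1 makes up for the factor c that
   its first coordinate does not receive. *)
move=> c0; pose l j : C := if r 0 (inord j) is Some _ then 1 else c^-1.
rewrite !TformE (@tsum_scale _ (hxn r) (hyn r) _ _ l c).
- have l0 j : l j != 0 by rewrite /l; case: (r 0 _) => [_|]; rewrite ?oner_neq0 ?invr_eq0.
  split=> [/eqP|->]; last by rewrite mulr0.
  by rewrite mulf_eq0 mulf_eq0 expf_eq0 (negPf c0) !mulf_eq0 !(negPf (l0 _)) /= => /eqP.
- by move=> j; rewrite /hxn /l mxE; case: (r 0 _) => [x|] /=; rewrite ?mul1r ?mulr1 ?mulVf.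
- by move=> j; rewrite /hyn /l mxE; case: (r 0 _) => [x|] /=; rewrite ?mul1r ?mulr0.
Qed.
End rows.

Section more_theta.
Context {R : realType}.
Local Notation C := (cplx R).
Variable q : C.
Hypotheses (q0 : q != 0) (q1 : nm q < 1).
Implicit Types (a b c z w : C) (f g : C -> C) (s : seq C).

Lemma theta_neq0_punctured a z : a != 0 -> z != 0 -> exists2 e : R, 0 < e &
  forall w, w != z -> nm (w - z) < e -> w != 0 /\ theta q (w / a) != 0.
Proof.
move=> a0 z0; have nz : 0 < nm z by rewrite nm_gt0.
have wn0 w : nm (w - z) < nm z -> w != 0.
  by apply: contraTneq => ->; rewrite sub0r nmN ltxx.
have za0 : z / a != 0 by rewrite mulf_neq0 ?invr_eq0.
have [za|nza] := pselect (qZ q (z / a)).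
  have [U [hU Uz HU]] := theta_factor q0 q1 a0 za.
  have [e e0 He] := analytic_neq0_near (hU z z0) Uz.
  exists (Num.min e (nm z)); first by rewrite lt_min e0.
  move=> w wz; rewrite lt_min => /andP[we /wn0 w0]; split=> //.
  by rewrite HU // mulf_neq0 ?subr_eq0 // He.
have tz : theta q (z / a) != 0 by apply/eqP => /(theta_eq0 q0 q1 za0).
have [e e0 He] := analytic_neq0_near (analytic_theta_scale q1 a0 z0) tz.
exists (Num.min e (nm z)); first by rewrite lt_min e0.
by move=> w wz; rewrite lt_min => /andP[we /wn0 w0]; split=> //; exact: He.
Qed.

(** The zeros are isolated, so points close enough to 1 but different from it avoid finitely many
    zero sets. *)
Lemma theta_generic s : (forall a, a \in s -> a != 0) ->
  exists2 w, w != 0 & forall a, a \in s -> theta q (w / a) != 0.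
Proof.
move=> s0; suff [e e0 He] : exists2 e : R, 0 < e & forall w, w != 1 -> nm (w - 1) < e ->
    w != 0 /\ forall a, a \in s -> theta q (w / a) != 0.
  have ne : nm ((e / 2)%:C%C : C) = e / 2.
    by apply: complexI; rewrite -nmE ger0_norm // ler0c divr_ge0 // ltW.
  have [||w0 Hw] := He (1 + (e / 2)%:C%C).
  - by rewrite -subr_eq0 addrAC subrr add0r -nm_gt0 ne divr_gt0.
  - by rewrite addrAC subrr add0r ne; lra.
  by exists (1 + (e / 2)%:C%C).
elim: s s0 => [|a s IH] s0.
  have [e e0 He] := theta_neq0_punctured (oner_neq0 C) (oner_neq0 C).
  by exists e => // w w1 we; have [w0 _] := He w w1 we.
have [|e e0 He] := IH; first by move=> b bs; apply: s0; rewrite inE bs orbT.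
have a0 : a != 0 by apply: s0; rewrite inE eqxx.
have [e' e0' He'] := theta_neq0_punctured a0 (oner_neq0 C).
exists (Num.min e e'); first by rewrite lt_min e0.
move=> w w1; rewrite lt_min => /andP[we we'].
have [w0 Hs] := He w w1 we; have [_ Ha] := He' w w1 we'.
by split=> // b; rewrite inE => /predU1P[->//|]; exact: Hs.
Qed.

Lemma qdistinct_neq0 s a : qdistinct q s -> a \in s -> a != 0.
Proof.
by elim: s => // d t IHt [d0 _ Ht]; rewrite inE => /predU1P[->//|]; exact: IHt.
Qed.

(** Dividing out n of the zeros leaves a function of constant multiplier, a monomial, and the
    remaining zero makes it vanish. *)
Lemma qper_many_zeros n c f s : c != 0 -> qdistinct q s -> size s = n.+1 -> qper q n c f ->
  (forall a, a \in s -> f a = 0) -> forall z, z != 0 -> f z = 0.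
Proof.
case: s => // a t c0 [a0 Ha dt] [st] Hf Hz z z0.
rewrite -st -(addn0 (size t)) in Hf.
have [|g [hg Eg] fg] := qper_factor q0 q1 c0 dt Hf.
  by move=> b bt; apply: Hz; rewrite inE bt orbT.
have [|k [m [_ Hk]]] := constant_multiplier q0 q1 hg (lam := c / \prod_(b <- t) - b).
  by move=> w w0; rewrite Eg // expr0 divr1.
suff k0 : k = 0 by rewrite fg // Hk // k0 mul0r mulr0.
have P0 : \prod_(b <- t) theta q (a / b) != 0.
  rewrite prodf_seq_neq0; apply/allP => b bt; apply/implyP => _.
  have b0 := qdistinct_neq0 dt bt; apply/eqP => /(theta_eq0 q0 q1 (mulf_neq0 a0 (invr_neq0 b0))).
  by rewrite -invf_div qZVE; exact: Ha.
have := Hz a (mem_head _ _); rewrite fg // Hk // => /eqP.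
by rewrite mulf_eq0 (negPf P0) mulf_eq0 (negPf (expfz_neq0 m a0)) orbF => /eqP.
Qed.
End more_theta.

(** * Determinants of two rows *)

Section connection_matrices.
Context {R : realType}.
Local Notation C := (cplx R).
Local Notation P1 := (one_point_compactification C).
Local Notation P1x4 := 'rV[P1]_4.

Lemma det2 (T : comPzRingType) (A : 'M[T]_2) : \det A = A 0 0 * A 1 1 - A 0 1 * A 1 0.
Proof.
rewrite (expand_det_row _ ord0) !big_ord_recl big_ord0 /cofactor !det_mx11 !mxE /= /bump /=.
rewrite expr0 expr1 mul1r mulN1r addr0 mulrN.
by congr (_ * A _ _ - A _ _ * A _ _); apply: val_inj.
Qed.

Lemma hxy_neq0 (p : P1) : (hx p != 0) || (hy p != 0).
Proof. by case: p => [z|] /=; rewrite oner_neq0 ?orbT. Qed.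

(** Both (a, b) and (c, d) are proportional to the homogeneous coordinates of p. *)
Lemma hxy_prop (p : P1) (a b c d : C) : hy p * a = hx p * b -> hy p * c = hx p * d ->
  a * d - b * c = 0.
Proof.
case: p => [z|] /=; first by rewrite !mul1r => -> ->; ring.
by rewrite !mul0r !mul1r => <- <-; ring.
Qed.

Lemma pi_spec (M : 'M[C]_2) i : \det M = 0 -> hy (piP1 M) * M i 0 = hx (piP1 M) * M i 1.
Proof.
rewrite det2 => d0; rewrite /piP1; case: ifPn => [/eqP/colP c1|c1].
  by rewrite /= mul0r mul1r; have := c1 i; rewrite !mxE => ->.
set S := [set p | _]; suff : S !=set0.
  move=> [p Sp]; have := @xgetPex _ 0 S (ex_intro _ p Sp); set x := xget 0 S.
  by rewrite /S /= => /colP/(_ i); rewrite !mxE mul1r.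
have two (j : 'I_2) : j = 0 \/ j = 1.
  by case: j => [[|[|//]] h]; [left|right]; apply: val_inj.
have [h|h] := eqVneq (M 0 1) 0; last first.
  exists (M 0 0 / M 0 1); apply/colP => j; rewrite !mxE.
  case: (two j) => ->; first by rewrite divfK.
  apply: (mulfI h); rewrite mulrA mulrCA divff // mulr1.
  by apply/eqP; rewrite -subr_eq0 -oppr_eq0 opprB (mulrC (M 0 1)) -d0; apply/eqP; ring.
have h1 : M 1 1 != 0.
  apply: contraNneq c1 => h1; apply/eqP/colP => j; rewrite !mxE.
  by case: (two j) => ->.
exists (M 1 0 / M 1 1); apply/colP => j; rewrite !mxE.
case: (two j) => ->; last by rewrite divfK.
move: d0; rewrite h mul0r subr0 mulr0 => /eqP; rewrite mulf_eq0 (negPf h1) orbF => /eqP ->.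
by [].
Qed.

Lemma pi_unique (M : 'M[C]_2) (p : P1) : M != 0 ->
  (forall i, hy p * M i 0 = hx p * M i 1) -> piP1 M = p.
Proof.
move=> M0 H; rewrite /piP1.
have colE (j : 'I_2) : col j M = 0 <-> forall i, M i j = 0.
  by split=> [/colP h i|h]; [have := h i; rewrite !mxE | apply/colP => i; rewrite !mxE].
have two (j : 'I_2) : j = 0 \/ j = 1.
  by case: j => [[|[|//]] h]; [left|right]; apply: val_inj.
case: p H => [z|] /= H.
  have c1 : col 1 M != 0.
    apply: contraNneq M0 => /colE c1; apply/eqP/matrixP => i j; rewrite mxE.
    by case: (two j) => ->; rewrite ?c1 //; have := H i; rewrite c1 mulr0 mul1r.
  rewrite (negPf c1); congr Some.
  set S := [set p | _]; have Sz : S z.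
    by apply/colP => i; rewrite !mxE; have := H i; rewrite mul1r.
  have /= := @xgetPex _ 0 S (ex_intro _ z Sz); set x := xget 0 S => Sx.
  have /eqP : (x - z) *: col 1 M = 0 by rewrite scalerBl -Sx -[X in _ - X]Sz subrr.
  by rewrite scaler_eq0 (negPf c1) orbF subr_eq0 => /eqP.
have -> : col 1 M = 0 by apply/colE => i; have := H i; rewrite mul0r mul1r.
by rewrite eqxx.
Qed.

Variables (q t0 kz kt k1 koo : C).
Hypotheses (q0 : q != 0) (q1 : nm q < 1).
Hypotheses (t00 : t0 != 0) (kz0 : kz != 0) (kt0 : kt != 0) (k10 : k1 != 0) (koo0 : koo != 0).
Let k := Kappas kz kt k1 koo.
Local Notation x := (xval t0 kt k1).
Hypothesis xdist : forall i j, (i < 4)%N -> (j < 4)%N -> i != j -> ~ qZ q (x i / x j).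
Hypothesis kzN : ~ qZ q (kz ^+ 2).
Hypothesis kooN : ~ qZ q (koo ^+ 2).
Implicit Types (f g : C -> C) (r : P1x4) (kap : C) (Cm : C -> 'M[C]_2).
Local Notation row_sol := (row_solution q t0 kt k1 koo).

Let x0 j : (j < 4)%N -> x j != 0 := xval_neq0 t00 kt0 k10 (j := j).

Definition capTheta z := thetas q [:: kt * z / t0; kt^-1 * z / t0; k1 * z; k1^-1 * z].

Lemma capThetaE z : capTheta z = \prod_(a <- [seq x j | j <- iota 0 4]) theta q (z / a).
Proof.
rewrite /capTheta /thetas !big_cons !big_nil /xval /=.
have e1 : kt * z / t0 = z / (kt^-1 * t0) by field; rewrite kt0 t00.
have e2 : kt^-1 * z / t0 = z / (kt * t0) by field; rewrite kt0 t00.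
have e3 : k1 * z = z / k1^-1 by rewrite invrK mulrC.
rewrite e1 e2 e3 (mulrC k1^-1 z); move: (theta q) => th; ring.
Qed.

(** This value is the multiplier of the determinant, so four zeros at the x_j account for the whole
    of it. *)
Lemma prod_x : \prod_(a <- [seq x j | j <- iota 0 4]) (- a) = t0 ^+ 2.
Proof. by rewrite !big_cons big_nil /xval /=; field; rewrite kt0 k10. Qed.

Lemma qdistinct_x (s : seq nat) : uniq s -> all (fun j => (j < 4)%N) s ->
  qdistinct q [seq x j | j <- s].
Proof.
elim: s => //= i s IH /andP[ins us] /andP[i4 s4]; split; [exact: x0| |exact: IH].
move=> a /mapP[j js ->]; have j4 : (j < 4)%N by move/allP: s4 => /(_ j js).
by apply: xdist => //; apply: contraNneq ins => <-.
Qed.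

Lemma iota4 j : (j \in iota 0 4) = (j < 4)%N.
Proof. by rewrite mem_iota. Qed.

Lemma det_capTheta f : qper q 4 (t0 ^+ 2) f -> (forall j, (j < 4)%N -> f (x j) = 0) ->
  exists c, forall z, z != 0 -> f z = c * capTheta z.
Proof.
move=> Hf Hz; have [||||c Hc] := @qper_theta_prod R q q0 q1 f [seq x j | j <- iota 0 4].
- exact: qdistinct_x.
- by rewrite prod_x expf_neq0.
- by rewrite prod_x.
- by move=> a /mapP[j]; rewrite iota4 => /Hz h ->.
- by exists c => z z0; rewrite Hc // capThetaE.
Qed.

Lemma det_wrong_multiplier c f : c != 0 -> qper q 4 c f -> ~ qZ q (c / t0 ^+ 2) ->
  (forall j, (j < 4)%N -> f (x j) = 0) -> forall z, z != 0 -> f z = 0.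
Proof.
move=> c0 Hf nc Hz; apply: (@qper_vanish R q q0 q1 c f [seq x j | j <- iota 0 4] c0) => //.
- exact: qdistinct_x.
- by move=> a /mapP[j]; rewrite iota4 => /Hz h ->.
- by rewrite prod_x.
Qed.

Lemma det_last_zero f j : (j < 4)%N -> qper q 4 (t0 ^+ 2) f ->
  (forall i, (i < 4)%N -> i != j -> f (x i) = 0) -> f (x j) = 0.
Proof.
move=> j4 Hf Hz.
have aux (l : seq nat) : uniq l -> all (fun i => (i < 4)%N && (i != j)) l -> size l = 3%N ->
    t0 ^+ 2 = \prod_(a <- x j :: [seq x i | i <- l]) (- a) -> f (x j) = 0.
  move=> ul al sl pl; apply: (@qper_last_zero R q q0 q1 (t0 ^+ 2) f [seq x i | i <- l] (x j)).
  - by rewrite expf_neq0.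
  - by apply: qdistinct_x => //; apply: sub_all al => i /andP[].
  - by rewrite size_map sl.
  - by move=> a /mapP[i /(allP al)/andP[i4 ij] ->]; exact: Hz.
  - exact: pl.
case: j j4 Hz aux => [|[|[|[|//]]]] _ _ aux;
  [apply: (aux [:: 1; 2; 3]%N)|apply: (aux [:: 0; 2; 3]%N)|apply: (aux [:: 0; 1; 3]%N)
  |apply: (aux [:: 0; 1; 2]%N)] => //;
  by rewrite -prod_x !big_cons big_nil; ring.
Qed.

Definition row_det f g f' g' z : C := f z * g' z - g z * f' z.

Lemma qper_row_det kap kap' r f g f' g' : kap != 0 -> kap' != 0 ->
  row_sol kap r f g -> row_sol kap' r f' g' ->
  qper q 4 (t0 ^+ 2 * (kap * kap')) (row_det f g f' g') /\
  forall j, (j < 4)%N -> row_det f g f' g' (x j) = 0.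
Proof.
move=> ka0 kb0 [Hf Hg H] [Hf' Hg' H']; split.
  have e1 : t0 * kap / koo * (t0 * kap' * koo) = t0 ^+ 2 * (kap * kap') by field.
  have e2 : t0 * kap * koo * (t0 * kap' / koo) = t0 ^+ 2 * (kap * kap') by field.
  have h1 := qperM Hf Hg'; have h2 := qperM Hg Hf'.
  by rewrite e1 in h1; rewrite e2 in h2; exact: (qperB h1 h2).
move=> j j4; apply: (@hxy_prop (r 0 (inord j))).
  by have := H (inord j); rewrite inordK.
by have := H' (inord j); rewrite inordK.
Qed.

Lemma row_det_capTheta kap r f g f' g' : kap != 0 ->
  row_sol kap r f g -> row_sol kap^-1 r f' g' ->
  exists c, forall z, z != 0 -> row_det f g f' g' z = c * capTheta z.
Proof.
move=> ka0 H H'; have ka0' : kap^-1 != 0 by rewrite invr_eq0.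
have [] := qper_row_det ka0 ka0' H H'; rewrite mulfV // mulr1; exact: det_capTheta.
Qed.

(** The determinant has multiplier t0^2 kap kap', while its four zeros at the x_j have product t0^2;
    a constant multiplier off q^Z is left. *)
Lemma row_det_wrong kap kap' r f g f' g' : kap != 0 -> kap' != 0 -> ~ qZ q (kap * kap') ->
  row_sol kap r f g -> row_sol kap' r f' g' ->
  forall z, z != 0 -> row_det f g f' g' z = 0.
Proof.
move=> ka0 kb0 nk H H'; have [h1 h2] := qper_row_det ka0 kb0 H H'.
apply: (det_wrong_multiplier _ h1 _ h2); first by rewrite !mulf_neq0.
by rewrite mulrAC divff ?expf_neq0 // mul1r.
Qed.

Lemma capTheta_neq0 : exists2 z, z != 0 & capTheta z != 0.
Proof.
have [|z z0 Hz] := @theta_generic R q q0 q1 [seq x j | j <- iota 0 4].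
  by move=> a /mapP[j]; rewrite iota4 => /x0 h ->.
exists z => //; rewrite capThetaE prodf_seq_neq0; apply/allP => a /Hz h.
by apply/implyP.
Qed.

End connection_matrices.

(** * Proportional rows *)

Section degenerate.
Context {R : realType}.
Local Notation C := (cplx R).
Variable q : C.
Hypotheses (q0 : q != 0) (q1 : nm q < 1).
Implicit Types (a b c d e z w : C) (f g F G : C -> C).

Definition vanishing f := forall z, z != 0 -> f z = 0.

(** theta(z / a) has isolated zeros only, across which the equality extends. *)
Lemma cancel_theta a F G : a != 0 -> analytic_star F -> analytic_star G ->
  (forall z, z != 0 -> theta q (z / a) * F z = theta q (z / a) * G z) ->
  forall z, z != 0 -> F z = G z.
Proof.
move=> a0 hF hG H z z0; have [e e0 He] := theta_neq0_punctured q0 q1 a0 z0.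
apply: (analytic_at_punctured (hF z z0) (hG z z0) e0) => w wz we.
by have [w0 tw] := He w wz we; apply: (mulfI tw); exact: H.
Qed.

Lemma qper2_factor c f : c != 0 -> qper q 2 c f -> ~ vanishing f ->
  exists a k, [/\ a != 0, k != 0 & forall z, z != 0 -> f z = k * (theta q (z / a) * theta q (z / (c / a)))].
Proof.
move=> c0 Hf nf; have [a a0 fa] := qper2_zero q0 q1 c0 Hf.
have [g Hg fg] := qper_div q0 q1 a0 c0 Hf fa.
have ca0 : - c / a != 0 by rewrite mulf_neq0 ?oppr_eq0 ?invr_eq0.
have [k Hk] := qper1_theta q0 q1 ca0 Hg.
have fE z : z != 0 -> f z = k * (theta q (z / a) * theta q (z / (c / a))).
  by move=> z0; rewrite fg // Hk // mulNr opprK mulrCA.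
exists a, k; split=> //; apply: contra_notN nf => /eqP k0 z z0.
by rewrite fE // k0 mul0r.
Qed.

Lemma qper2_mul_vanishing c d f g : c != 0 -> d != 0 -> qper q 2 c f -> qper q 2 d g ->
  vanishing (fun z => f z * g z) -> vanishing f \/ vanishing g.
Proof.
move=> c0 d0 Hf Hg H; have [|nf] := pselect (vanishing f); first by left.
have [|ng] := pselect (vanishing g); first by right.
have [a [k [a0 k0 fE]]] := qper2_factor c0 Hf nf.
have [b [l [b0 l0 gE]]] := qper2_factor d0 Hg ng.
have [|z z0 Hz] := @theta_generic R q q0 q1 [:: a; c / a; b; d / b].
  by move=> x; rewrite !inE => /or4P[] /eqP ->; rewrite ?mulf_neq0 ?invr_eq0.
exfalso; have := H z z0; rewrite fE // gE //; apply/eqP.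
have t1 : theta q (z / a) != 0 by apply: Hz; rewrite !inE eqxx.
have t2 : theta q (z / (c / a)) != 0 by apply: Hz; rewrite !inE eqxx ?orbT.
have t3 : theta q (z / b) != 0 by apply: Hz; rewrite !inE eqxx ?orbT.
have t4 : theta q (z / (d / b)) != 0 by apply: Hz; rewrite !inE eqxx ?orbT.
exact: (mulf_neq0 (mulf_neq0 k0 (mulf_neq0 t1 t2)) (mulf_neq0 l0 (mulf_neq0 t3 t4))).
Qed.

Lemma qper2_two_zeros c f a b : c != 0 -> a != 0 -> b != 0 -> ~ qZ q (b / a) ->
  qper q 2 c f -> f a = 0 -> f b = 0 -> ~ qZ q (c / (a * b)) -> vanishing f.
Proof.
move=> c0 a0 b0 ab Hf fa fb nc; apply: (@qper_vanish R q q0 q1 c f [:: a; b] c0 _ Hf).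
- by split=> // d; rewrite inE => /eqP ->.
- by move=> d; rewrite !inE => /orP[] /eqP ->.
- by rewrite big_cons big_seq1 mulrNN.
Qed.

Lemma wedge_nonvanishing c y : c != 0 -> y != 0 -> ~ vanishing (fun z => wedge q c z y).
Proof.
move=> c0 y0; have cy : c / y != 0 by rewrite mulf_neq0 ?invr_eq0.
have [|z z0 Hz] := @theta_generic R q q0 q1 [:: y; c / y].
  by move=> x; rewrite !inE => /orP[] /eqP ->.
have t1 : theta q (z / y) != 0 by apply: Hz; rewrite !inE eqxx.
have t2 : theta q (z * y / c) != 0.
  by have := Hz (c / y); rewrite !inE eqxx orbT invf_div mulrA; apply.
by move=> /(_ z z0) /eqP; apply/negP; exact: (mulf_neq0 (mulf_neq0 y0 t1) t2).
Qed.

Section with_points.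
Variables (x : nat -> C).
Hypothesis x0 : forall j, (j < 4)%N -> x j != 0.
Hypothesis xdist : forall i j, (i < 4)%N -> (j < 4)%N -> i != j -> ~ qZ q (x i / x j).

(** Two indices with p nonzero would give f and f' the same two zeros; the product of the zeros
    would then equal both c kap and c / kap modulo q^Z. So at most one condition is present, and a
    [wedge] satisfies it. *)
Lemma common_zero c kap f f' (p : nat -> C) : c != 0 -> kap != 0 -> ~ qZ q (kap ^+ 2) ->
  qper q 2 (c * kap) f -> qper q 2 (c * kap^-1) f' -> ~ vanishing f -> ~ vanishing f' ->
  (forall j, (j < 4)%N -> p j * f (x j) = 0) -> (forall j, (j < 4)%N -> p j * f' (x j) = 0) ->
  exists s, [/\ qper q 2 c s, ~ vanishing s & forall j, (j < 4)%N -> p j * s (x j) = 0].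
Proof.
move=> c0 ka0 nk Hf Hf' nf nf' H H'.
have [ck0 ck0'] : c * kap != 0 /\ c * kap^-1 != 0 by rewrite !mulf_neq0 ?invr_eq0.
have uniqj i j : (i < 4)%N -> (j < 4)%N -> p i != 0 -> p j != 0 -> i = j.
  move=> i4 j4 pi pj; apply/eqP; apply: contraT => ij; exfalso.
  have z0 h : (forall j, (j < 4)%N -> p j * h (x j) = 0) -> h (x i) = 0 /\ h (x j) = 0.
    move=> hh; split; apply/eqP; have /eqP := hh _ i4; have /eqP := hh _ j4;
    by rewrite !mulf_eq0 (negPf pi) (negPf pj).
  have [fi fj] := z0 _ H; have [fi' fj'] := z0 _ H'.
  have xij : ~ qZ q (x j / x i) by apply: xdist => //; rewrite eq_sym.
  have h1 : qZ q (c * kap / (x i * x j)).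
    have [//|n] := pselect (qZ q (c * kap / (x i * x j))).
    by exfalso; apply: nf; exact: (qper2_two_zeros ck0 (x0 i4) (x0 j4) xij Hf fi fj n).
  have h2 : qZ q (c * kap^-1 / (x i * x j)).
    have [//|n] := pselect (qZ q (c * kap^-1 / (x i * x j))).
    by exfalso; apply: nf'; exact: (qper2_two_zeros ck0' (x0 i4) (x0 j4) xij Hf' fi' fj' n).
  apply: nk; have := qZM q0 h1 (qZV h2); congr (qZ q _).
  by field; rewrite c0 ka0 x0 // x0.
have [[i i4 pi]|np] := pselect (exists2 i, (i < 4)%N & p i != 0).
  exists (fun z => wedge q c z (x i)); split.
  - exact: (qper_wedge q0 q1 c0 (x0 i4)).
  - exact: wedge_nonvanishing (x0 i4).
  - move=> j j4; have [->|pj] := eqVneq (p j) 0; first by rewrite mul0r.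
    by rewrite (uniqj j i j4 i4 pj pi) (wedgexx q0 q1) ?mulr0 ?x0.
exists (fun z => wedge q c z 1); split.
- exact: (qper_wedge q0 q1 c0 (oner_neq0 _)).
- exact: wedge_nonvanishing (oner_neq0 _).
- move=> j j4; have [->|pj] := eqVneq (p j) 0; first by rewrite mul0r.
  by exfalso; apply: np; exists j.
Qed.

(* If the two rows are proportional, they share a factor [(k th_e, gam)] whose
   multipliers are halfway between those of the rows. *)
Lemma degenerate_rows t0 koo kap f g f' g' (X Y : nat -> C) :
  t0 != 0 -> koo != 0 -> kap != 0 -> ~ qZ q (kap ^+ 2) -> ~ qZ q (koo ^+ 2) ->
  qper q 2 (t0 * kap / koo) f -> qper q 2 (t0 * kap * koo) g ->
  qper q 2 (t0 * kap^-1 / koo) f' -> qper q 2 (t0 * kap^-1 * koo) g' ->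
  ~ (vanishing f /\ vanishing g) -> ~ (vanishing f' /\ vanishing g') ->
  (forall j, (j < 4)%N -> Y j * f (x j) = X j * g (x j)) ->
  (forall j, (j < 4)%N -> Y j * f' (x j) = X j * g' (x j)) ->
  vanishing (fun z => f z * g' z - g z * f' z) ->
  exists f1 g1, [/\ qper q 2 (t0 / koo) f1, qper q 2 (t0 * koo) g1,
    ~ (vanishing f1 /\ vanishing g1) & forall j, (j < 4)%N -> Y j * f1 (x j) = X j * g1 (x j)].
Proof.
move=> t00 koo0 ka0 nkap nkoo Hf Hg Hf' Hg' nu nv H H' Hd.
have cf0 : t0 * kap / koo != 0 by rewrite !mulf_neq0 ?invr_eq0.
have cg0 : t0 * kap * koo != 0 by rewrite !mulf_neq0.
have cf0' : t0 * kap^-1 / koo != 0 by rewrite !mulf_neq0 ?invr_eq0.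
have cg0' : t0 * kap^-1 * koo != 0 by rewrite !mulf_neq0 ?invr_eq0.
have dE z : z != 0 -> f z * g' z = g z * f' z.
  by move=> z0; apply/eqP; rewrite -subr_eq0; apply/eqP; exact: Hd.
(* If a column vanishes in one row, it does so in both, and [common_zero] supplies the other entry
   of the new row. *)
have [zg|ng] := pselect (vanishing g).
  have nf : ~ vanishing f by move=> zf; apply: nu.
  have zg' : vanishing g'.
    have [] // := qper2_mul_vanishing cf0 cg0' Hf Hg'.
    by move=> z z0; rewrite dE // zg // mul0r.
  have nf' : ~ vanishing f' by move=> zf; apply: nv.
  have [|||||s [Hs ns Hp]] := @common_zero (t0 / koo) kap f f' Y _ ka0 nkap _ _ nf nf'.
  - by rewrite mulf_neq0 ?invr_eq0.
  - by rewrite mulrAC.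
  - by rewrite mulrAC.
  - by move=> j j4; rewrite H // zg ?mulr0 // x0.
  - by move=> j j4; rewrite H' // zg' ?mulr0 // x0.
  exists s, (fun _ => 0); split=> //.
  - by split=> [|z z0]; [exact: analytic_star_cst | rewrite mulr0].
  - by move=> [].
  - by move=> j j4; rewrite Hp // mulr0.
have [zf|nf] := pselect (vanishing f).
  have zf' : vanishing f'.
    have [] // := qper2_mul_vanishing cg0 cf0' Hg Hf'.
    by move=> z z0; rewrite -dE // zf // mul0r.
  have ng' : ~ vanishing g' by move=> zg; apply: nv.
  have [|||||s [Hs ns Hp]] := @common_zero (t0 * koo) kap g g' X _ ka0 nkap _ _ ng ng'.
  - by rewrite mulf_neq0.
  - by rewrite mulrAC.
  - by rewrite mulrAC.
  - by move=> j j4; rewrite -H // zf ?mulr0 // x0.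
  - by move=> j j4; rewrite -H' // zf' ?mulr0 // x0.
  exists (fun _ => 0), s; split=> //.
  - by split=> [|z z0]; [exact: analytic_star_cst | rewrite mulr0].
  - by move=> [].
  - by move=> j j4; rewrite Hp // mulr0.
have nf' : ~ vanishing f'.
  move=> zf'; have [] // := qper2_mul_vanishing cf0 cg0' Hf Hg'.
    by move=> z z0; rewrite dE // zf' // mulr0.
  by move=> zg'; apply: nv.
have dvd a c h : a != 0 -> c != 0 -> qper q 2 c h -> h a = 0 -> exists k, forall z, z != 0 ->
    h z = theta q (z / a) * (k * theta q (z / (c / a))).
  move=> a0 c0 Hh ha; have [h1 Hh1 hE] := qper_div q0 q1 a0 c0 Hh ha.
  have ca0 : - c / a != 0 by rewrite mulf_neq0 ?oppr_eq0 ?invr_eq0.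
  have [k Hk] := qper1_theta q0 q1 ca0 Hh1.
  by exists k => z z0; rewrite hE // Hk // mulNr opprK.
have an_th (a l : C) : a != 0 -> analytic_star (fun z => l * theta q (z / a)).
  by move=> a0; apply: analytic_starZ; exact: analytic_theta_scale.
have thx : theta q 1 = 0 by exact: theta1.
have kooN' : ~ qZ q (koo ^- 2) by rewrite qZVE.
(* A zero a of f is one of f' or of g. In the latter case theta(z / a) cancels from f and g; at the
   second zero b of f that of g is not reached, as b / b2 = koo^-2 is off q^Z, so f' vanishes at
   b. *)
have [e [e0 fe fe']] : exists e, [/\ e != 0, f e = 0 & f' e = 0].
  have [a a0 fa] := qper2_zero q0 q1 cf0 Hf.
  have := dE a a0; rewrite fa mul0r => /esym/eqP; rewrite mulf_eq0 => /orP[/eqP ga|/eqP fa'];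
    last by exists a.
  have [k fE] := dvd _ _ _ a0 cf0 Hf fa; have [l gE] := dvd _ _ _ a0 cg0 Hg ga.
  set b := t0 * kap / koo / a in fE; have b0 : b != 0 by rewrite mulf_neq0 ?invr_eq0.
  set b2 := t0 * kap * koo / a in gE; have b20 : b2 != 0 by rewrite mulf_neq0 ?invr_eq0.
  have l0 : l != 0.
    by apply: contra_notN ng => /eqP l0 z z0; rewrite gE // l0 mul0r mulr0.
  have eqs z : z != 0 -> k * theta q (z / b) * g' z = l * theta q (z / b2) * f' z.
    apply: (@cancel_theta a (fun z => k * theta q (z / b) * g' z)
       (fun z => l * theta q (z / b2) * f' z) a0).
    - exact: (analytic_starM (an_th b k b0) (proj1 Hg')).
    - exact: (analytic_starM (an_th b2 l b20) (proj1 Hf')).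
    - by move=> w w0; have := dE w w0; rewrite fE // gE //; move: (theta q) => th; rewrite !mulrA.
  have := eqs b b0; rewrite divff // thx mulr0 mul0r => /esym/eqP.
  rewrite mulf_eq0 => /orP[|/eqP fb']; last first.
    by exists b; split=> //; rewrite fE // divff // thx !mulr0.
  rewrite mulf_eq0 (negPf l0) /= => /eqP.
  have bb : b / b2 = koo ^- 2 by rewrite /b /b2; field; rewrite t00 ka0 koo0 a0.
  by rewrite bb => /(theta_eq0 q0 q1 (invr_neq0 (expf_neq0 2 koo0))).
have [k fE] := dvd _ _ _ e0 cf0 Hf fe; have [k' fE'] := dvd _ _ _ e0 cf0' Hf' fe'.
set b := t0 * kap / koo / e in fE; have b0 : b != 0 by rewrite mulf_neq0 ?invr_eq0.
set b' := t0 * kap^-1 / koo / e in fE'; have b0' : b' != 0 by rewrite mulf_neq0 ?invr_eq0.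
have bb : b / b' = kap ^+ 2 by rewrite /b /b'; field; rewrite t00 ka0 koo0 e0.
have k0 : k != 0 by apply: contra_notN nf => /eqP k0 z z0; rewrite fE // k0 mul0r mulr0.
have k0' : k' != 0 by apply: contra_notN nf' => /eqP h z z0; rewrite fE' // h mul0r mulr0.
have eqs z : z != 0 -> k * theta q (z / b) * g' z = k' * theta q (z / b') * g z.
  apply: (@cancel_theta e (fun z => k * theta q (z / b) * g' z)
     (fun z => k' * theta q (z / b') * g z) e0).
  - exact: (analytic_starM (an_th b k b0) (proj1 Hg')).
  - exact: (analytic_starM (an_th b' k' b0') (proj1 Hg)).
  - move=> w w0; have := dE w w0; rewrite fE // fE' //; move: (theta q) => th h.
    by rewrite !mulrA in h *; rewrite h; ring.
have thbb : theta q (b / b') != 0.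
  by apply/eqP; rewrite bb => /(theta_eq0 q0 q1 (expf_neq0 2 ka0)).
(* After theta(z / e) is cancelled, the second zeros b of f and b' of f' differ by kap^2, off q^Z,
   so the zero at b on the left must come from g. *)
have gb : g b = 0.
  have := eqs b b0; rewrite divff // thx mulr0 mul0r => /esym/eqP.
  by rewrite mulf_eq0 (negPf (mulf_neq0 k0' thbb)) /= => /eqP.
have [l gE] := dvd _ _ _ b0 cg0 Hg gb.
set d := t0 * kap * koo / b in gE.
have dE' : d = koo ^+ 2 * e by rewrite /d /b; field; rewrite t00 ka0 koo0 e0.
have d0 : d != 0 by rewrite mulf_neq0 ?invr_eq0.
have gE' z : z != 0 -> k * g' z = k' * theta q (z / b') * (l * theta q (z / d)).
  apply: (@cancel_theta b (fun z => k * g' z)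
    (fun z => k' * theta q (z / b') * (l * theta q (z / d))) b0).
  - exact: (analytic_starZ k (proj1 Hg')).
  - exact: (analytic_starM (an_th b' k' b0') (an_th d l d0)).
  - move=> w w0; have := eqs w w0; rewrite gE //; move: (theta q) => th h.
    have -> : th (w / b) * (k * g' w) = k * th (w / b) * g' w by ring.
    by rewrite h; ring.
(* The zero a is chosen so that a e = t0 / koo; since d = koo^2 e, also a d = t0 koo. The factor
   theta(z / a) is common to both new entries and does not affect their ratio. *)
pose a := t0 / (koo * e); have a0 : a != 0 by rewrite mulf_neq0 ?invr_eq0 ?mulf_neq0.
exists (fun z => k * (theta q (z / a) * theta q (z / e))),
  (fun z => l * (theta q (z / a) * theta q (z / d))); split.
- have := qperZ k (qperM (qper_theta q0 q1 a0) (qper_theta q0 q1 e0)).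
  by rewrite (_ : - a * - e = t0 / koo) //; rewrite /a; field; rewrite koo0 e0.
- have := qperZ l (qperM (qper_theta q0 q1 a0) (qper_theta q0 q1 d0)).
  by rewrite (_ : - a * - d = t0 * koo) //; rewrite dE' /a; field; rewrite koo0 e0.
- move=> [z1 _]; have [|z z0 Hz] := @theta_generic R q q0 q1 [:: a; e].
    by move=> y; rewrite !inE => /orP[] /eqP ->.
  have t1 : theta q (z / a) != 0 by apply: Hz; rewrite !inE eqxx.
  have t2 : theta q (z / e) != 0 by apply: Hz; rewrite !inE eqxx orbT.
  by have /eqP := z1 z z0; apply/negP; exact: (mulf_neq0 k0 (mulf_neq0 t1 t2)).
- move=> j j4; have xj := x0 j4.
  suff E : Y j * (k * theta q (x j / e)) = X j * (l * theta q (x j / d)).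
    move: E; move: (theta q) => th E.
    have -> : Y j * (k * (th (x j / a) * th (x j / e))) = th (x j / a) * (Y j * (k * th (x j / e))) by ring.
    by rewrite E; ring.
  (* Where theta(z / b) vanishes the first row says nothing, but the second one does, as b' is
     inequivalent to b. *)
  have [tb|tb] := eqVneq (theta q (x j / b)) 0; last first.
    have := H j j4; rewrite fE // gE //; move: tb; move: (theta q) => th tb h.
    by apply: (mulfI tb); move: h => h; apply: etrans (etrans _ h) _; ring.
  have tb' : theta q (x j / b') != 0.
    apply/eqP => tb'; apply: nkap; rewrite -bb.
    have h1 : qZ q (x j / b) by apply/(theta_eq0 q0 q1 _); rewrite ?mulf_neq0 ?invr_eq0.
    have h2 : qZ q (x j / b') by apply/(theta_eq0 q0 q1 _); rewrite ?mulf_neq0 ?invr_eq0.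
    by have := qZM q0 h2 (qZV h1); congr (qZ q _); field; rewrite b0 b0' xj.
  have := H' j j4; rewrite fE' // => h; apply: (mulfI (mulf_neq0 k0' tb')).
  have : k * (Y j * (theta q (x j / e) * (k' * theta q (x j / b')))) = X j * (k * g' (x j)).
    by rewrite h; ring.
  rewrite gE' //; move: (theta q) => th h'.
  by apply: etrans (etrans _ h') _; ring.
Qed.
End with_points.
End degenerate.

(** * Points of S^* and pairs of rows *)

Section monodromy.
Context {R : realType}.
Local Notation C := (cplx R).
Local Notation P1 := (one_point_compactification C).
Local Notation P1x4 := 'rV[P1]_4.
Variables (q t0 kz kt k1 koo : C).
Hypotheses (q0 : q != 0) (q1 : nm q < 1).
Hypotheses (t00 : t0 != 0) (kz0 : kz != 0) (kt0 : kt != 0) (k10 : k1 != 0) (koo0 : koo != 0).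
Let k := Kappas kz kt k1 koo.
Local Notation x := (xval t0 kt k1).
Hypothesis xdist : forall i j, (i < 4)%N -> (j < 4)%N -> i != j -> ~ qZ q (x i / x j).
Hypothesis kzN : ~ qZ q (kz ^+ 2).
Hypothesis kooN : ~ qZ q (koo ^+ 2).
Implicit Types (f g : C -> C) (r : P1x4) (kap : C) (Cm : C -> 'M[C]_2).
Local Notation row_sol := (row_solution q t0 kt k1 koo).
Local Notation Theta := (capTheta q t0 kt k1).

Let x0 j : (j < 4)%N -> x j != 0 := xval_neq0 t00 kt0 k10 (j := j).
Let kzV0 : kz^-1 != 0. Proof. by rewrite invr_eq0. Qed.

Lemma x_mem_neq0 y : y \in [seq x j | j <- iota 0 4] -> y != 0.
Proof. by move=> ys; have [i il ->] := mapP ys; apply: x0; rewrite -iota4. Qed.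

Lemma nonzero_rowP f g : nonzero_row f g <-> ~ (vanishing f /\ vanishing g).
Proof.
split=> [[z z0 h] [zf zg]|n]; first by move: h; rewrite zf // zg // eqxx.
have [//|nn] := pselect (nonzero_row f g); exfalso; apply: n.
by split=> z z0; apply/eqP; apply: contraT => h; exfalso; apply: nn; exists z; rewrite ?h ?orbT.
Qed.

Lemma ord_cond (P : nat -> Prop) : (forall j : 'I_4, P j) <-> forall j, (j < 4)%N -> P j.
Proof. by split=> H j; [move=> j4; exact: (H (Ordinal j4)) | exact: H]. Qed.

Lemma row_solB kap r f g f' g' (c : C) : row_sol kap r f g -> row_sol kap r f' g' ->
  row_sol kap r (fun z => f z - c * f' z) (fun z => g z - c * g' z).
Proof.
move=> [Hf Hg H] [Hf' Hg' H']; split.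
- exact: (qperB Hf (qperZ c Hf')).
- exact: (qperB Hg (qperZ c Hg')).
- by move=> j; rewrite !mulrBr H !(mulrCA _ c) H'.
Qed.

(* The common zeros of both rows would make the determinant vanish doubly. *)
Lemma rows_not_both_zero kap r f g f' g' (c : C) j : kap != 0 -> (j < 4)%N ->
  row_sol kap r f g -> row_sol kap^-1 r f' g' -> c != 0 ->
  (forall z, z != 0 -> row_det f g f' g' z = c * Theta z) ->
  ~ [/\ f (x j) = 0, g (x j) = 0, f' (x j) = 0 & g' (x j) = 0].
Proof.
move=> ka0 j4 H H' c0 dE [fj gj fj' gj'].
have kb0 : kap^-1 != 0 by rewrite invr_eq0.
have [_ dz] := qper_row_det koo0 ka0 kb0 H H'.
have [Hf Hg _] := H; have [Hf' Hg' _] := H'.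
have xj0 := x0 j4.
have [|a Ha fE] := qper_div q0 q1 xj0 _ Hf fj; first by rewrite !mulf_neq0 ?invr_eq0.
have [|b Hb gE] := qper_div q0 q1 xj0 _ Hg gj; first by rewrite !mulf_neq0 ?invr_eq0.
have [|a' Ha' fE'] := qper_div q0 q1 xj0 _ Hf' fj'; first by rewrite !mulf_neq0 ?invr_eq0.
have [|b' Hb' gE'] := qper_div q0 q1 xj0 _ Hg' gj'; first by rewrite !mulf_neq0 ?invr_eq0.
have h1 := qperM Ha Hb'; have h2 := qperM Hb Ha'.
have cE : - (t0 * kap / koo) / x j * (- (t0 * kap^-1 * koo) / x j) = t0 ^+ 2 / x j ^+ 2.
  by field; rewrite ka0 koo0 xj0.
have cE' : - (t0 * kap * koo) / x j * (- (t0 * kap^-1 / koo) / x j) = t0 ^+ 2 / x j ^+ 2.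
  by field; rewrite ka0 koo0 xj0.
rewrite cE in h1; rewrite cE' in h2.
have HD := qperB h1 h2.
have DE z : z != 0 -> row_det f g f' g' z =
    theta q (z / x j) * (theta q (z / x j) * (a z * b' z - b z * a' z)).
  by move=> z0; rewrite /row_det fE // gE // fE' // gE' //; move: (theta q) => th; ring.
(* With theta(z / x_j)^2 divided out, degree two remains, against zeros at the three other
   points. *)
have D0 : vanishing (fun z => a z * b' z - b z * a' z).
  pose l := [seq i <- iota 0 4 | i != j].
  apply: (@qper_many_zeros R q q0 q1 2 _ _ [seq x i | i <- l] _ _ _ HD).
  - by rewrite mulf_neq0 ?invr_eq0 ?expf_neq0.
  - apply: (qdistinct_x t00 kt0 k10 xdist); first by rewrite filter_uniq ?iota_uniq.
    by apply/allP => i; rewrite mem_filter iota4 => /andP[].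
  - rewrite size_map /l; move: j4 {xj0 fj gj fj' gj' a Ha fE b Hb gE a' Ha' fE' b' Hb' gE' h1 h2 cE cE' HD DE l}.
    by case: j => [|[|[|[|//]]]].
  - move=> y ys; have [i il ->] := mapP ys.
    have [ij i4] : i != j /\ (i < 4)%N by move: il; rewrite mem_filter iota4 => /andP[].
    have := dz i i4; rewrite DE ?x0 // => /eqP.
    have ti : theta q (x i / x j) != 0.
      by apply/eqP => /(theta_eq0 q0 q1 (mulf_neq0 (x0 i4) (invr_neq0 xj0))); exact: xdist.
    by rewrite mulf_eq0 (negPf ti) mulf_eq0 (negPf ti) /= => /eqP.
have [z z0 Tz] := capTheta_neq0 q0 q1 t00 kt0 k10.
have := dE z z0; rewrite DE // D0 // !mulr0 => /esym/eqP; apply/negP.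
exact: (mulf_neq0 c0 Tz).
Qed.

(** A row for kappa_0 = 1 has zero determinant against both rows, because kz and kz^-1 are off q^Z.
    Where Theta is nonzero the two rows are independent, so Cramer's rule makes the third vanish
    there. *)
Lemma hat_row_absurd r f g f' g' f1 g1 (c : C) :
  row_sol kz r f g -> row_sol kz^-1 r f' g' -> c != 0 ->
  (forall z, z != 0 -> row_det f g f' g' z = c * Theta z) ->
  row_sol 1 r f1 g1 -> ~ nonzero_row f1 g1.
Proof.
move=> H H' c0 dE H1.
have kzN1 : ~ qZ q kz by move=> h; apply: kzN; rewrite expr2; exact: qZM.
have kzN2 : ~ qZ q kz^-1 by rewrite qZVE.
have o0 : (1 : C) != 0 := oner_neq0 _.
have D1 : forall z, z != 0 -> row_det f g f1 g1 z = 0.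
  by apply: (row_det_wrong q0 q1 t00 kt0 k10 koo0 xdist kz0 o0 _ H H1); rewrite mulr1.
have D2 : forall z, z != 0 -> row_det f' g' f1 g1 z = 0.
  by apply: (row_det_wrong q0 q1 t00 kt0 k10 koo0 xdist kzV0 o0 _ H' H1); rewrite mulr1.
have key z : z != 0 -> Theta z != 0 -> f1 z = 0 /\ g1 z = 0.
  move=> z0 Tz; have e1 := D1 z z0; have e2 := D2 z z0; have e3 := dE z z0.
  have d0 : row_det f g f' g' z != 0 by rewrite e3; exact: (mulf_neq0 c0 Tz).
  rewrite /row_det in e1 e2 e3 d0; split; apply: (mulfI d0); rewrite mulr0.
    have -> : (f z * g' z - g z * f' z) * f1 z =
      f' z * (f z * g1 z - g z * f1 z) - f z * (f' z * g1 z - g' z * f1 z) by ring.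
    by rewrite e1 e2 !mulr0 subrr.
  have -> : (f z * g' z - g z * f' z) * g1 z =
      g' z * (f z * g1 z - g z * f1 z) - g z * (f' z * g1 z - g' z * f1 z) by ring.
  by rewrite e1 e2 !mulr0 subrr.
move=> /nonzero_rowP; apply.
have [Hf Hg _] := H1.
(* A function of degree two that is not identically 0 is nonzero at a generic point, which can be
   taken off the zeros of Theta. *)
have fin c1 h : c1 != 0 -> qper q 2 c1 h -> (forall z, z != 0 -> Theta z != 0 -> h z = 0) -> vanishing h.
  move=> c10 Hh hz; have [//|nh] := pselect (vanishing h).
  have [a [l [a0 l0 hE]]] := qper2_factor q0 q1 c10 Hh nh.
  have ca : c1 / a != 0 by rewrite mulf_neq0 ?invr_eq0.
  have [|z z0 Hz] := @theta_generic R q q0 q1 (a :: (c1 / a) :: [seq x j | j <- iota 0 4]).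
    move=> y; rewrite in_cons in_cons => /or3P[/eqP->|/eqP->|/x_mem_neq0] //.
  have Tz : Theta z != 0.
    rewrite (capThetaE _ _ t00 kt0) prodf_seq_neq0; apply/allP => y ys; apply/implyP => _.
    by apply: Hz; rewrite in_cons in_cons ys !orbT.
  have := hz z z0 Tz; rewrite hE // => /eqP.
  have t1 : theta q (z / a) != 0 by apply: Hz; rewrite !inE eqxx.
  have t2 : theta q (z / (c1 / a)) != 0 by apply: Hz; rewrite !inE eqxx orbT.
  by move/negP: (mulf_neq0 l0 (mulf_neq0 t1 t2)).
split.
- apply: (fin _ _ _ Hf); first by rewrite !mulf_neq0 ?invr_eq0.
  by move=> z z0 /(key z z0)[].
- apply: (fin _ _ _ Hg); first by rewrite !mulf_neq0 ?invr_eq0.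
  by move=> z z0 /(key z z0)[].
Qed.

Lemma TformP kap r : kap != 0 -> Tform q (Kappas kap kt k1 koo) t0 r = 0 <->
  exists f g, row_sol kap r f g /\ nonzero_row f g.
Proof. exact: row_solution_exists. Qed.

Lemma SstarP r : Sstar q k t0 r <-> Tform q k t0 r = 0 /\ Tform q (Kappas 1 kt k1 koo) t0 r <> 0.
Proof. by []. Qed.

Definition rows_ok r f g f' g' := [/\ row_sol kz r f g, row_sol kz^-1 r f' g' &
  exists2 c, c != 0 & forall z, z != 0 -> row_det f g f' g' z = c * Theta z].

Lemma rows_ok_Sstar r f g f' g' : rows_ok r f g f' g' -> Sstar q k t0 r.
Proof.
move=> [H H' [c c0 dE]]; apply/SstarP; split.
  apply/(TformP _ kz0); exists f, g; split=> //; apply/nonzero_rowP => -[zf zg].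
  have [z z0 Tz] := capTheta_neq0 q0 q1 t00 kt0 k10.
  have := dE z z0; rewrite /row_det zf // zg // !mul0r subrr => /esym/eqP.
  by move/negP: (mulf_neq0 c0 Tz).
move=> /(TformP _ (oner_neq0 _))[f1 [g1 [H1 n1]]].
exact: (hat_row_absurd H H' c0 dE H1 n1).
Qed.

(* the reason for removing the locus of hat kappa *)
Lemma Sstar_nondegenerate kap r f g f' g' : kap != 0 -> ~ qZ q (kap ^+ 2) ->
  Tform q (Kappas 1 kt k1 koo) t0 r <> 0 ->
  row_sol kap r f g -> row_sol kap^-1 r f' g' -> nonzero_row f g -> nonzero_row f' g' ->
  ~ (forall z, z != 0 -> row_det f g f' g' z = 0).
Proof.
move=> ka0 nka nT [Hf Hg H] [Hf' Hg' H'] /nonzero_rowP n1 /nonzero_rowP n2 D.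
have HH : forall j, (j < 4)%N -> hyn r j * f (x j) = hxn r j * g (x j).
  by apply/ord_cond => j; have := H j; rewrite /hyn /hxn inord_val.
have HH' : forall j, (j < 4)%N -> hyn r j * f' (x j) = hxn r j * g' (x j).
  by apply/ord_cond => j; have := H' j; rewrite /hyn /hxn inord_val.
have [f1 [g1 [Hf1 Hg1 n Hj]]] :=
  degenerate_rows q0 q1 x0 xdist t00 koo0 ka0 nka kooN Hf Hg Hf' Hg' n1 n2 HH HH' D.
apply: nT; apply/(TformP _ (oner_neq0 _)); exists f1, g1; split; last exact/nonzero_rowP.
split; rewrite ?mulr1 //; move=> j; have := Hj j (ltn_ord j).
by rewrite /hyn /hxn inord_val.
Qed.

Lemma Sstar_rows r : Sstar q k t0 r -> exists f g f' g', rows_ok r f g f' g'.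
Proof.
move=> /SstarP[T0 nT].
have [f [g [H n]]] := proj1 (TformP r kz0) T0.
have T0' : Tform q (Kappas kz^-1 kt k1 koo) t0 r = 0 by rewrite Tform_inv.
have [f' [g' [H' n']]] := proj1 (TformP r kzV0) T0'.
exists f, g, f', g'; split=> //.
have [c dE] := row_det_capTheta q0 q1 t00 kt0 k10 koo0 xdist kz0 H H'.
exists c => //; apply/eqP => c0.
apply: (Sstar_nondegenerate kz0 kzN nT H H' n n') => z z0.
by rewrite dE // c0 mul0r.
Qed.

End monodromy.

(** * The bijection P *)

Section bijection.
Context {R : realType}.
Local Notation C := (cplx R).
Local Notation P1 := (one_point_compactification C).
Local Notation P1x4 := 'rV[P1]_4.
Variables (q t0 kz kt k1 koo : C).
Hypotheses (q0 : q != 0) (q1 : nm q < 1).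
Hypotheses (t00 : t0 != 0) (kz0 : kz != 0) (kt0 : kt != 0) (k10 : k1 != 0) (koo0 : koo != 0).
Let k := Kappas kz kt k1 koo.
Local Notation x := (xval t0 kt k1).
Hypothesis xdist : forall i j, (i < 4)%N -> (j < 4)%N -> i != j -> ~ qZ q (x i / x j).
Hypothesis kzN : ~ qZ q (kz ^+ 2).
Hypothesis kooN : ~ qZ q (koo ^+ 2).
Implicit Types (f g : C -> C) (r : P1x4) (kap : C) (Cm : C -> 'M[C]_2).
Local Notation row_sol := (row_solution q t0 kt k1 koo).
Local Notation Theta := (capTheta q t0 kt k1).
Local Notation rows := (rows_ok q t0 kz kt k1 koo).

Let x0 j : (j < 4)%N -> x j != 0 := xval_neq0 t00 kt0 k10 (j := j).
Let kzV0 : kz^-1 != 0. Proof. by rewrite invr_eq0. Qed.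

Definition entry Cm i j : C -> C := fun z => Cm z i j.

Lemma ord2P (P : 'I_2 -> Prop) : P 0 -> P 1 -> forall i, P i.
Proof.
move=> P0 P1' [[|[|//]] lti].
  by rewrite (_ : Ordinal lti = 0) //; apply: val_inj.
by rewrite (_ : Ordinal lti = 1) //; apply: val_inj.
Qed.

Lemma sigma3_conj (a b : C) (M : 'M[C]_2) i j :
  (pow_sigma3 a *m M *m pow_sigma3 b) i j =
  (if i == 0 then a else a^-1) * M i j * (if j == 0 then b else b^-1).
Proof. by rewrite mul_mx_diag mxE mul_diag_mx !mxE. Qed.

Definition entry_mult (i j : 'I_2) : C :=
  t0 * (if i == 0 then kz else kz^-1) * (if j == 0 then koo^-1 else koo).

Lemma connection_matricesP Cm : connection_matrices q k t0 Cm <->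
  (forall i j, qper q 2 (entry_mult i j) (entry Cm i j)) /\
  exists2 c, c != 0 & forall z, z != 0 ->
    row_det (entry Cm 0 0) (entry Cm 0 1) (entry Cm 1 0) (entry Cm 1 1) z = c * Theta z.
Proof.
split.
  case=> anC mulC [c c0 dC]; split.
    move=> i j; split; first by move=> z z0; exact: (anC i j z z0).
    move=> z z0; rewrite /entry mulC // mxE sigma3_conj /entry_mult /= invrK.
    by move: (Cm z i j) => e; case: (i == 0); case: (j == 0); field; rewrite ?kz0 ?koo0 z0.
  by exists c => // z z0; rewrite -dC // det2.
case=> H [c c0 dC]; split.
- by move=> i j z z0; have [a _] := H i j; exact: a.
- move=> z z0; apply/matrixP => i j; have [_ m] := H i j.
  rewrite -[LHS]/(entry Cm i j (q * z)) m // mxE sigma3_conj /entry_mult /entry /= invrK.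
  by move: (Cm z i j) => e; case: (i == 0); case: (j == 0); field; rewrite ?kz0 ?koo0 z0.
- by exists c => // z z0; rewrite -dC // det2.
Qed.

Lemma capTheta_x j : (j < 4)%N -> Theta (x j) = 0.
Proof.
move=> j4; rewrite (capThetaE _ _ t00 kt0).
have xin : x j \in [seq x j | j <- iota 0 4] by apply: map_f; rewrite iota4.
by apply/eqP; rewrite prodf_seq_eq0; apply/hasP; exists (x j) => //=; rewrite divff ?x0 // theta1.
Qed.

Lemma rho_rows Cm : connection_matrices q k t0 Cm ->
  rows (rho k t0 Cm) (entry Cm 0 0) (entry Cm 0 1) (entry Cm 1 0) (entry Cm 1 1).
Proof.
move=> /connection_matricesP[H [c c0 dC]].
have D j : (j < 4)%N -> \det (Cm (x j)) = 0.
  move=> j4; have := dC (x j) (x0 j4); rewrite capTheta_x // mulr0 => <-.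
  by rewrite det2.
have pis (j : 'I_4) i : hy (rho k t0 Cm 0 j) * entry Cm i 0 (x j) = hx (rho k t0 Cm 0 j) * entry Cm i 1 (x j).
  by rewrite mxE; apply: pi_spec; exact: D.
split; last by exists c.
- by split; [exact: (H 0 0) | exact: (H 0 1) | move=> j; exact: pis].
- by split; [exact: (H 1 0) | exact: (H 1 1) | move=> j; exact: pis].
Qed.

Lemma rho_Sstar Cm : connection_matrices q k t0 Cm -> Sstar q k t0 (rho k t0 Cm).
Proof. by move=> /rho_rows H; exact: (rows_ok_Sstar q0 q1 t00 kz0 kt0 k10 koo0 xdist kzN H). Qed.

Definition mk_mx f g f' g' (z : C) : 'M[C]_2 :=
  \matrix_(i < 2, j < 2) if i == 0 then (if j == 0 then f z else g z)
                         else (if j == 0 then f' z else g' z).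

(** [rows_not_both_zero] makes the matrix nonzero at x_j, so that its two linear relations determine
    the point of P^1. *)
Lemma rows_connection r f g f' g' : rows r f g f' g' ->
  connection_matrices q k t0 (mk_mx f g f' g') /\ rho k t0 (mk_mx f g f' g') = r.
Proof.
move=> H; have [[Hf Hg Hj] [Hf' Hg' Hj'] [c c0 dC]] := H.
have [e00 e01 e10 e11] : [/\ entry (mk_mx f g f' g') 0 0 = f, entry (mk_mx f g f' g') 0 1 = g,
    entry (mk_mx f g f' g') 1 0 = f' & entry (mk_mx f g f' g') 1 1 = g'].
  by split; apply/funext => z; rewrite /entry mxE.
split.
  apply/connection_matricesP; split; last by exists c => //; rewrite e00 e01 e10 e11.
  by apply: ord2P; apply: ord2P; rewrite ?e00 ?e01 ?e10 ?e11.
apply/rowP => j; rewrite mxE; apply: pi_unique.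
  apply/eqP => M0.
  apply: (rows_not_both_zero q0 q1 t00 kt0 k10 koo0 xdist kz0 (ltn_ord j) (let: And3 a _ _ := H in a) (let: And3 _ a _ := H in a) c0 dC).
  have ee a b : mk_mx f g f' g' (x j) a b = 0 by move/matrixP: M0 => /(_ a b); rewrite [RHS]mxE.
  by split; [have := ee 0 0|have := ee 0 1|have := ee 1 0|have := ee 1 1]; rewrite mxE.
by apply: ord2P; rewrite !mxE /=; [exact: Hj | exact: Hj'].
Qed.

(* A combination of the two solutions has zero determinant against the other row,
   so it vanishes by nondegeneracy. *)
Lemma row_unique r kap f g F G f' g' : kap != 0 -> ~ qZ q (kap ^+ 2) ->
  Tform q (Kappas 1 kt k1 koo) t0 r <> 0 ->
  row_sol kap r f g -> row_sol kap r F G -> row_sol kap^-1 r f' g' ->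
  nonzero_row f g -> nonzero_row F G -> nonzero_row f' g' ->
  exists2 c, c != 0 & forall z, z != 0 -> F z = c * f z /\ G z = c * g z.
Proof.
move=> ka0 kN nT H K H' n m n'.
have [c dE] := row_det_capTheta q0 q1 t00 kt0 k10 koo0 xdist ka0 H H'.
have [d eE] := row_det_capTheta q0 q1 t00 kt0 k10 koo0 xdist ka0 K H'.
have c0 : c != 0.
  apply/eqP => c0; apply: (Sstar_nondegenerate q0 q1 t00 kt0 k10 koo0 xdist kooN ka0 kN nT H H' n n') => z z0.
  by rewrite dE // c0 mul0r.
have d0 : d != 0.
  apply/eqP => d0; apply: (Sstar_nondegenerate q0 q1 t00 kt0 k10 koo0 xdist kooN ka0 kN nT K H' m n') => z z0.
  by rewrite eE // d0 mul0r.
have L := row_solB (d / c) K H.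
have D z : z != 0 -> row_det (fun z => F z - d / c * f z) (fun z => G z - d / c * g z) f' g' z = 0.
  move=> z0; have e1 := dE z z0; have e2 := eE z z0; rewrite /row_det in e1 e2 *.
  have -> : (F z - d / c * f z) * g' z - (G z - d / c * g z) * f' z =
     (F z * g' z - G z * f' z) - d / c * (f z * g' z - g z * f' z) by ring.
  by rewrite e1 e2 mulrA divfK // subrr.
exists (d / c); first by rewrite mulf_neq0 ?invr_eq0.
have [[vf vg]|nv] := pselect (vanishing (fun z => F z - d / c * f z) /\ vanishing (fun z => G z - d / c * g z)).
  by move=> z z0; split; apply/eqP; rewrite -subr_eq0; apply/eqP; [exact: vf | exact: vg].
exfalso; apply: (Sstar_nondegenerate q0 q1 t00 kt0 k10 koo0 xdist kooN ka0 kN nT L H' _ n' D).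
exact/nonzero_rowP.
Qed.

Lemma rows_ok_nonzero r f g f' g' : rows r f g f' g' -> nonzero_row f g /\ nonzero_row f' g'.
Proof.
move=> [_ _ [c c0 dE]].
have [z z0 Tz] := capTheta_neq0 q0 q1 t00 kt0 k10.
have D : row_det f g f' g' z != 0 by rewrite dE //; exact: (mulf_neq0 c0 Tz).
split; exists z => //; move: D; rewrite /row_det; apply: contra_neqT; rewrite negb_or !negbK => /andP[/eqP-> /eqP->].
  by rewrite !mul0r subrr.
by rewrite !mulr0 subrr.
Qed.

(** The second row is a first row for kz^-1, so [row_unique] applies to each. *)
Lemma rows_unique r f g f' g' F G F' G' : rows r f g f' g' -> rows r F G F' G' ->
  exists c c', [/\ c != 0, c' != 0 &
   forall z, z != 0 -> [/\ F z = c * f z, G z = c * g z, F' z = c' * f' z & G' z = c' * g' z]].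
Proof.
move=> H K.
have [_ nT] := rows_ok_Sstar q0 q1 t00 kz0 kt0 k10 koo0 xdist kzN H.
have [n n'] := rows_ok_nonzero H; have [m m'] := rows_ok_nonzero K.
have [H1 H2 _] := H; have [K1 K2 _] := K.
have [c c0 E] := row_unique kz0 kzN nT H1 K1 H2 n m n'.
have H1' : row_sol kz^-1^-1 r f g by rewrite invrK.
have kzN' : ~ qZ q (kz^-1 ^+ 2) by rewrite exprVn qZVE.
have [c' c'0 E'] := row_unique kzV0 kzN' nT H2 K2 H1' n' m' n.
by exists c, c'; split=> // z z0; have [] := E z z0; have [] := E' z z0.
Qed.

End bijection.

(** * Diagonal equivalence and orbits *)

Section classes.
Context {R : realType}.
Local Notation C := (cplx R).
Local Notation P1 := (one_point_compactification C).
Local Notation P1x4 := 'rV[P1]_4.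
Local Notation orbit := Defs.orbit.
Variables (q t0 kz kt k1 koo : C).
Hypotheses (q0 : q != 0) (q1 : nm q < 1).
Hypotheses (t00 : t0 != 0) (kz0 : kz != 0) (kt0 : kt != 0) (k10 : k1 != 0) (koo0 : koo != 0).
Let k := Kappas kz kt k1 koo.
Local Notation x := (xval t0 kt k1).
Hypothesis xdist : forall i j, (i < 4)%N -> (j < 4)%N -> i != j -> ~ qZ q (x i / x j).
Hypothesis kzN : ~ qZ q (kz ^+ 2).
Hypothesis kooN : ~ qZ q (koo ^+ 2).
Implicit Types (f g : C -> C) (r : P1x4) (kap : C) (Cm : C -> 'M[C]_2).
Local Notation row_sol := (row_solution q t0 kt k1 koo).
Local Notation Theta := (capTheta q t0 kt k1).
Local Notation rows := (rows_ok q t0 kz kt k1 koo).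

Let x0 j : (j < 4)%N -> x j != 0 := xval_neq0 t00 kt0 k10 (j := j).
Lemma scaleP1K (c d : C) (p : P1) : scaleP1 c (scaleP1 d p) = scaleP1 (c * d) p.
Proof. by case: p => [z|] //=; rewrite mulrA. Qed.

Lemma scaleP1_1 (p : P1) : scaleP1 1 p = p.
Proof. by case: p => [z|] //=; rewrite mul1r. Qed.

Lemma scale_scale (c d : C) r :
  map_mx (scaleP1 c) (map_mx (scaleP1 d) r) = map_mx (scaleP1 (c * d)) r.
Proof. by apply/rowP => j; rewrite !mxE scaleP1K. Qed.

Lemma scale_1 r : map_mx (scaleP1 1) r = r.
Proof. by apply/rowP => j; rewrite !mxE scaleP1_1. Qed.

Lemma orbit_refl r : orbit r r.
Proof. by exists 1; [exact: oner_neq0 | rewrite scale_1]. Qed.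

Lemma orbit_scale (c : C) r : c != 0 -> orbit (map_mx (scaleP1 c) r) = orbit r.
Proof.
move=> c0; apply/seteqP; split=> s [d d0 ->].
  by exists (d * c); [rewrite mulf_neq0 | rewrite scale_scale].
by exists (d / c); [rewrite mulf_neq0 ?invr_eq0 | rewrite scale_scale divfK].
Qed.

Lemma orbit_eqP r s : orbit r = orbit s <-> exists2 c, c != 0 & s = map_mx (scaleP1 c) r.
Proof.
split=> [e|[c c0 ->]]; last by rewrite orbit_scale.
by have := orbit_refl s; rewrite -e.
Qed.

Definition diag_related Cm Cm' := exists d1 d2 : 'rV[C]_2,
  [/\ forall j, d1 0 j != 0, forall j, d2 0 j != 0
    & forall z, z != 0 -> Cm' z = diag_mx d1 *m Cm z *m diag_mx d2].

Lemma diag_conj (d1 d2 : 'rV[C]_2) (M : 'M[C]_2) i j :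
  (diag_mx d1 *m M *m diag_mx d2) i j = d1 0 i * M i j * d2 0 j.
Proof. by rewrite mul_mx_diag mxE mul_diag_mx !mxE. Qed.

Lemma diag_related_refl Cm : diag_related Cm Cm.
Proof.
exists (const_mx 1), (const_mx 1); split=> [j|j|z z0]; rewrite ?mxE ?oner_neq0 //.
by apply/matrixP => i j; rewrite diag_conj !mxE mul1r mulr1.
Qed.

Lemma diag_related_sym Cm Cm' : diag_related Cm Cm' -> diag_related Cm' Cm.
Proof.
move=> [d1 [d2 [h1 h2 e]]]; exists (map_mx GRing.inv d1), (map_mx GRing.inv d2).
split=> [j|j|z z0]; rewrite ?mxE ?invr_eq0 //.
apply/matrixP => i j; rewrite e // !diag_conj !mxE.
by move: (Cm z i j) => a; field; rewrite h1 h2.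
Qed.

Lemma diag_related_trans Cm Cm' Cm'' :
  diag_related Cm Cm' -> diag_related Cm' Cm'' -> diag_related Cm Cm''.
Proof.
move=> [d1 [d2 [h1 h2 e]]] [d1' [d2' [h1' h2' e']]].
exists (\row_j (d1' 0 j * d1 0 j)), (\row_j (d2' 0 j * d2 0 j)).
split=> [j|j|z z0]; rewrite ?mxE ?mulf_neq0 //.
apply/matrixP => i j; rewrite (e' _ z0) diag_conj (e _ z0) diag_conj [RHS]diag_conj !mxE;
  move: (d1' 0 i) (d1 0 i) (Cm z i j) (d2 0 j) (d2' 0 j) => a b m c d; ring.
Qed.

Lemma monodromy_class_eqP Cm Cm' : connection_matrices q k t0 Cm -> connection_matrices q k t0 Cm' ->
  monodromy_class q k t0 Cm = monodromy_class q k t0 Cm' <-> diag_related Cm Cm'.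
Proof.
move=> H H'; split=> [e|r].
  have : monodromy_class q k t0 Cm' Cm' by split=> //; exact: diag_related_refl.
  by rewrite -e => -[].
apply/seteqP; split=> D [HD rD]; split=> //.
  exact: (diag_related_trans (diag_related_sym r) rD).
exact: (diag_related_trans r rD).
Qed.

Lemma rho_diag_related Cm Cm' : connection_matrices q k t0 Cm -> connection_matrices q k t0 Cm' ->
  diag_related Cm Cm' -> exists2 c, c != 0 & rho k t0 Cm' = map_mx (scaleP1 c) (rho k t0 Cm).
Proof.
move=> H H' [d1 [d2 [h1 h2 e]]]; exists (d2 0 0 / d2 0 1); first by rewrite mulf_neq0 ?invr_eq0.
have [[_ _ HH] [_ _ HH'] _] := rho_rows q0 q1 t00 kz0 kt0 k10 koo0 H.
have K := rho_rows q0 q1 t00 kz0 kt0 k10 koo0 H'; have [K1 K2 [c c0 dC]] := K.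
apply/rowP => j; rewrite [LHS]mxE [RHS]mxE; apply: pi_unique.
  apply/eqP => M0.
  apply: (rows_not_both_zero q0 q1 t00 kt0 k10 koo0 xdist kz0 (ltn_ord j) K1 K2 c0 dC).
  have ee a b : entry Cm' a b (x j) = 0 by move/matrixP: M0 => /(_ a b); rewrite [RHS]mxE.
  by split; exact: ee.
have HHi i : hy (rho k t0 Cm 0 j) * Cm (x j) i 0 = hx (rho k t0 Cm 0 j) * Cm (x j) i 1.
  by move: i; apply: ord2P; [exact: HH | exact: HH'].
move=> i; rewrite -[xpoint k t0 j]/(x j) e ?x0 ?ltn_ord // !diag_conj.
move: (HHi i); case: (rho k t0 Cm 0 j) => [z|] /=.
  by rewrite !mul1r => ->; field; exact: h2.
by rewrite !mul0r mul1r mul1r => <-; rewrite mulr0 mul0r.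
Qed.

(** Scaling the first column by c realises the action of c on rho. *)
Lemma scale_connection Cm (c : C) : c != 0 -> connection_matrices q k t0 Cm ->
  exists2 Cm', connection_matrices q k t0 Cm' &
    diag_related Cm Cm' /\ rho k t0 Cm' = map_mx (scaleP1 c) (rho k t0 Cm).
Proof.
move=> c0 H; pose d2 : 'rV[C]_2 := \row_j if j == 0 then c else 1.
pose Cm' z := diag_mx (const_mx 1) *m Cm z *m diag_mx d2.
have d20 j : d2 0 j != 0 by rewrite mxE; case: ifP => _ //; exact: oner_neq0.
have rl : diag_related Cm Cm'.
  by exists (const_mx 1), d2; split=> // j; rewrite mxE oner_neq0.
have CE i j : entry Cm' i j = fun z => d2 0 j * entry Cm i j z.
  by apply/funext => z; rewrite /entry diag_conj mxE mul1r mulrC.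
have H' : connection_matrices q k t0 Cm'.
  have [a [d d0 b]] := proj1 (connection_matricesP q t0 kt k1 kz0 koo0 Cm) H.
  apply/(connection_matricesP q t0 kt k1 kz0 koo0); split.
    by move=> i j; rewrite CE; exact: (qperZ _ (a i j)).
  exists (c * d); first by rewrite mulf_neq0.
  by move=> z z0; rewrite -mulrA -b // /row_det !CE !mxE /=; ring.
exists Cm' => //; split=> //.
have [[_ _ HH] [_ _ HH'] _] := rho_rows q0 q1 t00 kz0 kt0 k10 koo0 H.
have [K1 K2 [l l0 dC]] := rho_rows q0 q1 t00 kz0 kt0 k10 koo0 H'.
apply/rowP => j; rewrite [LHS]mxE [RHS]mxE; apply: pi_unique.
  apply/eqP => M0.
  apply: (rows_not_both_zero q0 q1 t00 kt0 k10 koo0 xdist kz0 (ltn_ord j) K1 K2 l0 dC).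
  have ee a b : entry Cm' a b (x j) = 0 by move/matrixP: M0 => /(_ a b); rewrite [RHS]mxE.
  by split; exact: ee.
have HHi i : hy (rho k t0 Cm 0 j) * Cm (x j) i 0 = hx (rho k t0 Cm 0 j) * Cm (x j) i 1.
  by move: i; apply: ord2P; [exact: HH | exact: HH'].
move=> i; move: (rho k t0 Cm 0 j) (HHi i) => p.
rewrite -[xpoint k t0 j]/(x j) !diag_conj !mxE; case: p => [z|] /=.
  by rewrite !mul1r => ->; ring.
by rewrite !mul0r mul1r mul1r => <-; rewrite mul0r.
Qed.

Lemma related_of_rho Cm Cm' : connection_matrices q k t0 Cm -> connection_matrices q k t0 Cm' ->
  rho k t0 Cm' = rho k t0 Cm -> diag_related Cm Cm'.
Proof.
move=> H H' e.
have K := rho_rows q0 q1 t00 kz0 kt0 k10 koo0 H; have K' := rho_rows q0 q1 t00 kz0 kt0 k10 koo0 H'.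
rewrite e in K'.
have [c [c' [c0 c'0 E]]] := rows_unique q0 q1 t00 kz0 kt0 k10 koo0 xdist kzN kooN K K'.
exists (\row_j if j == 0 then c else c'), (const_mx 1); split=> [j|j|z z0].
- by rewrite mxE; case: ifP.
- by rewrite mxE oner_neq0.
have [e1 e2 e3 e4] := E z z0.
apply/matrixP => i j; rewrite diag_conj !mxE mulr1; move: i j.
by apply: ord2P; apply: ord2P.
Qed.

Implicit Types m : monodromy_manifold q k t0.

Lemma represents_exists m : exists Cm, represents m Cm.
Proof. by have /set_mem[Cm H e] := valP m; exists Cm. Qed.

Lemma Pmap_represents m Cm : represents m Cm -> Pmap m = orbit (rho k t0 Cm).
Proof.
move=> [H e]; apply/seteqP; split=> [s [Cm' [H' e'] os]|s os]; last by exists Cm.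
have r : diag_related Cm Cm' by apply/monodromy_class_eqP => //; rewrite -e -e'.
by move: os; have [c c0 ->] := rho_diag_related H H' r; rewrite orbit_scale.
Qed.

Lemma PmapP m : exists2 r, Sstar q k t0 r & Pmap m = orbit r.
Proof.
have [Cm H] := represents_exists m; exists (rho k t0 Cm); last exact: Pmap_represents.
by have [h _] := H; exact: (rho_Sstar q0 q1 t00 kz0 kt0 k10 koo0 xdist kzN h).
Qed.

(** Scaling a column makes the coordinates of the two representatives equal; the uniqueness of each
    row then provides the left diagonal factor. *)
Lemma Pmap_inj : injective (@Pmap R q k t0).
Proof.
move=> m m'; have [Cm H] := represents_exists m; have [Cm' H'] := represents_exists m'.
rewrite (Pmap_represents H) (Pmap_represents H') => /orbit_eqP[c c0 e].
have [h hm] := H; have [h' hm'] := H'.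
have [D hD [rD eD]] := scale_connection c0 h.
have r : diag_related D Cm' by apply: (related_of_rho hD h'); rewrite eD e.
apply: val_inj; rewrite /= -[LHS]/(set_val m) -[RHS]/(set_val m') hm hm'.
exact/monodromy_class_eqP/(diag_related_trans rD r).
Qed.

Lemma Pmap_surj r : Sstar q k t0 r -> exists m, Pmap m = orbit r.
Proof.
move=> /(Sstar_rows q0 q1 t00 kz0 kt0 k10 koo0 xdist kzN kooN)[f [g [f' [g' K]]]].
have [H e] := rows_connection q0 q1 t00 kz0 kt0 k10 koo0 xdist K.
have Hm : (monodromy_class q k t0 @` connection_matrices q k t0) (monodromy_class q k t0 (mk_mx f g f' g')).
  by exists (mk_mx f g f' g').
exists (SigSub (mem_set Hm) : monodromy_manifold q k t0).
by rewrite (@Pmap_represents _ (mk_mx f g f' g')) ?e.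
Qed.

Lemma Sstar_scale r (c : C) : c != 0 -> Sstar q k t0 r -> Sstar q k t0 (map_mx (scaleP1 c) r).
Proof.
move=> c0 /SstarP[a b]; apply/SstarP; split; first by apply/Tform_scale.
by move=> /(proj1 (Tform_scale _ _ _ _ c0)).
Qed.

End classes.

(** * Critical and fixed points *)

Section gradient.
Context {R : realType}.
Local Notation C := (cplx R).
Local Notation P1 := (one_point_compactification C).
Local Notation P1x4 := 'rV[P1]_4.
Local Notation orbit := Defs.orbit.
Variables (q t0 kz kt k1 koo : C).
Hypotheses (q0 : q != 0) (q1 : nm q < 1).
Hypotheses (t00 : t0 != 0) (kz0 : kz != 0) (kt0 : kt != 0) (k10 : k1 != 0) (koo0 : koo != 0).
Let k := Kappas kz kt k1 koo.
Local Notation x := (xval t0 kt k1).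
Hypothesis xdist : forall i j, (i < 4)%N -> (j < 4)%N -> i != j -> ~ qZ q (x i / x j).
Hypothesis kzN : ~ qZ q (kz ^+ 2).
Hypothesis kooN : ~ qZ q (koo ^+ 2).
Implicit Types (f g : C -> C) (r : P1x4) (kap : C) (Cm : C -> 'M[C]_2).
Local Notation row_sol := (row_solution q t0 kt k1 koo).
Local Notation Theta := (capTheta q t0 kt k1).
Local Notation rows := (rows_ok q t0 kz kt k1 koo).

Let x0 j : (j < 4)%N -> x j != 0 := xval_neq0 t00 kt0 k10 (j := j).
Definition upd r (i : 'I_4) (p : P1) : P1x4 := \row_j if j == i then p else r 0 j.

Lemma upd_id r i : upd r i (r 0 i) = r.
Proof. by apply/rowP => j; rewrite mxE; case: eqP => [->|]. Qed.

Lemma ord4P (P : 'I_4 -> Prop) : P (inord 0) -> P (inord 1) -> P (inord 2) -> P (inord 3) -> forall i, P i.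
Proof.
move=> P0' P1' P2 P3 i; rewrite -(inord_val i).
by case: i => [[|[|[|[|//]]]]].
Qed.

Lemma Tform_upd (kk : kappas R) r i p : Tform q kk t0 (upd r i p) =
  hy p * Tform q kk t0 (upd r i (Some 0)) + hx p * Tform q kk t0 (upd r i None).
Proof.
rewrite !TformE; move: (Tcoef q kk t0) => t; rewrite /tsum /hxn /hyn !mxE.
have E a b : (a < 4)%N -> (b < 4)%N -> (inord a == inord b :> 'I_4) = (a == b).
  by move=> a4 b4; rewrite -val_eqE /= !inordK.
by move: i; apply: ord4P; rewrite !E //=; ring.
Qed.

(** T is linear in the homogeneous coordinates of rho_i, and here both coefficients vanish: T = 0
    cannot be solved for rho_i. *)
Definition bad r i := forall p, Tform q k t0 (upd r i p) = 0.

(** The points 0 and infinity, fixed by the scaling action of C^*. *)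
Definition fixedP1 (p : P1) := hx p * hy p = 0.

Lemma hxy_inj (p p' : P1) (a b : C) : p != p' -> hy p * a = hx p * b -> hy p' * a = hx p' * b ->
  a = 0 /\ b = 0.
Proof.
case: p => [z|]; case: p' => [w|] //=; rewrite ?mul1r ?mul0r.
- move=> zw -> e; have : (z - w) * b = 0 by rewrite mulrBl e subrr.
  move/eqP; rewrite mulf_eq0 subr_eq0 => /orP[/eqP h|/eqP ->]; last by rewrite mulr0.
  by move: zw; rewrite h eqxx.
- by move=> _ -> <-; rewrite mulr0.
- by move=> _ <- ->; rewrite mulr0.
Qed.

(* Changing [rho_i] yields another first row, whose determinant against the second
   one still vanishes at [x i] because it vanishes at the three other points. *)
Lemma bad_row r f g f' g' i : rows r f g f' g' -> bad r i ->
  (f (x i) = 0 /\ g (x i) = 0) \/ (f' (x i) = 0 /\ g' (x i) = 0).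
Proof.
move=> H b; have [H1 H2 [c c0 dE]] := H.
have [_ nT] := rows_ok_Sstar q0 q1 t00 kz0 kt0 k10 koo0 xdist kzN H.
have [n n'] := rows_ok_nonzero q0 q1 t00 kt0 k10 H.
have [v0|v0] := pselect (f' (x i) = 0 /\ g' (x i) = 0); [by right | left].
have [p pr] : exists p, p != r 0 i.
  by case: (r 0 i) => [z|]; [exists None | exists (Some 0)].
have [F [G [K m]]] := proj1 (row_solution_exists q0 q1 t00 kt0 k10 koo0 (upd r i p) kz0) (b p).
have [K1 K2 K3] := K; have [h1 h2 h3] := H2.
have D : row_det F G f' g' (x i) = 0.
  apply: (det_last_zero q0 q1 t00 kt0 k10 xdist (ltn_ord i)).
    have h12 := qperM K1 h2; have h21 := qperM K2 h1.
    have e12 : t0 * kz / koo * (t0 / kz * koo) = t0 ^+ 2 by field; rewrite kz0 koo0.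
    have e21 : t0 * kz * koo * (t0 / kz / koo) = t0 ^+ 2 by field; rewrite kz0 koo0.
    rewrite e12 in h12; rewrite e21 in h21; exact: (qperB h12 h21).
  move=> j j4 ji; have := K3 (Ordinal j4); have := h3 (Ordinal j4).
  rewrite mxE ifN // => e1 e2.
  have := hxy_prop e2 e1; exact.
have e3 := h3 i.
(* The second row is nonzero at x i and has direction r_i, which the vanishing determinant imposes
   on (F, G). *)
have e4 : hy (r 0 i) * F (x i) = hx (r 0 i) * G (x i).
  move: v0 e3 D; rewrite /row_det; case: (r 0 i) => [z|] /=; rewrite ?mul1r ?mul0r.
    move=> v0 e; rewrite e mulrCA mulrA => D.
    have g0 : g' (x i) != 0 by apply/eqP => g0; apply: v0; rewrite e g0 mulr0.
    have : (F (x i) - z * G (x i)) * g' (x i) = 0 by rewrite mulrBl -{1}D; ring.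
    by move/eqP; rewrite mulf_eq0 (negPf g0) orbF subr_eq0 => /eqP.
  move=> v0 e; rewrite -e mulr0 sub0r => D.
  have f0 : f' (x i) != 0 by apply/eqP => f0; apply: v0; rewrite -e.
  by move/eqP: D; rewrite oppr_eq0 mulf_eq0 (negPf f0) orbF => /eqP.
(* Two distinct directions force F and G to vanish at x i; by uniqueness (F, G) is a multiple of the
   first row, which thus vanishes there. *)
have e5 : hy p * F (x i) = hx p * G (x i) by have := K3 i; rewrite mxE eqxx.
have [F0 G0] := hxy_inj pr e5 e4.
have K' : row_sol kz r F G.
  split=> // j; have := K3 j; rewrite mxE; case: eqP => [->|] //.
have [d d0 E] := row_unique q0 q1 t00 kt0 k10 koo0 xdist kooN kz0 kzN nT H1 K' H2 n m n'.
have [E1 E2] := E (x i) (x0 (ltn_ord i)).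
move: E1 E2; rewrite F0 G0 => /esym/eqP; rewrite mulf_eq0 (negPf d0) => /eqP-> /esym/eqP.
by rewrite mulf_eq0 (negPf d0) => /eqP->.
Qed.



(** Pigeonhole: since three zeros kill a function of degree two, only the two-two split survives in
    the applications. *)
Lemma split4 (P Q : nat -> Prop) : (forall j, (j < 4)%N -> P j \/ Q j) ->
  [\/ exists i j l, [/\ uniq [:: i; j; l], all (fun j => (j < 4)%N) [:: i; j; l], P i, P j & P l],
      exists i j l, [/\ uniq [:: i; j; l], all (fun j => (j < 4)%N) [:: i; j; l], Q i, Q j & Q l] |
      exists i j l m, [/\ uniq [:: i; j; l; m], all (fun j => (j < 4)%N) [:: i; j; l; m],
         P i /\ P j & Q l /\ Q m]].
Proof.
move=> H; have [] := H 0%N isT; have [] := H 1%N isT; have [] := H 2%N isT; have [] := H 3%N isT => h3 h2 h1 h0.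
- by constructor 1; exists 0%N, 1%N, 2%N.
- by constructor 1; exists 0%N, 1%N, 2%N.
- by constructor 1; exists 0%N, 1%N, 3%N.
- by constructor 3; exists 0%N, 1%N, 2%N, 3%N.
- by constructor 1; exists 0%N, 2%N, 3%N.
- by constructor 3; exists 0%N, 2%N, 1%N, 3%N.
- by constructor 3; exists 0%N, 3%N, 1%N, 2%N.
- by constructor 2; exists 1%N, 2%N, 3%N.
- by constructor 1; exists 1%N, 2%N, 3%N.
- by constructor 3; exists 1%N, 2%N, 0%N, 3%N.
- by constructor 3; exists 1%N, 3%N, 0%N, 2%N.
- by constructor 2; exists 0%N, 2%N, 3%N.
- by constructor 3; exists 2%N, 3%N, 0%N, 1%N.
- by constructor 2; exists 0%N, 1%N, 3%N.
- by constructor 2; exists 0%N, 1%N, 2%N.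
- by constructor 2; exists 0%N, 1%N, 2%N.
Qed.

Lemma three_zeros c f i j l : c != 0 -> uniq [:: i; j; l] -> all (fun j => (j < 4)%N) [:: i; j; l] ->
  qper q 2 c f -> f (x i) = 0 -> f (x j) = 0 -> f (x l) = 0 -> vanishing f.
Proof.
move=> c0 u a H fi fj fl.
apply: (qper_many_zeros q0 q1 c0 (qdistinct_x t00 kt0 k10 xdist u a) _ H); first by [].
by move=> y; rewrite /= !in_cons in_nil orbF => /or3P[]/eqP->.
Qed.

(** If neither function vanished, both multipliers would equal x_i x_j modulo q^Z. *)
Lemma two_zeros_pair c d f g i j : c != 0 -> d != 0 -> ~ qZ q (c / d) -> (i < 4)%N -> (j < 4)%N -> i != j ->
  qper q 2 c f -> qper q 2 d g -> f (x i) = 0 -> f (x j) = 0 -> g (x i) = 0 -> g (x j) = 0 ->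
  vanishing f \/ vanishing g.
Proof.
move=> c0 d0 cd i4 j4 ij Hf Hg fi fj gi gj.
have ji : ~ qZ q (x j / x i) by apply: xdist => //; rewrite eq_sym.
have [h|h] := pselect (qZ q (c / (x i * x j))); last first.
  by left; exact: (qper2_two_zeros q0 q1 c0 (x0 i4) (x0 j4) ji Hf fi fj h).
have [h'|h'] := pselect (qZ q (d / (x i * x j))); last first.
  by right; exact: (qper2_two_zeros q0 q1 d0 (x0 i4) (x0 j4) ji Hg gi gj h').
exfalso; apply: cd; have := qZM q0 h (qZV h').
have xi := x0 i4; have xj := x0 j4.
by have -> : c / (x i * x j) * (d / (x i * x j))^-1 = c / d by field; rewrite d0 xi xj.
Qed.

Definition split_rows f g f' g' :=
  (vanishing f /\ vanishing g') \/ (vanishing g /\ vanishing f').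

Lemma rows_vanishing r f g f' g' : rows r f g f' g' ->
  [/\ ~ (vanishing f /\ vanishing g), ~ (vanishing f' /\ vanishing g'),
     ~ (vanishing f /\ vanishing f') & ~ (vanishing g /\ vanishing g')].
Proof.
move=> [_ _ [c c0 dE]].
have [z z0 Tz] := capTheta_neq0 q0 q1 t00 kt0 k10.
have D : row_det f g f' g' z <> 0 by rewrite dE //; apply/eqP; exact: (mulf_neq0 c0 Tz).
by split=> -[a b]; apply: D; rewrite /row_det a // b // ?mul0r ?mulr0 subrr.
Qed.

Lemma rows_fixed r f g f' g' : rows r f g f' g' -> split_rows f g f' g' ->
  forall j, fixedP1 (r 0 j).
Proof.
move=> [H1 H2 [c c0 dE]] S j; have [_ _ h] := H1; have [_ _ h'] := H2.
apply/eqP; apply: contraT; rewrite mulf_eq0 negb_or => /andP[X0 Y0]; exfalso.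
apply: (rows_not_both_zero q0 q1 t00 kt0 k10 koo0 xdist kz0 (ltn_ord j) H1 H2 c0 dE).
have xj := x0 (ltn_ord j).
case: S (h j) (h' j) => -[-> // -> //]; rewrite mulr0.
  move=> /esym/eqP; rewrite mulf_eq0 (negPf X0) => /eqP->.
  by rewrite mulr0 => /eqP; rewrite mulf_eq0 (negPf Y0) => /eqP->.
move=> /eqP; rewrite mulf_eq0 (negPf Y0) => /eqP->.
by rewrite mulr0 => /esym/eqP; rewrite mulf_eq0 (negPf X0) => /eqP->.
Qed.

Let cf0 : t0 * kz / koo != 0. Proof. by rewrite !mulf_neq0 ?invr_eq0. Qed.
Let cg0 : t0 * kz * koo != 0. Proof. by rewrite !mulf_neq0. Qed.
Let cf'0 : t0 * kz^-1 / koo != 0. Proof. by rewrite !mulf_neq0 ?invr_eq0. Qed.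
Let cg'0 : t0 * kz^-1 * koo != 0. Proof. by rewrite !mulf_neq0 ?invr_eq0. Qed.

(** At each x_j one of the columns vanishes. Three zeros would kill a column and with it the
    determinant, so each column has two; as kz^2 is off q^Z, one of its entries is identically 0. *)
Lemma fixed_rows r f g f' g' : rows r f g f' g' -> (forall j, fixedP1 (r 0 j)) ->
  split_rows f g f' g'.
Proof.
move=> H F; have [n1 n2 n3 n4] := rows_vanishing H.
have [[Hf Hg h] [Hf' Hg' h'] _] := H.
have : forall j, (j < 4)%N -> (f (x j) = 0 /\ f' (x j) = 0) \/ (g (x j) = 0 /\ g' (x j) = 0).
  move=> j j4; have := h (Ordinal j4); have := h' (Ordinal j4); have := F (Ordinal j4).
  rewrite /fixedP1; case: (r 0 _) => [z|] /=; rewrite ?mulr1 ?mul1r ?mul0r.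
    by move=> -> -> ->; rewrite !mul0r; left.
  by move=> _ <- <-; right.
case/split4.
- case=> [i [j [l [u a [fi fi'] [fj fj'] [fl fl']]]]]; exfalso; apply: n3; split.
    exact: (three_zeros cf0 u a Hf fi fj fl).
  exact: (three_zeros cf'0 u a Hf' fi' fj' fl').
- case=> [i [j [l [u a [fi fi'] [fj fj'] [fl fl']]]]]; exfalso; apply: n4; split.
    exact: (three_zeros cg0 u a Hg fi fj fl).
  exact: (three_zeros cg'0 u a Hg' fi' fj' fl').
case=> [i [j [l [m [u a [[fi fi'] [fj fj']] [[gl gl'] [gm gm']]]]]]].
have /and5P[i4 j4 l4 m4 _] := a.
have [ij lm] : i != j /\ l != m.
  by move: u; rewrite /= !in_cons !in_nil !orbF !negb_or; case/and4P=> /and3P[? _ _] _ ? _.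
have e1 : t0 * kz / koo / (t0 * kz^-1 / koo) = kz ^+ 2 by field; rewrite t00 kz0 koo0.
have e2 : t0 * kz * koo / (t0 * kz^-1 * koo) = kz ^+ 2 by field; rewrite t00 kz0 koo0.
have A1 : vanishing f \/ vanishing f'.
  by apply: (two_zeros_pair cf0 cf'0 _ i4 j4 ij Hf Hf' fi fj fi' fj'); rewrite e1.
have A2 : vanishing g \/ vanishing g'.
  by apply: (two_zeros_pair cg0 cg'0 _ l4 m4 lm Hg Hg' gl gm gl' gm'); rewrite e2.
rewrite /split_rows; tauto.
Qed.

(** The count of [fixed_rows] with rows in place of columns: [bad_row] makes a row vanish at each
    x_j, and koo^2 off q^Z kills one entry of each row. *)
Lemma bad_fixed r : Sstar q k t0 r -> (forall i, bad r i) -> forall j, fixedP1 (r 0 j).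
Proof.
move=> S B; have [f [g [f' [g' H]]]] := Sstar_rows q0 q1 t00 kz0 kt0 k10 koo0 xdist kzN kooN S.
apply: (rows_fixed H); have [n1 n2 n3 n4] := rows_vanishing H.
have [[Hf Hg h] [Hf' Hg' h'] _] := H.
have : forall j, (j < 4)%N -> (f (x j) = 0 /\ g (x j) = 0) \/ (f' (x j) = 0 /\ g' (x j) = 0).
  by move=> j j4; exact: (bad_row H (B (Ordinal j4))).
case/split4.
- case=> [i [j [l [u a [fi gi] [fj gj] [fl gl]]]]]; exfalso; apply: n1; split.
    exact: (three_zeros cf0 u a Hf fi fj fl).
  exact: (three_zeros cg0 u a Hg gi gj gl).
- case=> [i [j [l [u a [fi gi] [fj gj] [fl gl]]]]]; exfalso; apply: n2; split.
    exact: (three_zeros cf'0 u a Hf' fi fj fl).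
  exact: (three_zeros cg'0 u a Hg' gi gj gl).
case=> [i [j [l [m [u a [[fi gi] [fj gj]] [[fl gl] [fm gm]]]]]]].
have /and5P[i4 j4 l4 m4 _] := a.
have [ij lm] : i != j /\ l != m.
  by move: u; rewrite /= !in_cons !in_nil !orbF !negb_or; case/and4P=> /and3P[? _ _] _ ? _.
have e1 : t0 * kz / koo / (t0 * kz * koo) = (koo ^+ 2)^-1 by field; rewrite t00 kz0 koo0.
have e2 : t0 * kz^-1 / koo / (t0 * kz^-1 * koo) = (koo ^+ 2)^-1 by field; rewrite t00 kz0 koo0.
have A1 : vanishing f \/ vanishing g.
  by apply: (two_zeros_pair cf0 cg0 _ i4 j4 ij Hf Hg fi fj gi gj); rewrite e1 qZVE.
have A2 : vanishing f' \/ vanishing g'.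
  by apply: (two_zeros_pair cf'0 cg'0 _ l4 m4 lm Hf' Hg' fl fm gl gm); rewrite e2 qZVE.
rewrite /split_rows; tauto.
Qed.

Lemma fixedP1_scale (c : C) (p : P1) : c != 0 -> fixedP1 (scaleP1 c p) <-> fixedP1 p.
Proof.
move=> c0; case: p => [z|] //; rewrite /fixedP1 /= !mulr1; split=> [/eqP|->]; last by rewrite mulr0.
by rewrite mulf_eq0 (negPf c0) => /eqP.
Qed.

(* If [rho_i] were the only coordinate outside {0, oo}, scaling would make T vanish
   at two values of [rho_i], hence at all of them. *)
Lemma good_index r : Sstar q k t0 r -> ~ (forall j, fixedP1 (r 0 j)) ->
  exists j i, [/\ i != j, ~ fixedP1 (r 0 j) & ~ bad r i].
Proof.
move=> S N.
have [i Bi] : exists i, ~ bad r i by apply/existsNP => h; apply: N; exact: bad_fixed.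
have [j Fj] : exists j, ~ fixedP1 (r 0 j) by apply/existsNP.
have [[j' [ij' Fj']]|A] := pselect (exists j, i != j /\ ~ fixedP1 (r 0 j)); first by exists j', i.
exfalso; have O l : i != l -> fixedP1 (r 0 l) by move=> il; apply: contrapT => h; apply: A; exists l.
have ij : i = j by apply/eqP; apply: contraT => /O.
apply: Bi => p; rewrite -ij in Fj.
have two0 : (2 : C) != 0 by rewrite pnatr_eq0.
have [T0 _] := S; have T2 : Tform q k t0 (map_mx (scaleP1 2) r) = 0 by apply/Tform_scale.
have e : map_mx (scaleP1 2) r = upd r i (scaleP1 2 (r 0 i)).
  apply/rowP => l; rewrite !mxE; case: eqP => [->//|/eqP li].
  have : fixedP1 (r 0 l) by apply: O; rewrite eq_sym.
  by rewrite /fixedP1; case: (r 0 l) => [z|] //=; rewrite mulr1 => ->; rewrite mulr0.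
rewrite e Tform_upd in T2; rewrite /Szero /= -(upd_id r i) Tform_upd in T0.
rewrite Tform_upd; move: (Tform _ _ _ _) (Tform _ _ _ _) T0 T2 => a b.
move: Fj; rewrite /fixedP1; case: (r 0 i) => [z|] /=; last by rewrite mulr0.
rewrite mulr1 !mul1r => /eqP z0 e1 e2.
have a0 : a = 0.
  have -> : a = ((b + 2 * z * a) - (b + z * a)) / z by field.
  by rewrite e1 e2 subrr mul0r.
by move: e1; rewrite a0 !mulr0 !addr0 => ->; rewrite mulr0.
Qed.

Implicit Types m : monodromy_manifold q k t0.

Lemma MsingP m r : Pmap m = orbit r -> Msing q k t0 m <-> forall j, fixedP1 (r 0 j).
Proof.
move=> e.
have tr Cm : represents m Cm -> (forall j, fixedP1 (rho k t0 Cm 0 j)) <-> forall j, fixedP1 (r 0 j).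
  move=> H; move: e; rewrite (Pmap_represents q0 q1 t00 kz0 kt0 k10 koo0 xdist H) => /orbit_eqP[c c0 ->].
  have e j : map_mx (scaleP1 c) (rho k t0 Cm) 0 j = scaleP1 c (rho k t0 Cm 0 j) by rewrite [LHS]mxE.
  by split=> h j; have := h j; rewrite e => /(fixedP1_scale _ c0).
split.
  case=> Cm H D; apply/(tr Cm H); have [h _] := H.
  apply: (rows_fixed (rho_rows q0 q1 t00 kz0 kt0 k10 koo0 h)).
  case: D => D; [right|left]; split=> z z0.
  - by have /is_diag_mxP := D z z0; exact.
  - by have /is_diag_mxP := D z z0; exact.
  - exact: D.
  - exact: D.
have [Cm H] := represents_exists m.
move=> /(tr Cm H) F; exists Cm => //; have [h _] := H.
case: (fixed_rows (rho_rows q0 q1 t00 kz0 kt0 k10 koo0 h) F) => -[v1 v2]; [right|left].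
  by move=> z i z0; move: i; apply: ord2P; [exact: v1 | exact: v2].
move=> z z0; apply/is_diag_mxP; apply: ord2P; apply: ord2P => //= _; [exact: v1 | exact: v2].
Qed.

End gradient.

(** * Non-splitting conditions and zeros of the T_ij *)

Section splitting.
Context {R : realType}.
Local Notation C := (cplx R).
Local Notation P1 := (one_point_compactification C).
Local Notation P1x4 := 'rV[P1]_4.
Local Notation orbit := Defs.orbit.
Variables (q t0 kz kt k1 koo : C).
Hypotheses (q0 : q != 0) (q1 : nm q < 1).
Hypotheses (t00 : t0 != 0) (kz0 : kz != 0) (kt0 : kt != 0) (k10 : k1 != 0) (koo0 : koo != 0).
Let k := Kappas kz kt k1 koo.
Local Notation x := (xval t0 kt k1).
Hypothesis nonres : nonresonant q k t0.

Lemma mulqZP (a y : C) : a != 0 -> mulqZ a q y <-> qZ q (y / a).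
Proof.
move=> a0; split=> [[z zq <-]|h]; first by rewrite mulrC mulrA mulVf // mul1r.
by exists (y / a) => //; rewrite mulrC divfK.
Qed.

Lemma nonres_squares : [/\ ~ qZ q (kz ^+ 2), ~ qZ q (kt ^+ 2), ~ qZ q (k1 ^+ 2) & ~ qZ q (koo ^+ 2)].
Proof. by case: nonres. Qed.

Lemma nonres_products : [/\ ~ qZ q (kt * k1 * t0), ~ qZ q (kt^-1 * k1^-1 * t0),
  ~ qZ q (kt * k1^-1 * t0) & ~ qZ q (kt^-1 * k1 * t0)].
Proof.
have [_ h] := nonres.
have p1 : (1 : int) \in pm1 by []; have m1 : (-1 : int) \in pm1 by [].
have [a b] := h _ p1; have [c d] := h _ m1.
rewrite /= in a b c d.
split=> H; [apply: c|apply: a|apply: d|apply: b]; apply/(mulqZP _ t00); rewrite -qZVE.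
- by rewrite (_ : _^-1 = kt * k1 * t0) //; rewrite exprN1; field; rewrite t00 kt0 k10.
- by rewrite (_ : _^-1 = kt^-1 * k1^-1 * t0) //; rewrite expr1z; field; rewrite t00 kt0 k10.
- by rewrite (_ : _^-1 = kt * k1^-1 * t0) //; rewrite exprN1; field; rewrite t00 kt0 k10.
- by rewrite (_ : _^-1 = kt^-1 * k1 * t0) //; rewrite expr1z; field; rewrite t00 kt0 k10.
Qed.

(** The six ratios of the x_j are kt^2, k1^2 and the four products in the non-resonance conditions
    that involve t0. *)
Lemma nonres_xdist i j : (i < 4)%N -> (j < 4)%N -> i != j -> ~ qZ q (x i / x j).
Proof.
have [_ h1 h2 _] := nonres_squares; have [h3 h4 h5 h6] := nonres_products.
have W : forall a b, (a < b)%N -> (b < 4)%N -> ~ qZ q (x a / x b).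
  move=> [|[|[|[|a]]]] [|[|[|[|b]]]] //= _ _ H.
  - by apply: h1; rewrite (_ : kt ^+ 2 = kt * t0 / (kt^-1 * t0)) //; field; rewrite t00 kt0.
  - by apply: h5; rewrite (_ : _ * t0 = kt * t0 / k1) //; field.
  - by apply: h3; rewrite (_ : _ * t0 = kt * t0 / k1^-1) //; field.
  - by apply: h4; rewrite (_ : _ * t0 = kt^-1 * t0 / k1) //; field; rewrite kt0 k10.
  - by apply: h6; rewrite (_ : _ * t0 = kt^-1 * t0 / k1^-1) //; field; rewrite kt0 k10.
  - by apply: h2; rewrite (_ : _ ^+ 2 = k1 / k1^-1) //; field.
move=> i4 j4; rewrite neq_ltn => /orP[ij|ji]; first exact: W.
by rewrite -qZVE invf_div; apply: W.
Qed.

(** Indices start at 0 here, hence the successors in the arguments of [Tcoef]. *)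
Definition pairs : seq (nat * nat) := [:: (0, 1); (0, 2); (0, 3); (1, 2); (1, 3); (2, 3)]%N.

Lemma pairsP (P : nat * nat -> Prop) : P (0, 1)%N -> P (0, 2)%N -> P (0, 3)%N -> P (1, 2)%N ->
  P (1, 3)%N -> P (2, 3)%N -> forall p, p \in pairs -> P p.
Proof.
move=> ? ? ? ? ? ? p; rewrite !in_cons in_nil orbF.
by move=> /orP[/eqP->|/or4P[/eqP->|/eqP->|/eqP->|/orP[]/eqP->]].
Qed.

(* Every T_ij is, up to a nonzero factor free of kappa_0, equal to
   theta (kappa_0 s) theta (kappa_0^-1 s) for this s. *)
Definition pair_arg (p : nat * nat) : C :=
  match p with
  | (0%N, 1%N) => koo^-1 * t0
  | (0%N, 2%N) => kt * k1 * koo^-1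
  | (0%N, 3%N) => k1 * koo * kt^-1
  | (1%N, 2%N) => kt * koo * k1^-1
  | (1%N, 3%N) => kt * k1 * koo
  | _ => koo * t0
  end.

Let th0 a : a != 0 -> ~ qZ q a -> theta q a != 0.
Proof. by move=> a0 h; apply/eqP => /(theta_eq0 q0 q1 a0). Qed.

Lemma Tcoef_split p : p \in pairs -> exists2 w, w != 0 & forall kap, kap != 0 ->
  Tcoef q (Kappas kap kt k1 koo) t0 p.1.+1 p.2.+1 =
  w * (theta q (kap * pair_arg p) * theta q (kap^-1 * pair_arg p)).
Proof.
have [_ h1 h2 _] := nonres_squares; have [h3 h4 h5 h6] := nonres_products.
have a1 := th0 (expf_neq0 2 kt0) h1; have a2 := th0 (expf_neq0 2 k10) h2.
have nz a b c : a != 0 -> b != 0 -> c != 0 -> a * b * c != 0 :> C.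
  by move=> a0 b0 c0; exact: (mulf_neq0 (mulf_neq0 a0 b0) c0).
have ktV : kt^-1 != 0 by rewrite invr_eq0.
have k1V : k1^-1 != 0 by rewrite invr_eq0.
have a3 := th0 (nz _ _ _ kt0 k10 t00) h3; have a4 := th0 (nz _ _ _ ktV k1V t00) h4.
have a5 := th0 (nz _ _ _ kt0 k1V t00) h5; have a6 := th0 (nz _ _ _ ktV k10 t00) h6.
have oo2 := expf_neq0 2 koo0; have t2 := expf_neq0 2 kt0; have o2 := expf_neq0 2 k10.
move: p; apply: pairsP.
- exists (theta q (kt ^+ 2) * theta q (k1 ^+ 2) * koo ^+ 2); first exact: nz.
  move=> kap ka0; rewrite /Tcoef !thetas2 /pair_arg /= !mulrA.
  by move: (theta q) => th; ring.
- exists (- (theta q (kt * k1^-1 * t0) * theta q (kt^-1 * k1 * t0) * koo ^+ 2)).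
    by rewrite oppr_eq0; exact: nz.
  move=> kap ka0; rewrite /Tcoef !thetas2 /pair_arg /=.
  rewrite (_ : kt * k1 * kap^-1 * koo^-1 = kap^-1 * (kt * k1 * koo^-1)); last by ring.
  rewrite (_ : kap * kt * k1 * koo^-1 = kap * (kt * k1 * koo^-1)); last by ring.
  by move: (theta q) => th; ring.
- exists (theta q (kt * k1 * t0) * theta q (kt^-1 * k1^-1 * t0) * kt ^+ 2); first exact: nz.
  move=> kap ka0; rewrite /Tcoef !thetas2 /pair_arg /=.
  rewrite (_ : k1 * koo * kap^-1 * kt^-1 = kap^-1 * (k1 * koo * kt^-1)); last by ring.
  rewrite (_ : kap * k1 * koo * kt^-1 = kap * (k1 * koo * kt^-1)); last by ring.
  by move: (theta q) => th; ring.
- exists (theta q (kt * k1 * t0) * theta q (kt^-1 * k1^-1 * t0) * k1 ^+ 2); first exact: nz.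
  move=> kap ka0; rewrite /Tcoef !thetas2 /pair_arg /=.
  rewrite (_ : kt * koo * kap^-1 * k1^-1 = kap^-1 * (kt * koo * k1^-1)); last by ring.
  rewrite (_ : kap * kt * koo * k1^-1 = kap * (kt * koo * k1^-1)); last by ring.
  by move: (theta q) => th; ring.
- exists (- (theta q (kt * k1^-1 * t0) * theta q (kt^-1 * k1 * t0))).
    by rewrite oppr_eq0; exact: (mulf_neq0 a5 a6).
  move=> kap ka0; rewrite /Tcoef !thetas2 /pair_arg /=.
  rewrite (_ : kap * kt * k1 * koo = kap * (kt * k1 * koo)); last by ring.
  rewrite (_ : kt * k1 * koo * kap^-1 = kap^-1 * (kt * k1 * koo)); last by ring.
  by move: (theta q) => th; ring.
- exists (theta q (kt ^+ 2) * theta q (k1 ^+ 2)); first exact: (mulf_neq0 a1 a2).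
  by move=> kap ka0; rewrite /Tcoef !thetas2 /pair_arg /= !mulrA.
Qed.

Lemma pair_arg_neq0 p : pair_arg p != 0.
Proof. by case: p => [[|[|a]] [|[|[|[|b]]]]]; rewrite /pair_arg !mulf_neq0 ?invr_eq0. Qed.

Lemma Tcoef_eq0 kap p : kap != 0 -> p \in pairs ->
  Tcoef q (Kappas kap kt k1 koo) t0 p.1.+1 p.2.+1 = 0 <->
  qZ q (kap * pair_arg p) \/ qZ q (kap^-1 * pair_arg p).
Proof.
move=> ka0 pin; have [w w0 ->] := Tcoef_split pin => //.
have s0 := pair_arg_neq0 p.
have e1 := theta_eq0 q0 q1 (mulf_neq0 ka0 s0).
have e2 := theta_eq0 q0 q1 (mulf_neq0 (invr_neq0 ka0) s0).
split; last by case=> [/e1 ->|/e2 ->]; rewrite ?mul0r ?mulr0.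
move=> /eqP; rewrite mulf_eq0 (negPf w0) /= mulf_eq0 => /orP[/eqP/e1|/eqP/e2]; tauto.
Qed.

(** If both vanished, [pair_arg p] and its product with kz or kz^-1 would lie in q^Z, hence so would
    kz^2. *)
Lemma hat_Tcoef_neq0 p : p \in pairs -> Tcoef q k t0 p.1.+1 p.2.+1 = 0 ->
  Tcoef q (Kappas 1 kt k1 koo) t0 p.1.+1 p.2.+1 != 0.
Proof.
move=> pin; have [kN _ _ _] := nonres_squares.
move=> /(Tcoef_eq0 kz0 pin) h; apply/eqP => /(Tcoef_eq0 (oner_neq0 _) pin).
have s0 := pair_arg_neq0 p.
rewrite invr1 !mul1r => h'; have {}h' : qZ q (pair_arg p) by tauto.
have kq : qZ q kz.
  case: h => h; have := qZM q0 h (qZV h'); rewrite mulfK // => //.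
  by rewrite qZVE.
by apply: kN; rewrite expr2; exact: qZM.
Qed.

(** Each T_ij has two theta factors that depend on kappa_0. The pairs 12 and 34 account for the four
    conditions with t0; the other four pairs give eight conditions, which are the sixteen sign
    choices up to inversion. *)
Lemma nonsplittingP : nonsplitting q k t0 <->
  forall p, p \in pairs -> Tcoef q k t0 p.1.+1 p.2.+1 != 0.
Proof.
have p1 : (1 : int) \in pm1 by []; have m1 : (-1 : int) \in pm1 by [].
split=> H.
  move=> p pin; apply/eqP => /(Tcoef_eq0 kz0 pin); move: p pin; apply: pairsP; rewrite /pair_arg.
  - case=> h.
      have [_] := H _ _ _ _ m1 p1 p1 p1; apply; apply/(mulqZP _ t00); rewrite -qZVE.
      by rewrite (_ : _^-1 = kz * (koo^-1 * t0)) //= exprN1 expr1z; field; rewrite t00 kz0 koo0.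
    have [_] := H _ _ _ _ p1 p1 p1 p1; apply; apply/(mulqZP _ t00); rewrite -qZVE.
    by rewrite (_ : _^-1 = kz^-1 * (koo^-1 * t0)) //= !expr1z; field; rewrite t00 kz0 koo0.
  - case=> h.
      by have [] := H _ _ _ _ p1 p1 p1 m1; case; rewrite /= !expr1z exprN1 -!mulrA in h *.
    by have [] := H _ _ _ _ m1 p1 p1 m1; case; rewrite /= !expr1z !exprN1 -!mulrA in h *.
  - case=> h.
      by have [] := H _ _ _ _ p1 m1 p1 p1; case; rewrite (_ : _ * _ = kz * (k1 * koo / kt)) //= !expr1z exprN1; ring.
    by have [] := H _ _ _ _ m1 m1 p1 p1; case; rewrite (_ : _ * _ = kz^-1 * (k1 * koo / kt)) //= !expr1z !exprN1; ring.
  - case=> h.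
      by have [] := H _ _ _ _ p1 p1 m1 p1; case; rewrite (_ : _ * _ = kz * (kt * koo / k1)) //= !expr1z exprN1; ring.
    by have [] := H _ _ _ _ m1 p1 m1 p1; case; rewrite (_ : _ * _ = kz^-1 * (kt * koo / k1)) //= !expr1z !exprN1; ring.
  - case=> h.
      by have [] := H _ _ _ _ p1 p1 p1 p1; case; rewrite (_ : _ * _ = kz * (kt * k1 * koo)) //= !expr1z; ring.
    by have [] := H _ _ _ _ m1 p1 p1 p1; case; rewrite (_ : _ * _ = kz^-1 * (kt * k1 * koo)) //= !expr1z !exprN1; ring.
  - case=> h.
      have [_] := H _ _ _ _ m1 p1 p1 m1; apply; apply/(mulqZP _ t00); rewrite -qZVE.
      by rewrite (_ : _^-1 = kz * (koo * t0)) //= !exprN1; field; rewrite t00 kz0 koo0.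
    have [_] := H _ _ _ _ p1 p1 p1 m1; apply; apply/(mulqZP _ t00); rewrite -qZVE.
    by rewrite (_ : _^-1 = kz^-1 * (koo * t0)) //= expr1z exprN1; field; rewrite t00 kz0 koo0.
have N p : p \in pairs -> ~ qZ q (kz * pair_arg p) /\ ~ qZ q (kz^-1 * pair_arg p).
  move=> pin; have /eqP h := H p pin; split=> h'; apply: h; apply/(Tcoef_eq0 kz0 pin); tauto.
have [a1 a2] := N (0, 1)%N isT; have [b1 b2] := N (0, 2)%N isT; have [c1 c2] := N (0, 3)%N isT.
have [d1 d2] := N (1, 2)%N isT; have [f1 f2] := N (1, 3)%N isT; have [g1 g2] := N (2, 3)%N isT.
rewrite /pair_arg in a1 a2 b1 b2 c1 c2 d1 d2 f1 f2 g1 g2.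
have eq a b : a = b -> ~ qZ q b -> ~ qZ q a by move=> ->.
have eqV a b : a^-1 = b -> ~ qZ q b -> ~ qZ q a by move=> <-; rewrite qZVE.
have pmP (e : int) : e \in pm1 -> e = 1 \/ e = -1.
  by rewrite !in_cons in_nil orbF => /orP[]/eqP->; [left|right].
move=> e0 et e1 eoo /pmP E0 /pmP Et /pmP E1 /pmP Eoo; split.
  by case: E0 => ->; case: Et => ->; case: E1 => ->; case: Eoo => ->; rewrite ?expr1z ?exprN1 /=;
  first [ apply: eq b1; ring | apply: eq b2; ring | apply: eq c1; ring | apply: eq c2; ring
        | apply: eq d1; ring | apply: eq d2; ring | apply: eq f1; ring | apply: eq f2; ring
        | apply: eqV b1; by field; rewrite kz0 kt0 k10 koo0 | apply: eqV b2; by field; rewrite ?kz0 kt0 k10 koo0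
        | apply: eqV c1; by field; rewrite kz0 kt0 k10 koo0 | apply: eqV c2; by field; rewrite ?kz0 kt0 k10 koo0
        | apply: eqV d1; by field; rewrite kz0 kt0 k10 koo0 | apply: eqV d2; by field; rewrite ?kz0 kt0 k10 koo0
        | apply: eqV f1; by field; rewrite kz0 kt0 k10 koo0 | apply: eqV f2; by field; rewrite ?kz0 kt0 k10 koo0 ].
move=> /(mulqZP _ t00); rewrite -qZVE.
case: E0 => ->; case: Eoo => ->; rewrite ?expr1z ?exprN1 /=.
- by apply: eq a2; field; rewrite t00 kz0 koo0.
- by apply: eq g2; field; rewrite t00 kz0 koo0.
- by apply: eq a1; field; rewrite t00 kz0 koo0.
- by apply: eq g1; field; rewrite t00 kz0 koo0.
Qed.

End splitting.

(** * Fixed points of the scaling action in S^* *)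

Section fixed_points.
Context {R : realType}.
Local Notation C := (cplx R).
Local Notation P1 := (one_point_compactification C).
Local Notation P1x4 := 'rV[P1]_4.
Local Notation orbit := Defs.orbit.
Variables (q t0 kz kt k1 koo : C).
Hypotheses (q0 : q != 0) (q1 : nm q < 1).
Hypotheses (t00 : t0 != 0) (kz0 : kz != 0) (kt0 : kt != 0) (k10 : k1 != 0) (koo0 : koo != 0).
Let k := Kappas kz kt k1 koo.
Hypothesis nonres : nonresonant q k t0.
Implicit Types r : P1x4.

Definition pair_point (p : nat * nat) (c : C) : P1x4 :=
  \row_(j < 4) if ((j : nat) == p.1) || ((j : nat) == p.2) then None else Some c.

Lemma Tform_pair_point (kk : kappas R) p c : p \in pairs ->
  Tform q kk t0 (pair_point p c) = Tcoef q kk t0 p.1.+1 p.2.+1.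
Proof.
rewrite TformE; move: (Tcoef q kk t0) => t; move: p.
by apply: pairsP; rewrite /tsum /hxn /hyn !mxE !inordK //=; ring.
Qed.

Lemma scale_pair_point p (c d : C) : map_mx (scaleP1 c) (pair_point p d) = pair_point p (c * d).
Proof. by apply/rowP => j; rewrite !mxE; case: ifP. Qed.

Lemma pair_point_Sstar p c : p \in pairs -> Tcoef q k t0 p.1.+1 p.2.+1 = 0 ->
  Sstar q k t0 (pair_point p c).
Proof.
move=> pin T0; apply/SstarP; rewrite !Tform_pair_point //; split=> //.
exact/eqP/(hat_Tcoef_neq0 q0 q1 t00 kz0 kt0 k10 koo0 nonres pin T0).
Qed.

Definition mask_point (b : nat -> bool) : P1x4 := \row_(j < 4) if b j then None else Some 0.

Lemma fixed_mask r : (forall j, fixedP1 (r 0 j)) -> r = mask_point (fun j => r 0 (inord j) == None).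
Proof.
move=> F; apply/rowP => j; rewrite mxE inord_val; have := F j; rewrite /fixedP1.
by case: (r 0 j) => [z|] //=; rewrite mulr1 => ->.
Qed.

Lemma Tform_mask (kk : kappas R) (b : nat -> bool) : Tform q kk t0 (mask_point b) =
  tsum (Tcoef q kk t0) (fun j => (b j)%:R) (fun j => (~~ b j)%:R).
Proof.
rewrite TformE /tsum /hxn /hyn !mxE !inordK //.
have E1 j : hx (if b j then None else Some (0 : C)) = (b j)%:R by case: (b j).
have E2 j : hy (if b j then None else Some (0 : C)) = (~~ b j)%:R by case: (b j).
by rewrite !E1 !E2.
Qed.

Lemma fixed_pair r : Sstar q k t0 r -> (forall j, fixedP1 (r 0 j)) ->
  exists p, [/\ p \in pairs, r = pair_point p 0 & Tcoef q k t0 p.1.+1 p.2.+1 = 0].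
Proof.
move=> /SstarP[T0 hT] /fixed_mask; set b := fun j => _ == None => e.
have N : tsum (Tcoef q (Kappas 1 kt k1 koo) t0) (fun j => (b j)%:R) (fun j => (~~ b j)%:R) <> 0.
  by move=> h; apply: hT; rewrite e Tform_mask.
(* Unless exactly two of the coordinates are infinite, every term of T for hat kappa vanishes, which
   S^* excludes. *)
have [p [pin ep]] : exists p, p \in pairs /\ mask_point b = pair_point p 0.
  case b0 : (b 0%N); case b1 : (b 1%N); case b2 : (b 2%N); case b3 : (b 3%N);
  first [ exfalso; apply: N; rewrite /tsum b0 b1 b2 b3 /=; ring
        | exists (0, 1)%N; split=> //; apply/rowP; apply: ord4P; rewrite !mxE !inordK //= ?b0 ?b1 ?b2 ?b3 //; fail
        | exists (0, 2)%N; split=> //; apply/rowP; apply: ord4P; rewrite !mxE !inordK //= ?b0 ?b1 ?b2 ?b3 //; fail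
        | exists (0, 3)%N; split=> //; apply/rowP; apply: ord4P; rewrite !mxE !inordK //= ?b0 ?b1 ?b2 ?b3 //; fail
        | exists (1, 2)%N; split=> //; apply/rowP; apply: ord4P; rewrite !mxE !inordK //= ?b0 ?b1 ?b2 ?b3 //; fail
        | exists (1, 3)%N; split=> //; apply/rowP; apply: ord4P; rewrite !mxE !inordK //= ?b0 ?b1 ?b2 ?b3 //; fail
        | exists (2, 3)%N; split=> //; apply/rowP; apply: ord4P; rewrite !mxE !inordK //= ?b0 ?b1 ?b2 ?b3 //; fail ].
by exists p; split=> //; [rewrite e ep | rewrite -(Tform_pair_point k 0 pin) -ep -e].
Qed.

Lemma pair_point_fixed p j : fixedP1 (pair_point p (0 : C) 0 j).
Proof. by rewrite mxE /fixedP1; case: ifP => _ /=; rewrite ?mulr0 ?mul0r. Qed.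

Lemma nonsplitting_not_fixed r : nonsplitting q k t0 -> Sstar q k t0 r -> ~ forall j, fixedP1 (r 0 j).
Proof.
move=> /(nonsplittingP q0 q1 t00 kz0 kt0 k10 koo0 nonres) H S /(fixed_pair S)[p [pin _ T0]].
by move: (H p pin); rewrite T0 eqxx.
Qed.

Let xdist := nonres_xdist t00 kt0 k10 nonres.
Let kzN : ~ qZ q (kz ^+ 2). Proof. by have [] := nonres_squares nonres. Qed.
Let kooN : ~ qZ q (koo ^+ 2). Proof. by have [] := nonres_squares nonres. Qed.

Implicit Types m : monodromy_manifold q k t0.

Lemma Msing_nonempty : ~ nonsplitting q k t0 -> Msing q k t0 !=set0.
Proof.
move=> ns; have [p [pin T0]] : exists p, p \in pairs /\ Tcoef q k t0 p.1.+1 p.2.+1 = 0.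
  apply: contrapT => h; apply: ns; apply/(nonsplittingP q0 q1 t00 kz0 kt0 k10 koo0 nonres) => p pin.
  by apply/eqP => T0; apply: h; exists p.
have [m e] := Pmap_surj q0 q1 t00 kz0 kt0 k10 koo0 xdist kzN kooN (pair_point_Sstar 0 pin T0).
exists m; apply: (proj2 (MsingP q0 q1 t00 kz0 kt0 k10 koo0 xdist kzN e)) => j.
exact: pair_point_fixed.
Qed.

Lemma Msing_pair m : Msing q k t0 m ->
  exists p, [/\ p \in pairs, Pmap m = orbit (pair_point p 0) & Tcoef q k t0 p.1.+1 p.2.+1 = 0].
Proof.
have [r S e] := PmapP q0 q1 t00 kz0 kt0 k10 koo0 xdist kzN m.
move=> /(MsingP q0 q1 t00 kz0 kt0 k10 koo0 xdist kzN e) /(fixed_pair S)[p [pin rE T0]].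
by exists p; split=> //; rewrite e rE.
Qed.

Lemma Msing_finite : finite_set (Msing q k t0).
Proof.
have inj := Pmap_inj q0 q1 t00 kz0 kt0 k10 koo0 xdist kzN kooN.
pose B : set (set P1x4) := (fun p => orbit (pair_point p 0)) @` [set p | p \in pairs].
have fB : finite_set B by exact: finite_image (finite_seq pairs).
apply: (@sub_finite_set _ _ (@Pmap R q k t0 @^-1` B)).
  by move=> m /Msing_pair[p [pin e _]]; exists p.
by apply: finite_preimage fB => m m' _ _; exact: inj.
Qed.

End fixed_points.

(** * Charts *)

Section differentiability.
Context {K : numFieldType}.

Lemma near_eq_differentiable (V W : normedModType K) (f g : V -> W) x :
  (\near x, f x = g x) -> differentiable f x -> differentiable g x.
Proof.
move=> fg df; have [dc /eqaddoP H] := proj1 (diff_locallyP x f) df.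
have E : g \o shift x = cst (g x) + 'd f x +o_ 0 id.
  apply/eqaddoP => e e0; move: (H e e0).
  have fg' : \forall h \near (0 : V), f (h + x) = g (h + x).
    by move: fg; rewrite (near_shift 0) subr0.
  have fx : f x = g x by exact: nbhs_singleton fg.
  apply: filterS2 fg' => h e1.
  by rewrite -fx /= /shift /= !fctE /= e1.
have dE : 'd g x = 'd f x :> (V -> W) by apply: diff_unique.
by apply/diff_locallyP; rewrite dE.
Qed.

Lemma differentiable_row (V : normedModType K) n (f : V -> 'rV[K]_n) x :
  (forall j, differentiable (fun v => f v 0 j : K) x) -> differentiable f x.
Proof.
move=> H; have -> : f = \sum_(j < n) (fun v => f v 0 j *: (delta_mx 0 j : 'rV[K]_n)).
  by apply/funext => v; rewrite {1}(row_sum_delta (f v)) fct_sumE.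
by apply: differentiable_sum => j; apply: differentiableZl; exact: H.
Qed.

End differentiability.

Section P1_topology.
Context {R : realType}.
Local Notation C := (cplx R).
Local Notation P1 := (one_point_compactification C).
Local Notation P1x4 := 'rV[P1]_4.

Lemma compact_nm_bounded (K : set C) : compact K -> exists n : nat, forall w, K w -> nm w < n%:R.
Proof.
move=> /compact_near_coveringP cov.
have [|N _ HN] := cov nat \oo (fun n w => nm w < n%:R) _; last by exists N; exact: (HN N (leqnn N)).
move=> z _; exists ([set w | nm (w - z) < 1], [set n | ((Num.trunc (nm z + 1)).+1 <= n)%N]) => /=.
  by split; [apply/nbhs_nmP; exists 1 | exists (Num.trunc (nm z + 1)).+1].
move=> [w n] [/= hw hn]; have := nm_tri w z 0; rewrite !subr0 => h.
apply: le_lt_trans (h) _; apply: (@lt_le_trans _ _ (Num.trunc (nm z + 1)).+1%:R); last by rewrite ler_nat.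
by apply: lt_trans (truncnS_gt _); lra.
Qed.

(** Neighbourhoods of infinity are complements of compact sets. Compact sets are bounded and closed
    discs are compact, so inversion turns these neighbourhoods into those of 0. *)
Lemma nbhs_parP1 (p : P1) (A : set P1) : nbhs p A <-> nbhs (cenP1 p) [set w | A (parP1 p w)].
Proof.
case: p => [z|] //; split.
  case=> K [/compact_nm_bounded[n Kn] _] KA; apply/nbhs_nmP.
  exists (n.+1%:R^-1) => //= w; rewrite subr0 => wn.
  case: ifPn => w0; first by apply: KA; right.
  apply: KA; left; exists w^-1 => //= /Kn; rewrite nmV => h.
  have wp : 0 < nm w by rewrite nm_gt0.
  have h1 : (nm w)^-1 < n.+1%:R by apply: lt_trans h _; rewrite ltr_nat.
  by move: h1; rewrite invf_plt ?posrE ?ltr0n // => h1; have := lt_trans wn h1; rewrite ltxx.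
move=> /nbhs_nmP[e /= e0 He]; exists (annulus 0 e^-1).
  split; first exact: compact_annulus.
  apply: closed_nm => z H; rewrite /annulus /= nm_ge0 /= leNgt; apply/negP => h.
  have [|w /andP[_ h2] h3] := H (nm z - e^-1); first by rewrite subr_gt0.
  by have := nm_tri_mid w z 0; rewrite !subr0; lra.
move=> q [[z nz <-]|->]; last by have := He 0; rewrite subrr nm0 eqxx; apply.
have z1 : e^-1 < nm z by rewrite ltNge; apply/negP => h; apply: nz; rewrite /annulus /= nm_ge0.
have zp : 0 < nm z by apply: lt_trans z1; rewrite invr_gt0.
have z0 : z != 0 by rewrite -nm_gt0.
have := He z^-1; rewrite subr0 invr_eq0 (negPf z0) invrK; apply.
by rewrite nmV invf_plt ?posrE.
Qed.

Definition par (r : P1x4) (u : 'rV[C]_4) : P1x4 := \row_j parP1 (r 0 j) (u 0 j).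
Definition cen (r : P1x4) : 'rV[C]_4 := map_mx cenP1 r.

Lemma nbhs_par (r : P1x4) (A : set P1x4) : nbhs r A <-> nbhs (cen r) [set u | A (par r u)].
Proof.
split.
  move=> [P nP PA]; exists (fun i j => [set w | P i j (parP1 (r i j) w)]).
    by move=> i j; rewrite /= mxE; apply/nbhs_parP1; exact: nP.
  move=> u Pu; apply: PA => i j; rewrite ord1 mxE; have := Pu i j; by rewrite ord1.
move=> [P nP PA]; exists (fun i j => parP1 (r i j) @` P i j).
  move=> i j; apply/nbhs_parP1; have := nP i j; rewrite mxE; apply: filterS => w Pw /=.
  by exists w.
move=> s Ps; have /choice[v Hv] : forall j : 'I_4, exists w, P 0 j w /\ parP1 (r 0 j) w = s 0 j.
  by move=> j; have [w Pw <-] := Ps 0 j; exists w.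
have -> : s = par r (\row_j v j) by apply/rowP => j; rewrite !mxE; have [_ ->] := Hv j.
by apply: PA => i j; rewrite ord1 mxE; have [] := Hv j.
Qed.

End P1_topology.

(** * Explicit charts *)

Section charts.
Context {R : realType}.
Local Notation C := (cplx R).
Local Notation P1 := (one_point_compactification C).
Local Notation P1x4 := 'rV[P1]_4.
Implicit Types (r s : P1x4) (p : P1) (b : bool) (w : C) (tau : 'I_4 -> bool) (u : 'rV[C]_4).

(* [chartP1 b] is the inverse of the coordinate z of P^1 or, if [b], of 1/z;
   [HX] and [HY] are homogeneous coordinates polynomial in the chart variable. *)
Definition chartP1 b w : P1 := if b then (if w == 0 then None else Some w^-1) else Some w.
Definition HX b w : C := if b then 1 else w.
Definition HY b w : C := if b then w else 1.
(** The nonzero factor between [hx], [hy], which jump at infinity, and the polynomial coordinates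
    [HX], [HY]. *)
Definition hlam b w : C := if b && (w != 0) then w^-1 else 1.

Lemma parP1E p w : parP1 p w = chartP1 (p == None) w.
Proof. by case: p. Qed.

Lemma hlam_neq0 b w : hlam b w != 0.
Proof. by rewrite /hlam; case: ifP => [/andP[_ w0]|_]; rewrite ?invr_eq0 ?oner_neq0. Qed.

Lemma hx_chart b w : hx (chartP1 b w) = hlam b w * HX b w.
Proof.
by rewrite /chartP1 /hlam /HX; case: b => /=; [case: (w == 0)|]; rewrite /= ?mulr1 ?mul1r.
Qed.

Lemma hy_chart b w : hy (chartP1 b w) = hlam b w * HY b w.
Proof.
rewrite /chartP1 /hlam /HY; case: b => /=; last by rewrite mulr1.
by have [->|w0] := eqVneq w 0; rewrite /= ?mulr0 // mulVf.
Qed.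

Definition pt tau u : P1x4 := \row_l chartP1 (tau l) (u 0 l).

Lemma parE r u : par r u = pt (fun l => r 0 l == None) u.
Proof. by apply/rowP => l; rewrite !mxE parP1E. Qed.

Lemma ptE tau u l : pt tau u 0 l = chartP1 (tau l) (u 0 l).
Proof. by rewrite mxE. Qed.

Lemma upd_eq r i p : upd r i p 0 i = p.
Proof. by rewrite mxE eqxx. Qed.

Lemma upd_ne r i p l : l != i -> upd r i p 0 l = r 0 l.
Proof. by move=> li; rewrite mxE (negPf li). Qed.

Definition XX tau u (n : nat) := HX (tau (inord n)) (u 0 (inord n)).
Definition YY tau u (n : nat) := HY (tau (inord n)) (u 0 (inord n)).

Definition setn (i : 'I_4) (v : C) (X : nat -> C) (n : nat) := if n == i :> nat then v else X n.

Variables (q t0 : C).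
Implicit Types k : kappas R.

Definition TT k tau u := tsum (Tcoef q k t0) (XX tau u) (YY tau u).
(** [Tcst] and [Tlin] are the coefficients of the linear form that T defines on the homogeneous
    coordinates of rho_i. *)
Definition Tcst k tau i u := tsum (Tcoef q k t0) (setn i 0 (XX tau u)) (setn i 1 (YY tau u)).
Definition Tlin k tau i u := tsum (Tcoef q k t0) (setn i 1 (XX tau u)) (setn i 0 (YY tau u)).

Lemma Tform_proportional k r (X Y l : nat -> C) : (forall n, l n != 0) ->
  (forall n, (n < 4)%N -> hxn r n = l n * X n) -> (forall n, (n < 4)%N -> hyn r n = l n * Y n) ->
  exists2 c, c != 0 & Tform q k t0 r = c * tsum (Tcoef q k t0) X Y.
Proof.
move=> l0 hX hY; exists (l 0%N * l 1%N * l 2%N * l 3%N).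
  exact: (mulf_neq0 (mulf_neq0 (mulf_neq0 (l0 _) (l0 _)) (l0 _)) (l0 _)).
rewrite TformE /tsum !hX ?hY //.
move: (Tcoef q k t0) (l 0%N) (l 1%N) (l 2%N) (l 3%N) => t a b c d; ring.
Qed.

Lemma Tform_pt k tau u : Tform q k t0 (pt tau u) = 0 <-> TT k tau u = 0.
Proof.
have [c c0 ->] := @Tform_proportional k (pt tau u) (XX tau u) (YY tau u)
  (fun n => hlam (tau (inord n)) (u 0 (inord n))) (fun n => hlam_neq0 _ _)
  (fun n n4 => etrans (congr1 (fun p => hx p) (mxE _ _ _ _)) (hx_chart _ _))
  (fun n n4 => etrans (congr1 (fun p => hy p) (mxE _ _ _ _)) (hy_chart _ _)).
rewrite -/(TT k tau u); split=> [/eqP|->]; last by rewrite mulr0.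
by rewrite mulf_eq0 (negPf c0) => /eqP.
Qed.

Lemma Tform_upd_pt k tau u i : exists2 c, c != 0 & forall p,
  Tform q k t0 (upd (pt tau u) i p) = c * (hy p * Tcst k tau i u + hx p * Tlin k tau i u).
Proof.
pose l n := if n == i :> nat then 1 else hlam (tau (inord n)) (u 0 (inord n)).
have l0 n : l n != 0 by rewrite /l; case: ifP => _; [exact: oner_neq0 | exact: hlam_neq0].
exists (l 0%N * l 1%N * l 2%N * l 3%N).
  exact: (mulf_neq0 (mulf_neq0 (mulf_neq0 (l0 _) (l0 _)) (l0 _)) (l0 _)).
move=> p; rewrite Tform_upd.
have E n : (n < 4)%N -> (inord n == i :> 'I_4) = (n == i :> nat) by move=> n4; rewrite -val_eqE /= inordK.
have hX p' n : (n < 4)%N -> hxn (upd (pt tau u) i p') n = l n * setn i (hx p') (XX tau u) n.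
  by move=> n4; rewrite /hxn !mxE E // /l /setn; case: ifP => _; rewrite ?mul1r // hx_chart.
have hY p' n : (n < 4)%N -> hyn (upd (pt tau u) i p') n = l n * setn i (hy p') (YY tau u) n.
  by move=> n4; rewrite /hyn !mxE E // /l /setn; case: ifP => _; rewrite ?mul1r // hy_chart.
rewrite !TformE /tsum !hX ?hY // /Tcst /Tlin /tsum /=.
move: (Tcoef q k t0) (l 0%N) (l 1%N) (l 2%N) (l 3%N) (hx p) (hy p) => t a b c d x y.
move: (setn i 0 (XX tau u)) (setn i 1 (XX tau u)) (setn i 0 (YY tau u)) (setn i 1 (YY tau u)) => f g f' g'.
ring.
Qed.

Definition root_of (a b : C) : P1 := if b == 0 then None else Some (- a / b).

Lemma root_ofP (a b : C) p : (a != 0) || (b != 0) ->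
  hy p * a + hx p * b = 0 <-> p = root_of a b.
Proof.
rewrite /root_of; have [->|b0] /= := eqVneq b 0.
  rewrite orbF => a0; rewrite mulr0 addr0; split=> [/eqP|->]; last by rewrite mul0r.
  by rewrite mulf_eq0 (negPf a0) orbF; case: p => [z|] //=; rewrite oner_eq0.
move=> _; split=> [|->] /=; last by field.
case: p => [z|] /=; rewrite ?mul0r ?add0r mul1r.
  by move/eqP; rewrite addrC addr_eq0 => /eqP e; congr Some; rewrite -e mulfK.
by move/eqP; rewrite (negPf b0).
Qed.

Section chart.
Variables (k : kappas R) (j i : 'I_4) (e : 'I_2 -> 'I_4) (tau : 'I_4 -> bool).
Hypotheses (ij : i != j) (ei : forall a, e a != i) (ej : forall a, e a != j) (e01 : e 0 != e 1).
Hypothesis tauj : tau j = false.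
Implicit Types W : 'rV[C]_2.

Lemma index_cases (P : 'I_4 -> Prop) : P j -> P i -> (forall a, P (e a)) -> forall l, P l.
Proof.
move=> Pj Pi Pe l; have [->//|lj] := eqVneq l j; have [->//|li] := eqVneq l i.
have [->//|l0] := eqVneq l (e 0); have [->//|l1] := eqVneq l (e 1).
have u : uniq [:: l; j; i; e 0; e 1].
  by rewrite /= !inE !negb_or lj li l0 l1 (eq_sym j) ij (eq_sym j) ej (eq_sym j) ej (eq_sym i) ei (eq_sym i) ei e01.
by have := uniq_leq_size u (s2 := enum 'I_4) (fun x _ => mem_enum _ _); rewrite size_enum_ord.
Qed.

(* [rho_j = 1], [rho_i] solves T = 0, and the two other coordinates [rho_(e a)] are
   given by [W], in the chart of P^1 selected by [tau]. *)
Definition coords W : 'rV[C]_4 :=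
  \row_l (if l == j then 1 else if l == e 0 then W 0 0 else if l == e 1 then W 0 1 else 0).

Lemma coords_j W : coords W 0 j = 1.
Proof. by rewrite mxE eqxx. Qed.

Lemma coords_e W a : coords W 0 (e a) = W 0 a.
Proof.
rewrite mxE (negPf (ej a)); move: a; apply: ord2P; first by rewrite eqxx.
by rewrite eqxx eq_sym (negPf e01).
Qed.

Definition coefA W := Tcst k tau i (coords W).
Definition coefB W := Tlin k tau i (coords W).

Definition chart_inv W : P1x4 := upd (pt tau (coords W)) i (root_of (coefA W) (coefB W)).

Lemma chart_inv_i W : chart_inv W 0 i = root_of (coefA W) (coefB W).
Proof. by rewrite mxE eqxx. Qed.

Lemma chart_inv_j W : chart_inv W 0 j = Some 1.
Proof. by rewrite /chart_inv upd_ne 1?eq_sym // ptE coords_j tauj. Qed.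

Lemma chart_inv_e W a : chart_inv W 0 (e a) = chartP1 (tau (e a)) (W 0 a).
Proof. by rewrite /chart_inv upd_ne // ptE coords_e. Qed.

Definition chart_image W := (coefA W != 0) || (coefB W != 0) /\ Tform q (hat k) t0 (chart_inv W) <> 0.

(** The ratio p / pj, or its inverse if b, in homogeneous form so that p may be infinite in the
    inverse case. *)
Definition coord b (pj p : P1) : C :=
  if b then (hx pj * hy p) / (hy pj * hx p) else (hx p * hy pj) / (hy p * hx pj).

Definition chart_map r : 'rV[C]_2 := \row_a coord (tau (e a)) (r 0 j) (r 0 (e a)).

(** The second condition allows rho_j = 1 after scaling, the third lets T = 0 determine rho_i, and
    the last puts rho_(e a) in the affine chart selected by tau. *)
Definition chart_domain r := [/\ Sstar q k t0 r, ~ fixedP1 (r 0 j), exists p, Tform q k t0 (upd r i p) <> 0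
  & forall a, if tau (e a) then hx (r 0 (e a)) <> 0 else hy (r 0 (e a)) <> 0].

Lemma upd_upd r p p' : upd (upd r i p) i p' = upd r i p'.
Proof. by apply/rowP => l; rewrite !mxE; case: eqP. Qed.

Lemma chart_inv_chart_domain W : chart_image W -> chart_domain (chart_inv W) /\ chart_map (chart_inv W) = W.
Proof.
move=> [AB hT]; have [c c0 E] := Tform_upd_pt k tau (coords W) i.
split; last first.
  apply/rowP => a; rewrite mxE chart_inv_j chart_inv_e /coord /chartP1 /=.
  case: (tau (e a)) => /=; last by rewrite mulr1 mul1r divr1.
  by have [->|w0] := eqVneq (W 0 a) 0; rewrite /= ?mulr0 ?mul0r // !mul1r invrK.
split.
- split; last exact: hT.
  rewrite /Szero /= /chart_inv E.
  by have /(root_ofP _ AB) -> : root_of (coefA W) (coefB W) = root_of (coefA W) (coefB W) by []; rewrite mulr0.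
- by rewrite chart_inv_j /fixedP1 /= mulr1; exact/eqP/oner_neq0.
- have h p : Tform q k t0 (upd (chart_inv W) i p) = c * (hy p * coefA W + hx p * coefB W) by rewrite upd_upd E.
  case/orP: AB => nz; [exists (Some 0)|exists None]; rewrite h /=.
    by rewrite mul1r mul0r addr0; apply/eqP; exact: (mulf_neq0 c0 nz).
  by rewrite mul1r mul0r add0r; apply/eqP; exact: (mulf_neq0 c0 nz).
- move=> a; rewrite chart_inv_e; case: (tau (e a)) => /=; last exact/eqP/oner_neq0.
  case: ifPn => w0 /=; first exact/eqP/oner_neq0.
  by apply/eqP; rewrite invr_eq0.
Qed.

(** Scaling by the inverse of rho_j normalises r, after which rho_i is the only root of a nonzero
    linear form. *)
Lemma chart_map_chart_image r : chart_domain r -> chart_image (chart_map r) /\ exists2 c, c != 0 & chart_inv (chart_map r) = map_mx (scaleP1 c) r.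
Proof.
move=> [[T0 hT] nf [p0 Tp] et].
have [z rj z0] : exists2 z, r 0 j = Some z & z != 0.
  case: (r 0 j) nf => [z|]; rewrite /fixedP1 /= ?mulr0 //.
  by rewrite mulr1 => h; exists z => //; exact/eqP.
have zV : z^-1 != 0 by rewrite invr_eq0.
pose s := map_mx (scaleP1 z^-1) r.
have [c c0 E] := Tform_upd_pt k tau (coords (chart_map r)) i.
have sE : s = upd (pt tau (coords (chart_map r))) i (s 0 i).
  apply/rowP; apply: index_cases => [||a].
  - by rewrite upd_ne 1?eq_sym // ptE coords_j tauj mxE rj /= mulVf.
  - by rewrite upd_eq.
  rewrite upd_ne // ptE coords_e !mxE /coord rj /chartP1 /=.
  have := et a; case: (tau (e a)); case: (r 0 (e a)) => [w|] //= /eqP w0.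
  - by rewrite mulr1 mul1r mulf_eq0 invr_eq0 (negPf z0) (negPf w0) /= invf_div mulrC.
  - by rewrite mulr0 mul0r eqxx.
  - by rewrite mulr1 mul1r mulrC.
have T1 : Tform q k t0 s = 0 by apply/Tform_scale.
have hT1 : Tform q (hat k) t0 s <> 0 by move=> /(proj1 (Tform_scale _ _ _ _ zV)).
have AB : (coefA (chart_map r) != 0) || (coefB (chart_map r) != 0).
  apply: contraT; rewrite negb_or !negbK => /andP[/eqP A0 /eqP B0].
  exfalso; apply: Tp; apply/(Tform_scale _ _ _ _ zV).
  have -> : map_mx (scaleP1 z^-1) (upd r i p0) = upd s i (scaleP1 z^-1 p0).
    by apply/rowP => l; rewrite !mxE; case: eqP => // _; rewrite mxE.
  by rewrite sE upd_upd E -/(coefA _) -/(coefB _) A0 B0 !mulr0 addr0 mulr0.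
have si : s 0 i = root_of (coefA (chart_map r)) (coefB (chart_map r)).
  apply/(root_ofP _ AB); move: T1; rewrite sE E => /eqP; rewrite mulf_eq0 (negPf c0) => /eqP.
  by rewrite -sE.
have ps : chart_inv (chart_map r) = s by rewrite /chart_inv -si -sE.
by split; [split=> //; rewrite ps | exists z^-1].
Qed.

Lemma chart_map_scale (c : C) r : c != 0 -> chart_map (map_mx (scaleP1 c) r) = chart_map r.
Proof.
move=> c0; apply/rowP => a; rewrite !mxE /coord.
case: (r 0 j) => [z|]; case: (r 0 (e a)) => [w|]; case: (tau (e a)) => //=;
  rewrite ?mulr0 ?mul0r ?invr0 ?mulr0 // ?mul1r ?mulr1 //.
- have [->|w0] := eqVneq w 0; first by rewrite mulr0 invr0 !mulr0.
  by field; rewrite c0 w0.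
- have [->|w0] := eqVneq z 0; first by rewrite mulr0 invr0 !mulr0.
  by field; rewrite c0 w0.
Qed.

Lemma chart_domain_scale (c : C) r : c != 0 -> chart_domain r -> chart_domain (map_mx (scaleP1 c) r).
Proof.
move=> c0 [[T0 hT] nf [p0 Tp] et]; split.
- split; first by apply/Tform_scale.
  by move=> /(proj1 (Tform_scale _ _ _ _ c0)).
- by rewrite mxE => /(fixedP1_scale _ c0).
- exists (scaleP1 c p0).
  have -> : upd (map_mx (scaleP1 c) r) i (scaleP1 c p0) = map_mx (scaleP1 c) (upd r i p0).
    by apply/rowP => l; rewrite !mxE; case: eqP => // _; rewrite mxE.
  by move=> /(proj1 (Tform_scale _ _ _ _ c0)).
- move=> a; have := et a; rewrite mxE; case: (r 0 (e a)) => [w|] //=; case: (tau (e a)) => //.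
  by move=> /eqP w0; apply/eqP; rewrite mulf_neq0.
Qed.

End chart.
End charts.

Section differentiable_functions.
Context {K : numFieldType} {V : normedModType K}.
Implicit Types (f g : V -> K) (x : V).

Lemma diff_mul f g x : differentiable f x -> differentiable g x -> differentiable (fun v => f v * g v) x.
Proof. exact: differentiableM. Qed.

Lemma diff_add f g x : differentiable f x -> differentiable g x -> differentiable (fun v => f v + g v) x.
Proof. exact: differentiableD. Qed.

Lemma diff_opp f x : differentiable f x -> differentiable (fun v => - f v) x.
Proof. exact: differentiableN. Qed.

Lemma diff_div f g x : differentiable f x -> differentiable g x -> g x != 0 ->
  differentiable (fun v => f v / g v) x.
Proof. by move=> df dg gx; apply: diff_mul => //; exact: differentiableV. Qed.

End differentiable_functions.

(** * Regularity of the charts and of their inverses *)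

Section chart_topology.
Context {R : realType}.
Local Notation C := (cplx R).
Local Notation P1 := (one_point_compactification C).
Local Notation P1x4 := 'rV[P1]_4.
Implicit Types (r s : P1x4) (p : P1) (b : bool) (w : C) (tau : 'I_4 -> bool) (u : 'rV[C]_4).

Lemma near_all (T : topologicalType) (x : T) (P : T -> Prop) : (forall y, P y) -> \forall y \near x, P y.
Proof. by move=> h; exact: nearW h. Qed.

Lemma near_neq0 (V : topologicalType) (f : V -> C) x : {for x, continuous f} -> f x != 0 ->
  \forall v \near x, f v != 0.
Proof.
move=> fc fx; have /fc : nbhs (f x) [set w : C | w != 0]; last by [].
apply/nbhs_nmP; exists (nm (f x)); first by rewrite nm_gt0.
by move=> w h; apply/eqP => w0; move: h; rewrite w0 sub0r nmN ltxx.
Qed.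

Lemma diff_tsum (V : normedModType C) (t : nat -> nat -> C) (X Y : V -> nat -> C) x :
  (forall n, differentiable (fun v => X v n) x) -> (forall n, differentiable (fun v => Y v n) x) ->
  differentiable (fun v => tsum t (X v) (Y v)) x.
Proof.
move=> dX dY; rewrite /tsum.
have m (c : C) (a a' d l : nat) : differentiable (fun v => c * X v a * X v a' * (Y v d * Y v l)) x.
  apply: diff_mul; last by apply: diff_mul.
  by apply: diff_mul => //; apply: diff_mul => //; exact: differentiable_cst.
by do 5! (apply: diff_add; last exact: m); exact: m.
Qed.

Lemma diff_HX (V : normedModType C) b (f : V -> C) x : differentiable f x ->
  differentiable (fun v => HX b (f v)) x.
Proof. by case: b => // _; exact: differentiable_cst. Qed.

Lemma diff_HY (V : normedModType C) b (f : V -> C) x : differentiable f x ->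
  differentiable (fun v => HY b (f v)) x.
Proof. by case: b => // _; exact: differentiable_cst. Qed.

Lemma par_cen r : par r (cen r) = r.
Proof. by apply/rowP => l; rewrite !mxE; case: (r 0 l) => [z|] //=; rewrite eqxx. Qed.

Lemma near_entry r l (A : set P1) : nbhs (r 0 l) A -> \forall s \near r, A ((s : P1x4) 0 l).
Proof.
move=> nA; exists (fun a (c : 'I_4) => if c == l then A else setT).
  by move=> a c; case: eqP => [->|_]; [rewrite ord1 | exact: filterT].
by move=> s Ps; have := Ps 0 l; rewrite eqxx.
Qed.

Lemma near_upd r i p (A : set P1x4) : nbhs (upd r i p) A -> \forall s \near r, A (upd s i p).
Proof.
case=> P nP PA; exists (fun a (c : 'I_4) => if c == i then setT else P a c).
  move=> a c; case: eqP => [_|/eqP bi]; first exact: filterT.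
  by have := nP a c; rewrite ord1 upd_ne.
move=> s Ps; apply: PA => a c; rewrite ord1; have [->|bi] := eqVneq c i.
  by rewrite upd_eq; have := nbhs_singleton (nP 0 i); rewrite upd_eq.
by rewrite upd_ne //; have := Ps 0 c; rewrite (negPf bi).
Qed.

Lemma near_hx_neq0 p : hx p <> 0 -> nbhs p [set p' | hx p' <> 0].
Proof.
move=> /eqP h; apply/nbhs_parP1; case: p h => [z|] /= h.
  apply/nbhs_nmP; exists (nm z); first by rewrite nm_gt0.
  by move=> w hw w0; move: hw; rewrite /= in w0; rewrite w0 sub0r nmN ltxx.
apply/nbhs_nmP; exists 1 => // w _ /=; case: ifPn => w0 /=; first exact/eqP.
by apply/eqP; rewrite invr_eq0.
Qed.

Lemma near_hy_neq0 p : hy p <> 0 -> nbhs p [set p' | hy p' <> 0].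
Proof.
case: p => [z|] //= _; apply/nbhs_parP1/nbhs_nmP; exists 1 => // w _ /=; exact/eqP/oner_neq0.
Qed.

Lemma near_nonfixed r l : ~ fixedP1 (r 0 l) -> \forall s \near r, ~ fixedP1 ((s : P1x4) 0 l).
Proof.
rewrite /fixedP1 => h; apply: (near_entry (A := [set p | ~ (hx p * hy p = 0)])).
have hX : hx (r 0 l) <> 0 by move=> e; apply: h; rewrite e mul0r.
have hY : hy (r 0 l) <> 0 by move=> e; apply: h; rewrite e mulr0.
apply: filterS2 (near_hx_neq0 hX) (near_hy_neq0 hY) => p /= /eqP p1 /eqP p2.
exact/eqP/(mulf_neq0 p1 p2).
Qed.

Variables (q t0 : C).

Lemma near_Tform_neq0 (k : kappas R) r : Tform q k t0 r <> 0 -> \forall s \near r, Tform q k t0 s <> 0.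
Proof.
move=> T0; apply/nbhs_par.
have T1 : TT q t0 k (fun l => r 0 l == None) (cen r) != 0.
  by apply/eqP => /Tform_pt; rewrite -parE par_cen.
have c : {for cen r, continuous (TT q t0 k (fun l => r 0 l == None))}.
  apply: differentiable_continuous; apply: diff_tsum => n.
    by apply: diff_HX; exact: differentiable_coord.
  by apply: diff_HY; exact: differentiable_coord.
by apply: filterS (near_neq0 c T1) => u /eqP h /=; rewrite parE => /Tform_pt.
Qed.

Section chart.
Variables (k : kappas R) (j i : 'I_4) (e : 'I_2 -> 'I_4) (tau : 'I_4 -> bool).
Hypotheses (ij : i != j) (ei : forall a, e a != i) (ej : forall a, e a != j) (e01 : e 0 != e 1).
Hypothesis tauj : tau j = false.
Implicit Types W : 'rV[C]_2.
Local Notation psi := (chart_inv q t0 k j i e tau).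
Local Notation phi := (chart_map j e tau).
Local Notation domD := (chart_image q t0 k j i e tau).
Local Notation domV := (chart_domain q t0 k j i e tau).
Local Notation coefA := (coefA q t0 k j i e tau).
Local Notation coefB := (coefB q t0 k j i e tau).

Lemma near_domV r : domV r -> \forall s \near r, Sstar q k t0 s -> domV s.
Proof.
move=> [_ nf [p Tp] et].
have N1 := near_nonfixed nf.
have N2 : \forall s \near r, Tform q k t0 (upd s i p) <> 0 by exact: near_upd (near_Tform_neq0 Tp).
have N3 a : \forall s \near r, if tau (e a) then hx ((s : P1x4) 0 (e a)) <> 0 else hy (s 0 (e a)) <> 0.
  have := et a; case: (tau (e a)) => h.
    by exact: near_entry (near_hx_neq0 h).
  exact: near_entry (near_hy_neq0 h).
apply: filterS2 (filterI N1 N2) (filterI (N3 0) (N3 1)) => s [h1 h2] [h3 h4] S.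
split=> //; first by exists p.
by apply: ord2P.
Qed.

Lemma diff_coords W l : differentiable (fun W => coords j e W 0 l : C) W.
Proof.
have -> : (fun W => coords j e W 0 l) = (fun W : 'rV[C]_2 => if l == j then 1 else
  if l == e 0 then W 0 0 else if l == e 1 then W 0 1 else 0) by apply/funext => W'; rewrite mxE.
case: (l == j); first exact: differentiable_cst.
case: (l == e 0); first exact: differentiable_coord.
case: (l == e 1); first exact: differentiable_coord.
exact: differentiable_cst.
Qed.

Lemma diff_setnX v W n : differentiable (fun W => setn i v (XX tau (coords j e W)) n : C) W.
Proof.
rewrite /setn; case: (n == i); first exact: differentiable_cst.
by apply: diff_HX; exact: diff_coords.
Qed.

Lemma diff_setnY v W n : differentiable (fun W => setn i v (YY tau (coords j e W)) n : C) W.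
Proof.
rewrite /setn; case: (n == i); first exact: differentiable_cst.
by apply: diff_HY; exact: diff_coords.
Qed.

Lemma diff_coefA W : differentiable coefA W.
Proof. by apply: diff_tsum => n; [exact: diff_setnX | exact: diff_setnY]. Qed.

Lemma diff_coefB W : differentiable coefB W.
Proof. by apply: diff_tsum => n; [exact: diff_setnX | exact: diff_setnY]. Qed.

Lemma chart_par b w0 w : (w0 != 0 -> w != 0) ->
  chartP1 b w = parP1 (chartP1 b w0) (if b && (w0 != 0) then w^-1 else w).
Proof. case: b => //; rewrite /chartP1 /=; case: (boolP (w0 == 0)) => w00 //= h.
by rewrite (negPf (h isT)). Qed.

Lemma root_of_par (a0 b0 a b : C) : (b0 != 0 -> b != 0) -> (b0 = 0 -> a != 0) ->
  root_of a b = parP1 (root_of a0 b0) (if b0 == 0 then - b / a else - a / b).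
Proof.
rewrite /root_of; have [->|b00] := eqVneq b0 0 => hb ha /=; last by rewrite (negPf (hb isT)).
have a1 := ha erefl; case: (boolP (b == 0)) => [/eqP ->|b1].
  by rewrite oppr0 mul0r eqxx.
have nz : - b / a != 0 by rewrite mulf_neq0 ?oppr_eq0 ?invr_eq0.
by rewrite ifN //; congr Some; field; rewrite a1.
Qed.

(** [chart_inv] in the coordinates of (P^1)^4 centred at its value at W0. An inversion occurs when
    the chart chosen by tau and the centred one differ, that is when tau selects 1 / z at a finite
    point. *)
Definition local_coord W0 W : 'rV[C]_4 :=
  \row_l (if l == i then (if coefB W0 == 0 then - coefB W / coefA W else - coefA W / coefB W)
          else if tau l && (coords j e W0 0 l != 0) then (coords j e W 0 l)^-1 else coords j e W 0 l).

Lemma near_local_coord W0 : domD W0 ->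
  \forall W \near W0, psi W = par (psi W0) (local_coord W0 W).
Proof.
move=> [AB _].
have N1 : \forall W \near W0, coefB W0 != 0 -> coefB W != 0.
  have [b0|b0] := eqVneq (coefB W0) 0; first by apply: near_all => W; rewrite ?b0 ?eqxx.
  by apply: filterS (near_neq0 (differentiable_continuous (diff_coefB W0)) b0) => W h _.
have N2 : \forall W \near W0, coefB W0 = 0 -> coefA W != 0.
  have [b0|b0] := eqVneq (coefB W0) 0; last by apply: near_all => W h; rewrite h eqxx in b0.
  have a0 : coefA W0 != 0 by move: AB; rewrite b0 eqxx orbF.
  by apply: filterS (near_neq0 (differentiable_continuous (diff_coefA W0)) a0) => W h _.
have N3 a : \forall W \near W0, coords j e W0 0 (e a) != 0 -> coords j e W 0 (e a) != 0.
  have [b0|b0] := eqVneq (coords j e W0 0 (e a)) 0; first by apply: near_all => W; rewrite ?b0 ?eqxx.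
  by apply: filterS (near_neq0 (differentiable_continuous (diff_coords W0 (e a))) b0) => W h _.
apply: filterS2 (filterI N1 N2) (filterI (N3 0) (N3 1)) => W [h1 h2] [h3 h4].
have h5 a : coords j e W0 0 (e a) != 0 -> coords j e W 0 (e a) != 0 by move: a; apply: ord2P.
apply/rowP; apply: (index_cases ij ei ej e01) => [||a].
- by rewrite (chart_inv_j q t0 k e ij tauj) mxE (chart_inv_j q t0 k e ij tauj) mxE eq_sym (negPf ij) tauj /= coords_j.
- rewrite chart_inv_i [RHS]mxE chart_inv_i mxE eqxx; exact: root_of_par.
have -> : par (psi W0) (local_coord W0 W) 0 (e a) = parP1 (psi W0 0 (e a)) (local_coord W0 W 0 (e a)) by rewrite [LHS]mxE.
have -> : local_coord W0 W 0 (e a) = if tau (e a) && (coords j e W0 0 (e a) != 0)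
    then (coords j e W 0 (e a))^-1 else coords j e W 0 (e a) by rewrite [LHS]mxE (negPf (ei a)).
rewrite /chart_inv upd_ne // upd_ne // !ptE; exact: chart_par (h5 a).
Qed.


Lemma local_coord_cen W0 : domD W0 -> local_coord W0 W0 = cen (psi W0).
Proof.
move=> [AB _]; apply/rowP; apply: (index_cases ij ei ej e01) => [||a].
- by rewrite [LHS]mxE [RHS]mxE (chart_inv_j q t0 k e ij tauj) eq_sym (negPf ij) tauj /= coords_j.
- rewrite [LHS]mxE [RHS]mxE chart_inv_i eqxx /root_of; case: (boolP (coefB W0 == 0)) => //= /eqP ->.
  by rewrite oppr0 mul0r.
rewrite [LHS]mxE [RHS]mxE (negPf (ei a)) /chart_inv upd_ne // ptE /chartP1.
by case: (tau (e a)) => //=; case: (boolP (coords j e W0 0 (e a) == 0)) => //= /eqP.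
Qed.

Lemma diff_local_coord W0 : domD W0 -> differentiable (local_coord W0) W0.
Proof.
move=> [AB _]; apply: differentiable_row => l.
have -> : (fun W => local_coord W0 W 0 l) = (fun W => if l == i then
    (if coefB W0 == 0 then - coefB W / coefA W else - coefA W / coefB W)
    else if tau l && (coords j e W0 0 l != 0) then (coords j e W 0 l)^-1 else coords j e W 0 l).
  by apply/funext => W; rewrite [LHS]mxE.
case: (l == i).
  case: (boolP (coefB W0 == 0)) => b0.
    have a0 : coefA W0 != 0 by move: AB; rewrite b0 orbF.
    exact: (diff_div (diff_opp (diff_coefB W0)) (diff_coefA W0) a0).
  exact: (diff_div (diff_opp (diff_coefA W0)) (diff_coefB W0) b0).
case: (boolP (tau l && (coords j e W0 0 l != 0))) => [/andP[_ c0]|_]; last exact: diff_coords.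
exact: (differentiableV (diff_coords W0 l) c0).
Qed.

Lemma chart_inv_cont W0 (A : set P1x4) : domD W0 -> nbhs (psi W0) A -> \forall W \near W0, A (psi W).
Proof.
move=> D /nbhs_par; rewrite -local_coord_cen // => nA.
have c := differentiable_continuous (diff_local_coord D).
by apply: filterS2 (near_local_coord D) (c _ nA) => W ->.
Qed.

Lemma near_chart_image W0 : domD W0 -> \forall W \near W0, domD W.
Proof.
move=> D; have [AB hT] := D.
have N1 : \forall W \near W0, (coefA W != 0) || (coefB W != 0).
  case/orP: AB => h.
    by apply: filterS (near_neq0 (differentiable_continuous (diff_coefA W0)) h) => W ->.
  by apply: filterS (near_neq0 (differentiable_continuous (diff_coefB W0)) h) => W ->; rewrite orbT.
by apply: filterS2 N1 (chart_inv_cont D (near_Tform_neq0 hT)) => W h1 h2; split.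
Qed.

Lemma holo_chart_inv W0 (F : P1x4 -> C) : domD W0 -> holo_at F (psi W0) ->
  differentiable (fun W => F (psi W)) W0.
Proof.
move=> D /nbhs_singleton; rewrite -/(cen (psi W0)) -local_coord_cen // => dF.
have dc := differentiable_comp (diff_local_coord D) dF.
apply: near_eq_differentiable dc.
by apply: filterS (near_local_coord D) => W ->.
Qed.

(** [chart_map] as a rational function of the coordinates centred at r; where r is infinite, u is
    already the inverse coordinate, hence the product. *)
Definition chart_coord r u : 'rV[C]_2 := \row_a
  if tau (e a) then (if r 0 (e a) == None then u 0 j * u 0 (e a) else u 0 j / u 0 (e a))
  else u 0 (e a) / u 0 j.

Lemma near_chart_map r : domV r -> \forall u \near cen r, phi (par r u) = chart_coord r u /\
  differentiable (chart_coord r) u.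
Proof.
move=> [_ nf _ et].
have [z rj z0] : exists2 z, r 0 j = Some z & z != 0.
  case: (r 0 j) nf => [z|]; rewrite /fixedP1 /= ?mulr0 //.
  by rewrite mulr1 => h; exists z => //; exact/eqP.
have cc l : {for cen r, continuous (fun u : 'rV[C]_4 => u 0 l : C)}.
  by apply: differentiable_continuous; exact: differentiable_coord.
have Nj : \forall u \near cen r, (u : 'rV[C]_4) 0 j != 0.
  by apply: near_neq0 (cc j) _; rewrite mxE rj.
have Ne a : \forall u \near cen r, tau (e a) -> r 0 (e a) != None -> (u : 'rV[C]_4) 0 (e a) != 0.
  have := et a; case: (boolP (tau (e a))) => t h; last by apply: near_all.
  case: (boolP (r 0 (e a) == None)) => rn; first by apply: near_all.
  have : cen r 0 (e a) != 0 by rewrite mxE; case: (r 0 (e a)) h rn => //= w /eqP.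
  by move/(near_neq0 (cc (e a))); apply: filterS => u h' _ _.
apply: filterS2 (filterI (Ne 0) (Ne 1)) Nj => u [h0 h1] uj.
have he a : tau (e a) -> r 0 (e a) != None -> u 0 (e a) != 0 by move: a; apply: ord2P.
split.
  apply/rowP => a; rewrite !mxE /coord rj /=; have := et a.
  case: (tau (e a)); case: (r 0 (e a)) => [w|] /= h.
  - by rewrite mulr1 mul1r.
  - case: (boolP (u 0 (e a) == 0)) => [/eqP ->|u0] /=; first by rewrite !mulr0 mul0r.
    by rewrite mulr1 mul1r invrK.
  - by rewrite mulr1 mul1r.
  - by exfalso; exact: h.
apply: differentiable_row => a.
have -> : (fun v => chart_coord r v 0 a) = (fun v : 'rV[C]_4 =>
  if tau (e a) then (if r 0 (e a) == None then v 0 j * v 0 (e a) else v 0 j / v 0 (e a))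
  else v 0 (e a) / v 0 j) by apply/funext => v; rewrite [LHS]mxE.
have dc l := @differentiable_coord C 1 4 u 0 l.
case: (boolP (tau (e a))) => t.
  case: (boolP (r 0 (e a) == None)) => rn; first exact: (diff_mul (dc j) (dc (e a))).
  exact: (diff_div (dc j) (dc (e a)) (he a t rn)).
exact: (diff_div (dc (e a)) (dc j) uj).
Qed.

Lemma near_diff_chart_map r : domV r ->
  \forall u \near cen r, differentiable (fun u => phi (par r u)) u.
Proof.
move=> D; have N := near_chart_map D.
have N' : \forall u \near cen r, \forall v \near u, phi (par r v) = chart_coord r v.
  by apply: filterS (nbhs_interior N) => u; apply: filterS => v [].
apply: filterS2 N' N => u h [_ d].
by apply: near_eq_differentiable d; apply: filterS h => v ->.
Qed.

Lemma near_par_map r (A : set 'rV[C]_2) : domV r -> nbhs (phi r) A ->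
  \forall u \near cen r, A (phi (par r u)).
Proof.
move=> D; rewrite -{1}(par_cen r) => nA.
exact: (differentiable_continuous (nbhs_singleton (near_diff_chart_map D)) nA).
Qed.

Lemma chart_map_cont r (A : set 'rV[C]_2) : domV r -> nbhs (phi r) A -> \forall s \near r, A (phi s).
Proof. by move=> D /(near_par_map D) nA; apply/nbhs_par. Qed.

Lemma holo_chart_map r (g : 'rV[C]_2 -> C) : domV r -> (\forall W \near phi r, differentiable g W) ->
  holo_at (fun s => g (phi s)) r.
Proof.
move=> D /(near_par_map D) N; apply: filterS2 (near_diff_chart_map D) N => u d1 d2.
exact: (differentiable_comp d1 d2).
Qed.

End chart.
End chart_topology.

(** * Charts on the monodromy manifold *)

Section manifold.
Context {R : realType}.
Local Notation C := (cplx R).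
Local Notation P1 := (one_point_compactification C).
Local Notation P1x4 := 'rV[P1]_4.
Local Notation orbit := Defs.orbit.
Variables (q t0 : C) (k : kappas R).
Local Notation M := (monodromy_manifold q k t0).
Local Notation Pmap := (@Pmap R q k t0).
Hypothesis Pinj : injective Pmap.
Hypothesis Prange : forall m : M, exists2 r, Sstar q k t0 r & Pmap m = orbit r.
Hypothesis Psurj : forall r, Sstar q k t0 r -> exists m : M, Pmap m = orbit r.
Implicit Types (m : M) (r s : P1x4) (U : set M) (f : M -> C).

Lemma open_subspace_near (S A : set P1x4) : open (A : set (subspace S)) <->
  forall r, S r -> A r -> \forall s \near r, S s -> A s.
Proof.
rewrite openE; split=> [H r Sr Ar|H].
  have h : nbhs_subspace (r : subspace S) A := H r Ar.
  by rewrite -(nbhs_subspace_in Sr) in h.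
suff h : forall r : P1x4, A r -> nbhs_subspace (A := S) r A by exact: h.
move=> r Ar; have [Sr|nSr] := pselect (S r).
  by rewrite -(nbhs_subspace_in Sr); exact: H.
by rewrite -(nbhs_subspace_out nSr) => s ->.
Qed.

Definition saturated_near r (Q : P1x4 -> M -> Prop) :=
  \forall s \near r, forall m, Sstar q k t0 s -> Pmap m = orbit s -> Q s m.

(** Moves the test for openness from sets of orbits to points of S^*: [Pinj] recovers U from its
    image, and [Psurj] provides the class of each nearby point. *)
Lemma mm_openP U : open U <-> forall r m, Sstar q k t0 r -> Pmap m = orbit r -> U m ->
  saturated_near r (fun _ => U).
Proof.
split.
  case=> W /open_subspace_near oW -> r m Sr mr Um.
  have N : \forall s \near r, Sstar q k t0 s -> W (orbit s) by apply: oW Sr _; rewrite /= -mr.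
  apply: filterS N => s H m' Ss ms.
  by rewrite /preimage /= ms; exact: H.
move=> H; exists (Pmap @` U); last first.
  by apply/seteqP; split=> m; [move=> Um; exists m | move=> [m' Um' /Pinj <-]].
apply/open_subspace_near => r Sr [m Um mr].
apply: filterS (H r m Sr mr Um) => s Hs Ss.
by have [m' ms] := Psurj Ss; exists m' => //; exact: Hs.
Qed.

Lemma mm_holoP U f : mm_holo q k t0 U f <-> open U /\ forall r m, Sstar q k t0 r -> Pmap m = orbit r -> U m ->
  exists2 F, holo_at F r & saturated_near r (fun s m' => f m' = F s).
Proof.
split.
  case=> W [g [oW UE hg fg]]; have oU : open U by exists W.
  split=> // r m Sr mr Um; have Wr : W (orbit r) by rewrite -mr; move: Um; rewrite UE.
  have [F hF Fg] := hg r Sr Wr; exists F => //.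
  have N := proj1 (mm_openP U) oU r m Sr mr Um.
  apply: filterS2 Fg N => s h1 h2 m' Ss ms.
  by rewrite fg ?ms; [exact: h1 | exact: h2].
case=> oU H; have [W oW UE] := oU.
(* f transported along P; 0 is a default on sets that are not the orbit of a class. *)
pose g (O : set P1x4) : C := if pselect (exists m, Pmap m = O) is left h then f (projT1 (cid h)) else 0.
have gE m : g (Pmap m) = f m.
  rewrite /g; case: pselect => [h|[]]; last by exists m.
  by case: (cid h) => m' /= /Pinj ->.
exists W, g; split=> //.
move=> r Sr Wr; have [m mr] := Psurj Sr.
have Um : U m by rewrite UE /preimage /= mr.
have [F hF N] := H r m Sr mr Um; exists F => //.
apply: filterS N => s h Ss; have [m' ms] := Psurj Ss.
by rewrite /= -ms gE; exact: h.
Qed.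

Section chart.
Variables (j i : 'I_4) (e : 'I_2 -> 'I_4) (tau : 'I_4 -> bool).
Hypotheses (ij : i != j) (ei : forall a, e a != i) (ej : forall a, e a != j) (e01 : e 0 != e 1).
Hypothesis tauj : tau j = false.
Local Notation psi := (chart_inv q t0 k j i e tau).
Local Notation phi := (chart_map j e tau).
Local Notation domD := (chart_image q t0 k j i e tau).
Local Notation domV := (chart_domain q t0 k j i e tau).

Definition chart_set : set M := [set m | exists2 r, domV r & Pmap m = orbit r].

(** Evaluated on a chosen representative; [chart_map_scale] makes the value independent of the
    choice. *)
Definition chart_fun m : 'rV[C]_2 := phi (projT1 (cid2 (Prange m))).

Lemma chart_funE m r : Pmap m = orbit r -> chart_fun m = phi r.
Proof.
rewrite /chart_fun; case: (cid2 _) => s /= _ -> /esym/orbit_eqP[c c0 ->].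
exact: chart_map_scale.
Qed.

Lemma chart_setP m r : Pmap m = orbit r -> chart_set m <-> domV r.
Proof.
move=> mr; split=> [[s ds]|d]; last by exists r.
rewrite mr => /esym/orbit_eqP[c c0 ->]; exact: chart_domain_scale.
Qed.

Lemma chart_inv_class W : domD W -> exists m, [/\ Pmap m = orbit (psi W), chart_set m & chart_fun m = W].
Proof.
move=> D; have [dV pE] := chart_inv_chart_domain ij ei ej e01 tauj D.
have [Sr _ _ _] := dV; have [m mr] := Psurj Sr.
by exists m; split=> //; [exact/(chart_setP mr) | rewrite (chart_funE mr)].
Qed.

Lemma chart_fun_inv m : chart_set m -> domD (chart_fun m) /\ Pmap m = orbit (psi (chart_fun m)).
Proof.
move=> [r dr mr]; rewrite (chart_funE mr).
have [D [c c0 pE]] := chart_map_chart_image ij ei ej e01 tauj dr.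
by split=> //; rewrite pE orbit_scale.
Qed.

Lemma chart_inj : {in chart_set &, injective chart_fun}.
Proof.
move=> m m'; rewrite !inE => /chart_fun_inv[_ h] /chart_fun_inv[_ h'] E.
apply: Pinj; exact: etrans h (etrans (congr1 (fun W => orbit (psi W)) E) (esym h')).
Qed.

Lemma open_chart_set : open chart_set.
Proof.
apply/mm_openP => r m Sr mr /(chart_setP mr) dr.
apply: filterS (near_domV dr) => s h m' Ss ms.
by apply/(chart_setP ms); exact: h.
Qed.

Lemma open_chart_fun U : U `<=` chart_set -> open U <-> open (chart_fun @` U).
Proof.
move=> UV; split.
  move=> /mm_openP oU; rewrite openE => _ [m Um <-]; rewrite /interior /=.
  have [D mr] := chart_fun_inv (UV _ Um).
  have [[Sr _ _ _] _] := chart_inv_chart_domain ij ei ej e01 tauj D.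
  have N := chart_inv_cont ij ei ej e01 tauj D (oU _ _ Sr mr Um).
  apply: filterS2 N (near_chart_image ij ei ej e01 tauj D) => W h DW.
  have [m' [mr' _ mE]] := chart_inv_class DW; exists m' => //.
  have [[SW _ _ _] _] := chart_inv_chart_domain ij ei ej e01 tauj DW.
  exact: h.
rewrite openE => oU; apply/mm_openP => r m Sr mr Um.
have dr : domV r by apply/(chart_setP mr); exact: UV.
have nU : nbhs (phi r) (chart_fun @` U) by rewrite -(chart_funE mr); apply: oU; exists m.
apply: filterS2 (chart_map_cont dr nU) (near_domV dr) => s [m1 Um1 e1] h m' Ss ms.
have Vm' : chart_set m' by apply/(chart_setP ms); exact: h.
suff -> : m' = m1 by [].
by apply: chart_inj; rewrite ?inE //; [exact: UV | rewrite e1 (chart_funE ms)].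
Qed.

Lemma mm_holo_chart : holo_chart (mm_holo q k t0) chart_set chart_fun.
Proof.
split; [exact: open_chart_set | exact: chart_inj | exact: open_chart_fun |].
move=> U f UV oU; split.
  move=> /mm_holoP[_ H].
  pose g W : C := if pselect (exists m, Pmap m = orbit (psi W)) is left h then f (projT1 (cid h)) else 0.
  have gE W m : Pmap m = orbit (psi W) -> g W = f m.
    move=> mr; rewrite /g; case: pselect => [h|[]]; last by exists m.
    by case: (cid h) => m' /= e'; congr f; apply: Pinj; rewrite e' mr.
  exists g; last by move=> m /UV /chart_fun_inv[_ /gE].
  move=> _ [m Um <-].
  have [D mr] := chart_fun_inv (UV _ Um).
  have [[Sr _ _ _] _] := chart_inv_chart_domain ij ei ej e01 tauj D.
  have [F hF N] := H _ _ Sr mr Um.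
  apply: near_eq_differentiable (holo_chart_inv ij ei ej e01 tauj D hF).
  apply: filterS2 (chart_inv_cont ij ei ej e01 tauj D N) (near_chart_image ij ei ej e01 tauj D) => W h DW.
  have [m' [mr' _ _]] := chart_inv_class DW.
  have [[SW _ _ _] _] := chart_inv_chart_domain ij ei ej e01 tauj DW.
  by rewrite (gE _ _ mr') (h _ SW mr').
case=> g dg fg; apply/mm_holoP; split=> // r m Sr mr Um.
have dr : domV r by apply/(chart_setP mr); exact: UV.
exists (fun s => g (phi s)).
  apply: holo_chart_map dr _.
  have : open (chart_fun @` U) by apply/open_chart_fun.
  rewrite openE => oV; have : nbhs (phi r) (chart_fun @` U) by rewrite -(chart_funE mr); apply: oV; exists m.
  by apply: filterS => W; exact: dg.
apply: filterS (proj1 (mm_openP U) oU r m Sr mr Um) => s h m' Ss ms.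
by rewrite fg; [rewrite (chart_funE ms) | exact: h].
Qed.

End chart.
End manifold.

(** * Topology of the monodromy manifold *)

Section countable_base.
Context {R : realType}.
Local Notation C := (cplx R).

Definition rational_point (c : (rat * rat) * (rat * rat)) : 'rV[C]_2 :=
  \row_a (if a == 0 then (ratr c.1.1 : R) +i* (ratr c.1.2 : R) else ratr c.2.1 +i* ratr c.2.2)%C.

Definition rational_ball (x : ((rat * rat) * (rat * rat)) * nat) : set 'rV[C]_2 :=
  [set W | forall a, nm (W 0 a - rational_point x.1 0 a) < x.2.+1%:R^-1].

Lemma nbhs_rowP (W : 'rV[C]_2) (A : set 'rV[C]_2) : nbhs W A <->
  exists2 d : R, 0 < d & forall V : 'rV[C]_2, (forall a, nm (V 0 a - W 0 a) < d) -> A V.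
Proof.
split.
  case=> P nP PA; have /nbhs_nmP[d d0 Hd] := nP 0 0; have /nbhs_nmP[d' d'0 Hd'] := nP 0 1.
  exists (Num.min d d'); first by rewrite lt_min d0.
  move=> V HV; apply: PA => b a; rewrite ord1; move: a (HV a); apply: ord2P; rewrite lt_min => /andP[h h'].
    exact: Hd.
  exact: Hd'.
case=> d d0 Hd; exists (fun b a => [set w | nm (w - W b a) < d]).
  by move=> b a; apply/nbhs_nmP; exists d.
by move=> V HV; apply: Hd => a; exact: HV.
Qed.

Lemma rational_ball_open x : open (rational_ball x).
Proof.
rewrite openE => W HW; apply/nbhs_rowP.
pose e a := x.2.+1%:R^-1 - nm (W 0 a - rational_point x.1 0 a).
have e0 a : 0 < e a by rewrite subr_gt0; exact: HW.
exists (Num.min (e 0) (e 1)); first by rewrite lt_min !e0.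
move=> V HV a; have ha : nm (V 0 a - W 0 a) < e a.
  by move: a (HV a); apply: ord2P; rewrite lt_min => /andP[].
by apply: le_lt_trans (nm_tri _ (W 0 a) _) _; rewrite -ltrBrDr.
Qed.

Lemma rational_dense (z : C) (e : R) : 0 < e -> exists c : rat * rat,
  nm (z - (ratr c.1 +i* ratr c.2)%C) < e.
Proof.
case: z => a b e0; have e2 : 0 < e / 2 by rewrite divr_gt0.
have [r hr] : exists r : rat, ratr r \in `](a - e / 2), (a + e / 2)[ by apply: rat_in_itvoo; lra.
have [s hs] : exists s : rat, ratr s \in `](b - e / 2), (b + e / 2)[ by apply: rat_in_itvoo; lra.
exists (r, s); apply: le_lt_trans (nm_le_ReIm _) _ => /=.
move: hr hs; rewrite !in_itv /= => /andP[r1 r2] /andP[s1 s2].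
have h1 : `|a - ratr r| < e / 2 by rewrite ltr_norml; apply/andP; split; lra.
have h2 : `|b - ratr s| < e / 2 by rewrite ltr_norml; apply/andP; split; lra.
by move: h1 h2; lra.
Qed.

Lemma rational_ball_base (W : 'rV[C]_2) (A : set 'rV[C]_2) : nbhs W A ->
  exists2 x, rational_ball x W & rational_ball x `<=` A.
Proof.
move=> /nbhs_rowP[d d0 Hd]; have d2 : 0 < d / 2 by rewrite divr_gt0.
have [N HN] := nat_inv_lt d2.
have n0 : 0 < N.+1%:R^-1 :> R by rewrite invr_gt0 ltr0n.
have [c hc] := rational_dense (W 0 0) n0; have [c' hc'] := rational_dense (W 0 1) n0.
have HW : rational_ball (c, c', N) W by apply: ord2P; rewrite mxE.
exists (c, c', N) => // V HV; apply: Hd => a.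
have h1 := HV a; have h2 := HW a; have h3 := HN N (leqnn N).
apply: le_lt_trans (nm_tri _ (rational_point (c, c') 0 a) _) _.
rewrite [X in _ + X]nmB (splitr d); apply: ltrD; [exact: lt_trans h1 h3 | exact: lt_trans h2 h3].
Qed.

End countable_base.

Section subtype.
Context {X : topologicalType} (U : set X).

Lemma nbhs_set_type (x : set_type U) (A : set (set_type U)) : nbhs x A <->
  exists O, [/\ open O, O (set_val x) & set_val @^-1` O `<=` A].
Proof.
split; first by case=> _ [[G oG <-] Gx GA]; exists G.
by case=> G [oG Gx GA]; exists (set_val @^-1` G); split=> //; exists G.
Qed.

(** The point n lies in every neighbourhood of m as well as in its own, so the two cannot be
    separated. *)
Lemma not_hausdorff_set_type m n : U m -> U n -> (forall O, open O -> O m -> O n) ->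
  hausdorff_space (set_type U) -> m = n.
Proof.
move=> Um Un H hU.
pose m' : set_type U := SigSub (mem_set Um); pose n' : set_type U := SigSub (mem_set Un).
suff : m' = n' by move/(congr1 set_val).
apply: hU => A B /nbhs_set_type[G [oG Gm GA]] /nbhs_singleton Bn.
by exists n'; split=> //; apply: GA; exact: H oG Gm.
Qed.

End subtype.

Section charts_topology.
Context {R : realType} {X : topologicalType}.
Local Notation C := (cplx R).
Variable holo : set X -> (X -> C) -> Prop.

Lemma holo_chart_preimage (V : set X) phi (O : set 'rV[C]_2) : holo_chart holo V phi -> open O ->
  open (V `&` phi @^-1` O).
Proof.
move=> [oV inj HV _] oO; apply/HV; first by move=> ? [].
have -> : phi @` (V `&` phi @^-1` O) = (phi @` V) `&` O.
  apply/seteqP; split; first by move=> _ [x [Vx Ox] <-]; split=> //; exists x.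
  by move=> _ [[x Vx <-] Ox]; exists x.
by apply: openI => //; exact/HV.
Qed.

Lemma holo_chart_hausdorff (V : set X) phi : holo_chart holo V phi -> hausdorff_space (set_type V).
Proof.
move=> H x y xy; have [oV inj _ _] := H.
apply: val_inj; apply: inj; [exact: valP|exact: valP|].
apply: norm_hausdorff => A B; rewrite !nbhsE => -[GA [oA Ax] sA] [GB [oB By] sB].
have nA : nbhs x (set_val @^-1` (V `&` phi @^-1` GA)).
  apply/nbhs_set_type; exists (V `&` phi @^-1` GA); split=> //; first exact: holo_chart_preimage.
  by split=> //; exact/set_mem/valP.
have nB : nbhs y (set_val @^-1` (V `&` phi @^-1` GB)).
  apply/nbhs_set_type; exists (V `&` phi @^-1` GB); split=> //; first exact: holo_chart_preimage.
  by split=> //; exact/set_mem/valP.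
have [z [[_ zA] [_ zB]]] := xy _ _ nA nB.
by exists (phi (set_val z)); split; [exact: sA | exact: sB].
Qed.

(** The base consists of the rational balls pulled back through countably many charts. *)
Lemma holo_chart_second_countable (U : set X) (I : countType) (good : I -> Prop) V phi :
  (forall i, good i -> holo_chart holo (V i) (phi i)) ->
  (forall x, U x -> exists2 i, good i & V i x) -> @second_countable (set_type U).
Proof.
move=> H cov.
pose B0 (p : I * (((rat * rat) * (rat * rat)) * nat)) : set (set_type U) :=
  set_val @^-1` (V p.1 `&` phi p.1 @^-1` rational_ball p.2).
exists (B0 @` [set p | good p.1]).
  by apply: (sub_countable (card_image_le _ _)); exact: countableP.
split.
  move=> _ [p gp <-]; exists (V p.1 `&` phi p.1 @^-1` rational_ball p.2) => //.
  by apply: holo_chart_preimage; [exact: H | exact: rational_ball_open].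
move=> x A /nbhs_set_type[G [oG Gx GA]].
have [i gi Vx] : exists2 i, good i & V i (set_val x) by apply: cov; exact/set_mem/valP.
have [oV inj HV _] := H i gi.
have oW : open (phi i @` (V i `&` G)) by apply/HV; [move=> ? [] | exact: openI].
have : nbhs (phi i (set_val x)) (phi i @` (V i `&` G)).
  by move: oW; rewrite openE => h; apply: h; exists (set_val x).
move=> /rational_ball_base[b bx bW].
exists (B0 (i, b)); first by split; [exists (i, b) | split].
move=> y [Vy /bW[z [Vz Gz] zy]]; apply: GA.
have zE : z = set_val y by apply: inj => //; rewrite inE.
by rewrite /preimage /= -zE.
Qed.

End charts_topology.

Lemma other_indices (i j : 'I_4) : i != j ->
  exists e : 'I_2 -> 'I_4, [/\ forall a, e a != i, forall a, e a != j & e 0 != e 1].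
Proof.
move=> ij.
have c2 : #|[set~ i] :\ j| = 2%N.
  have := cardsD1 j [set~ i]; rewrite !inE eq_sym ij cardsC1 card_ord /=; lia.
pose e (a : 'I_2) : 'I_4 := nth i (enum ([set~ i] :\ j)) a.
have sz : size (enum ([set~ i] :\ j)) = 2%N by rewrite -cardE.
have ein (a : 'I_2) : e a \in [set~ i] :\ j by rewrite -mem_enum; apply: mem_nth; rewrite sz.
exists e; split=> [a|a|].
- by have := ein a; rewrite !inE => /andP[].
- by have := ein a; rewrite !inE => /andP[].
- by rewrite nth_uniq ?sz ?enum_uniq.
Qed.

(** * Ratios of coordinates that separate orbits *)

Section separation.
Context {R : realType}.
Local Notation C := (cplx R).
Local Notation P1 := (one_point_compactification C).
Local Notation P1x4 := 'rV[P1]_4.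
Local Notation orbit := Defs.orbit.
Implicit Types (r s : P1x4) (p : P1).

Lemma near_scaleP1 (c : C) p (A : set P1) : c != 0 -> nbhs (scaleP1 c p) A ->
  nbhs p [set p' | A (scaleP1 c p')].
Proof.
move=> c0; have n0 : 0 < nm c by rewrite nm_gt0.
case: p => [z|] /nbhs_parP1/nbhs_nmP[e e0 He]; apply/nbhs_parP1/nbhs_nmP.
  exists (e / nm c); first by rewrite divr_gt0.
  move=> w hw; apply: (He (c * w)); rewrite /= -mulrBr nmM mulrC -ltr_pdivlMr //.
exists (e * nm c); first by rewrite mulr_gt0.
move=> w /=; rewrite subr0 => hw.
have := He (w / c); rewrite /= subr0 nmM nmV ltr_pdivrMr // => /(_ hw).
case: (boolP (w == 0)) => w0 /=; first by rewrite (eqP w0) mul0r eqxx.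
by rewrite mulf_eq0 invr_eq0 (negPf w0) (negPf c0) /= invf_div.
Qed.

Lemma near_scale (c : C) r (A : set P1x4) : c != 0 -> nbhs (map_mx (scaleP1 c) r) A ->
  \forall s \near r, A (map_mx (scaleP1 c) s).
Proof.
move=> c0 [P nP PA]; exists (fun a b => [set p | P a b (scaleP1 c p)]).
  by move=> a b; apply: near_scaleP1 => //; have := nP a b; rewrite mxE.
by move=> s Ps; apply: PA => a b; rewrite mxE; exact: Ps.
Qed.

(* rho_i / rho_j as a point of P^1, in homogeneous coordinates *)
Definition ratio_x r (i j : 'I_4) : C := hx (r 0 i) * hy (r 0 j).
Definition ratio_y r (i j : 'I_4) : C := hy (r 0 i) * hx (r 0 j).
Definition ratio_det r s i j := ratio_x r i j * ratio_y s i j - ratio_y r i j * ratio_x s i j.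

Lemma ratio_det_scale r (c : C) i j : ratio_det r (map_mx (scaleP1 c) r) i j = 0.
Proof.
rewrite /ratio_det /ratio_x /ratio_y !mxE.
by case: (r 0 i) => [z|]; case: (r 0 j) => [w|] /=; ring.
Qed.

Lemma near_ratio_det r s i j : ratio_det r s i j != 0 -> exists A B : set P1x4,
  [/\ nbhs r A, nbhs s B & forall r' s', A r' -> B s' -> ratio_det r' s' i j != 0].
Proof.
move=> D.
pose X t u l : C := HX ((t : P1x4) 0 l == None) ((u : 'rV[C]_4) 0 l).
pose Y t u l : C := HY ((t : P1x4) 0 l == None) ((u : 'rV[C]_4) 0 l).
have hX t u l : hx (par t u 0 l) = hlam (t 0 l == None) (u 0 l) * X t u l.
  by rewrite mxE parP1E hx_chart.
have hY t u l : hy (par t u 0 l) = hlam (t 0 l == None) (u 0 l) * Y t u l.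
  by rewrite mxE parP1E hy_chart.
(* The determinant in polynomial coordinates is continuous; it differs from [ratio_det] by the
   nonzero factors [hlam], which need not be continuous. *)
pose E (p : 'rV[C]_4 * 'rV[C]_4) : C :=
  (X r p.1 i * Y r p.1 j) * (Y s p.2 i * X s p.2 j) - (Y r p.1 i * X r p.1 j) * (X s p.2 i * Y s p.2 j).
have EP u v : exists2 c, c != 0 & ratio_det (par r u) (par s v) i j = c * E (u, v).
  exists (hlam (r 0 i == None) (u 0 i) * hlam (r 0 j == None) (u 0 j) *
    (hlam (s 0 i == None) (v 0 i) * hlam (s 0 j == None) (v 0 j))).
    by apply: mulf_neq0; apply: mulf_neq0; exact: hlam_neq0.
  rewrite /ratio_det /ratio_x /ratio_y !hX !hY /E /=.
  move: (X r u i) (X r u j) (Y r u i) (Y r u j) (X s v i) (X s v j) (Y s v i) (Y s v j) => a b c d a' b' c' d'.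
  move: (hlam _ _) (hlam _ _) (hlam _ _) (hlam _ _) => l1 l2 l3 l4; ring.
have E0 : E (cen r, cen s) != 0.
  have [c c0 e] := EP (cen r) (cen s); rewrite !par_cen in e; move: D; rewrite e.
  by rewrite mulf_eq0 negb_or => /andP[].
have cX t l u : {for u, continuous (fun u => X t u l)}.
  by apply: differentiable_continuous; apply: diff_HX; exact: differentiable_coord.
have cY t l u : {for u, continuous (fun u => Y t u l)}.
  by apply: differentiable_continuous; apply: diff_HY; exact: differentiable_coord.
have cE : {for (cen r, cen s), continuous E}.
  have c1 (f : 'rV[C]_4 -> C) : {for cen r, continuous f} ->
      (fun p : 'rV[C]_4 * 'rV[C]_4 => f p.1) @ (cen r, cen s) --> f (cen r).
    move=> fc A nA; exists (f @^-1` A, setT); last by move=> [u v] [/= h _].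
    by split; [exact: fc A nA | exact: filterT].
  have c2 (f : 'rV[C]_4 -> C) : {for cen s, continuous f} ->
      (fun p : 'rV[C]_4 * 'rV[C]_4 => f p.2) @ (cen r, cen s) --> f (cen s).
    move=> fc A nA; exists (setT, f @^-1` A); last by move=> [u v] [/= _ h].
    by split; [exact: filterT | exact: fc A nA].
  have FF := nbhs_filter (cen r, cen s).
  have H1 := cvgM (cvgM (c1 _ (cX r i _)) (c1 _ (cY r j _))) (cvgM (c2 _ (cY s i _)) (c2 _ (cX s j _))).
  have H2 := cvgM (cvgM (c1 _ (cY r i _)) (c1 _ (cX r j _))) (cvgM (c2 _ (cX s i _)) (c2 _ (cY s j _))).
  have := cvgB (H1 FF FF FF) (H2 FF FF FF); exact.
have [[QA QB] [/= nA nB] QE] := near_neq0 cE E0.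
exists (par r @` QA), (par s @` QB); split.
- by apply/nbhs_par; apply: filterS nA => u; exists u.
- by apply/nbhs_par; apply: filterS nB => u; exists u.
move=> _ _ [u hu <-] [v hv <-]; have [c c0 ->] := EP u v.
by apply: (mulf_neq0 c0); exact: (QE (u, v)).
Qed.

End separation.

(** * The Hausdorff property under the non-splitting conditions *)

Section monodromy_surface.
Context {R : realType}.
Local Notation C := (cplx R).
Local Notation P1 := (one_point_compactification C).
Local Notation P1x4 := 'rV[P1]_4.
Local Notation orbit := Defs.orbit.
Variables (q t0 kz kt k1 koo : C).
Hypotheses (q0 : q != 0) (q1 : nm q < 1).
Hypotheses (t00 : t0 != 0) (kz0 : kz != 0) (kt0 : kt != 0) (k10 : k1 != 0) (koo0 : koo != 0).
Let k := Kappas kz kt k1 koo.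
Hypothesis nonres : nonresonant q k t0.
Local Notation M := (monodromy_manifold q k t0).
Local Notation Pmap := (@Pmap R q k t0).
Implicit Types (r s : P1x4) (m : M).

Let xdist := nonres_xdist t00 kt0 k10 nonres.
Let kzN : ~ qZ q (kz ^+ 2). Proof. by have [] := nonres_squares nonres. Qed.
Let kooN : ~ qZ q (koo ^+ 2). Proof. by have [] := nonres_squares nonres. Qed.
Let Pinj : injective Pmap := Pmap_inj q0 q1 t00 kz0 kt0 k10 koo0 xdist kzN kooN.
Let Prange : forall m, exists2 r, Sstar q k t0 r & Pmap m = orbit r :=
  PmapP q0 q1 t00 kz0 kt0 k10 koo0 xdist kzN.
Let Psurj r : Sstar q k t0 r -> exists m, Pmap m = orbit r :=
  Pmap_surj q0 q1 t00 kz0 kt0 k10 koo0 xdist kzN kooN (r := r).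

Hypothesis T_neq0 : forall p, p \in pairs -> Tcoef q k t0 p.1.+1 p.2.+1 != 0.

Let hxy_or (r : P1x4) n : hyn r n = 0 -> hxn r n != 0.
Proof. by rewrite /hyn /hxn => h; have := hxy_neq0 (r 0 (inord n)); rewrite h eqxx orbF. Qed.

Let hyx_or (r : P1x4) n : hxn r n = 0 -> hyn r n != 0.
Proof. by rewrite /hyn /hxn => h; have := hxy_neq0 (r 0 (inord n)); rewrite h eqxx. Qed.

Let mul0_or (a b : C) : a * b = 0 -> a = 0 \/ b = 0.
Proof. by move=> /eqP; rewrite mulf_eq0 => /orP[]/eqP; [left|right]. Qed.

(** Only the term of T_ij survives; as T_ij is nonzero, a third coordinate must be infinite, and
    then T for hat kappa vanishes too. *)
Lemma no_two_infinities p r : p \in pairs -> Sstar q k t0 r -> hyn r p.1 = 0 -> hyn r p.2 = 0 -> False.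
Proof.
move=> pin [T0 hT]; rewrite /Szero /= TformE in T0; rewrite /Szero /= TformE in hT.
move: (hxy_or (r := r)) hT T0 (T_neq0 pin).
move: (hxn r) (hyn r) (Tcoef q k t0) (Tcoef q (hat k) t0) => X Y t t' hxy hT T0.
have K a b (d e : C) : d != 0 -> a != 0 -> b != 0 -> d * a * b * e = 0 :> C -> e = 0.
  by move=> d0 a0 b0 /eqP; rewrite mulf_eq0 (negPf (mulf_neq0 (mulf_neq0 d0 a0) b0)) => /eqP.
by move: p pin; apply: pairsP => /= tp h1 h2; have x1 := hxy _ h1; have x2 := hxy _ h2;
  move: T0; rewrite /tsum h1 h2 ?(mulr0, mul0r, addr0, add0r) => /(K _ _ _ _ tp x1 x2)/mul0_or [] h3;
  apply: hT; rewrite /tsum h1 h2 h3; ring.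
Qed.

(** Here the surviving term is that of the complementary pair, so a third coordinate must be 0, with
    the same contradiction. *)
Lemma no_two_zeros p r : p \in pairs -> Sstar q k t0 r -> hxn r p.1 = 0 -> hxn r p.2 = 0 -> False.
Proof.
move=> pin [T0 hT]; rewrite /Szero /= TformE in T0; rewrite /Szero /= TformE in hT.
have t12 := T_neq0 (p := (0, 1)%N) isT; have t13 := T_neq0 (p := (0, 2)%N) isT.
have t14 := T_neq0 (p := (0, 3)%N) isT; have t23 := T_neq0 (p := (1, 2)%N) isT.
have t24 := T_neq0 (p := (1, 3)%N) isT; have t34 := T_neq0 (p := (2, 3)%N) isT.
move: (hyx_or (r := r)) hT T0 t12 t13 t14 t23 t24 t34.
move: (hxn r) (hyn r) (Tcoef q k t0) (Tcoef q (hat k) t0) => X Y t t' hxy hT T0 /= t12 t13 t14 t23 t24 t34.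
have K a b (d c e : C) : d != 0 -> a != 0 -> b != 0 -> d * c * e * (a * b) = 0 :> C -> c * e = 0.
  move=> d0 a0 b0 /eqP; rewrite mulf_eq0 (negPf (mulf_neq0 a0 b0)) orbF -mulrA mulf_eq0 (negPf d0).
  by move=> /eqP.
by move: p pin; apply: pairsP => /= h1 h2; have y1 := hxy _ h1; have y2 := hxy _ h2;
  move: T0; rewrite /tsum h1 h2 ?(mulr0, mul0r, addr0, add0r);
  first [ move=> /(K _ _ _ _ _ t12 y1 y2)/mul0_or [] h3 | move=> /(K _ _ _ _ _ t13 y1 y2)/mul0_or [] h3
        | move=> /(K _ _ _ _ _ t14 y1 y2)/mul0_or [] h3 | move=> /(K _ _ _ _ _ t23 y1 y2)/mul0_or [] h3
        | move=> /(K _ _ _ _ _ t24 y1 y2)/mul0_or [] h3 | move=> /(K _ _ _ _ _ t34 y1 y2)/mul0_or [] h3 ];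
  apply: hT; rewrite /tsum h1 h2 h3; ring.
Qed.

Let pair_of (i j : 'I_4) : i != j -> ((i : nat), (j : nat)) \in pairs \/ ((j : nat), (i : nat)) \in pairs.
Proof.
by case: i => [[|[|[|[|//]]]] hi]; case: j => [[|[|[|[|//]]]] hj] //= _; by [left|right].
Qed.

Lemma hy_unique r i j : i != j -> Sstar q k t0 r -> hy (r 0 i) = 0 -> hy (r 0 j) = 0 -> False.
Proof.
move=> ij S h1 h2; have [pin|pin] := pair_of ij; apply: (no_two_infinities pin S);
  by rewrite /hyn /= inord_val.
Qed.

Lemma hx_unique r i j : i != j -> Sstar q k t0 r -> hx (r 0 i) = 0 -> hx (r 0 j) = 0 -> False.
Proof.
move=> ij S h1 h2; have [pin|pin] := pair_of ij; apply: (no_two_zeros pin S);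
  by rewrite /hxn /= inord_val.
Qed.

Let fixed_hxy (p : P1) : fixedP1 p -> hx p = 0 \/ hy p = 0.
Proof. exact: mul0_or. Qed.

(** At most one coordinate is 0 and at most one is infinite, which leaves two of the four. *)
Lemma two_nonfixed r : Sstar q k t0 r -> exists i j, [/\ i != j, ~ fixedP1 (r 0 i) & ~ fixedP1 (r 0 j)].
Proof.
move=> S.
have H a b c : a != b -> a != c -> b != c -> fixedP1 (r 0 a) -> fixedP1 (r 0 b) -> fixedP1 (r 0 c) -> False.
  move=> ab ac bc /fixed_hxy[] ha /fixed_hxy[] hb /fixed_hxy[] hc;
  by [exact: (hx_unique ab S) | exact: (hx_unique ac S) | exact: (hx_unique bc S)
     | exact: (hy_unique ab S) | exact: (hy_unique ac S) | exact: (hy_unique bc S)].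
have [h0|h0] := pselect (fixedP1 (r 0 (inord 0))); have [h1|h1] := pselect (fixedP1 (r 0 (inord 1)));
have [h2|h2] := pselect (fixedP1 (r 0 (inord 2))); have [h3|h3] := pselect (fixedP1 (r 0 (inord 3)));
first [ by exists (inord 0), (inord 1); split=> //; rewrite -val_eqE /= !inordK
      | by exists (inord 0), (inord 2); split=> //; rewrite -val_eqE /= !inordK
      | by exists (inord 0), (inord 3); split=> //; rewrite -val_eqE /= !inordK
      | by exists (inord 1), (inord 2); split=> //; rewrite -val_eqE /= !inordK
      | by exists (inord 1), (inord 3); split=> //; rewrite -val_eqE /= !inordK
      | by exists (inord 2), (inord 3); split=> //; rewrite -val_eqE /= !inordK
      | exfalso; first [ apply: (H _ _ _ _ _ _ h0 h1 h2); by rewrite -val_eqE /= !inordK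
                       | apply: (H _ _ _ _ _ _ h0 h1 h3); by rewrite -val_eqE /= !inordK
                       | apply: (H _ _ _ _ _ _ h0 h2 h3); by rewrite -val_eqE /= !inordK
                       | apply: (H _ _ _ _ _ _ h1 h2 h3); by rewrite -val_eqE /= !inordK ] ].
Qed.

(** If all ratios agree, let r_i and r_j be finite and nonzero. Were s_j equal to 0 or infinity, s_i
    would be too, which the two lemmas on zeros and infinities exclude. Then s_j / r_j is the
    scaling that takes r to s. *)
Lemma ratio_det_separates r s : Sstar q k t0 r -> Sstar q k t0 s -> orbit r <> orbit s ->
  exists i j, ratio_det r s i j != 0.
Proof.
move=> Sr Ss ne; apply: contrapT => h; apply: ne.
have D i j : ratio_det r s i j = 0 by apply/eqP; apply: contraT => d; exfalso; apply: h; exists i, j.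
have [i [j [ij Fi Fj]]] := two_nonfixed Sr.
have nfz l : ~ fixedP1 (r 0 l) -> exists2 z, r 0 l = Some z & z != 0.
  by case: (r 0 l) => [z|]; rewrite /fixedP1 /= ?mulr0 // mulr1 => hz; exists z => //; exact/eqP.
have [z rj z0] := nfz j Fj; have [w ri w0] := nfz i Fi.
have Dij := D i j; rewrite /ratio_det /ratio_x /ratio_y ri rj /= !mulr1 !mul1r in Dij.
have nz (a b : C) : a != 0 -> a * b = 0 -> b = 0.
  by move=> a0 /mul0_or[h0|//]; move: a0; rewrite h0 eqxx.
have [y sj y0] : exists2 y, s 0 j = Some y & y != 0.
  case sj : (s 0 j) Dij => [y|] /=; rewrite ?mulr1 ?mulr0 ?subr0.
    move=> e; exists y => //; apply/eqP => y0; move: e; rewrite y0 mulr0 mulr0 sub0r => /eqP.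
    rewrite oppr_eq0 => /eqP/(nz _ _ z0) hs.
    by apply: (hx_unique ij Ss hs); rewrite sj y0.
  move=> /(nz _ _ w0) hs; exfalso; apply: (hy_unique ij Ss hs); by rewrite sj.
apply/orbit_eqP; exists (y / z); first by rewrite mulf_neq0 ?invr_eq0.
apply/rowP => l; rewrite mxE; have := D l j; rewrite /ratio_det /ratio_x /ratio_y rj sj /= !mulr1.
case: (r 0 l) => [a|] /=; case sl : (s 0 l) => [b|] //=; rewrite ?mulr1 ?mul1r ?mul0r ?mulr0 ?subr0 ?sub0r.
- move=> /eqP; rewrite subr_eq0 => /eqP e; congr Some.
  have -> : y / z * a = a * y / z by rewrite mulrC mulrA.
  by rewrite e mulrC mulKf.
- by move=> /eqP; rewrite oppr_eq0 (negPf z0).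
- by move=> /eqP; rewrite (negPf y0).
Qed.

Lemma monodromy_hausdorff : hausdorff_space (set_type [set: M]).
Proof.
move=> m n mn; apply: val_inj; apply: Pinj; apply: contrapT => ne.
have [r Sr mr] := Prange (set_val m); have [s Ss ns] := Prange (set_val n).
have [|i [j D]] := ratio_det_separates Sr Ss; first by rewrite -mr -ns.
have [A [B [nA nB AB]]] := near_ratio_det D.
(* Classes with a representative in the interior of A; such a set is open because scaling by c is
   continuous. *)
pose G (A : set P1x4) : set M := [set m' | exists s', [/\ Sstar q k t0 s', Pmap m' = orbit s' & nbhs s' A]].
have oG (A' : set P1x4) : open (G A').
  apply/(mm_openP Pinj Psurj) => r1 m1 Sr1 mr1 [s1 [Ss1 ms1 ns1]].
  have [c c0 e] : exists2 c, c != 0 & s1 = map_mx (scaleP1 c) r1 by apply/orbit_eqP; rewrite -mr1.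
  move: ns1; rewrite e => /nbhs_interior/(near_scale c0) N.
  apply: filterS N => s2 h m2 Ss2 ms2; exists (map_mx (scaleP1 c) s2); split=> //.
    exact: Sstar_scale.
  by rewrite orbit_scale.
have nbG (m' : set_type [set: M]) r' A' : Sstar q k t0 r' -> Pmap (set_val m') = orbit r' -> nbhs r' A' ->
    nbhs m' (set_val @^-1` G A').
  by move=> S' e' n'; apply/nbhs_set_type; exists (G A'); split=> //; exists r'.
have [x [[r1 [_ xr1 nr1]] [s1 [_ xs1 ns1]]]] := mn _ _ (nbG m r A Sr mr nA) (nbG n s B Ss ns nB).
have [c c0 e] : exists2 c, c != 0 & s1 = map_mx (scaleP1 c) r1 by apply/orbit_eqP; rewrite -xr1.
have := AB _ _ (nbhs_singleton nr1) (nbhs_singleton ns1).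
by rewrite e ratio_det_scale eqxx.
Qed.

End monodromy_surface.

(** * Smooth points and singularities *)

Section main.
Context {R : realType}.
Local Notation C := (cplx R).
Local Notation P1 := (one_point_compactification C).
Local Notation P1x4 := 'rV[P1]_4.
Local Notation orbit := Defs.orbit.
Variables (q t0 kz kt k1 koo : C).
Hypotheses (q0 : q != 0) (q1 : nm q < 1).
Hypotheses (t00 : t0 != 0) (kz0 : kz != 0) (kt0 : kt != 0) (k10 : k1 != 0) (koo0 : koo != 0).
Let k := Kappas kz kt k1 koo.
Hypothesis nonres : nonresonant q k t0.
Local Notation M := (monodromy_manifold q k t0).
Local Notation Pmap := (@Pmap R q k t0).
Implicit Types (r s : P1x4) (m : M).

Let xdist := nonres_xdist t00 kt0 k10 nonres.
Let kzN : ~ qZ q (kz ^+ 2). Proof. by have [] := nonres_squares nonres. Qed.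
Let kooN : ~ qZ q (koo ^+ 2). Proof. by have [] := nonres_squares nonres. Qed.
Let Pinj : injective Pmap := Pmap_inj q0 q1 t00 kz0 kt0 k10 koo0 xdist kzN kooN.
Let Prange : forall m, exists2 r, Sstar q k t0 r & Pmap m = orbit r :=
  PmapP q0 q1 t00 kz0 kt0 k10 koo0 xdist kzN.
Let Psurj r : Sstar q k t0 r -> exists m, Pmap m = orbit r :=
  Pmap_surj q0 q1 t00 kz0 kt0 k10 koo0 xdist kzN kooN (r := r).

Definition chart_index : countType := (('I_4 * 'I_4) * ('I_4 * 'I_4) * {ffun 'I_4 -> bool})%type.
Definition chart_e (x : chart_index) (a : 'I_2) : 'I_4 := if a == 0 then x.1.2.1 else x.1.2.2.
Definition good_chart (x : chart_index) :=
  [/\ x.1.1.2 != x.1.1.1, forall a, chart_e x a != x.1.1.2, forall a, chart_e x a != x.1.1.1,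
      chart_e x 0 != chart_e x 1 & x.2 x.1.1.1 = false].
Definition chart_V (x : chart_index) : set M := chart_set x.1.1.1 x.1.1.2 (chart_e x) x.2.
Definition chart_phi (x : chart_index) : M -> 'rV[C]_2 := chart_fun Prange x.1.1.1 (chart_e x) x.2.

Lemma good_holo_chart x : good_chart x -> holo_chart (mm_holo q k t0) (chart_V x) (chart_phi x).
Proof. by case=> ij ei ej e01 tj; exact: mm_holo_chart. Qed.

Lemma chart_exists m : ~ Msing q k t0 m -> exists2 x, good_chart x & chart_V x m.
Proof.
have [r Sr mr] := Prange m.
move=> ns; have nf : ~ forall j, fixedP1 (r 0 j).
  by move=> h; apply: ns; exact: (proj2 (MsingP q0 q1 t00 kz0 kt0 k10 koo0 xdist kzN mr)).
have [j [i [ij nfj /existsNP[p Tp]]]] := good_index q0 q1 t00 kz0 kt0 k10 koo0 xdist kzN kooN Sr nf.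
have [e [ei ej e01]] := other_indices ij.
(* The inverse coordinate is used exactly where r is infinite, so each rho_(e a) is in range; the
   test l != j makes tau j false by computation. *)
pose x : chart_index := ((j, i), (e 0, e 1), [ffun l => (l != j) && (r 0 l == None)]).
have eE a : chart_e x a = e a by rewrite /chart_e; move: a; apply: ord2P.
exists x.
  split=> //= [a|a|].
  - by rewrite eE.
  - by rewrite eE.
  - by rewrite ffunE eqxx.
exists r => //; split=> //; first by exists p.
move=> a; rewrite /= eE ffunE ej /=; case: (r 0 (e a)) => [z|] /=; exact/eqP/oner_neq0.
Qed.

Lemma smooth_chart x m : good_chart x -> chart_V x m -> smooth_at (mm_holo q k t0) m.
Proof.
move=> g Vm; have H := good_holo_chart g; exists (chart_V x) => //; split.
- by case: H.
- exact: holo_chart_hausdorff H.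
- apply: (holo_chart_second_countable (I := unit) (good := xpredT) (fun _ _ => H)).
  by move=> y Vy; exists tt.
- by move=> y Vy; exists (chart_V x), (chart_phi x); split=> //; exact: subset_refl.
Qed.

Lemma smooth_away m : ~ Msing q k t0 m -> smooth_at (mm_holo q k t0) m.
Proof. by move=> /chart_exists[x g Vx]; exact: smooth_chart g Vx. Qed.

Lemma nonsplitting_surface : nonsplitting q k t0 -> complex_surface (mm_holo q k t0) [set: M].
Proof.
move=> ns.
have nM m : ~ Msing q k t0 m.
  have [r Sr mr] := Prange m.
  move=> /(proj1 (MsingP q0 q1 t00 kz0 kt0 k10 koo0 xdist kzN mr)).
  exact: (nonsplitting_not_fixed q0 q1 t00 kz0 kt0 k10 koo0 nonres ns Sr).
have T0 := proj1 (nonsplittingP q0 q1 t00 kz0 kt0 k10 koo0 nonres) ns.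
split.
- exact: openT.
- exact: (monodromy_hausdorff q0 q1 t00 kz0 kt0 k10 koo0 nonres T0).
- apply: (holo_chart_second_countable good_holo_chart) => m _; exact: chart_exists.
- move=> m _; have [x g Vx] := chart_exists (nM m).
  by exists (chart_V x), (chart_phi x); split=> //; exact: good_holo_chart.
Qed.

Lemma near_pair_point p (A : set P1x4) : nbhs (pair_point p 0) A ->
  \forall c \near (0 : C), A (pair_point p c).
Proof.
case=> P nP PA.
have N (l : 'I_4) : \forall c \near (0 : C), P 0 l (pair_point p c 0 l).
  have := nP 0 l; rewrite mxE; case E : (_ || _) => h.
    by apply: near_all => c; rewrite mxE E; exact: nbhs_singleton h.
  by have h' : \forall c \near (0 : C), P 0 l (Some c) by []; apply: filterS h' => c; rewrite mxE E.
apply: filterS2 (filterI (N (inord 0)) (N (inord 1))) (filterI (N (inord 2)) (N (inord 3))).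
by move=> c [h0 h1] [h2 h3]; apply: PA => a; rewrite (ord1 a); apply: ord4P.
Qed.

(* Every neighbourhood of [m] contains the class of [pair_point p 1]. *)
Lemma Msing_singular m : Msing q k t0 m -> singularity (mm_holo q k t0) m.
Proof.
move=> /(Msing_pair q0 q1 t00 kz0 kt0 k10 koo0 nonres)[p [pin mp T0]] [U Um [oU hU _ _]].
have SS c : Sstar q k t0 (pair_point p c) by exact: pair_point_Sstar.
have [n np] := Psurj (SS 1).
have H (G : set M) : open G -> G m -> G n.
  move=> /(mm_openP Pinj Psurj) oG Gm.
  have /nbhs_nmP[e e0 He] := near_pair_point (oG _ _ (SS 0) mp Gm).
  (* For small nonzero c, [pair_point p c] is near the fixed point, and it lies in the orbit of
     [pair_point p 1], that is in the class n. *)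
  have [N HN] := nat_inv_lt e0; pose c : C := N.+1%:R^-1.
  have c0 : c != 0 by rewrite invr_eq0 pnatr_eq0.
  have := He c; rewrite subr0 nmV nmn => /(_ (HN N (leqnn N))); apply; first exact: SS.
  by rewrite np -(orbit_scale _ c0) scale_pair_point mulr1.
(* A Hausdorff neighbourhood would identify m with n, although the coordinates of [pair_point p 1]
   outside p equal 1 and are not fixed. *)
have mn : m = n by apply: (not_hausdorff_set_type Um _ H hU); exact: H oU Um.
have F : forall j, fixedP1 (pair_point p (1 : C) 0 j).
  apply: (proj1 (MsingP q0 q1 t00 kz0 kt0 k10 koo0 xdist kzN np)); rewrite -mn.
  by apply: (proj2 (MsingP q0 q1 t00 kz0 kt0 k10 koo0 xdist kzN mp)) => j; exact: pair_point_fixed.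
have no : ~ fixedP1 (Some 1 : P1) by rewrite /fixedP1 /= mulr1; exact/eqP/oner_neq0.
move: p pin F {mp T0 SS np H} => p; move: p; apply: pairsP => F.
- by have := F (inord 2); rewrite mxE inordK //=; exact: no.
- by have := F (inord 1); rewrite mxE inordK //=; exact: no.
- by have := F (inord 1); rewrite mxE inordK //=; exact: no.
- by have := F (inord 0); rewrite mxE inordK //=; exact: no.
- by have := F (inord 0); rewrite mxE inordK //=; exact: no.
- by have := F (inord 0); rewrite mxE inordK //=; exact: no.
Qed.

End main.

Theorem theorem2p17 (R : realType) (q t0 : cplx R) (k : kappas R)
    (hq0 : 0 < `|q|) (hq1 : `|q| < 1)
    (hk : nonzero_kappas k) (ht0 : t0 != 0)
    (hres : nonresonant q k t0) :
  (nonsplitting q k t0 ->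
     complex_surface (mm_holo q k t0) [set: monodromy_manifold q k t0]) /\
  (~ nonsplitting q k t0 ->
     [/\ Msing q k t0 !=set0,
         finite_set (Msing q k t0),
         forall m, Msing q k t0 m -> singularity (mm_holo q k t0) m
       & forall m, ~ Msing q k t0 m -> smooth_at (mm_holo q k t0) m]).
Proof.
case: k hk hres => kz kt k1 koo [/= kz0 kt0 k10 koo0] hres.
have q0 : q != 0 by rewrite -normr_gt0.
have q1 : nm q < 1 by move: hq1; rewrite nmE ltcR.
split=> [|ns]; first exact: nonsplitting_surface.
split.
- exact: Msing_nonempty.
- exact: Msing_finite.
- exact: Msing_singular.
- exact: smooth_away.
Qed.
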